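(* Let $\mathcal H=\partial_t+\sum_{j=1}^dA_j\partial_j$ and $\Gamma$ satisfy the hyperbolicity assumption and the Uniform Lopatinski Condition given in the context, and let $S$, $B$, $R=B^{1/2}$, $\gamma>0$ (fixed, large enough) be as in the context. Let $f\in L^2(\Omega_T^+)$ with $f|_{t<0}=0$, and let $g=0$. Let $u$ be the solution of $$\mathcal H u=f\ \ (x>0),\qquad \Gamma u|_{x=0}=0,\qquad u|_{t<0}=0,$$ let $\underline u^\varepsilon$ be the solution of $$\mathcal H\underline u^\varepsilon+\tfrac1\varepsilon\,\mathbb M\,\underline u^\varepsilon\,\mathbf 1_{x<0}=f\,\mathbf 1_{x>0}\ \ (x\in\mathbb R),\qquad \underline u^\varepsilon|_{t<0}=0,$$ and let $\underline{\tilde u}=\underline u^-\mathbf 1_{x<0}+u\,\mathbf 1_{x\ge0}$, with $\underline u^-$ defined in the context. Then $$\lim_{\varepsilon\to0^+}\|\underline u^\varepsilon-\underline{\tilde u}\|_{L^2(\Omega_T)}=0.$$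
   Context: Variables: $t$, $y=(x_1,\dots,x_{d-1})\in\mathbb R^{d-1}$, $x=x_d\in\mathbb R$. $T>0$ is fixed. $\Omega_T=[0,T]\times\mathbb R^d$, $\Omega_T^\pm=[0,T]\times\mathbb R^d_\pm$ with $\mathbb R^d_\pm=\{\pm x>0\}$. Operator: $\mathcal H=\partial_t+\sum_{j=1}^dA_j\partial_j$, with $A_j$ constant real $N\times N$ matrices and $\det A_d\ne0$. $\Gamma:\mathbb R^N\to\mathbb R^p$ is linear (a constant $p\times N$ real matrix) of rank $p$. Hyperbolicity assumption: for all $(\eta,\xi)\in\mathbb R^{d-1}\times\mathbb R\setminus\{0\}$ the eigenvalues of $\sum_{j=1}^{d-1}\eta_jA_j+\xi A_d$ are real, semi-simple and of constant multiplicity. Frequencies: $\zeta=(\gamma,\tau,\eta)$, $\gamma\ge0$, $\tau\in\mathbb R$, $\eta\in\mathbb R^{d-1}$; $A(\zeta)=-(A_d)^{-1}\big((i\tau+\gamma)\mathrm{Id}+\sum_{j=1}^{d-1}i\eta_jA_j\big)$. For a square complex matrix $M$, $\mathbb E_-(M)$ [resp. $\mathbb E_+(M)$] is the span of the generalized eigenvectors of $M$ for eigenvalues with negative [resp. positive] real part. For subspaces $\mathbb F,\mathbb G\subset\mathbb C^N$ with $\dim\mathbb F+\dim\mathbb G=N$, $\det(\mathbb F,\mathbb G)$ is the determinant obtained by taking orthonormal bases in each (its modulus is well defined). Uniform Lopatinski Condition: there is $C>0$ such that $|\det(\mathbb E_-(A(\zeta)),\ker\Gamma)|\ge C$ for all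 $\zeta$ with $\gamma>0$. Kreiss symmetrizer: $S(\zeta)$ is a fixed matrix-valued function, homogeneous of order zero in $\zeta$, $C^\infty$ on $\mathbb R^+\times\mathbb R^d\setminus\{0\}$, for which there are $\lambda>0,\delta>0,C_1$ with: $S$ hermitian; $\mathrm{Re}(SA)\ge\lambda\gamma\,\mathrm{Id}$, where $\mathrm{Re}\,Q=\frac12(Q+Q^* )$; $S\ge\delta\,\mathrm{Id}-C_1\Gamma^*\Gamma$ (such $S$ exists under the Uniform Lopatinski Condition). Rauch's matrix: $B(\zeta)$ is a fixed hermitian, uniformly positive definite, uniformly bounded $N\times N$ matrix depending smoothly on $\zeta\neq 0$ such that $\ker\Gamma=\mathbb E_+(S^{-1}B)$ (such $B$ exists). Set $R=B^{1/2}$, $S_R=R^{-1}SR^{-1}$, $A_R=RAR^{-1}$. $\mathbb P^-$ is the projector on $\mathbb E_-(S_R)$ parallel to $\mathbb E_+(S_R)$ and $\mathbb P^+=\mathrm{Id}-\mathbb P^-$. $\mathcal F$ is the tangential Fourier transform (in $(t,y)$, dual variables $(\tau,\eta)$). The Fourier–Laplace transform of $w$ is $\hat w=\mathcal F(e^{-\gamma t}w)$. For a symbol $Q(\zeta)$, $\underline Q$ denotes the Fourier multiplier $\mathcal F(\underline Qw)=Q(\zeta)\mathcal F(w)$. $\gamma>0$ is fixed once and for all, large enough. The penalization operator is $$\mathbb M=-e^{\gamma t}A_d\,\underline S^{-1}\underline R\,\underline{\mathbb P}^-\underline R\,e^{-\gamma t}.$$ The function $\underline u^-$ on $\Omega_T^-$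 (case $g=0$): $\underline u^-=e^{\gamma t}\mathcal F^{-1}\big(R^{-1}\underline{\hat v}^-\big)$, where $\underline{\hat v}^-$ (with $\mathbb P^+\underline{\hat v}^-=\underline{\hat v}^-$) solves $$S_R\,\partial_x\underline{\hat v}^--\mathbb P^+S_RA_R\,\underline{\hat v}^-=0\ \ (x<0),\qquad \underline{\hat v}^-|_{x=0}=\mathbb P^+R\hat u|_{x=0},$$ and $\hat u$ is the Fourier–Laplace transform of $u$. Functions of $t\in[0,T]$ vanishing for $t<0$ are understood as extended in $t$ when the tangential transform is applied. *)

(* Defs.v *)
From HB Require Import structures.
From mathcomp Require Import all_boot all_order all_algebra.
From mathcomp Require Import all_classical all_reals all_analysis.
From mathcomp Require Import mxpoly sesquilinear spectral complex.
Set Implicit Arguments.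
Unset Strict Implicit.
Unset Printing Implicit Defensive.

Import Order.TTheory GRing.Theory Num.Theory.
Import numFieldNormedType.Exports.
Local Open Scope classical_set_scope.
Local Open Scope ring_scope.
Local Open Scope sesquilinear_scope.
Local Open Scope complex_scope.

Definition rV_display : measure_display.
Proof. exact: default_measure_display. Qed.

Section measurable_rV.
Context {R : realType} (m : nat).
Let coors (i : 'I_m) (v : 'rV[R]_m) : measurableTypeR R := v ord0 i.
Let rV_set0 : g_sigma_preimage coors set0.
Proof. exact: sigma_algebra0. Qed.
Let rV_setC A : g_sigma_preimage coors A -> g_sigma_preimage coors (~` A).
Proof. exact: sigma_algebraC. Qed.
Let rV_bigcup (F : _^nat) : (forall i, g_sigma_preimage coors (F i)) ->
  g_sigma_preimage coors (\bigcup_i (F i)).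
Proof. exact: sigma_algebra_bigcup. Qed.
HB.instance Definition _ := @isMeasurable.Build rV_display
  'rV[R]_m (g_sigma_preimage coors) rV_set0 rV_setC rV_bigcup.
End measurable_rV.

Section meas.
Context {R : realType} (m : nat).
Lemma measurable_coord (i : 'I_m) :
  measurable_fun [set: 'rV[R]_m] (fun v : 'rV[R]_m => v ord0 i : measurableTypeR R).
Proof.
move=> _ Y mY; rewrite setTI; apply: sub_sigma_algebra => /=.
rewrite -bigcup_seq/=; exists i => /=; first by rewrite mem_index_enum.
by exists Y => //; rewrite setTI.
Qed.

Lemma measurable_rVP d (T : measurableType d) (f : T -> 'rV[R]_m) :
  (forall i, measurable_fun [set: T] (fun x => f x ord0 i : measurableTypeR R)) ->
  measurable_fun [set: T] f.
Proof.
move=> mf.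
apply: (@measurability _ _ _ _ setT f (\big[setU/set0]_(i < m) preimage_set_system setT (fun v : 'rV[R]_m => v ord0 i : measurableTypeR R) measurable)) => //.
move=> A [C hC <-]; move: hC; rewrite -bigcup_seq => -[i _ [B mB <-]].
have := mf i measurableT B mB.
by rewrite !setTI.
Qed.
End meas.

Lemma product_measure1_sigma_finite d1 d2 (T1 : measurableType d1)
    (T2 : measurableType d2) (R : realType)
    (m1 : {sigma_finite_measure set T1 -> \bar R})
    (m2 : {sigma_finite_measure set T2 -> \bar R}) :
  sigma_finite setT (m1 \x m2)%E.
Proof.
have /sigma_finiteP[F [TF ndF Foo]] := sigma_finiteT m1.
have /sigma_finiteP[G [TG ndG Goo]] := sigma_finiteT m2.
exists (fun n => F n `*` G n).
  rewrite -setXTT TF TG predeqE => -[x y]; split.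
    move=> [/= [n _ Fnx] [k _ Gky]]; exists (maxn n k) => //; split.
    - by move: x Fnx; exact/subsetPset/ndF/leq_maxl.
    - by move: y Gky; exact/subsetPset/ndG/leq_maxr.
  by move=> [n _ []/= ? ?]; split; exists n.
move=> k; have [? ?] := Foo k; have [? ?] := Goo k.
split; first exact: measurableX.
by rewrite product_measure1E// lte_mul_pinfty// ge0_fin_numE.
Qed.

Section leb_step.
Context {R : realType} (m : nat).
Variable mu : {sigma_finite_measure set 'rV[R]_m -> \bar R}.
Local Notation RR := (measurableTypeR R).

Definition rV_cons (p : RR * 'rV[R]_m) : 'rV[R]_m.+1 :=
  \row_i oapp (fun j => p.2 ord0 j) p.1 (unlift ord0 i).

Lemma measurable_rV_cons : measurable_fun [set: RR * 'rV[R]_m] rV_cons.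
Proof.
apply: measurable_rVP => i; case: (unliftP ord0 i) => [j|] ->.
  rewrite (_ : (fun _ => _) = (fun v : 'rV[R]_m => v ord0 j : RR) \o snd).
    exact: measurableT_comp (measurable_coord j) measurable_snd.
  by apply/funext => p /=; rewrite mxE liftK.
rewrite (_ : (fun _ => _) = fst); first exact: measurable_fst.
by apply/funext => p /=; rewrite mxE unlift_none.
Qed.

Definition rV_uncons (v : 'rV[R]_m.+1) : RR * 'rV[R]_m :=
  (v ord0 ord0, \row_j v ord0 (lift ord0 j)).

Lemma rV_consK : cancel rV_cons rV_uncons.
Proof.
move=> [a v]; congr pair; first by rewrite mxE unlift_none.
by apply/rowP => j; rewrite !mxE liftK.
Qed.

Lemma measurable_rV_uncons : measurable_fun [set: 'rV[R]_m.+1] rV_uncons.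
Proof.
apply: measurable_fun_pair; first exact: measurable_coord.
apply: measurable_rVP => j.
rewrite (_ : (fun _ => _) = (fun v : 'rV[R]_m.+1 => v ord0 (lift ord0 j) : RR)).
  exact: measurable_coord.
by apply/funext => v; rewrite mxE.
Qed.

Definition lebesgue_rV_step : set 'rV[R]_m.+1 -> \bar R :=
  pushforward (@lebesgue_measure R \x mu)%E rV_cons.

Let mpre (A : set 'rV[R]_m.+1) : measurable A -> measurable (rV_cons @^-1` A).
Proof. by move=> mA; rewrite -[X in measurable X]setTI; exact: measurable_rV_cons. Qed.

Let step0 : lebesgue_rV_step set0 = 0%E.
Proof. by rewrite /lebesgue_rV_step /pushforward preimage_set0 measure0. Qed.

Let step_ge0 A : (0 <= lebesgue_rV_step A)%E.
Proof. by rewrite /lebesgue_rV_step /pushforward measure_ge0. Qed.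

Let step_sigma_additive : semi_sigma_additive lebesgue_rV_step.
Proof.
move=> F mF tF mUF; rewrite /lebesgue_rV_step /pushforward preimage_bigcup.
apply: measure_semi_sigma_additive.
- by move=> n; exact: mpre.
- apply/trivIsetP => /= i j _ _ ij; rewrite -preimage_setI.
  by move/trivIsetP : tF => /(_ _ _ _ _ ij) ->//; rewrite preimage_set0.
- by rewrite -preimage_bigcup; exact: mpre.
Qed.

HB.instance Definition _ := isMeasure.Build _ _ _ lebesgue_rV_step
  step0 step_ge0 step_sigma_additive.

Let step_sigma_finite : sigma_finite setT lebesgue_rV_step.
Proof.
have [F FT Foo] : sigma_finite setT (@lebesgue_measure R \x mu)%E.
  exact: product_measure1_sigma_finite.
exists (fun n => rV_uncons @^-1` F n); first by rewrite -preimage_bigcup -FT.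
move=> n; have [mF Fn] := Foo n; split.
  by rewrite -[X in measurable X]setTI; exact: measurable_rV_uncons.
rewrite /lebesgue_rV_step /pushforward -comp_preimage.
by rewrite (_ : _ \o _ = id) //; apply/funext => p /=; rewrite rV_consK.
Qed.

HB.instance Definition _ :=
  Measure_isSigmaFinite.Build _ _ _ lebesgue_rV_step step_sigma_finite.

End leb_step.

Section leb.
Context {R : realType}.

Let dirac_sigma_finite : sigma_finite setT (@dirac _ 'rV[R]_0 0 R).
Proof.
by apply: fin_num_fun_sigma_finite; [rewrite measure0|exact: fin_num_measure].
Qed.

HB.instance Definition _ :=
  Measure_isSigmaFinite.Build _ _ _ (@dirac _ 'rV[R]_0 0 R) dirac_sigma_finite.

Fixpoint lebesgue_rV (m : nat) : {sigma_finite_measure set 'rV[R]_m -> \bar R} :=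
  match m with
  | 0 => @dirac _ 'rV[R]_0 0 R
  | m'.+1 => lebesgue_rV_step (lebesgue_rV m')
  end.
End leb.

Section space_time.
Context {R : realType} (m : nat).
Definition lebesgue_ty : set ('rV[R]_m * measurableTypeR R) -> \bar R :=
  (lebesgue_rV m \x @lebesgue_measure R)%E.
HB.instance Definition _ := Measure.on lebesgue_ty.
HB.instance Definition _ := Measure_isSigmaFinite.Build _ _ _ lebesgue_ty
  (product_measure1_sigma_finite _ _).
End space_time.
Arguments lebesgue_ty {R} m.

Section L2.
Context {R : realType} {N : nat}.
Local Notation C := R[i].

Definition cvnorm (v : 'cV[C]_N) : R :=
  Num.sqrt (\sum_i ((complex.Re (v i 0)) ^+ 2 + (complex.Im (v i 0)) ^+ 2)).

Context d (T : measurableType d) (mu : {measure set T -> \bar R}).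

Definition L2norm (D : set T) (f : T -> 'cV[C]_N) : \bar R :=
  ('N[mu]_2%:E [ (fun z => (\1_D z * cvnorm (f z))%R%:E) ])%E.

Definition mem_L2 (D : set T) (f : T -> 'cV[C]_N) : Prop :=
  (forall i, measurable_fun D (fun z => complex.Re (f z i 0)) /\
             measurable_fun D (fun z => complex.Im (f z i 0))) /\
  (L2norm D f < +oo)%E.

Definition cvint (D : set T) (f : T -> 'cV[C]_N) : 'cV[C]_N :=
  \col_i ((\int[mu]_(z in D) complex.Re (f z i 0)) +i*
          (\int[mu]_(z in D) complex.Im (f z i 0))).

End L2.

Section smooth.
Context {R : realType} {V : normedModType R}.

Fixpoint Ck_on (k : nat) (U : set V) (f : V -> R) : Prop :=
  (forall z, U z -> {for z, continuous f}) /\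
  match k with
  | 0 => True
  | k'.+1 => forall v, (forall z, U z -> derivable f z v) /\
                       Ck_on k' U (fun z => 'D_v f z)
  end.

(* On a non-open set, smoothness means smoothness of an extension to an open
   neighbourhood; on a half-space this is smoothness up to the boundary. *)
Definition smooth_on (Z : set V) (f : V -> R) : Prop :=
  exists U g, [/\ open U, Z `<=` U, forall k, Ck_on k U g
                & forall z, Z z -> f z = g z].

Definition smooth_mx_on N (Z : set V) (Q : V -> 'M[R[i]]_N) : Prop :=
  forall i j, smooth_on Z (fun z => complex.Re (Q z i j)) /\
              smooth_on Z (fun z => complex.Im (Q z i j)).

Definition test_function (phi : V -> R) : Prop :=
  (forall k, Ck_on k setT phi) /\
  exists2 K, compact K & forall z, ~ K z -> phi z = 0.

End smooth.

Section linear_algebra.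
Context {R : realType} {N : nat}.
Local Notation C := R[i].

Definition Cmx {m1 m2} (M : 'M[R]_(m1, m2)) : 'M[C]_(m1, m2) :=
  map_mx (fun x : R => x%:C) M.

Definition is_hermitian (Q : 'M[C]_N) : Prop := Q^t* = Q.

(* The order of R[i] makes the quadratic form real and nonnegative. *)
Definition psd (Q : 'M[C]_N) : Prop :=
  forall v : 'cV[C]_N, 0 <= (v^t* *m Q *m v) 0 0.

Definition mx_ge (P Q : 'M[C]_N) : Prop := psd (P - Q).

Definition mx_Re (Q : 'M[C]_N) : 'M[C]_N := 2^-1 *: (Q + Q^t*).

Definition eigvals (M : 'M[C]_N) : seq C :=
  sval (closed_field_poly_normal (char_poly M)).

(* Subspaces of C^N (column vectors) are encoded as row spaces of the
   transposed vectors; geigenspace is about row vectors, hence M^T. *)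
Definition Eneg (M : 'M[C]_N) : 'M[C]_N :=
  (\sum_(a <- eigvals M | (complex.Re a < 0)%R) geigenspace M^T a)%MS.

Definition Epos (M : 'M[C]_N) : 'M[C]_N :=
  (\sum_(a <- eigvals M | (0 < complex.Re a)%R) geigenspace M^T a)%MS.

Definition Cker p (G : 'M[R]_(p, N)) : 'M[C]_N := kermx (Cmx G)^T.

(* |det(F, G)| >= c, which includes dim F + dim G = N; the modulus does not
   depend on the orthonormal bases P of F and Q of G. *)
Definition det_subspaces_ge (F G : 'M[C]_N) (c : R) : Prop :=
  (\rank F + \rank G)%N = N /\
  forall k l (e : (k + l)%N = N) (P : 'M[C]_(k, N)) (Q : 'M[C]_(l, N)),
    P \is unitarymx -> Q \is unitarymx -> (P == F)%MS -> (Q == G)%MS ->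
    c%:C <= `|\det (castmx (e, erefl N) (col_mx P Q))|.

Definition projneg (M : 'M[C]_N) : 'M[C]_N := (proj_mx (Eneg M) (Epos M))^T.
Definition projpos (M : 'M[C]_N) : 'M[C]_N := 1%:M - projneg M.

End linear_algebra.

Section symbols.
Context {R : realType} {n N : nat}.
Local Notation C := R[i].

(* zeta = (gamma, (tau, eta)), with tau at index 0 and eta_j at index j + 1;
   the space dimension is d = n + 1. *)
Local Notation freq := (R * 'rV[R]_n.+1)%type.

Variables (A : 'I_n -> 'M[R]_N) (Ad : 'M[R]_N).

Definition hyperbolic : Prop :=
  exists k (mult : 'I_k -> nat) (lam : 'I_k -> 'rV[R]_n -> R -> R),
  (forall i, (0 < mult i)%N) /\
  forall (eta : 'rV[R]_n) (xi : R), (eta, xi) != 0 ->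
  let M := \sum_j eta 0 j *: A j + xi *: Ad in
  [/\ injective (fun i => lam i eta xi),
      char_poly M = \prod_i ('X - (lam i eta xi)%:P) ^+ mult i
    & forall i, \rank (eigenspace M (lam i eta xi)) = mult i].

Definition freq_dom : set freq := [set z | 0 <= z.1 /\ z != 0].

Definition Asym (z : freq) : 'M[C]_N :=
  - invmx (Cmx Ad) *m
    ((z.1 +i* z.2 0 ord0)%:M +
     \sum_j (0 +i* z.2 0 (lift ord0 j)) *: Cmx (A j)).

Context {p : nat}.
Variable G : 'M[R]_(p, N).

Definition uniform_lopatinski : Prop :=
  exists2 c : R, 0 < c &
    forall z : freq, 0 < z.1 -> det_subspaces_ge (Eneg (Asym z)) (Cker G) c.

Definition kreiss_symmetrizer (S : freq -> 'M[C]_N) : Prop :=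
  [/\ forall (k : R) z, 0 < k -> freq_dom z -> S (k *: z) = S z,
      smooth_mx_on freq_dom S,
      forall z, freq_dom z -> is_hermitian (S z)
    & exists lam delta C1 : R, [/\ 0 < lam, 0 < delta
        & forall z, freq_dom z ->
          mx_ge (mx_Re (S z *m Asym z)) ((lam * z.1)%:C)%:M /\
          mx_ge (S z) ((delta%:C)%:M - C1%:C *: ((Cmx G)^t* *m Cmx G))]].

Definition rauch_matrix (S B : freq -> 'M[C]_N) : Prop :=
  [/\ forall z, freq_dom z -> is_hermitian (B z),
      exists2 b : R, 0 < b & forall z, freq_dom z -> mx_ge (B z) (b%:C)%:M,
      exists K : R, forall z i j, freq_dom z -> `|B z i j| <= K%:C,
      smooth_mx_on freq_dom B
    & forall z, freq_dom z ->
        S z \in unitmx /\ (Cker G == Epos (invmx (S z) *m B z))%MS].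

Definition is_sqrt_of (B Q : freq -> 'M[C]_N) : Prop :=
  forall z, freq_dom z ->
    [/\ is_hermitian (Q z), psd (Q z) & Q z *m Q z = B z].

(* Q is the square root of B (called R = B^{1/2} on paper) from here on. *)
Definition SR (S Q : freq -> 'M[C]_N) z := invmx (Q z) *m S z *m invmx (Q z).
Definition AR (Q : freq -> 'M[C]_N) z := Q z *m Asym z *m invmx (Q z).

Definition penal_symbol (S Q : freq -> 'M[C]_N) z : 'M[C]_N :=
  - (Cmx Ad *m invmx (S z) *m Q z *m projneg (SR S Q z) *m Q z).

End symbols.

Section fourier.
Context {R : realType} {m N : nat}.
Local Notation C := R[i].

Definition expi (a : R) : C := cos a +i* sin a.

Definition fourier_trunc (w : 'rV[R]_m -> 'cV[C]_N) (k : nat) (th : 'rV[R]_m) : 'cV[C]_N :=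
  cvint (lebesgue_rV m) [set s | `|s| <= k%:R]
    (fun s => expi (- \sum_i s 0 i * th 0 i) *: w s).

(* W = F w in L^2, as the L^2 limit of the transforms of truncations of w *)
Definition fourier (w W : 'rV[R]_m -> 'cV[C]_N) : Prop :=
  [/\ mem_L2 (lebesgue_rV m) setT w, mem_L2 (lebesgue_rV m) setT W
    & L2norm (lebesgue_rV m) setT (fun th => W th - fourier_trunc w k th)
        @[k --> \oo] --> 0%E].

(* transform in the first variable only, the second one being a parameter *)
Definition tfourier (w W : 'rV[R]_m * R -> 'cV[C]_N) : Prop :=
  [/\ mem_L2 (lebesgue_ty m) setT w, mem_L2 (lebesgue_ty m) setT W
    & L2norm (lebesgue_ty m) setT
        (fun z => W z - fourier_trunc (fun s => w (s, z.2)) k z.1)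
        @[k --> \oo] --> 0%E].

Definition multiplier (Q : 'rV[R]_m -> 'M[C]_N)
    (w w' : 'rV[R]_m * R -> 'cV[C]_N) : Prop :=
  exists W, tfourier w W /\ tfourier w' (fun z => Q z.1 *m W z).

End fourier.

Section problems.
Context {R : realType} {n N : nat}.
Local Notation C := R[i].

(* points ((t, y), x), with t at index 0 and y_j at index j + 1 *)
Local Notation space := ('rV[R]_n.+1 * R)%type.
Local Notation freq := (R * 'rV[R]_n.+1)%type.

Definition time (z : space) : R := z.1 0 ord0.
Definition xpos : set space := [set z | 0 < z.2].
Definition xneg : set space := [set z | z.2 < 0].
Definition Omega_T (T : R) : set space := [set z | 0 <= time z <= T].

Definition weight (g : R) (u : space -> 'cV[C]_N) : space -> 'cV[C]_N :=
  fun z => (expR (g * time z))%:C *: u z.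
Definition bweight (g : R) (u : 'rV[R]_n.+1 -> 'cV[C]_N) :=
  fun s : 'rV[R]_n.+1 => (expR (g * s 0 ord0))%:C *: u s.

Definition mem_L2w (g : R) (D : set space) (u : space -> 'cV[C]_N) : Prop :=
  mem_L2 (lebesgue_ty n.+1) D (weight (- g) u).

Variables (A : 'I_n -> 'M[R]_N) (Ad : 'M[R]_N).

Definition transport (phi : space -> R) (u : space -> 'cV[C]_N) (z : space) :=
  ('D_((delta_mx 0 ord0, 0) : space) phi z)%:C *: u z +
  \sum_j ('D_((delta_mx 0 (lift ord0 j), 0) : space) phi z)%:C *:
           (Cmx (A j) *m u z) +
  ('D_((0, 1) : space) phi z)%:C *: (Cmx Ad *m u z).

Local Notation vint := (cvint (lebesgue_ty n.+1)).

Definition vanishes_past (D : set space) (u : space -> 'cV[C]_N) : Prop :=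
  {ae lebesgue_ty n.+1, forall z : space, D z -> time z < 0 -> u z = 0}.

(* u0 is the trace of u at x = 0, characterized by Green's formula, so the third
   clause says H u = F in x > 0 weakly, with boundary values u0. *)
Definition bvp_solution p (G : 'M[R]_(p, N)) (g : R)
    (F u : space -> 'cV[C]_N) (u0 : 'rV[R]_n.+1 -> 'cV[C]_N) : Prop :=
  [/\ mem_L2w g xpos u,
      mem_L2 (lebesgue_rV n.+1) setT (bweight (- g) u0),
      forall phi, test_function phi ->
        - vint xpos (transport phi u) =
        vint xpos (fun z => (phi z)%:C *: F z) +
        cvint (lebesgue_rV n.+1) setT
          (fun s => (phi (s, 0))%:C *: (Cmx Ad *m u0 s)),
      {ae lebesgue_rV n.+1, forall s, Cmx G *m u0 s = 0}
    & vanishes_past xpos u].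

Variables S Q : freq -> 'M[C]_N.

(* w = M u, where M is conjugated by e^{g t} *)
Definition penal_op (g : R) (u w : space -> 'cV[C]_N) : Prop :=
  multiplier (fun th => penal_symbol Ad S Q (g, th))
    (weight (- g) u) (weight (- g) w).

Definition penalized_solution (g eps : R) (F u : space -> 'cV[C]_N) : Prop :=
  [/\ mem_L2w g setT u,
      exists2 w, penal_op g u w &
        forall phi, test_function phi ->
          - vint setT (transport phi u) +
          (eps^-1)%:C *: vint xneg (fun z => (phi z)%:C *: w z) =
          vint xpos (fun z => (phi z)%:C *: F z)
    & vanishes_past setT u].

Definition cderivable (v : R -> 'cV[C]_N) (x : R) : Prop :=
  forall i, derivable (fun y => complex.Re (v y i 0)) x 1 /\
            derivable (fun y => complex.Im (v y i 0)) x 1.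

Definition cderive (v : R -> 'cV[C]_N) (x : R) : 'cV[C]_N :=
  \col_i (derive1 (fun y => complex.Re (v y i 0)) x +i*
          derive1 (fun y => complex.Im (v y i 0)) x).

Definition cvg_left0 (v : R -> 'cV[C]_N) (l : 'cV[C]_N) : Prop :=
  forall i, complex.Re (v x i 0) @[x --> 0^'-] --> complex.Re (l i 0) /\
            complex.Im (v x i 0) @[x --> 0^'-] --> complex.Im (l i 0).

(* h0 is the Fourier-Laplace transform of u at x = 0 *)
Definition profile_system (g : R) (h0 : 'rV[R]_n.+1 -> 'cV[C]_N)
    (v : space -> 'cV[C]_N) : Prop :=
  {ae lebesgue_rV n.+1, forall th,
    let z : freq := (g, th) in
    let Pp := projpos (SR S Q z) in
    let vth := fun x => v (th, x) in
    (forall x, x < 0 ->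
      [/\ Pp *m vth x = vth x, cderivable vth x
        & SR S Q z *m cderive vth x -
          Pp *m SR S Q z *m AR A Ad Q z *m vth x = 0]) /\
    cvg_left0 vth (Pp *m Q z *m h0 th)}.

Definition restr (D : set space) (u : space -> 'cV[C]_N) : space -> 'cV[C]_N :=
  fun z => if z \in D then u z else 0.

(* um is u^- for the trace u0; on x < 0 the transform of e^{-g t} um is R^{-1} v *)
Definition profile (g : R) (u0 : 'rV[R]_n.+1 -> 'cV[C]_N)
    (um : space -> 'cV[C]_N) : Prop :=
  exists h0 v, [/\ fourier (bweight (- g) u0) h0,
    profile_system g h0 v
  & tfourier (restr xneg (weight (- g) um))
      (restr xneg (fun z => invmx (Q (g, z.1)) *m v z))].

Definition glue_halves (um u : space -> 'cV[C]_N) : space -> 'cV[C]_N :=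
  fun z => if z.2 < 0 then um z else u z.

(* F extends f to all times; f vanishes for t < 0 *)
Definition time_extension (T g : R) (f F : space -> 'cV[C]_N) : Prop :=
  [/\ mem_L2w g xpos F,
      {ae lebesgue_ty n.+1, forall z : space,
         (Omega_T T `&` xpos) z -> F z = f z}
    & vanishes_past xpos F].

End problems.

(* Main.v *)
(* After multiplication by e^{-gt} and Fourier transform in (t, y), each of the
   three problems becomes, for almost every frequency, a weak constant
   coefficient ODE in x. A solution z in L^2 of z' = A z + r on the whole line
   satisfies int Re (S z, A z + r) = 0 (cut off, transform in x, and use that S
   is hermitian), so Re (SA) >= lam g gives an energy estimate. Since Gamma u = 0
   forces P^- R u = 0 at x = 0, the profile u^- has the same trace as u there, so
   z = u^eps - u~ has no jump at x = 0 and solves the penalized ODE on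
   the whole line with a source S^{-1} R P^- (R^{-1} S A u^-) on x < 0, which the
   penalization eps^{-1} |P^- R z|^2 absorbs. Hence at each frequency
   lam g |z|^2 <= (eps / 4) |R^{-1} S A u^-|^2 in L^2(dx). As A(zeta) is unbounded
   this bound need not be integrable in the frequency, but |z|^2 is also bounded
   independently of eps, by the same estimate applied to u^eps, and dominated
   convergence concludes. *)
From HB Require Import structures.
Require Import Defs.
From mathcomp Require Import all_boot all_order all_algebra.
From mathcomp Require Import all_classical all_reals all_analysis.
From mathcomp Require Import mxpoly sesquilinear spectral complex.
From mathcomp Require Import measurable_realfun.
From mathcomp Require Import ring lra.
Set Implicit Arguments.
Unset Strict Implicit.
Unset Printing Implicit Defensive.
Import Order.TTheory GRing.Theory Num.Theory.
Import numFieldNormedType.Exports.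
Local Open Scope classical_set_scope.
Local Open Scope ring_scope.
Local Open Scope complex_scope.

(** The transforms of the statement are L2 limits of transforms of sharp truncations, while the
    equations can only be tested with smooth real functions of compact support. The bridge is that
    the L2 transform does not depend on the cut-off: smooth cut-offs times [e^{-g t}] and a cosine
    or sine are admissible tests, and the derivatives of the cut-offs are errors tending to 0 in L2.
    At almost every frequency all these errors become small together, so the frequency-wise equation
    is exact.

    The vanishing of the integral of [Re (S z, z')] is stated as equality of the L2 norms of
    [S z + z'] and [S z - z']. Only integrals of nonnegative functions then occur, and after
    transform in x the equality is pointwise, since [(S z, i xi z)] has zero real part.

    The constant [eps / 4] is the minimum of [p^2 / eps + p r], up to sign and the factor [r^2],
    with [p] the size of [P^- R z]. The source contains the unbounded [A], but the bound independent
    of [eps] only involves [f] and a bound on [S] over all frequencies, which comes from homogeneity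
    and compactness of a half sphere reaching [gamma = 0]. *)

Definition rint d (T : measurableType d) (R : realType) (mu : {measure set T -> \bar R})
  (f : T -> R) := mu.-integrable setT (EFin \o f).

(** * Real-valued integrals and Fubini *)

Section real_integrals.
Context d (T : measurableType d) (R : realType) (mu : {measure set T -> \bar R}).
Implicit Types f g : T -> R.

Lemma rint_measurable f : rint mu f -> measurable_fun setT f.
Proof. by move=> /integrableP[/measurable_EFinP]. Qed.

Lemma rint_le f g : measurable_fun setT f -> rint mu g ->
  (forall x, `|f x| <= `|g x|) -> rint mu f.
Proof.
move=> mf ig fg; apply: le_integrable ig => //; first exact/measurable_EFinP.
by move=> x _; rewrite /= lee_fin.
Qed.

Lemma eq_rint f g : f =1 g -> rint mu f -> rint mu g.
Proof. by move=> /funext ->. Qed.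

Lemma rintD f g : rint mu f -> rint mu g -> rint mu (fun x => f x + g x).
Proof. by move=> iF iG; apply: (integrableD measurableT iF iG). Qed.

Lemma rintB f g : rint mu f -> rint mu g -> rint mu (fun x => f x - g x).
Proof. by move=> iF iG; apply: (integrableB measurableT iF iG). Qed.

Lemma rintZ k f : rint mu f -> rint mu (fun x => k * f x).
Proof. by move=> iF; apply: (integrableZl measurableT k iF). Qed.

Lemma rint0 : rint mu (fun=> 0).
Proof. exact: integrable0. Qed.

Lemma rint_sum (I : Type) (s : seq I) (P : pred I) (h : I -> T -> R) :
  (forall i, rint mu (h i)) -> rint mu (fun x => \sum_(i <- s | P i) h i x).
Proof.
move=> ih; elim: s => [|i s IH].
  by apply: eq_rint rint0 => x; rewrite big_nil.
apply: (@eq_rint (fun x => (if P i then h i x else 0) + \sum_(i <- s | P i) h i x)).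
  by move=> x; rewrite big_cons; case: ifP => //; rewrite add0r.
by apply: rintD => //; case: (P i) => //; exact: rint0.
Qed.

Lemma rint_norm f : rint mu f -> rint mu (fun x => `|f x|).
Proof. by move=> /integrable_norm. Qed.

Lemma rint_mul_bounded f g M : rint mu g -> measurable_fun setT f ->
  (forall x, `|f x| <= M) -> rint mu (fun x => f x * g x).
Proof.
move=> ig mf fM; apply: (@rint_le _ (fun x => M * g x)).
- by apply: measurable_funM => //; exact: rint_measurable.
- exact: rintZ.
- move=> x; rewrite !normrM ler_wpM2r//; apply: le_trans (fM x) _; exact: ler_norm.
Qed.

Lemma RintD f g : rint mu f -> rint mu g ->
  \int[mu]_x (f x + g x) = \int[mu]_x f x + \int[mu]_x g x.
Proof. by move=> iF iG; rewrite RintegralD. Qed.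

Lemma RintB f g : rint mu f -> rint mu g ->
  \int[mu]_x (f x - g x) = \int[mu]_x f x - \int[mu]_x g x.
Proof. by move=> iF iG; rewrite RintegralB. Qed.

Lemma RintZ k f : rint mu f -> \int[mu]_x (k * f x) = k * \int[mu]_x f x.
Proof. by move=> iF; rewrite RintegralZl. Qed.

Lemma Rint_ext f g : f =1 g -> \int[mu]_x f x = \int[mu]_x g x.
Proof. by move=> /funext ->. Qed.

Lemma Rint_zero : \int[mu]_x (0 : R) = 0.
Proof. by rewrite Rintegral_cst// mul0r. Qed.

Lemma Rint_sum (I : Type) (s : seq I) (P : pred I) (h : I -> T -> R) :
  (forall i, rint mu (h i)) ->
  \int[mu]_x (\sum_(i <- s | P i) h i x) = \sum_(i <- s | P i) \int[mu]_x h i x.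
Proof.
move=> ih; elim: s => [|i s IH].
  transitivity (\int[mu]_x (0 : R)); last by rewrite Rint_zero big_nil.
  by apply: Rint_ext => x; rewrite big_nil.
rewrite big_cons -IH; case: ifP => Pi.
  by rewrite -RintD//; [apply: Rint_ext => x; rewrite big_cons Pi|exact: rint_sum].
by apply: Rint_ext => x; rewrite big_cons Pi.
Qed.

Lemma EFin_Rint f : rint mu f -> ((\int[mu]_x f x)%:E = \int[mu]_x (f x)%:E)%E.
Proof. by move=> iF; rewrite /Rintegral fineK//; exact: integrable_fin_num. Qed.

Lemma Rint_le f g : rint mu f -> rint mu g -> (forall x, f x <= g x) ->
  \int[mu]_x f x <= \int[mu]_x g x.
Proof. by move=> iF iG fg; apply: le_Rintegral. Qed.

Lemma Rint_norm f : rint mu f -> `|\int[mu]_x f x| <= \int[mu]_x `|f x|.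
Proof. by move=> iF; apply: le_normr_Rintegral. Qed.

Lemma rint_ge0P f : measurable_fun setT f -> (forall x, 0 <= f x) ->
  (\int[mu]_x (f x)%:E < +oo)%E -> rint mu f.
Proof.
move=> mf f0 foo; apply/integrableP; split; first exact/measurable_EFinP.
by apply: le_lt_trans foo; under eq_integral => x _ do rewrite /= ger0_norm//.
Qed.

Lemma rint_indic A : measurable A -> (mu A < +oo)%E -> rint mu (\1_A : T -> R).
Proof.
move=> mA Aoo; apply: rint_ge0P.
- exact: measurable_indic.
- by move=> x; rewrite indicE.
- by rewrite integral_indic// setIT.
Qed.

Lemma rint_lty f : rint mu f -> (\int[mu]_x (`|f x|)%:E < +oo)%E.
Proof. by move=> /integrableP[]. Qed.

Lemma ge0_int_le (f g : T -> \bar R) : measurable_fun setT f -> measurable_fun setT g ->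
  (forall x, 0 <= f x)%E -> (forall x, f x <= g x)%E ->
  (\int[mu]_x f x <= \int[mu]_x g x)%E.
Proof. by move=> mf mg f0 fg; apply: ge0_le_integral. Qed.

Lemma Rint_dominated (f_ : nat -> T -> R) f g : (forall n, measurable_fun setT (f_ n)) ->
  measurable_fun setT f -> {ae mu, forall x, f_ n x @[n --> \oo] --> f x} ->
  rint mu g -> (forall n x, `|f_ n x| <= g x) ->
  \int[mu]_x f_ n x @[n --> \oo] --> \int[mu]_x f x.
Proof.
move=> mf_ mf ff ig fg.
have [||||| iF _ cv] := @dominated_convergence _ _ _ mu setT measurableT
  (fun n x => (f_ n x)%:E) (EFin \o f) (EFin \o g).
- by move=> n; exact/measurable_EFinP.
- exact/measurable_EFinP.
- by apply: filterS ff => x fx _; apply/fine_cvgP; split => //=; apply: nearW.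
- exact: ig.
- by apply: aeW => x n _; rewrite /= lee_fin.
by apply: fine_cvg; rewrite (EFin_Rint iF).
Qed.

End real_integrals.

(** [fine] sends infinite values to 0, and an integrable function takes them only on a null set. It
    serves for integrals over slices, which are finite only almost everywhere. *)
Lemma rint_ae_fine d (T : measurableType d) (R : realType) (mu : {measure set T -> \bar R})
  (f : T -> \bar R) : mu.-integrable setT f -> rint mu (fine \o f).
Proof.
move=> iF.
have mf : measurable_fun setT (fine \o f).
  by apply: (measurableT_comp (fine_measurable measurableT)); exact: measurable_int iF.
apply/integrableP; split; first exact/measurable_EFinP.
move/integrableP : (iF) => [mF]; apply: le_lt_trans.
rewrite le_eqVlt; apply/orP; left; apply/eqP.
apply: ae_eq_integral => //.
- by apply: measurableT_comp => //; exact/measurable_EFinP.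
- exact: measurableT_comp.
- by apply: filterS (integrable_ae measurableT iF) => x h _ /=; rewrite -[in RHS](fineK (h I)).
Qed.

Section real_fubini.
Context d1 d2 (T1 : measurableType d1) (T2 : measurableType d2) (R : realType).
Variables (m1 : {sigma_finite_measure set T1 -> \bar R})
          (m2 : {sigma_finite_measure set T2 -> \bar R}).
Implicit Types f : T1 * T2 -> R.

Lemma measurable_slice1 d (T : measurableType d) (f : T1 * T2 -> T) x :
  measurable_fun setT f -> measurable_fun setT (fun y => f (x, y)).
Proof. by move=> mf; apply: (measurableT_comp mf); exact: pair1_measurable. Qed.

Lemma measurable_slice2 d (T : measurableType d) (f : T1 * T2 -> T) y :
  measurable_fun setT f -> measurable_fun setT (fun x => f (x, y)).
Proof. by move=> mf; apply: (measurableT_comp mf); exact: pair2_measurable. Qed.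

(** The inner real integral takes a default value where that of the slice is infinite; this concerns
    a null set of slices and leaves the outer integral unchanged. *)
Lemma Rint_prod1 f : rint (m1 \x m2)%E f ->
  \int[(m1 \x m2)%E]_z f z = \int[m1]_x \int[m2]_y f (x, y).
Proof.
move=> iF; rewrite /Rintegral -(integral12_prod_meas1 iF); congr fine.
have iFF := integrable_fubini_F iF.
apply: ae_eq_integral => //.
- exact: measurable_int iFF.
- by apply/measurable_EFinP/(measurableT_comp (fine_measurable measurableT)) => //; exact: measurable_int iFF.
- by apply: filterS (integrable_ae measurableT iFF) => x h _; rewrite fineK//; exact: h.
Qed.

Lemma Rint_prod2 f : rint (m1 \x m2)%E f ->
  \int[(m1 \x m2)%E]_z f z = \int[m2]_y \int[m1]_x f (x, y).
Proof.
move=> iF; rewrite /Rintegral -(integral21_prod_meas1 iF); congr fine.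
have iFF : m2.-integrable setT (fubini_G m1 (EFin \o f)).
  apply/integrableP; split; first exact: (measurable_fubini_G iF).
  have := iF => /integrable21ltyP => /(_ (measurable_int _ iF)).
  apply: le_lt_trans; apply: ge0_int_le => //.
  - by apply: measurableT_comp => //; exact: (measurable_fubini_G iF).
  - apply: (measurable_fun_fubini_tonelli_G (abse \o (EFin \o f))) => //=.
      by apply: measurableT_comp => //; exact: measurable_int iF.
  - move=> y; apply: le_abse_integral => //.
    by apply: measurable_slice2; exact: measurable_int iF.
apply: ae_eq_integral => //.
- exact: measurable_int iFF.
- by apply/measurable_EFinP/(measurableT_comp (fine_measurable measurableT)) => //; exact: measurable_int iFF.
- by apply: filterS (integrable_ae measurableT iFF) => x h _; rewrite fineK//; exact: h.
Qed.

Lemma Rint_swap f : rint (m1 \x m2)%E f ->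
  \int[m1]_x \int[m2]_y f (x, y) = \int[m2]_y \int[m1]_x f (x, y).
Proof. by move=> iF; rewrite -Rint_prod1// Rint_prod2. Qed.

Lemma rint_prod (f : T1 -> R) (g : T2 -> R) : rint m1 f -> rint m2 g ->
  rint (m1 \x m2)%E (fun z => f z.1 * g z.2).
Proof.
move=> iF iG; apply/integrable12ltyP.
  apply/measurable_EFinP/measurable_funM.
    exact: measurableT_comp (rint_measurable iF) measurable_fst.
  exact: measurableT_comp (rint_measurable iG) measurable_snd.
rewrite (_ : (fun x => _) = fun x => (`|f x|%:E * \int[m2]_y `|g y|%:E)%E).
  rewrite ge0_integralZr//; last exact: integral_ge0.
    by apply: lte_mul_pinfty; rewrite ?integral_ge0// ?ge0_fin_numE ?integral_ge0// ?rint_lty.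
  by apply/measurable_EFinP/measurableT_comp => //; exact: rint_measurable iF.
apply/funext => x; rewrite -ge0_integralZl_EFin//.
- by apply: eq_integral => y _; rewrite /= normrM EFinM.
- by apply/measurable_EFinP/measurableT_comp => //; exact: rint_measurable iG.
Qed.

(* Measurability of a parametric integral, without integrability: both signs
   are handled by Tonelli. *)
Lemma measurable_Rint_param f : measurable_fun setT f ->
  measurable_fun setT (fun x => \int[m2]_y f (x, y)).
Proof.
move=> mf.
have mE : measurable_fun setT (EFin \o f) by exact/measurable_EFinP.
apply: (measurableT_comp (fine_measurable measurableT)).
rewrite (_ : (fun x => _) = fun x =>
  (\int[m2]_y (EFin \o f)^\+ (x, y) - \int[m2]_y (EFin \o f)^\- (x, y))%E); last first.
  by apply/funext => x; rewrite [LHS]integralE; congr (_ - _)%E;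
    apply: eq_integral => y _; rewrite !unlock.
apply: emeasurable_funB.
- apply: (measurable_fun_fubini_tonelli_F ((EFin \o f)^\+)%E) => //.
  exact: measurable_funepos.
- apply: (measurable_fun_fubini_tonelli_F ((EFin \o f)^\-)%E) => //.
  exact: measurable_funeneg.
Qed.

End real_fubini.

(** * Plancherel on the line *)

Section poisson_kernel.
Context {R : realType}.
Notation mu := (@lebesgue_measure R).
Implicit Types (d r s t : R).

Lemma int0y_FTC (f F : R -> R) : (forall x, 0 <= x -> 0 <= f x) -> continuous f ->
  (forall x, is_derive x (1 : R) F (f x)) -> F x @[x --> +oo] --> (0 : R) ->
  (\int[mu]_(x in [set x | (0 <= x)%R]) (f x)%:E = (- F 0)%:E)%E.
Proof.
move=> f0 cf dF F0.
have cF : continuous F.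
  by move=> x; apply/differentiable_continuous/derivable1_diffP; exact: (@ex_derive _ _ _ _ _ _ _ (dF x)).
rewrite -set_itvcy (ge0_continuous_FTC2y f0 _ F0); first by rewrite -EFinB sub0r.
- exact: continuous_subspaceT.
- by move=> x _; exact: (@ex_derive _ _ _ _ _ _ _ (dF x)).
- exact: cvg_at_right_filter (cF 0).
- by move=> x _; rewrite derive1E; exact: (@derive_val _ _ _ _ _ _ _ (dF x)).
Qed.

Lemma expR_lin_cvg0 d : 0 < d -> expR (- (d * x)) @[x --> +oo] --> (0 : R).
Proof.
move=> d0; apply: (cvg_comp _ _ _ (@cvgr_expR R)).
by apply: gt0_cvgMry => //; exact: cvg_id.
Qed.

(** Antiderivative of [e^{-d x} (1 + cos (r x))] that vanishes at infinity. The summand 1 keeps the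
    integrand nonnegative, as [int0y_FTC] requires; the bare cosine is recovered by subtraction in
    [Rint_pw_cos]. *)
Let F d r x : R := expR (- (d * x)) * (- d^-1 +
  (r * sin (r * x) - d * cos (r * x)) / (d ^+ 2 + r ^+ 2)).

Let den_gt0 d r : 0 < d -> 0 < d ^+ 2 + r ^+ 2.
Proof. by move=> d0; rewrite ltr_wpDr ?sqr_ge0// exprn_gt0. Qed.

Let dF d r x : 0 < d -> is_derive x (1 : R) (F d r) (expR (- (d * x)) * (1 + cos (r * x))).
Proof.
move=> d0; rewrite /F.
have h1 : is_derive x (1:R) (fun x => - (d * x)) (- d).
  by apply: is_derive_eq; rewrite /GRing.scale /= mulr1.
have h2 : is_derive x (1:R) (fun x => r * x) r.
  by apply: is_derive_eq; rewrite /GRing.scale /= mulr1.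
have he := is_derive1_comp (is_derive_expR _) h1.
have hs := is_derive1_comp (is_derive_sin _) h2.
have hc := is_derive1_comp (is_derive_cos _) h2.
have hrs := is_deriveZ r hs.
have hdc := is_deriveZ d hc.
have hx := is_deriveM he (is_deriveD (is_derive_cst (- d^-1) x 1)
   (is_deriveM (is_deriveB hrs hdc) (is_derive_cst (d ^+ 2 + r ^+ 2)^-1 x 1))).
apply: (is_derive_eq hx).
rewrite /GRing.scale /= /cst /= !mulr0 !add0r.
rewrite [X in _ + X * _ = _](_ : _ = - d^-1 + (r * sin (r * x) - d * cos (r * x)) / (d ^+ 2 + r ^+ 2))//.
have dn := den_gt0 r d0.
by field; rewrite !gt_eqF// -?expr2.
Qed.

Let F_cvg d r : 0 < d -> F d r x @[x --> +oo] --> (0 : R).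
Proof.
move=> d0; pose M := d^-1 + (`|r| + d) / (d ^+ 2 + r ^+ 2).
have dn := den_gt0 r d0.
apply: norm_cvg0.
apply: (@squeeze_cvgr _ _ _ _ (cst 0) (fun x => expR (- (d * x)) * M)).
- apply: nearW => x; rewrite normr_ge0/= normrM ger0_norm ?expR_ge0// ler_wpM2l ?expR_ge0//.
  apply: (le_trans (ler_normD _ _)); rewrite normrN (gtr0_norm (_ : 0 < d^-1)) ?invr_gt0// lerD2l.
  rewrite normrM (gtr0_norm (_ : 0 < _^-1)) ?invr_gt0// ler_wpM2r ?invr_ge0 ?(ltW dn)//.
  apply/(le_trans (ler_normB _ _))/lerD; rewrite normrM.
    by rewrite ler_piMr// ler_norml sin_geN1 sin_le1.
  by rewrite (gtr0_norm d0) ler_piMr ?(ltW d0)// ler_norml cos_geN1 cos_le1.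
- exact: cvg_cst.
- by rewrite -(mul0r M); apply: cvgMr_tmp; exact: expR_lin_cvg0.
Qed.

Definition pw d t : R := expR (- (d * `|t|)).

Lemma pw_gt0 d t : 0 < pw d t. Proof. exact: expR_gt0. Qed.

Lemma continuous_pw d : continuous (pw d).
Proof.
move=> x; apply: (@continuous_comp R R R (fun t => - (d * `|t|)) expR); last exact: continuous_expR.
apply: (@continuousN R R^o R (fun t => d * `|t|)).
by apply: (@continuousM R R (fun=> d) (fun t => `|t|)); [exact: cvg_cst|exact: norm_continuous].
Qed.

Lemma continuous_scale (r : R) : continuous (fun t : R => r * t).
Proof. by move=> x; apply: mulrl_continuous. Qed.

Let Dcos_ge0 u : 0 <= 1 + cos u :> R.
Proof. by have := cos_geN1 u; lra. Qed.

Let continuous_Dcos r : continuous (fun t : R => 1 + cos (r * t)).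
Proof.
move=> x; apply: (@continuousD R R^o R (fun=> 1) (fun t => cos (r * t))); first exact: cvg_cst.
by apply: (@continuous_comp R R R (fun t => r * t) cos); [exact: continuous_scale|exact: continuous_cos].
Qed.

Let continuous_pw_Dcos d r : continuous (fun t : R => pw d t * (1 + cos (r * t))).
Proof.
by move=> x; apply: (@continuousM R R (pw d)); [exact: continuous_pw|exact: continuous_Dcos].
Qed.

Lemma int_pw_1Dcos d r : 0 < d ->
  (\int[mu]_t (pw d t * (1 + cos (r * t)))%:E = (2 * (d^-1 + d / (d ^+ 2 + r ^+ 2)))%:E)%E.
Proof.
move=> d0; rewrite ge0_symfun_integralT; last 3 first.
- by move=> x; rewrite mulr_ge0 ?Dcos_ge0 ?ltW ?pw_gt0.
- exact: continuous_pw_Dcos.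
- by move=> x /=; rewrite /pw normrN mulrN cosN.
rewrite EFinM; congr (_ * _)%E.
transitivity (\int[mu]_(x in [set x | (0 <= x)%R]) (expR (- (d * x)) * (1 + cos (r * x)))%:E)%E.
  by apply: eq_integral => x; rewrite inE /= => x0; rewrite /pw ger0_norm.
have h1 x : 0 <= x -> 0 <= expR (- (d * x)) * (1 + cos (r * x)).
  by move=> x0; rewrite mulr_ge0 ?expR_ge0 ?Dcos_ge0.
have h2 : continuous (fun x : R => expR (- (d * x)) * (1 + cos (r * x))).
  move=> x; apply: (@continuousM R R (fun t => expR (- (d * t)))); last exact: continuous_Dcos.
  apply: (@continuous_comp R R R (fun t => - (d * t)) expR); last exact: continuous_expR.
  by apply: (@continuousN R R^o R (fun t => d * t)); exact: continuous_scale.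
have -> := int0y_FTC h1 h2 (fun x => dF r x d0) (F_cvg r d0).
congr EFin; rewrite /F !mulr0 oppr0 expR0 sin0 cos0.
by field; rewrite !gt_eqF// ?den_gt0// -expr2.
Qed.

Let m_pw1c d r : measurable_fun setT (fun t => pw d t * (1 + cos (r * t))).
Proof.
exact: (continuous_measurable_fun (@continuous_pw_Dcos d r)).
Qed.

Let r_pw1c d r : 0 < d -> rint mu (fun t => pw d t * (1 + cos (r * t))).
Proof.
move=> d0; apply: rint_ge0P => //.
- exact: m_pw1c.
- by move=> x; rewrite mulr_ge0 ?Dcos_ge0 ?ltW ?pw_gt0.
- by rewrite int_pw_1Dcos// ltry.
Qed.

Lemma rint_pw d : 0 < d -> rint mu (pw d).
Proof.
move=> d0; apply: eq_rint (rintZ 2^-1 (r_pw1c 0 d0)) => x /=.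
by rewrite mul0r cos0; field.
Qed.

Lemma measurable_pw d : measurable_fun setT (pw d).
Proof. exact: (continuous_measurable_fun (@continuous_pw d)). Qed.

Lemma Rint_pw_cos d r : 0 < d ->
  \int[mu]_t (pw d t * cos (r * t)) = 2 * d / (d ^+ 2 + r ^+ 2).
Proof.
move=> d0.
have E u : \int[mu]_t (pw d t * (1 + cos (u * t))) = 2 * (d^-1 + d / (d ^+ 2 + u ^+ 2)).
  by rewrite /Rintegral int_pw_1Dcos.
have -> : \int[mu]_t (pw d t * cos (r * t)) =
  \int[mu]_t (pw d t * (1 + cos (r * t)) - 2^-1 * (pw d t * (1 + cos (0 * t)))).
  by apply: Rint_ext => x; rewrite mul0r cos0; field.
rewrite RintB ?RintZ ?E//; [|exact: r_pw1c..|by apply: rintZ; exact: r_pw1c].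
by field; rewrite !gt_eqF// ?den_gt0// -expr2.
Qed.

Lemma Rint_opp (f : R -> R) : rint mu f -> \int[mu]_t f (- t) = \int[mu]_t f t.
Proof.
move=> iF; rewrite /Rintegral; congr fine.
have mN : measurable_fun setT (-%R : R -> R) by exact: oppr_measurable.
have mf : measurable_fun setT (EFin \o f) := measurable_int _ iF.
have EN : forall g : R -> \bar R, (\int[pushforward mu (-%R : measurableTypeR R -> measurableTypeR R)]_y g y = \int[mu]_y g y)%E.
  by move=> g; apply: eq_measure_integral => A mA _; exact: lebesgue_measureN.
have iN : mu.-integrable setT ((EFin \o f) \o -%R).
  apply/integrableP; split; first exact: measurableT_comp.
  move/integrableP : iF => [_]; rewrite -EN.
  rewrite ge0_integral_pushforward//; exact: measurableT_comp.
by rewrite -[RHS]EN integral_pushforward.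
Qed.

Lemma Rint_pw_sin d r : 0 < d -> \int[mu]_t (pw d t * sin (r * t)) = 0.
Proof.
move=> d0; have iF : rint mu (fun t => pw d t * sin (r * t)).
  apply: (rint_le _ (rint_pw d0)).
  - apply: measurable_funM; first exact: measurable_pw.
    apply: continuous_measurable_fun => x.
    by apply: (@continuous_comp R R R (fun t => r * t) sin); [exact: continuous_scale|exact: continuous_sin].
  - by move=> x; rewrite normrM ler_piMr// ler_norml sin_geN1 sin_le1.
have := Rint_opp iF.
have -> : \int[mu]_t (pw d (- t) * sin (r * - t)) = -1 * \int[mu]_t (pw d t * sin (r * t)).
  by rewrite -RintZ//; apply: Rint_ext => x; rewrite /pw normrN !mulrN sinN; ring.
by move=> h; lra.
Qed.

(** Fourier transform of the weight [pw d], that is [2 pi] times the Poisson kernel of the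
    half-plane at height [d]; hence the mass [2 pi] for every positive [d]. *)
Definition pk d r : R := 2 * d / (d ^+ 2 + r ^+ 2).

Lemma pk_ge0 d r : 0 <= d -> 0 <= pk d r.
Proof. by move=> d0; rewrite /pk divr_ge0// ?mulr_ge0// addr_ge0// sqr_ge0. Qed.

Lemma int_pk d s : 0 < d -> (\int[mu]_t (pk d (s - t))%:E = (2 * pi)%:E)%E.
Proof.
move=> d0.
have c2 : continuous (fun x : R => 2 * (oneDsqr x)^-1).
  move=> x; apply: (@continuousM R R (fun=> 2) (fun x => (oneDsqr x)^-1)); first exact: cvg_cst.
  exact: continuous_oneDsqrV.
have E1 : (\int[mu]_x (2 * (oneDsqr x)^-1)%:E = (2 * pi)%:E)%E.
  rewrite ge0_symfun_integralT; last 3 first.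
  - by move=> x; rewrite mulr_ge0// invr_ge0.
  - exact: c2.
  - by move=> x /=; rewrite /oneDsqr sqrrN.
  have -> : (\int[mu]_(x in [set x | (0 <= x)%R]) (2 * (oneDsqr x)^-1)%:E = 2%:E * (pi / 2)%:E)%E.
    rewrite -set_itvcy -integral0y_oneDsqr -ge0_integralZl_EFin//.
    - apply/measurable_EFinP; apply: measurable_funTS.
      exact: (continuous_measurable_fun (@continuous_oneDsqrV R)).
  by rewrite -!EFinM; congr EFin; field.
pose L (t : R) : R := d^-1 * (t - s).
have dL t : is_derive t (1 : R) L d^-1.
  rewrite /L; apply: is_derive_eq.
  by rewrite /GRing.scale /= oppr0 addr0 mulr1.
have L' : L^`()%classic = cst d^-1.
  by apply/funext => t; rewrite derive1E; exact: (@derive_val _ _ _ _ _ _ _ (dL t)).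
rewrite -E1 [RHS](increasing_ge0_integration_by_substitutionT (F := L)).
- apply: eq_integral => t _; rewrite /= L' /GRing.mul /= -/(GRing.mul _ _); congr EFin.
  rewrite /pk /L /oneDsqr /cst.
  have hd : d ^+ 2 + (s - t) ^+ 2 != 0 by rewrite gt_eqF// den_gt0.
  rewrite (_ : 1 + (d^-1 * (t - s)) ^+ 2 = (d ^+ 2 + (s - t) ^+ 2) / d ^+ 2); last by field; rewrite gt_eqF.
  by field; rewrite hd gt_eqF.
- by move=> x y xy; rewrite /L ltr_pM2l ?invr_gt0// ltrD2r.
- by rewrite L' => x; exact: cvg_cst.
- by rewrite L'; apply: is_cvg_cst.
- by rewrite L'; apply: is_cvg_cst.
- by move=> x; exact: (@ex_derive _ _ _ _ _ _ _ (dL x)).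
- apply: gt0_cvgMrNy; rewrite ?invr_gt0//; apply: cvg_addrr_Ny.
- apply: gt0_cvgMry; rewrite ?invr_gt0//; apply: cvg_addrr.
- exact: c2.
- by move=> x; rewrite mulr_ge0// invr_ge0.
Qed.

Lemma continuous_pk d s : 0 < d -> continuous (fun t : R => pk d (s - t)).
Proof.
move=> d0 x; rewrite /pk.
have c1 : continuous (fun t : R => d ^+ 2 + (s - t) ^+ 2).
  move=> y; apply: (@continuousD R R^o R (fun=> d ^+ 2) (fun t => (s - t) ^+ 2)); first exact: cvg_cst.
  apply: (@continuous_comp R R R (fun t => s - t) (fun u => u ^+ 2)); last exact: exprn_continuous.
  apply: (@continuousB R R^o R (fun=> s) (fun t => t)); [exact: cvg_cst|exact: cvg_id].
apply: (@continuousM R R (fun=> 2 * d) (fun t => (d ^+ 2 + (s - t) ^+ 2)^-1)); first exact: cvg_cst.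
by apply: continuousV; [rewrite gt_eqF// den_gt0|exact: c1].
Qed.

Lemma measurable_pk d : 0 < d -> measurable_fun setT (pk d : R -> R).
Proof.
move=> d0; apply: continuous_measurable_fun.
have := @continuous_pk d 0 d0.
rewrite (_ : (fun t => _) = pk d)//; apply/funext => t.
by rewrite /pk sub0r sqrrN.
Qed.

Lemma rint_pk d s : 0 < d -> rint mu (fun t => pk d (s - t)).
Proof.
move=> d0; apply: rint_ge0P.
- exact: (continuous_measurable_fun (@continuous_pk d s d0)).
- by move=> x; rewrite pk_ge0// ltW.
- by rewrite int_pk// ltry.
Qed.

Lemma Rint_pk d s : 0 < d -> \int[mu]_t pk d (s - t) = 2 * pi.
Proof. by move=> d0; rewrite /Rintegral int_pk. Qed.

(** Away from the origin the kernel is [O(d)] times the fixed integrable profile [pk 1], because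
    [1 + r^2 <= (1 + e^-2) r^2] there. *)
Lemma pk_tail d r e : 0 < d -> 0 < e -> e <= `|r| ->
  pk d r <= d * (1 + e ^- 2) * pk 1 r.
Proof.
move=> d0 e0 er; rewrite /pk expr1n mulr1.
have r2 : e ^+ 2 <= r ^+ 2 by rewrite -(real_normK (num_real r)) ler_sqr ?nnegrE// ltW.
have e2 : 0 < e ^+ 2 by rewrite exprn_gt0.
have r0 : 0 < r ^+ 2 by apply: lt_le_trans r2.
have d2 : 0 < d ^+ 2 by rewrite exprn_gt0.
rewrite ler_pdivrMr ?addr_gt0//.
rewrite [leRHS](_ : _ = d * 2 * ((1 + e ^- 2) * (d ^+ 2 + r ^+ 2)) / (1 + r ^+ 2)); last by ring.
rewrite ler_pdivlMr ?addr_gt0// [2 * d]mulrC ler_pM2l ?mulr_gt0//.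
have h1 : 1 <= e ^- 2 * r ^+ 2 by rewrite mulrC ler_pdivlMr// mul1r.
have h2 : 0 <= e ^- 2 * d ^+ 2 by rewrite mulr_ge0 ?invr_ge0// ltW.
rewrite mulrDl mul1r mulrDr; lra.
Qed.

Definition dn (n : nat) : R := n.+1%:R^-1.
Lemma dn_gt0 n : 0 < dn n. Proof. by rewrite invr_gt0. Qed.

(** Near [s] continuity controls the integrand; far from [s] the bound [M] and [pk_tail] do. The
    mass [2 pi] of the kernel is the origin of the factor in Plancherel's formula. *)
Lemma pk_approx_id (h : R -> R) (M s : R) : measurable_fun setT h -> (forall x, `|h x| <= M) ->
  {for s, continuous h} ->
  \int[mu]_t (pk (dn n) (s - t) * h t) @[n --> \oo] --> 2 * pi * h s.
Proof.
move=> mh hM ch; apply/cvgrPdist_le => /= e e0.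
have M0 : 0 <= M by apply: le_trans (hM 0).
have p0 := @pi_gt0 R.
(* Against the mass [2 pi] this tolerance leaves [e / 2] for the region near [s]. *)
have e1 : 0 < e / (4 * pi) by rewrite divr_gt0// mulr_gt0.
have /cvgrPdist_le/(_ _ e1) := ch.
rewrite near_simpl => /nbhs_ballP[r /= r0 hr].
(* [dn n * D] bounds the far region: the factor of [pk_tail], the oscillation [2 M] of [h], and the
   mass of [pk 1]. *)
pose D := (1 + r ^- 2) * (2 * M) * (2 * pi).
have p0' := ltW p0; have r20 : 0 <= r ^- 2 by rewrite invr_ge0 exprn_ge0 ?ltW.
have D0 : 0 <= D by rewrite /D !mulr_ge0// ?addr_ge0.
have hn : \forall n \near \oo, dn n * D <= e / 2.
  have : dn n * D @[n --> \oo] --> 0 * D by apply: cvgMr_tmp; exact: cvg_harmonic.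
  rewrite mul0r => /cvgrPdist_le/(_ (e / 2)); rewrite divr_gt0// => /(_ isT).
  by apply: filterS => n; rewrite sub0r normrN; apply: le_trans; exact: ler_norm.
near=> n.
have d0 := dn_gt0 n.
have i1 := rint_pk s d0.
have ih : rint mu (fun t => pk (dn n) (s - t) * h t).
  by apply: eq_rint (rint_mul_bounded i1 mh hM) => t; rewrite mulrC.
have E : 2 * pi * h s - \int[mu]_t (pk (dn n) (s - t) * h t) =
    \int[mu]_t (h s * pk (dn n) (s - t) - pk (dn n) (s - t) * h t).
  by rewrite RintB//; [rewrite RintZ// Rint_pk// mulrC|exact: rintZ].
rewrite E.
have iG : rint mu (fun t => e / (4 * pi) * pk (dn n) (s - t) +
    (dn n * (1 + r ^- 2) * (2 * M)) * pk 1 (s - t)).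
  by apply: rintD; apply: rintZ; exact: rint_pk.
have iD : rint mu (fun t => h s * pk (dn n) (s - t) - pk (dn n) (s - t) * h t).
  by apply: rintB => //; exact: rintZ.
apply: (le_trans (Rint_norm iD)).
apply: (le_trans (Rint_le (rint_norm iD) iG _)).
  move=> t; rewrite [h s * _]mulrC -mulrBr normrM (ger0_norm (pk_ge0 _ (ltW d0))).
  have pn := pk_ge0 (s - t) (ltW d0); have p1 := pk_ge0 (s - t) (@ler01 R).
  have [rt|tr] := leP r `|s - t|.
    apply: (@le_trans _ _ (pk (dn n) (s - t) * (2 * M))).
      rewrite ler_wpM2l//; apply: (le_trans (ler_normB _ _)).
      by have := hM s; have := hM t; lra.
    apply: (@le_trans _ _ ((dn n * (1 + r ^- 2) * pk 1 (s - t)) * (2 * M))).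
      by rewrite ler_wpM2r ?mulr_ge0// pk_tail.
    have : 0 <= e / (4 * pi) * pk (dn n) (s - t) by rewrite mulr_ge0// ltW.
    rewrite (_ : dn n * (1 + r ^- 2) * (2 * M) * pk 1 (s - t) = dn n * (1 + r ^- 2) * pk 1 (s - t) * (2 * M)); last by ring.
    lra.
  rewrite mulrC -[X in X <= _]addr0; apply: lerD.
    rewrite ler_wpM2r//; exact: hr.
  by apply: mulr_ge0 => //; apply: mulr_ge0; [apply: mulr_ge0; [exact: ltW|exact: addr_ge0]|exact: mulr_ge0].
rewrite RintD; [|by apply: rintZ; exact: rint_pk..].
rewrite (RintZ _ (rint_pk s d0)) (RintZ _ (rint_pk s (@ltr01 R))) !Rint_pk//.
have hn' : dn n * D <= e / 2 by near: n.
have E4 (q : R) : 0 < q -> e / (4 * q) * (2 * q) = e / 2 by move=> q0; field; exact: lt0r_neq0.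
rewrite E4//.
rewrite (_ : dn n * (1 + r ^- 2) * (2 * M) * (2 * pi) = dn n * D); last by rewrite /D; ring.
lra.
Unshelve. all: by end_near. Qed.

End poisson_kernel.

(** * Complex-valued functions, integrated by components *)

Section complex_functions.
Context {R : realType}.
Local Notation C := R[i].
Implicit Types z w : C.

(** The norm of [R[i]] is itself complex-valued, so all estimates are made with this real squared
    modulus. *)
Definition sqn (z : C) : R := (complex.Re z) ^+ 2 + (complex.Im z) ^+ 2.

Lemma cReD z w : complex.Re (z + w) = complex.Re z + complex.Re w. Proof. by case: z; case: w. Qed.
Lemma cImD z w : complex.Im (z + w) = complex.Im z + complex.Im w. Proof. by case: z; case: w. Qed.
Lemma cReN z : complex.Re (- z) = - complex.Re z. Proof. by case: z. Qed.
Lemma cImN z : complex.Im (- z) = - complex.Im z. Proof. by case: z. Qed.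
Lemma cReB z w : complex.Re (z - w) = complex.Re z - complex.Re w. Proof. by rewrite cReD cReN. Qed.
Lemma cImB z w : complex.Im (z - w) = complex.Im z - complex.Im w. Proof. by rewrite cImD cImN. Qed.
Lemma cReM z w : complex.Re (z * w) = complex.Re z * complex.Re w - complex.Im z * complex.Im w.
Proof. by case: z; case: w. Qed.
Lemma cImM z w : complex.Im (z * w) = complex.Re z * complex.Im w + complex.Im z * complex.Re w.
Proof. by case: z => a b; case: w => c d /=; rewrite [a * d]mulrC. Qed.

Lemma Re_sum (I : Type) (s : seq I) (P : pred I) (F : I -> C) :
  complex.Re (\sum_(i <- s | P i) F i) = \sum_(i <- s | P i) complex.Re (F i).
Proof. by elim/big_rec2: _ => // i y1 y2 _ <-; rewrite cReD. Qed.
Lemma Im_sum (I : Type) (s : seq I) (P : pred I) (F : I -> C) :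
  complex.Im (\sum_(i <- s | P i) F i) = \sum_(i <- s | P i) complex.Im (F i).
Proof. by elim/big_rec2: _ => // i y1 y2 _ <-; rewrite cImD. Qed.
Lemma eq_ReIm z w : complex.Re z = complex.Re w -> complex.Im z = complex.Im w -> z = w.
Proof. by case: z => a b; case: w => c d /= -> ->. Qed.

Lemma sqn_ge0 z : 0 <= sqn z. Proof. by rewrite addr_ge0 ?sqr_ge0. Qed.
Lemma sqn0 : sqn 0 = 0. Proof. by rewrite /sqn /= expr0n addr0. Qed.
Lemma sqnM z w : sqn (z * w) = sqn z * sqn w.
Proof. by rewrite /sqn cReM cImM; ring. Qed.
Lemma sqnN z : sqn (- z) = sqn z.
Proof. by rewrite /sqn cReN cImN; ring. Qed.
Lemma sqnR (x : R) : sqn x%:C = x ^+ 2. Proof. by rewrite /sqn /= expr0n addr0. Qed.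
Lemma sqnB z w : sqn (z - w) = sqn (w - z). Proof. by rewrite -sqnN opprB. Qed.

(* (1 + e) |z|^2 + (1 + 1/e) |w|^2 bounds |z + w|^2; e = 1 is the crude version. *)
Lemma sqnD_le (e : R) z w : 0 < e -> sqn (z + w) <= (1 + e) * sqn z + (1 + e^-1) * sqn w.
Proof.
move=> e0; have sq (a b : R) : (a + b) ^+ 2 <= (1 + e) * a ^+ 2 + (1 + e^-1) * b ^+ 2.
  rewrite -subr_ge0.
  have -> : (1 + e) * a ^+ 2 + (1 + e^-1) * b ^+ 2 - (a + b) ^+ 2 = e^-1 * (e * a - b) ^+ 2.
    by field; rewrite gt_eqF.
  by rewrite mulr_ge0 ?invr_ge0 ?sqr_ge0 ?ltW.
by rewrite /sqn cReD cImD; have := sq (complex.Re z) (complex.Re w);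
  have := sq (complex.Im z) (complex.Im w); lra.
Qed.

Lemma sqnD_le2 z w : sqn (z + w) <= 2 * sqn z + 2 * sqn w.
Proof. by have := @sqnD_le 1 z w ltr01; rewrite invr1 -natr1. Qed.

Lemma sqn_Re_le z : complex.Re z ^+ 2 <= sqn z.
Proof. by rewrite lerDl sqr_ge0. Qed.
Lemma sqn_Im_le z : complex.Im z ^+ 2 <= sqn z.
Proof. by rewrite lerDr sqr_ge0. Qed.

Lemma sqn_expi (a : R) : sqn (expi a) = 1.
Proof. by rewrite /sqn /= cos2Dsin2. Qed.

Lemma expiD (a b : R) : expi (a + b) = expi a * expi b.
Proof. by apply: eq_ReIm; rewrite ?cReM ?cImM /= ?cosD ?sinD//; ring. Qed.

Lemma norm_sqr_le (a M : R) : a ^+ 2 <= M ^+ 2 -> 0 <= M -> `|a| <= M.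
Proof. by move=> h M0; rewrite -(@ler_sqr R `|a| M) ?nnegrE// real_normK// num_real. Qed.

Section measure.
Context d (T : measurableType d) (mu : {measure set T -> \bar R}).
Implicit Types f g : T -> C.

Definition mC f := measurable_fun setT (fun x => complex.Re (f x)) /\
  measurable_fun setT (fun x => complex.Im (f x)).
Definition rC f := rint mu (fun x => complex.Re (f x)) /\ rint mu (fun x => complex.Im (f x)).
Definition Cint f : C := (\int[mu]_x complex.Re (f x)) +i* (\int[mu]_x complex.Im (f x)).
(** Squared L2 norm, left in [\bar R] so that it can be compared and passed to the limit before
    finiteness is known. *)
Definition E2 f : \bar R := (\int[mu]_x (sqn (f x))%:E)%E.

Lemma mC_D f g : mC f -> mC g -> mC (fun x => f x + g x).
Proof.
move=> [f1 f2] [g1 g2]; split.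
  by under eq_fun do rewrite cReD; exact: measurable_funD.
by under eq_fun do rewrite cImD; exact: measurable_funD.
Qed.

Lemma mC_M f g : mC f -> mC g -> mC (fun x => f x * g x).
Proof.
move=> [f1 f2] [g1 g2]; split.
  by under eq_fun do rewrite cReM; apply: measurable_funB; exact: measurable_funM.
by under eq_fun do rewrite cImM; apply: measurable_funD; exact: measurable_funM.
Qed.

Lemma mC_cst (c : C) : mC (fun=> c). Proof. by split; exact: measurable_cst. Qed.

Lemma mC_N f : mC f -> mC (fun x => - f x).
Proof.
move=> [f1 f2]; split.
  by under eq_fun do rewrite cReN; exact: measurable_funN.
by under eq_fun do rewrite cImN; exact: measurable_funN.
Qed.

Lemma mC_B f g : mC f -> mC g -> mC (fun x => f x - g x).
Proof. by move=> mf mg; apply: mC_D => //; exact: mC_N. Qed.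

Lemma mC_R (h : T -> R) : measurable_fun setT h -> mC (fun x => (h x)%:C).
Proof. by move=> mh; split => //=; exact: measurable_cst. Qed.

Lemma mC_expi (h : T -> R) : measurable_fun setT h -> mC (fun x => expi (h x)).
Proof.
move=> mh; split => /=; apply: measurableT_comp => //.
- exact: (continuous_measurable_fun (@continuous_cos R)).
- exact: (continuous_measurable_fun (@continuous_sin R)).
Qed.

Lemma measurable_sqn f : mC f -> measurable_fun setT (fun x => sqn (f x)).
Proof. by move=> [f1 f2]; apply: measurable_funD; exact: measurable_funX. Qed.

Lemma measurable_sqnE f : mC f -> measurable_fun setT (fun x => (sqn (f x))%:E).
Proof. by move=> mf; apply/measurable_EFinP; exact: measurable_sqn. Qed.

Lemma rC_mC f : rC f -> mC f.
Proof. by move=> [/rint_measurable ? /rint_measurable]. Qed.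

Lemma rC_D f g : rC f -> rC g -> rC (fun x => f x + g x).
Proof.
move=> [f1 f2] [g1 g2]; split.
  by apply: eq_rint (rintD f1 g1) => x; rewrite cReD.
by apply: eq_rint (rintD f2 g2) => x; rewrite cImD.
Qed.

Lemma rC_Z (c : C) f : rC f -> rC (fun x => c * f x).
Proof.
move=> [f1 f2]; split.
  by apply: eq_rint (rintB (rintZ (complex.Re c) f1) (rintZ (complex.Im c) f2)) => x; rewrite cReM.
by apply: eq_rint (rintD (rintZ (complex.Re c) f2) (rintZ (complex.Im c) f1)) => x; rewrite cImM.
Qed.

Lemma rC_sum (I : Type) (s : seq I) (P : pred I) (F : I -> T -> C) : (forall i, rC (F i)) ->
  rC (fun x => \sum_(i <- s | P i) F i x).
Proof.
move=> mF; split.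
  by apply: eq_rint (rint_sum s P (fun i => (mF i).1)) => x; rewrite Re_sum.
by apply: eq_rint (rint_sum s P (fun i => (mF i).2)) => x; rewrite Im_sum.
Qed.

Lemma rC_mul_bounded f g (M : R) : mC f -> rC g -> (forall x, sqn (f x) <= M ^+ 2) -> 0 <= M ->
  rC (fun x => f x * g x).
Proof.
move=> [f1 f2] [g1 g2] fM M0.
have b1 x : `|complex.Re (f x)| <= M.
  by apply: norm_sqr_le => //; apply: le_trans (fM x); exact: sqn_Re_le.
have b2 x : `|complex.Im (f x)| <= M.
  by apply: norm_sqr_le => //; apply: le_trans (fM x); exact: sqn_Im_le.
split.
  by apply: eq_rint (rintB (rint_mul_bounded g1 f1 b1) (rint_mul_bounded g2 f2 b2)) => x; rewrite cReM.
by apply: eq_rint (rintD (rint_mul_bounded g2 f1 b1) (rint_mul_bounded g1 f2 b2)) => x; rewrite cImM.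
Qed.

Lemma rC_le f (g : T -> R) : mC f -> rint mu g -> (forall x, sqn (f x) <= g x ^+ 2) ->
  (forall x, 0 <= g x) -> rC f.
Proof.
move=> [f1 f2] ig fg g0; split; apply: (rint_le _ ig) => // x; rewrite (ger0_norm (g0 x)).
  by apply: norm_sqr_le => //; apply: le_trans (fg x); exact: sqn_Re_le.
by apply: norm_sqr_le => //; apply: le_trans (fg x); exact: sqn_Im_le.
Qed.

Lemma Cint_ext f g : f =1 g -> Cint f = Cint g.
Proof. by move=> /funext ->. Qed.

Lemma CintD f g : rC f -> rC g -> Cint (fun x => f x + g x) = Cint f + Cint g.
Proof.
move=> [f1 f2] [g1 g2]; apply: eq_ReIm; rewrite ?cReD ?cImD /=.
  by rewrite -RintD//; apply: Rint_ext => x; rewrite cReD.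
by rewrite -RintD//; apply: Rint_ext => x; rewrite cImD.
Qed.

Lemma CintB f g : rC f -> rC g -> Cint (fun x => f x - g x) = Cint f - Cint g.
Proof.
move=> [f1 f2] [g1 g2]; apply: eq_ReIm; rewrite ?cReB ?cImB /=.
  by rewrite -RintB//; apply: Rint_ext => x; rewrite cReB.
by rewrite -RintB//; apply: Rint_ext => x; rewrite cImB.
Qed.

Lemma CintZ c f : rC f -> Cint (fun x => c * f x) = c * Cint f.
Proof.
move=> [f1 f2]; apply: eq_ReIm; rewrite ?cReM ?cImM /=.
  by rewrite -!RintZ// -RintB; [apply: Rint_ext => x; rewrite cReM|exact: rintZ..].
by rewrite -!RintZ// -RintD; [apply: Rint_ext => x; rewrite cImM|exact: rintZ..].
Qed.

Lemma Cint0 : Cint (fun=> 0) = 0.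
Proof. by apply: eq_ReIm; rewrite /= Rint_zero. Qed.

Lemma Cint_sum (I : Type) (s : seq I) (P : pred I) (F : I -> T -> C) : (forall i, rC (F i)) ->
  Cint (fun x => \sum_(i <- s | P i) F i x) = \sum_(i <- s | P i) Cint (F i).
Proof.
move=> rF; apply: eq_ReIm; rewrite ?Re_sum ?Im_sum /=.
  by rewrite -Rint_sum => [|i]; [apply: Rint_ext => x; rewrite Re_sum|case: (rF i)].
by rewrite -Rint_sum => [|i]; [apply: Rint_ext => x; rewrite Im_sum|case: (rF i)].
Qed.

Lemma E2_ge0 f : (0 <= E2 f)%E.
Proof. by apply: integral_ge0 => x _; rewrite lee_fin sqn_ge0. Qed.

Lemma E2_ext f g : f =1 g -> E2 f = E2 g.
Proof. by move=> /funext ->. Qed.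

Lemma E2_le f g (c : R) : mC f -> mC g -> 0 <= c -> (forall x, sqn (f x) <= c * sqn (g x)) ->
  (E2 f <= c%:E * E2 g)%E.
Proof.
move=> mf mg c0 fg; rewrite /E2 -ge0_integralZl_EFin//; last exact: measurable_sqnE.
  apply: ge0_int_le.
  - exact: measurable_sqnE.
  - by apply: measurable_funeM; exact: measurable_sqnE.
  - by move=> x; rewrite lee_fin sqn_ge0.
  - by move=> x; rewrite -EFinM lee_fin.
by move=> x _; rewrite lee_fin sqn_ge0.
Qed.

Lemma E2D_le (e : R) f g : mC f -> mC g -> 0 < e ->
  (E2 (fun x => f x + g x)%R <= (1 + e)%:E * E2 f + (1 + e^-1)%:E * E2 g)%E.
Proof.
move=> mf mg e0.
have e1 : 0 <= 1 + e^-1 by rewrite addr_ge0// invr_ge0 ltW.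
have e2 : 0 <= 1 + e by rewrite addr_ge0// ltW.
have s0 h x : (0 <= (sqn (h x))%:E :> \bar R)%E by rewrite lee_fin sqn_ge0.
rewrite /E2 -!ge0_integralZl_EFin//; try exact: measurable_sqnE.
rewrite -ge0_integralD//.
- apply: ge0_int_le => //.
  + by apply: measurable_sqnE; exact: mC_D.
  + by apply: emeasurable_funD; apply: measurable_funeM; exact: measurable_sqnE.
  + by move=> x; rewrite -!EFinM -EFinD lee_fin sqnD_le.
- by move=> x _; rewrite mule_ge0.
- by apply: measurable_funeM; exact: measurable_sqnE.
- by move=> x _; rewrite mule_ge0.
- by apply: measurable_funeM; exact: measurable_sqnE.
Qed.

Lemma E2D_le2 f g : mC f -> mC g ->
  (E2 (fun x => f x + g x)%R <= 2%:E * E2 f + 2%:E * E2 g)%E.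
Proof. by move=> mf mg; have := E2D_le mf mg ltr01; rewrite invr1 -natr1. Qed.

Lemma E2_fin f : mC f -> (E2 f < +oo)%E -> rint mu (fun x => sqn (f x)).
Proof. by move=> mf foo; apply: rint_ge0P => //; [exact: measurable_sqn|move=> x; exact: sqn_ge0]. Qed.

End measure.

Section fubini.
Context d1 d2 (T1 : measurableType d1) (T2 : measurableType d2).
Variables (m1 : {sigma_finite_measure set T1 -> \bar R})
          (m2 : {sigma_finite_measure set T2 -> \bar R}).
Implicit Types f : T1 * T2 -> C.

Lemma mC_slice1 f x : mC f -> mC (fun y => f (x, y)).
Proof.
by move=> [f1 f2]; split; [exact: (measurable_slice1 x f1)|exact: (measurable_slice1 x f2)].
Qed.

Lemma mC_slice2 f y : mC f -> mC (fun x => f (x, y)).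
Proof.
by move=> [f1 f2]; split; [exact: (measurable_slice2 y f1)|exact: (measurable_slice2 y f2)].
Qed.

Lemma mC_Cint_param f : mC f -> mC (fun x => Cint m2 (fun y => f (x, y))).
Proof.
by move=> [f1 f2]; split; [exact: (measurable_Rint_param m2 f1)|exact: (measurable_Rint_param m2 f2)].
Qed.

Lemma Cint_prod1 f : rC (m1 \x m2)%E f ->
  Cint (m1 \x m2)%E f = Cint m1 (fun x => Cint m2 (fun y => f (x, y))).
Proof. by move=> [f1 f2]; apply: eq_ReIm => /=; rewrite Rint_prod1. Qed.

Lemma E2_prod1 f : mC f -> E2 (m1 \x m2)%E f = (\int[m1]_x E2 m2 (fun y => f (x, y)))%E.
Proof.
move=> mf; rewrite /E2 (fubini_tonelli1 (fun z : T1 * T2 => (sqn (f z))%:E))//; first exact: measurable_sqnE.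
by move=> x; rewrite lee_fin sqn_ge0.
Qed.

Lemma E2_prod2 f : mC f -> E2 (m1 \x m2)%E f = (\int[m2]_y E2 m1 (fun x => f (x, y)))%E.
Proof.
move=> mf; rewrite /E2 (fubini_tonelli2 (fun z : T1 * T2 => (sqn (f z))%:E))//; first exact: measurable_sqnE.
by move=> x; rewrite lee_fin sqn_ge0.
Qed.

Lemma measurable_E2_slice1 f : mC f -> measurable_fun setT (fun x => E2 m2 (fun y => f (x, y))).
Proof.
move=> mf; apply: (measurable_fun_fubini_tonelli_F (fun z : T1 * T2 => (sqn (f z))%:E)).
  exact: measurable_sqnE.
by move=> z; rewrite lee_fin sqn_ge0.
Qed.

Lemma measurable_E2_slice2 f : mC f -> measurable_fun setT (fun y => E2 m1 (fun x => f (x, y))).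
Proof.
move=> mf; apply: (measurable_fun_fubini_tonelli_G (fun z : T1 * T2 => (sqn (f z))%:E)).
  exact: measurable_sqnE.
by move=> z; rewrite lee_fin sqn_ge0.
Qed.
End fubini.

Lemma mC_comp d1 d2 (T1 : measurableType d1) (T2 : measurableType d2) (f : T2 -> C) (g : T1 -> T2) :
  mC f -> measurable_fun setT g -> mC (fun x => f (g x)).
Proof. by move=> [f1 f2] mg; split; [exact: (measurableT_comp f1 mg)|exact: (measurableT_comp f2 mg)]. Qed.

End complex_functions.

(** * Plancherel for bounded functions of compact support *)

Section plancherel1.
Context {R : realType}.
Local Notation C := R[i].
Local Notation RR := (measurableTypeR R).
Notation mu := (@lebesgue_measure R).

(** Named in order to carry a sigma-finite structure, so that it can be the second factor of
    [mu \x leb2] in Fubini's theorem. *)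
Definition leb2 : set (RR * RR) -> \bar R := (mu \x mu)%E.
HB.instance Definition _ := Measure.on leb2.
HB.instance Definition _ := Measure_isSigmaFinite.Build _ _ _ leb2
  (product_measure1_sigma_finite _ _).

Lemma measurable_cosT d (T : measurableType d) (h : T -> R) : measurable_fun setT h ->
  measurable_fun setT (fun x => cos (h x)).
Proof. by move=> mh; apply: (measurableT_comp (continuous_measurable_fun (@continuous_cos R)) mh). Qed.

Lemma measurable_sinT d (T : measurableType d) (h : T -> R) : measurable_fun setT h ->
  measurable_fun setT (fun x => sin (h x)).
Proof. by move=> mh; apply: (measurableT_comp (continuous_measurable_fun (@continuous_sin R)) mh). Qed.

Lemma norm_cos_le1 (x : R) : `|cos x| <= 1. Proof. by rewrite ler_norml cos_geN1 cos_le1. Qed.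
Lemma norm_sin_le1 (x : R) : `|sin x| <= 1. Proof. by rewrite ler_norml sin_geN1 sin_le1. Qed.

Lemma rint_cosM d (T : measurableType d) (m : {measure set T -> \bar R}) (h g : T -> R) :
  rint m g -> measurable_fun setT h -> rint m (fun x => cos (h x) * g x).
Proof.
by move=> ig mh; apply: (rint_mul_bounded (M := 1) ig) => [|x]; [exact: measurable_cosT|exact: norm_cos_le1].
Qed.

Lemma rint_sinM d (T : measurableType d) (m : {measure set T -> \bar R}) (h g : T -> R) :
  rint m g -> measurable_fun setT h -> rint m (fun x => sin (h x) * g x).
Proof.
by move=> ig mh; apply: (rint_mul_bounded (M := 1) ig) => [|x]; [exact: measurable_sinT|exact: norm_sin_le1].
Qed.

Lemma Rint_prodM (f g : R -> R) : rint mu f -> rint mu g ->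
  \int[leb2]_p (f p.1 * g p.2) = (\int[mu]_x f x) * (\int[mu]_x g x).
Proof.
move=> iF iG; rewrite (Rint_prod1 (rint_prod iF iG)) /=.
rewrite mulrC -RintZ//; apply: Rint_ext => x.
by rewrite RintZ// mulrC.
Qed.

Definition ft1 (f : R -> C) (t : R) : C := Cint mu (fun s => expi (- (s * t)) * f s).

Section weighted_energy.
Variables (f : R -> C) (d : R).
Hypotheses (rf : rC mu f) (d0 : 0 < d).
Let a s := complex.Re (f s).
Let b s := complex.Im (f s).
(** [P] and [Q] are the real and imaginary parts of [f s] times the conjugate of [f s']. The
    function [k] below is the real part of this product times [e^{-i t (s - s')}], weighted by
    [pw d], so [k (t, .)] integrates to the weighted squared modulus of the transform at [t]. *)
Let P (p : RR * RR) := a p.1 * a p.2 + b p.1 * b p.2.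
Let Q (p : RR * RR) := b p.1 * a p.2 - a p.1 * b p.2.

Let ia : rint mu a. Proof. by case: rf. Qed.
Let ib : rint mu b. Proof. by case: rf. Qed.
Let iP : rint leb2 P. Proof. by apply: rintD; exact: (rint_prod (m1 := mu) (m2 := mu)). Qed.
Let iQ : rint leb2 Q. Proof. by apply: rintB; exact: (rint_prod (m1 := mu) (m2 := mu)). Qed.

Let k (z : RR * (RR * RR)) := cos (z.1 * (z.2.1 - z.2.2)) * (pw d z.1 * P z.2) +
                              sin (z.1 * (z.2.1 - z.2.2)) * (pw d z.1 * Q z.2).

Let marg : measurable_fun setT (fun z : RR * (RR * RR) => z.1 * (z.2.1 - z.2.2)).
Proof.
apply: measurable_funM; first exact: measurable_fst.
by apply: measurable_funB; apply: (measurableT_comp _ measurable_snd);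
  [exact: measurable_fst|exact: measurable_snd].
Qed.

Let ik : rint (mu \x leb2)%E k.
Proof.
apply: rintD.
- by apply: rint_cosM => //; exact: (rint_prod (m1 := mu) (m2 := leb2) (rint_pw d0) iP).
- by apply: rint_sinM => //; exact: (rint_prod (m1 := mu) (m2 := leb2) (rint_pw d0) iQ).
Qed.

Let ms t : measurable_fun setT (fun s : R => s * t).
Proof. exact: mulrr_measurable. Qed.

Lemma Re_ft1 t : complex.Re (ft1 f t) = \int[mu]_s (cos (s * t) * a s + sin (s * t) * b s).
Proof. by apply: Rint_ext => s; rewrite cReM /= cosN sinN; ring. Qed.

Lemma Im_ft1 t : complex.Im (ft1 f t) = \int[mu]_s (cos (s * t) * b s - sin (s * t) * a s).
Proof. by apply: Rint_ext => s; rewrite cImM /= cosN sinN; ring. Qed.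

Let sqn_ft1 t : pw d t * sqn (ft1 f t) = \int[leb2]_p k (t, p).
Proof.
have i1 : rint mu (fun s => cos (s * t) * a s + sin (s * t) * b s).
  exact: (rintD (rint_cosM ia (ms t)) (rint_sinM ib (ms t))).
have i2 : rint mu (fun s => cos (s * t) * b s - sin (s * t) * a s).
  exact: (rintB (rint_cosM ib (ms t)) (rint_sinM ia (ms t))).
rewrite /sqn Re_ft1 Im_ft1 !expr2 -!Rint_prodM// -RintD; last 2 first.
- exact: (rint_prod (m1 := mu) (m2 := mu) i1 i1).
- exact: (rint_prod (m1 := mu) (m2 := mu) i2 i2).
rewrite -RintZ; last first.
  by apply: rintD; [exact: (rint_prod (m1 := mu) (m2 := mu) i1 i1)|exact: (rint_prod (m1 := mu) (m2 := mu) i2 i2)].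
apply: Rint_ext => -[s s'] /=; rewrite /k /P /Q /=.
by rewrite (mulrBr t) cosB sinB ![t * _]mulrC; ring.
Qed.

(** Fubini moves the integral in [t] inside: the cosine part produces the Poisson kernel and the
    sine part is odd. The weight makes the triple integrand integrable before anything is known
    about the size of the transform. *)
Lemma weighted_energy :
  \int[mu]_t (pw d t * sqn (ft1 f t)) = \int[leb2]_p (pk d (p.1 - p.2) * P p).
Proof.
transitivity (\int[mu]_t \int[leb2]_p k (t, p)).
  by apply: Rint_ext => t; exact: sqn_ft1.
rewrite (Rint_swap (m1 := mu) (m2 := leb2) ik); apply: Rint_ext => -[s s'] /=.
set r := s - s'.
have mr : measurable_fun setT (fun t : R => r * t) by exact: mulrl_measurable.
have h1 : rint mu (fun t => pw d t * cos (r * t)).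
  by apply: eq_rint (rint_cosM (rint_pw d0) mr) => t; rewrite mulrC.
have h2 : rint mu (fun t => pw d t * sin (r * t)).
  by apply: eq_rint (rint_sinM (rint_pw d0) mr) => t; rewrite mulrC.
transitivity (\int[mu]_t (P (s, s') * (pw d t * cos (r * t)) + Q (s, s') * (pw d t * sin (r * t)))).
  by apply: Rint_ext => t; rewrite /k /= [t * _]mulrC; ring.
rewrite RintD; [|exact: rintZ..].
by rewrite (RintZ _ h1) (RintZ _ h2) Rint_pw_cos// Rint_pw_sin// mulr0 addr0 mulrC.
Qed.

Lemma rint_weighted_energy : rint mu (fun t => pw d t * sqn (ft1 f t)).
Proof.
have h := integrable_fubini_F (m1 := mu) (m2 := leb2) ik.
have : rint mu (fun t => \int[leb2]_p k (t, p)).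
  apply: (@rint_ae_fine _ _ _ mu _ h).
by apply: eq_rint => t; rewrite sqn_ft1.
Qed.

End weighted_energy.

Lemma mC_ft1 f : mC f -> mC (ft1 f).
Proof.
move=> mf; apply: (mC_Cint_param mu (f := fun z : RR * RR => expi (- (z.2 * z.1)) * f z.2)).
apply: mC_M; last exact: (mC_comp mf measurable_snd).
apply: mC_expi; apply: measurable_funN; apply: measurable_funM; [exact: measurable_snd|exact: measurable_fst].
Qed.

Definition pconv d (a : R -> R) (s : R) : R := \int[mu]_t (pk d (s - t) * a t).

Section bounded.
Variables (d M : R) (d0 : 0 < d).

Let mpk2 : measurable_fun setT (fun p : RR * RR => pk d (p.1 - p.2)).
Proof.
apply: (measurableT_comp (measurable_pk d0)).
by apply: measurable_funB; [exact: measurable_fst|exact: measurable_snd].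
Qed.

Lemma pk_le r : pk d r <= 2 / d.
Proof.
rewrite /pk ler_pdivrMr; last by rewrite ltr_wpDr ?sqr_ge0// exprn_gt0.
rewrite (_ : 2 / d * (d ^+ 2 + r ^+ 2) = 2 * d + 2 / d * r ^+ 2); last by field; rewrite gt_eqF.
by rewrite lerDl mulr_ge0 ?sqr_ge0// divr_ge0// ltW.
Qed.

Lemma pk_sym r s : pk d (r - s) = pk d (s - r).
Proof. by rewrite /pk -[(r - s) ^+ 2]sqrrN opprB. Qed.

Lemma rint_pk_prod (a g : R -> R) : rint mu a -> rint mu g ->
  rint leb2 (fun p => pk d (p.1 - p.2) * (a p.1 * g p.2)).
Proof.
move=> ia ig; apply: (@rint_mul_bounded _ _ _ _ _ _ (2 / d)).
- exact: (rint_prod (m1 := mu) (m2 := mu)).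
- exact: mpk2.
- by move=> x; rewrite ger0_norm ?pk_le// pk_ge0// ltW.
Qed.

Lemma measurable_pconv a : measurable_fun setT a -> measurable_fun setT (pconv d a).
Proof.
move=> ma; apply: (measurable_Rint_param (T1 := RR) mu (f := fun p : RR * RR => pk d (p.1 - p.2) * a p.2)).
by apply: measurable_funM => //; exact: measurableT_comp ma measurable_snd.
Qed.

Lemma rint_pk_bounded a s : measurable_fun setT (a : R -> R) -> (forall x : R, `|a x : R| <= M) ->
  rint mu (fun t => pk d (s - t) * a t).
Proof.
by move=> ma aM; apply: eq_rint (rint_mul_bounded (rint_pk s d0) ma aM) => t; rewrite mulrC.
Qed.

Lemma pconv_le a s : measurable_fun setT (a : R -> R) -> (forall x : R, `|a x : R| <= M) ->
  `|pconv d a s| <= 2 * pi * M.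
Proof.
move=> ma aM; apply: (le_trans (Rint_norm (rint_pk_bounded s ma aM))).
rewrite mulrC -(Rint_pk s d0) -RintZ; last exact: rint_pk.
apply: Rint_le; [exact/rint_norm/rint_pk_bounded|apply: rintZ; exact: rint_pk|].
move=> t; rewrite normrM mulrC (ger0_norm (pk_ge0 _ (ltW d0))) ler_wpM2r//.
by rewrite pk_ge0// ltW.
Qed.

Lemma pk_form_l (a g : R -> R) : rint mu a -> rint mu g ->
  \int[leb2]_p (pk d (p.1 - p.2) * (a p.1 * g p.2)) = \int[mu]_s (a s * pconv d g s).
Proof.
move=> ia ig; rewrite (Rint_prod1 (m1 := mu) (m2 := mu) (rint_pk_prod ia ig)) /=; apply: Rint_ext => s.
rewrite -RintZ.
  by apply: Rint_ext => t; ring.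
have := @rint_mul_bounded _ _ _ mu (fun t => pk d (s - t)) g (2 / d) ig; apply.
- exact: (continuous_measurable_fun (@continuous_pk R d s d0)).
- by move=> x; rewrite ger0_norm ?pk_le// pk_ge0// ltW.
Qed.

Lemma pk_form_r (a g : R -> R) : rint mu a -> rint mu g ->
  \int[leb2]_p (pk d (p.1 - p.2) * (a p.1 * g p.2)) = \int[mu]_s (g s * pconv d a s).
Proof.
move=> ia ig; rewrite (Rint_prod2 (m1 := mu) (m2 := mu) (rint_pk_prod ia ig)) /=; apply: Rint_ext => s.
rewrite -RintZ.
  by apply: Rint_ext => t; rewrite (pk_sym t); ring.
have := @rint_mul_bounded _ _ _ mu (fun t => pk d (s - t)) a (2 / d) ia; apply.
- exact: (continuous_measurable_fun (@continuous_pk R d s d0)).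
- by move=> x; rewrite ger0_norm ?pk_le// pk_ge0// ltW.
Qed.

End bounded.

Lemma lebesgue_itv_lty (K : R) : (mu (`[(- K)%R, K]%classic : set RR) < +oo)%E.
Proof. by rewrite lebesgue_measure_itv /=; case: ifP => _; rewrite ?ltry. Qed.

(** Continuous functions are dense in L1 of the segment [[-K, K]]. Clipping the approximant to
    [[-M, M]] keeps the bound without increasing the distance to [a], and setting it to 0 outside
    the segment spoils continuity at most at the two endpoints. *)
Lemma bounded_approx (a : R -> R) (M K e : R) : measurable_fun setT (a : R -> R) ->
  (forall x : R, `|a x : R| <= M) -> (forall x : R, K <= `|x| -> a x = 0) -> 0 < e ->
  exists h : R -> R, [/\ measurable_fun setT h, forall x, `|h x| <= M,
    forall s, `|s| < K -> {for s, continuous h}, rint mu h &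
    \int[mu]_x `|a x - h x| <= e].
Proof.
move=> ma aM aK e0.
have M0 : 0 <= M by apply: le_trans (aM 0).
pose I := `[- K, K]%classic.
have mI : measurable (I : set RR) by exact: measurable_itv.
have Ioo : (mu I < +oo)%E by exact: lebesgue_itv_lty.
have iaI : mu.-integrable I (EFin \o a).
  apply: measurable_bounded_integrable => //; first exact: measurable_funTS.
  by exists M; split; rewrite ?num_real// => x Mx y _; apply: le_trans (aM y) (ltW Mx).
have [g_ [cg ig gl]] := approximation_continuous_integrable mI Ioo iaI.
have /fine_cvgP[gfin /cvgrPdist_le/(_ _ e0)] := gl.
move=> gl'; near \oo => n.
pose h x : R := Num.max (- M) (Num.min M (g_ n x)).
pose hI x : R := if x \in I then h x else 0.
have ch : continuous h.
  move=> x; apply: (@continuous_max R R (fun=> - M) (fun x => Num.min M (g_ n x))).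
    exact: cvg_cst.
  by apply: (@continuous_min R R (fun=> M) (g_ n)); [exact: cvg_cst|exact: cg].
have hM x : `|h x| <= M.
  rewrite ler_norml /h le_max lexx/= ge_max ge_min lexx andbT.
  by move: M0; lra.
have mh : measurable_fun setT hI.
  rewrite (_ : hI = h \_ I); last by apply/funext => x; rewrite patchE.
  apply/(measurable_restrictT _ mI); apply: measurable_funTS; exact: continuous_measurable_fun.
have hIM x : `|hI x| <= M by rewrite /hI; case: ifP => // _; rewrite normr0.
have irI : rint mu (\1_I : R -> R) by exact: rint_indic.
exists hI; split => //.
- move=> s sK; have : \forall t \near s, hI t = h t.
    have : s \in `]- K, K[ by rewrite in_itv/= -ltr_norml.
    move=> /near_in_itvoo; apply: filterS => t tI; rewrite /hI mem_set//=.
    exact: subset_itv_oo_cc.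
  move=> hh; suff : hI t @[t --> s] --> h s by rewrite -(nbhs_singleton hh).
  apply: cvg_trans (ch s); apply: near_eq_cvg.
  by apply: filterS hh => t ->.
- apply: (rint_le _ (rintZ M irI)) => [//|x]; rewrite normrM (ger0_norm M0) indicE /hI.
  by case: ifP => _; rewrite ?normr1 ?mulr1 ?normr0 ?mulr0.
- have E : \int[mu]_x `|a x - hI x| <= \int[mu]_(x in I) `|a x - g_ n x|.
    rewrite [leRHS]Rintegral_mkcond; apply: Rint_le.
    + apply: rint_norm; apply: rintB.
        apply: (rint_le _ (rintZ M irI)) => [//|x]; rewrite normrM (ger0_norm M0) indicE.
        have [xI|xI] := boolP (x \in I); first by rewrite normr1 mulr1.
        rewrite aK ?normr0 ?mulr0//.
        move: xI; rewrite notin_setE /I /= in_itv/= -ler_norml => /negP.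
        by rewrite -ltNge => /ltW.
      apply: (rint_le _ (rintZ M irI)) => [//|x]; rewrite normrM (ger0_norm M0) indicE /hI.
      by case: ifP => _; rewrite ?normr1 ?mulr1 ?normr0 ?mulr0.
    + have : mu.-integrable I (EFin \o (fun x => `|a x - g_ n x|)).
        have : mu.-integrable I (fun x => `|(EFin \o a) x - (EFin \o g_ n) x|%E).
          by apply: integrable_abse; apply: integrableB => //; exact: ig.
        by apply: eq_integrable.
      by move=> /(integrable_mkcond _ mI); rewrite /rint restrict_EFin.
    + move=> x; rewrite patchE /hI; case: ifPn => xI.
        rewrite /h; have := aM x; rewrite ler_norml => /andP[l1 l2].
        have n1 := ler_norm (a x - g_ n x).
        have n2 : g_ n x - a x <= `|a x - g_ n x| by rewrite distrC ler_norm.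
        rewrite /Order.max /Order.min; rewrite ler_norml; apply/andP.
        by case: (ltP M (g_ n x)) => g1; case: ltP => g2; split; lra.
      rewrite aK ?subrr ?normr0//.
      move: xI; rewrite notin_setE /I /= in_itv/= -ler_norml => /negP.
      by rewrite -ltNge => /ltW.
  apply: le_trans E _.
  have : `|0 - fine (\int[mu]_(z in I) `|(a z - g_ n z)%:E|)%E| <= e by near: n.
  by rewrite sub0r normrN; apply: le_trans; rewrite ler_norm.
Unshelve. all: by end_near. Qed.

Lemma rint_bounded_supp (a : R -> R) (M K : R) : measurable_fun setT (a : R -> R) ->
  (forall x : R, `|a x : R| <= M) -> (forall x : R, K <= `|x| -> a x = 0) -> rint mu a.
Proof.
move=> ma aM aK; have [h [mh hM _ ih _]] := bounded_approx ma aM aK (@ltr01 R).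
have M0 : 0 <= M by apply: le_trans (aM 0).
have mI : measurable (`[- K, K]%classic : set RR) by exact: measurable_itv.
have irI : rint mu (\1_(`[- K, K]%classic) : R -> R).
  by apply: rint_indic => //; exact: lebesgue_itv_lty.
apply: (rint_le _ (rintZ M irI)) => [//|x]; rewrite normrM (ger0_norm M0) indicE.
have [xI|xI] := boolP (x \in _); first by rewrite normr1 mulr1.
rewrite aK ?normr0 ?mulr0//.
by move: xI; rewrite notin_setE /= in_itv/= -ler_norml => /negP; rewrite -ltNge => /ltW.
Qed.

Lemma three_norms (e x y z w : R) : `|x - y| <= e / 2 -> `|z| <= e / 4 -> `|w| <= e / 4 ->
  `|(x + w) - (y + z)| <= e.
Proof. by rewrite !ler_norml => /andP[? ?] /andP[? ?] /andP[? ?]; apply/andP; split; lra. Qed.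

(** Since [a] is merely measurable, [pk_approx_id] does not apply to it; one factor [a] is replaced
    by an L1 approximant [h] that is continuous where it matters. The remainder integrates [a - h]
    against a function bounded by [2 pi M] uniformly in [n]. *)
Lemma pk_form_cvg (a : R -> R) (M K : R) : measurable_fun setT (a : R -> R) ->
  (forall x : R, `|a x : R| <= M) -> (forall x : R, K <= `|x| -> a x = 0) ->
  \int[leb2]_p (pk (dn n) (p.1 - p.2) * (a p.1 * a p.2)) @[n --> \oo] -->
  2 * pi * \int[mu]_x (a x ^+ 2).
Proof.
move=> ma aM aK.
have M0 : 0 <= M by apply: le_trans (aM 0).
have p0 := @pi_gt0 R.
have ia := rint_bounded_supp ma aM aK.
apply/cvgrPdist_le => /= e e0.
(* Times the bound [2 pi M] this is at most [e / 4]; the [+ 1] covers the case [M = 0]. *)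
have e1 : 0 < e / (8 * pi * (M + 1)) by rewrite divr_gt0// !mulr_gt0// ltr_wpDl.
have [h [mh hM ch ih ahe]] := bounded_approx ma aM aK e1.
have iah : rint mu (fun x => a x - h x) by exact: rintB.
have iaa : rint mu (fun x => a x * a x) by exact: (rint_mul_bounded ia ma aM).
have ia_h : rint mu (fun x => a x * h x) by exact: (rint_mul_bounded ih ma aM).
have c1 : \int[mu]_s (a s * pconv (dn n) h s) @[n --> \oo] -->
    \int[mu]_s (a s * (2 * pi * h s)).
  apply: (@Rint_dominated _ _ _ mu (fun n s => a s * pconv (dn n) h s) (fun s => a s * (2 * pi * h s)) (fun s => 2 * pi * M * `|a s|)).
  - by move=> n; apply: measurable_funM => //; exact: (measurable_pconv (dn_gt0 n) mh).
  - by apply: measurable_funM => //; apply: measurable_funM.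
  (* Where [h] may be discontinuous, [a] vanishes. *)
  - apply: aeW => s; have [sK|Ks] := ltP `|s| K.
      by apply: cvgMl_tmp; exact: (pk_approx_id mh hM (ch _ sK)).
    by rewrite aK// mul0r; under eq_fun do rewrite mul0r; exact: cvg_cst.
  - by apply: rintZ; exact: rint_norm.
  - move=> n s; rewrite normrM mulrC ler_wpM2r//.
    exact: (pconv_le (dn_gt0 n) _ mh hM).
have bnd (g : R -> R) c : 0 <= c -> (forall x, `|g x| <= c) -> measurable_fun setT g ->
    `|\int[mu]_s ((a s - h s) * g s)| <= c * (e / (8 * pi * (M + 1))).
  move=> c0 gc mg.
  have ir : rint mu (fun s => (a s - h s) * g s).
    by apply: eq_rint (rint_mul_bounded iah mg gc) => s; rewrite mulrC.
  apply: (le_trans (Rint_norm ir)).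
  apply: (@le_trans _ _ (\int[mu]_s (c * `|a s - h s|))).
    apply: Rint_le; [exact: rint_norm|apply: rintZ; exact: rint_norm|].
    by move=> s; rewrite normrM mulrC ler_wpM2r.
  by rewrite RintZ ?ler_wpM2l//; exact: rint_norm.
have p2M : 0 <= 2 * pi * M by rewrite !mulr_ge0// ltW.
have e4 : 2 * pi * M * (e / (8 * pi * (M + 1))) <= e / 4.
  have -> : 2 * pi * M * (e / (8 * pi * (M + 1))) = (e / 4) * (M / (M + 1)).
    have E (q m : R) : 0 < q -> 0 <= m -> 2 * q * m * (e / (8 * q * (m + 1))) = (e / 4) * (m / (m + 1)).
      move=> q0 m0; field; rewrite (lt0r_neq0 q0)/=.
      by rewrite andbT; apply: lt0r_neq0; move: m0; lra.
    exact: E.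
  rewrite ler_piMr//; first by rewrite divr_ge0// ltW.
  by rewrite ler_pdivrMr ?mul1r; move: M0; lra.
move/cvgrPdist_le : c1 => /(_ (e / 2)); rewrite divr_gt0// => /(_ isT) c1.
near=> n.
have d0 : (0 : R) < dn n by exact: dn_gt0.
(* In the second term the first variable is integrated first, so that [a - h] stands outside the
   convolution and can be measured in L1. *)
have E1 : \int[leb2]_p (pk (dn n) (p.1 - p.2) * (a p.1 * a p.2)) =
    \int[mu]_s (a s * pconv (dn n) h s) + \int[mu]_s ((a s - h s) * pconv (dn n) a s).
  rewrite -(pk_form_l d0 ia ih) -(pk_form_r d0 ia iah) -RintD; last 2 first.
  - exact: (rint_pk_prod d0 ia ih).
  - exact: (rint_pk_prod d0 ia iah).
  by apply: Rint_ext => p; ring.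
have E2 : 2 * pi * \int[mu]_x (a x ^+ 2) =
    \int[mu]_s (a s * (2 * pi * h s)) + \int[mu]_s ((a s - h s) * (2 * pi * a s)).
  have r1 : rint mu (fun s => a s * (2 * pi * h s)).
    by apply: eq_rint (rintZ (2 * pi) ia_h) => s; ring.
  have r2 : rint mu (fun s => (a s - h s) * (2 * pi * a s)).
    by apply: eq_rint (rintZ (2 * pi) (rintB iaa ia_h)) => s; ring.
  rewrite -RintD// -RintZ; last by apply: eq_rint iaa => s; rewrite expr2.
  by apply: Rint_ext => s; ring.
rewrite E1 E2.
have h1 : `|\int[mu]_s (a s * (2 * pi * h s)) - \int[mu]_s (a s * pconv (dn n) h s)| <= e / 2.
  by near: n.
have h2 : `|\int[mu]_s ((a s - h s) * pconv (dn n) a s)| <= e / 4.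
  apply: le_trans e4; apply: bnd => //.
    by move=> x; exact: (pconv_le d0 _ ma aM).
  exact: measurable_pconv.
have h3 : `|\int[mu]_s ((a s - h s) * (2 * pi * a s))| <= e / 4.
  apply: le_trans e4; apply: bnd => //.
    move=> x; rewrite normrM ger0_norm; last by rewrite mulr_ge0// ltW.
    by rewrite ler_wpM2l// mulr_ge0// ltW.
  exact: measurable_funM.
exact: three_norms h1 h2 h3.
Unshelve. all: by end_near. Qed.

(* Plancherel for bounded functions of compact support: the weights e^{-|t|/(n+1)}
   increase to 1, and turn the energy into a quadratic form of the Poisson kernel. *)
Lemma plancherel1 (f : R -> C) (M K : R) : mC f -> 0 <= M -> (forall x, sqn (f x) <= M ^+ 2) ->
  (forall x : R, K <= `|x| -> f x = 0) -> E2 mu (ft1 f) = ((2 * pi)%:E * E2 mu f)%E.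
Proof.
move=> mf M0 fM fK.
have p0 := @pi_gt0 R.
pose a s := complex.Re (f s); pose b s := complex.Im (f s).
have ma : measurable_fun setT a by case: mf.
have mb : measurable_fun setT b by case: mf.
have aM (x : R) : `|a x| <= M.
  by apply: norm_sqr_le => //; apply: le_trans (fM x); exact: sqn_Re_le.
have bM (x : R) : `|b x| <= M.
  by apply: norm_sqr_le => //; apply: le_trans (fM x); exact: sqn_Im_le.
have aK (x : R) : K <= `|x| -> a x = 0 by move=> /fK; rewrite /a => ->.
have bK (x : R) : K <= `|x| -> b x = 0 by move=> /fK; rewrite /b => ->.
have ia := rint_bounded_supp ma aM aK.
have ib := rint_bounded_supp mb bM bK.
have iaa : rint mu (fun x => a x ^+ 2).
  by apply: eq_rint (rint_mul_bounded ia ma aM) => s; rewrite expr2.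
have ibb : rint mu (fun x => b x ^+ 2).
  by apply: eq_rint (rint_mul_bounded ib mb bM) => s; rewrite expr2.
have rf : rC mu f by [].
have mft := mC_ft1 mf.
have c1 : \int[mu]_t (pw (dn n) t * sqn (ft1 f t)) @[n --> \oo] -->
    2 * pi * \int[mu]_x sqn (f x).
  have -> : \int[mu]_x sqn (f x) = \int[mu]_x (a x ^+ 2) + \int[mu]_x (b x ^+ 2) by rewrite RintD.
  rewrite mulrDr; under eq_fun => n.
    rewrite (weighted_energy rf (dn_gt0 n)).
    have -> : \int[leb2]_p (pk (dn n) (p.1 - p.2) *
        (complex.Re (f p.1) * complex.Re (f p.2) + complex.Im (f p.1) * complex.Im (f p.2))) =
      \int[leb2]_p (pk (dn n) (p.1 - p.2) * (a p.1 * a p.2)) +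
      \int[leb2]_p (pk (dn n) (p.1 - p.2) * (b p.1 * b p.2)).
      rewrite -RintD; [|exact: (rint_pk_prod (dn_gt0 n))..].
      by apply: Rint_ext => p; rewrite mulrDr.
  over.
  by apply: cvgD; [exact: (pk_form_cvg ma aM aK)|exact: (pk_form_cvg mb bM bK)].
(* Monotone convergence presupposes no finiteness of the energy of the transform; finiteness results
   from comparing this limit with the previous one. *)
have c2 : (\int[mu]_t (pw (dn n) t * sqn (ft1 f t))%:E)%E @[n --> \oo] --> E2 mu (ft1 f).
  have := @cvg_monotone_convergence _ _ _ mu setT measurableT
    (fun n t => (pw (dn n) t * sqn (ft1 f t))%:E).
  have -> : (\int[mu]_x limn (fun n => (pw (dn n) x * sqn (ft1 f x))%:E) = E2 mu (ft1 f))%E.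
    apply: eq_integral => t _; apply/cvg_lim => //.
    apply: cvg_EFin; first exact: nearW.
    rewrite -[X in _ --> X]mul1r; apply: cvgMr_tmp.
    have hd : - (dn n * `|t|) @[n --> \oo] --> (0 : R).
      rewrite -oppr0; apply: cvgN; rewrite -(mul0r `|t|); apply: cvgMr_tmp.
      exact: cvg_harmonic.
    by rewrite -(@expR0 R); exact: (cvg_comp _ _ hd (@continuous_expR R 0)).
  apply.
  - move=> n; apply/measurable_EFinP; apply: measurable_funM; first exact: measurable_pw.
    exact: measurable_sqn.
  - by move=> n x _; rewrite lee_fin mulr_ge0 ?sqn_ge0// ltW// pw_gt0.
  - move=> x _ n m nm; rewrite lee_fin ler_wpM2r ?sqn_ge0// /pw ler_expR lerN2 ler_wpM2r//.
    by rewrite /dn lef_pV2 ?posrE// ler_nat.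
have c3 : (\int[mu]_t (pw (dn n) t * sqn (ft1 f t))%:E)%E @[n --> \oo] -->
    ((2 * pi * \int[mu]_x sqn (f x))%:E)%E.
  under eq_fun => n do rewrite -(EFin_Rint (rint_weighted_energy rf (dn_gt0 n))).
  by apply: cvg_EFin => //; exact: nearW.
rewrite (cvg_unique _ c2 c3)// EFinM EFin_Rint//; exact: rintD.
Qed.

End plancherel1.

(** * Square-integrable functions, several variables *)

Lemma cvge0P {R : realType} (u : nat -> \bar R) : (forall n, (0 <= u n)%E) ->
  (forall e : R, 0 < e -> \forall n \near \oo, (u n <= e%:E)%E) -> u n @[n --> \oo] --> 0%E.
Proof.
move=> u0 ue; apply/fine_cvgP; split.
  apply: filterS (ue 1 ltr01) => n u1; rewrite ge0_fin_numE//.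
  by apply: le_lt_trans u1 _; exact: ltry.
apply/cvgrPdist_le => /= e e0; apply: filterS (ue e e0) => n une.
have ufin : u n \is a fin_num by rewrite ge0_fin_numE//; apply: le_lt_trans une _; exact: ltry.
by rewrite sub0r normrN ger0_norm ?fine_ge0// -lee_fin fineK.
Qed.

Lemma cvge0_le {R : realType} (u : nat -> \bar R) (e : R) : u n @[n --> \oo] --> 0%E ->
  (forall n, (0 <= u n)%E) -> 0 < e -> \forall n \near \oo, (u n <= e%:E)%E.
Proof.
move=> /fine_cvgP[ufin /cvgrPdist_le uc] u0 e0; have := uc _ e0; apply: filterS2 ufin => n fn.
by rewrite sub0r normrN /= ger0_norm ?fine_ge0// -lee_fin fineK.
Qed.

Section L2_limits.
Context {R : realType} d (T : measurableType d) (mu : {measure set T -> \bar R}).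
Local Notation C := R[i].
Implicit Types f g : T -> C.

Lemma E2_ae_eq f g : mC f -> mC g -> {ae mu, forall x, f x = g x} -> E2 mu f = E2 mu g.
Proof.
move=> mf mg fg; apply: ae_eq_integral => //; try exact: measurable_sqnE.
by apply: filterS fg => x fgx _; rewrite fgx.
Qed.

Lemma cvg_sqn (u : nat -> C) (z : C) :
  complex.Re (u n) @[n --> \oo] --> complex.Re z ->
  complex.Im (u n) @[n --> \oo] --> complex.Im z -> sqn (u n) @[n --> \oo] --> sqn z.
Proof. by move=> h1 h2; rewrite /sqn !expr2; apply: cvgD; exact: cvgM. Qed.

Lemma E2_fatou (g_ : nat -> T -> C) g (b : \bar R) : (forall n, mC (g_ n)) -> mC g ->
  {ae mu, forall x, sqn (g_ n x) @[n --> \oo] --> sqn (g x)} ->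
  (\forall n \near \oo, (E2 mu (g_ n) <= b)%E) -> (E2 mu g <= b)%E.
Proof.
move=> mg_ mg gg [N _ Nb].
(* Shifting by [N] makes the eventual bound valid at every index. *)
pose h n x := (sqn (g_ (n + N)%N x))%:E.
have mh n : measurable_fun setT (h n) by exact: measurable_sqnE.
have -> : E2 mu g = (\int[mu]_x limn_einf (h ^~ x))%E.
  apply: ae_eq_integral => //; first exact: measurable_sqnE.
    (* Measurability of the liminf is read off the limsup of the opposites. *)
    rewrite (_ : (fun x => _) = fun x => (- limn_esup (fun n => - h n x))%E).
      have mm : measurable_fun setT (fun x => limn_esup (fun n => - h n x)%E).
        by apply: (@measurable_fun_limn_esup _ _ _ setT (fun n x => - h n x)%E) => n; exact: measurableT_comp.
      exact: (measurableT_comp _ mm).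
    by apply/funext => x; rewrite limn_esupN oppeK.
  apply: filterS gg => x gx _.
  suff : h n x @[n --> \oo] --> (sqn (g x))%:E by move=> /cvg_limn_einf_sup[-> _].
  apply: cvg_EFin; first exact: nearW.
  by rewrite (cvg_shiftn N (fun n => sqn (g_ n x))).
apply: (le_trans (fatou mu measurableT mh _)).
  by move=> n x _; rewrite lee_fin sqn_ge0.
rewrite limn_einf_lim; apply: lime_le; first exact: is_cvg_einfs.
apply: nearW => n; apply: (@le_trans _ _ (\int[mu]_x h n x)%E).
  by apply: ereal_inf_lbound; exists n => /=.
by apply: Nb; exact: leq_addl.
Qed.

(** Young's inequality on the cross term [2 w (u - w)]: the small factor falls on the fixed [w], the
    large one on the difference that tends to 0. *)
Lemma sqn_diff_le (e : R) (u w : C) : 0 < e ->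
  `|sqn u - sqn w| <= e * sqn w + (1 + e^-1) * sqn (u - w).
Proof.
move=> e0.
have h1 := sqnD_le w (u - w) e0; rewrite addrC subrK in h1.
have h2 := sqnD_le u (w - u) e0; rewrite addrC subrK sqnB in h2.
have sq (a b : R) : `|a ^+ 2 - b ^+ 2| <= e * b ^+ 2 + (1 + e^-1) * (a - b) ^+ 2.
  have k0 : 0 <= e^-1 by rewrite invr_ge0 ltW.
  have -> : a ^+ 2 - b ^+ 2 = (a - b) ^+ 2 + 2 * b * (a - b) by ring.
  have : `|2 * b * (a - b)| <= e * b ^+ 2 + e^-1 * (a - b) ^+ 2.
    rewrite ler_norml; apply/andP; split; rewrite -subr_ge0.
      rewrite (_ : _ - _ = e^-1 * (e * b + (a - b)) ^+ 2); last by field; rewrite gt_eqF.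
      by rewrite mulr_ge0 ?sqr_ge0.
    rewrite (_ : _ - _ = e^-1 * (e * b - (a - b)) ^+ 2); last by field; rewrite gt_eqF.
    by rewrite mulr_ge0 ?sqr_ge0.
  move=> h; apply: (le_trans (ler_normD _ _)); rewrite ger0_norm ?sqr_ge0//.
  by rewrite (_ : (1 + e^-1) * _ = (a - b) ^+ 2 + e^-1 * (a - b) ^+ 2); [move: h; lra|ring].
rewrite /sqn cReB cImB.
have -> (a b c e' : R) : (a + b) - (c + e') = (a - c) + (b - e') by ring.
apply: (le_trans (ler_normD _ _)).
have := sq (complex.Re u) (complex.Re w); have := sq (complex.Im u) (complex.Im w).
by move=> ? ?; rewrite !mulrDr; lra.
Qed.

Lemma E2_cvg (g_ : nat -> T -> C) g : (forall n, mC (g_ n)) -> mC g -> (E2 mu g < +oo)%E ->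
  E2 mu (fun x => g_ n x - g x) @[n --> \oo] --> 0%E -> E2 mu (g_ n) @[n --> \oo] --> E2 mu g.
Proof.
move=> mg_ mg goo gg.
have ig := E2_fin mg goo.
have g0 : 0 <= \int[mu]_x sqn (g x) by apply: Rintegral_ge0 => x _; exact: sqn_ge0.
have -> : E2 mu g = (\int[mu]_x sqn (g x))%:E by rewrite EFin_Rint.
have /fine_cvgP[ffin fc] := gg.
have idn : \forall n \near \oo, rint mu (fun x => sqn (g_ n x - g x)).
  apply: filterS ffin => n; rewrite ge0_fin_numE ?E2_ge0// => h.
  by apply: E2_fin => //; exact: mC_B.
have ign : \forall n \near \oo, rint mu (fun x => sqn (g_ n x)).
  apply: filterS idn => n i1.
  apply: (rint_le _ (rintD (rintZ 2 i1) (rintZ 2 ig))); first exact: measurable_sqn.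
  move=> x; have := sqnD_le2 (g_ n x - g x) (g x); rewrite subrK => h.
  by rewrite !ger0_norm ?sqn_ge0//; apply: le_trans h; exact: sqn_ge0.
have E n : rint mu (fun x => sqn (g_ n x)) -> E2 mu (g_ n) = (\int[mu]_x sqn (g_ n x))%:E.
  by move=> h; rewrite EFin_Rint.
suff : \int[mu]_x sqn (g_ n x) @[n --> \oo] --> \int[mu]_x sqn (g x).
  move=> h; apply/fine_cvgP; split; first by apply: filterS ign => n /E ->.
  by apply: cvg_trans h; apply: near_eq_cvg; apply: filterS ign => n hn; rewrite /= E.
apply/cvgrPdist_le => /= e e0.
pose a := \int[mu]_x sqn (g x).
(* Chosen so that the contribution of the fixed function is at most [e / 2]. *)
pose k := e / (2 * (a + 1)).
have a1 : 0 < a + 1 by rewrite ltr_wpDl.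
have k0 : 0 < k by rewrite divr_gt0// mulr_gt0.
have ka : k * a <= e / 2.
  have -> : k * a = e / 2 * (a / (a + 1)) by rewrite /k; field; rewrite gt_eqF.
  by rewrite ler_piMr ?divr_ge0 ?(ltW e0)// ler_pdivrMr// mul1r lerDl.
have c0 : 0 < 1 + k^-1 by rewrite addr_gt0// invr_gt0.
have e1 : 0 < e / 2 / (1 + k^-1) by rewrite !divr_gt0.
move/cvgrPdist_le : fc => /(_ _ e1) fc.
near=> n.
have in1 : rint mu (fun x => sqn (g_ n x)) by near: n.
have in2 : rint mu (fun x => sqn (g_ n x - g x)) by near: n.
have fn : `|0 - fine (E2 mu (fun x => g_ n x - g x))| <= e / 2 / (1 + k^-1) by near: n.
rewrite distrC -RintB//; apply: (le_trans (Rint_norm (rintB in1 ig))).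
apply: (@le_trans _ _ (\int[mu]_x (k * sqn (g x) + (1 + k^-1) * sqn (g_ n x - g x)))).
  apply: Rint_le.
  - by apply: rint_norm; exact: rintB.
  - by apply: rintD; exact: rintZ.
  - by move=> x; exact: sqn_diff_le.
rewrite RintD; [|exact: rintZ..]; rewrite (RintZ _ ig) (RintZ _ in2).
have : (1 + k^-1) * \int[mu]_x sqn (g_ n x - g x) <= e / 2.
  rewrite -ler_pdivlMl// mulrC; apply: le_trans fn; rewrite sub0r normrN.
  exact: ler_norm.
by rewrite -/a; move: ka; lra.
Unshelve. all: by end_near. Qed.

Lemma cvg_geometric_incr (u : nat -> R) (c : R) : (forall n, `|u n.+1 - u n| <= c * 2^-1 ^+ n) ->
  cvgn u.
Proof.
move=> h.
have : cvgn (series (fun n => u n.+1 - u n)).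
  apply: normed_cvg; apply: (series_le_cvg (v_ := fun n => c * 2^-1 ^+ n)).
  - by move=> n; exact: normr_ge0.
  - by move=> n; apply: le_trans (h n).
  - exact: h.
  - by apply: is_cvg_geometric_series; rewrite ger0_norm ?invr_ge0// invf_lt1// ltr1n.
move=> hs; have : cvgn (fun n => u 0%N + series (fun n => u n.+1 - u n) n).
  by apply: is_cvgD => //; exact: is_cvg_cst.
rewrite (_ : (fun n => _) = u)//; apply/funext => n.
by rewrite /series /= telescope_sumr// addrC subrK.
Qed.

(** Riesz-Fischer: a subsequence with rapidly decreasing increments converges almost everywhere, and
    Fatou along it turns the Cauchy bound into convergence of the whole sequence. *)
Lemma L2_complete (f_ : nat -> T -> C) : (forall n, mC (f_ n)) ->
  (forall e : R, 0 < e -> exists K, forall k l, (K <= k)%N -> (K <= l)%N ->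
     (E2 mu (fun x => f_ k x - f_ l x)%R <= e%:E)%E) ->
  exists2 f, mC f & E2 mu (fun x => f x - f_ n x) @[n --> \oo] --> 0%E.
Proof.
move=> mf_ cau.
(* [32 = 4 * 8]: squared increments weighted by [4^j] still have summable integrals [8^-j], and a
   finite weighted sum bounds the increments at a point by a multiple of [2^-j]. *)
have e0 j : 0 < (32^-1 : R) ^+ j by rewrite exprn_gt0// invr_gt0.
pose K j := projT1 (cid (cau _ (e0 j))).
have Kp j k l : (K j <= k)%N -> (K j <= l)%N ->
    (E2 mu (fun x => f_ k x - f_ l x)%R <= ((32^-1 : R) ^+ j)%:E)%E.
  by rewrite /K; case: cid => /= x; apply.
pose N := fix N j := match j with 0 => K 0%N | j'.+1 => maxn (N j').+1 (K j'.+1) end.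
have NK j : (K j <= N j)%N by case: j => //= j; exact: leq_maxr.
have NS' j : (N j < N j.+1)%N by exact: leq_maxl.
have NS j : (N j <= N j.+1)%N by exact: ltnW.
have Nge j : (j <= N j)%N by elim: j => // j IH; exact: leq_ltn_trans (NS' j).
have Nmono i j : (i <= j)%N -> (N i <= N j)%N.
  by move=> /subnK <-; elim: (j - i)%N => // n IH; rewrite addSn; apply: leq_trans IH (NS _).
pose g j := f_ (N j).
have gd j : (E2 mu (fun x => g j.+1 x - g j x)%R <= ((32^-1 : R) ^+ j)%:E)%E.
  by apply: Kp => //; exact: leq_trans (NK j) (NS j).
have mD j : mC (fun x => g j.+1 x - g j x) by apply: mC_B; exact: mf_.
pose h j x := (4 ^+ j * sqn (g j.+1 x - g j x))%:E.
have h0 j x : (0 <= h j x)%E by rewrite lee_fin mulr_ge0 ?sqn_ge0// exprn_ge0.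
have mh j : measurable_fun setT (h j).
  by apply/measurable_EFinP; apply: measurable_funM => //; exact: measurable_sqn.
pose H x := (\sum_(j <oo) h j x)%E.
have mH : measurable_fun setT H.
  by apply: ge0_emeasurable_sum => // k x _ _; exact: h0.
have intH : (\int[mu]_x H x < +oo)%E.
  rewrite integral_nneseries//.
  apply: (@le_lt_trans _ _ (\sum_(j <oo) ((8^-1 : R) ^+ j)%:E)%E).
    apply: lee_nneseries => j _; first by move=> _; apply: integral_ge0.
    rewrite /h; under eq_integral do rewrite EFinM.
    rewrite ge0_integralZl_EFin ?exprn_ge0//; last exact: measurable_sqnE.
      apply: (@le_trans _ _ ((4 ^+ j)%:E * ((32^-1 : R) ^+ j)%:E)%E).
        by apply: lee_wpmul2l; [rewrite lee_fin exprn_ge0|exact: gd].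
      by rewrite -EFinM lee_fin -exprMn (_ : 4 * 32^-1 = 8^-1 :> R)//; field.
    by move=> x _; rewrite lee_fin sqn_ge0.
  have c8 : cvgn (series (fun n => (1 : R) * 8^-1 ^+ n)).
    by apply: is_cvg_geometric_series; rewrite ger0_norm ?invr_ge0// invf_lt1// ltr1n.
  have -> : (\sum_(j <oo) ((8^-1 : R) ^+ j)%:E)%E = (limn (series (fun n => (1 : R) * 8^-1 ^+ n)))%:E.
    apply/cvg_lim => //; apply: cvg_EFin; first by apply: nearW => n; rewrite sumEFin.
    apply: cvg_trans c8; apply: near_eq_cvg; apply: nearW => n; rewrite /= sumEFin /series /=.
    by apply: eq_bigr => i _; rewrite mul1r.
  exact: ltry.
have aeH : {ae mu, forall x, H x \is a fin_num}.
  have iH : mu.-integrable setT H.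
    apply/integrableP; split => //.
    under eq_integral do rewrite gee0_abs ?nneseries_ge0//.
    exact: intH.
  by apply: filterS (integrable_ae measurableT iH) => x; exact.
have cvg_ae : {ae mu, forall x, cvgn (fun j => complex.Re (g j x)) /\ cvgn (fun j => complex.Im (g j x))}.
  apply: filterS aeH => x Hx.
  have sq j : sqn (g j.+1 x - g j x) <= (Num.sqrt (fine (H x)) * 2^-1 ^+ j) ^+ 2.
    have H0 : (0 <= H x)%E by exact: nneseries_ge0.
    rewrite exprMn sqr_sqrtr ?fine_ge0// -exprM mulnC exprM.
    rewrite (_ : (2^-1) ^+ 2 = 4^-1 :> R); last by field.
    rewrite exprVn ler_pdivlMr ?exprn_gt0// mulrC -lee_fin fineK//.
    have := @nneseries_lim_ge _ (h ^~ x) xpredT 0%N j.+1 (fun i _ _ => h0 i x); apply: le_trans.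
    by rewrite big_nat_recr//= leeDr// sume_ge0.
  have s0 j : 0 <= Num.sqrt (fine (H x)) * 2^-1 ^+ j.
    by rewrite mulr_ge0 ?sqrtr_ge0// exprn_ge0// invr_ge0.
  split; apply: (@cvg_geometric_incr _ (Num.sqrt (fine (H x)))) => j; apply: norm_sqr_le => //;
    apply: le_trans (sq j).
  - by rewrite -cReB; exact: sqn_Re_le.
  - by rewrite -cImB; exact: sqn_Im_le.
(* The limsup is measurable and defined at every point; it is the limit at almost every one. *)
pose f x := fine (limn_esup (fun j => (complex.Re (g j x))%:E)) +i*
            fine (limn_esup (fun j => (complex.Im (g j x))%:E)).
have mf : mC f.
  split; rewrite /f /=; apply: (measurableT_comp (fine_measurable measurableT));
    apply: measurable_fun_limn_esup => n; apply/measurable_EFinP; [exact: (mf_ _).1|exact: (mf_ _).2].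
have flim (u : nat -> R) : cvgn u -> fine (limn_esup (fun j => (u j)%:E)) = limn u.
  move=> cu; rewrite (_ : limn_esup _ = (limn u)%:E)//.
  have : (u j)%:E @[j --> \oo] --> (limn u)%:E by apply: cvg_EFin => //; exact: nearW.
  by move=> /cvg_limn_einf_sup[_ ->].
have gf : {ae mu, forall x, complex.Re (g n x) @[n --> \oo] --> complex.Re (f x) /\
                          complex.Im (g n x) @[n --> \oo] --> complex.Im (f x)}.
  by apply: filterS cvg_ae => x [c1 c2]; rewrite /f /= !flim.
exists f => //.
apply: cvge0P => [n|e e1]; first exact: E2_ge0.
have [K0 K0p] := cau _ e1.
exists K0 => // n /= K0n.
(* Here [n] is fixed and the limit is taken along the subsequence. *)
apply: (@E2_fatou (fun j x => g j x - f_ n x)).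
- by move=> j; apply: mC_B; exact: mf_.
- by apply: mC_B => //; exact: mf_.
- apply: filterS gf => x [c1 c2]; apply: cvg_sqn.
    by under eq_fun do rewrite cReB; rewrite cReB; apply: cvgB => //; exact: cvg_cst.
  by under eq_fun do rewrite cImB; rewrite cImB; apply: cvgB => //; exact: cvg_cst.
- by exists K0 => // j /= K0j; apply: K0p => //; exact: leq_trans K0j (Nge j).
Qed.

(** Because [|f| <= 1 + |f|^2], and the constant is integrable on a set of finite measure. *)
Lemma rC_finite_supp (B : set T) f : measurable B -> (mu B < +oo)%E -> mC f ->
  (E2 mu f < +oo)%E -> (forall x, ~ B x -> f x = 0) -> rC mu f.
Proof.
move=> mB Boo mf foo fB; have iB := rint_indic mB Boo; have i2 := E2_fin mf foo.
apply: (rC_le mf (rintD iB i2)) => x; last by rewrite addr_ge0 ?sqn_ge0// indicE.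
have := sqn_ge0 (f x); have [xB|xB] := pselect (B x).
  by rewrite indicE mem_set//=; set q := sqn _ => q0; nra.
by rewrite fB// sqn0 => _; rewrite sqr_ge0.
Qed.

(** Large values become 0 instead of being rescaled, so that [clip j f - clip i f] is dominated by
    [f - clip i f] when [i <= j]. *)
Definition clip (j : nat) (f : T -> C) (x : T) : C := if sqn (f x) <= j%:R ^+ 2 then f x else 0.

Lemma mC_clip j f : mC f -> mC (clip j f).
Proof.
move=> mf; have mA : measurable [set x | sqn (f x) <= j%:R ^+ 2].
  have := measurable_fun_ler (measurable_sqn mf) (@measurable_cst _ _ _ _ setT (j%:R ^+ 2 : R)).
  move=> /(_ measurableT [set true] I); rewrite setTI.
  by rewrite (_ : _ @^-1` _ = [set x | sqn (f x) <= j%:R ^+ 2]).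
have : mC (fun x => (\1_[set x | sqn (f x) <= j%:R ^+ 2] x : R)%:C * f x).
  by apply: mC_M => //; apply: mC_R; exact: measurable_indic.
rewrite (_ : (fun x => _) = clip j f)//; apply/funext => x; rewrite /clip indicE.
by case: ifPn => h; [rewrite mem_set//= mul1r|rewrite memNset ?mul0r//; exact/negP].
Qed.

Lemma clip_near f x : \forall j \near \oo, clip j f x = f x.
Proof.
exists (Num.bound (Num.sqrt (sqn (f x)))) => // j /= Nj; rewrite /clip.
have := archi_boundP (sqrtr_ge0 (sqn (f x))) => h.
have : Num.sqrt (sqn (f x)) <= j%:R by apply: le_trans (ltW h) _; rewrite ler_nat.
rewrite -(ler_sqr (x := Num.sqrt _)) ?nnegrE ?sqrtr_ge0// sqr_sqrtr ?sqn_ge0//.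
by move=> ->.
Qed.

Lemma sqn_sub_clip j f x : sqn (f x - clip j f x) <= sqn (f x).
Proof. by rewrite /clip; case: ifP => _; rewrite ?subrr ?sqn0 ?subr0// sqn_ge0. Qed.

Lemma sqn_clip j f x : sqn (clip j f x) <= sqn (f x).
Proof. by rewrite /clip; case: ifP => _//; rewrite sqn0 sqn_ge0. Qed.

Lemma sqn_clipB i j f x : (i <= j)%N -> sqn (clip j f x - clip i f x) <= sqn (f x - clip i f x).
Proof.
move=> ij; rewrite /clip; case: ifPn => // hj; case: ifPn => hi.
- exfalso; move/negP : hj; apply; apply: le_trans hi _.
  by rewrite ler_sqr ?nnegrE// ler_nat.
- by rewrite subrr sqn0 subr0 sqn_ge0.
Qed.

Lemma E2_clip_cvg f : mC f -> (E2 mu f < +oo)%E ->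
  E2 mu (fun x => f x - clip j f x) @[j --> \oo] --> 0%E.
Proof.
move=> mf foo; have i2 := E2_fin mf foo.
have mj j : measurable_fun setT (fun x => sqn (f x - clip j f x)).
  by apply: measurable_sqn; apply: mC_B => //; exact: mC_clip.
have ij j : rint mu (fun x => sqn (f x - clip j f x)).
  by apply: (rint_le (mj j) i2) => x; rewrite !ger0_norm ?sqn_ge0// sqn_sub_clip.
have : \int[mu]_x sqn (f x - clip j f x) @[j --> \oo] --> \int[mu]_x (0 : R).
  apply: (@Rint_dominated _ _ _ mu (fun j x => sqn (f x - clip j f x)) (fun=> 0) (fun x => sqn (f x))) => //.
  - apply: aeW => x; apply: cvg_near_cst; apply: filterS (clip_near f x) => j ->.
    by rewrite subrr sqn0.
  - by move=> j x; rewrite ger0_norm ?sqn_ge0// sqn_sub_clip.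
rewrite Rint_zero => h; under eq_fun => j do rewrite /E2 -(EFin_Rint (ij j)).
by apply: cvg_EFin => //; exact: nearW.
Qed.

End L2_limits.

Section isometry_extend.
Context {R : realType} d1 d2 (T1 : measurableType d1) (T2 : measurableType d2).
Variables (n : {sigma_finite_measure set T1 -> \bar R}) (m : {sigma_finite_measure set T2 -> \bar R}).
Local Notation C := R[i].
Variables (e : T1 * T2 -> C) (B : set T2) (c : R).
Hypotheses (me : mC e) (e1 : forall z, sqn (e z) = 1) (mB : measurable B) (Boo : (m B < +oo)%E).
Hypothesis c0 : 0 <= c.

Definition ktr (f : T2 -> C) (t : T1) : C := Cint m (fun s => e (t, s) * f s).

Hypothesis isom_bounded : forall (f : T2 -> C) (M : R), mC f -> 0 <= M ->
  (forall s, sqn (f s) <= M ^+ 2) -> (forall s, ~ B s -> f s = 0) -> E2 n (ktr f) = (c%:E * E2 m f)%E.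

Lemma mC_ktr f : mC f -> mC (ktr f).
Proof.
move=> mf; apply: (mC_Cint_param m (f := fun z : T1 * T2 => e z * f z.2)).
by apply: mC_M => //; exact: (mC_comp mf measurable_snd).
Qed.

Lemma rC_ker f t : rC m f -> rC m (fun s => e (t, s) * f s).
Proof.
move=> rf; apply: (rC_mul_bounded (M := 1) _ rf) => //; first exact: (mC_slice1 t me).
by move=> x; rewrite e1 expr1n.
Qed.

Lemma ktrB f g t : rC m f -> rC m g -> ktr (fun s => f s - g s) t = ktr f t - ktr g t.
Proof.
move=> rf rg; rewrite /ktr -CintB; [|exact: rC_ker..].
by apply: Cint_ext => s; rewrite mulrBr.
Qed.

Lemma ktr_cvg (f_ : nat -> T2 -> C) f t : (forall j, mC (f_ j)) -> rC m f ->
  (forall j s, sqn (f_ j s) <= sqn (f s)) -> (forall s, \forall j \near \oo, f_ j s = f s) ->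
  complex.Re (ktr (f_ j) t) @[j --> \oo] --> complex.Re (ktr f t) /\
  complex.Im (ktr (f_ j) t) @[j --> \oo] --> complex.Im (ktr f t).
Proof.
move=> mf_ rf ff fc.
have mf := rC_mC rf.
have mk g : mC g -> mC (fun s => e (t, s) * g s) by move=> mg; apply: mC_M => //; exact: (mC_slice1 t me).
have ig : rint m (fun s => `|complex.Re (f s)| + `|complex.Im (f s)|).
  by case: rf => f1 f2; apply: rintD; exact: rint_norm.
have bd j s : sqn (e (t, s) * f_ j s) <= (`|complex.Re (f s)| + `|complex.Im (f s)|) ^+ 2.
  rewrite sqnM e1 mul1r; apply: le_trans (ff j s) _; rewrite /sqn.
  rewrite -(real_normK (num_real (complex.Re (f s)))) -(real_normK (num_real (complex.Im (f s)))).
  by have := normr_ge0 (complex.Re (f s)); have := normr_ge0 (complex.Im (f s)); nra.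
have b0 s : 0 <= `|complex.Re (f s)| + `|complex.Im (f s)| by rewrite addr_ge0.
split; apply: (@Rint_dominated _ _ _ m _ _ _ _ _ _ ig).
- by move=> j; exact: (mk _ (mf_ j)).1.
- exact: (mk _ mf).1.
- by apply: aeW => s; apply: cvg_near_cst; apply: filterS (fc s) => j ->.
- by move=> j s; apply: norm_sqr_le => //; apply: le_trans (bd j s); exact: sqn_Re_le.
- by move=> j; exact: (mk _ (mf_ j)).2.
- exact: (mk _ mf).2.
- by apply: aeW => s; apply: cvg_near_cst; apply: filterS (fc s) => j ->.
- by move=> j s; apply: norm_sqr_le => //; apply: le_trans (bd j s); exact: sqn_Im_le.
Qed.

(** Density of bounded functions. The isometry is known for [clip j f]; its transform tends to that
    of [f] at every point by dominated convergence, and Fatou controls the difference in L2. *)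
Lemma isom_L2 f : mC f -> (E2 m f < +oo)%E -> (forall s, ~ B s -> f s = 0) ->
  E2 n (ktr f) = (c%:E * E2 m f)%E.
Proof.
move=> mf foo fB.
have rf := rC_finite_supp mB Boo mf foo fB.
have mj j : mC (clip j f) by exact: mC_clip.
have jB j s : ~ B s -> clip j f s = 0 by rewrite /clip => /fB ->; rewrite if_same.
have joo j : (E2 m (clip j f) < +oo)%E.
  apply: le_lt_trans foo; apply: ge0_int_le; try exact: measurable_sqnE.
    by move=> x; rewrite lee_fin sqn_ge0.
  by move=> x; rewrite lee_fin sqn_clip.
have rj j := rC_finite_supp mB Boo (mj j) (joo j) (jB j).
have isoB i j : (i <= j)%N ->
    (E2 n (fun t => ktr (clip j f) t - ktr (clip i f) t)%R <= c%:E * E2 m (fun s => f s - clip i f s)%R)%E.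
  move=> ij; have -> : E2 n (fun t => ktr (clip j f) t - ktr (clip i f) t) =
      E2 n (ktr (fun s => clip j f s - clip i f s)).
    by apply: E2_ext => t; rewrite ktrB.
  rewrite (@isom_bounded _ j%:R) ?ler0n//.
  - apply: lee_wpmul2l; first by rewrite lee_fin.
    apply: ge0_int_le; try (apply: measurable_sqnE; exact: mC_B).
      by move=> x; rewrite lee_fin sqn_ge0.
    by move=> x; rewrite lee_fin sqn_clipB.
  - exact: mC_B.
  - move=> s; rewrite /clip; case: ifPn => hj; case: ifPn => hi.
    + by rewrite subrr sqn0 sqr_ge0.
    + by rewrite subr0.
    + by rewrite sub0r sqnN; apply: le_trans hi _; rewrite ler_sqr ?nnegrE// ler_nat.
    + by rewrite subrr sqn0 sqr_ge0.
  - by move=> s Bs; rewrite !jB// subrr.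
have mk := mC_ktr mf.
have mkj j : mC (ktr (clip j f)) by exact: mC_ktr.
have appr i : (E2 n (fun t => ktr f t - ktr (clip i f) t)%R <= c%:E * E2 m (fun s => f s - clip i f s)%R)%E.
  apply: (@E2_fatou _ _ _ _ (fun j t => ktr (clip j f) t - ktr (clip i f) t)).
  - by move=> j; exact: mC_B.
  - exact: mC_B.
  - apply: aeW => t; have [h1 h2] := ktr_cvg t mj rf (fun j s => sqn_clip j f s) (clip_near f).
    apply: cvg_sqn.
      by under eq_fun do rewrite cReB; rewrite cReB; apply: cvgB => //; exact: cvg_cst.
    by under eq_fun do rewrite cImB; rewrite cImB; apply: cvgB => //; exact: cvg_cst.
  - by exists i => // j /= ij; exact: isoB.
have c1 := E2_clip_cvg mf foo.
have Eiso j : E2 n (ktr (clip j f)) = (c%:E * E2 m (clip j f))%E.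
  apply: (@isom_bounded _ j%:R) => //; last exact: jB.
  by move=> s; rewrite /clip; case: ifPn => // _; rewrite sqn0 sqr_ge0.
have cm : E2 m (clip j f) @[j --> \oo] --> E2 m f.
  apply: E2_cvg => //; apply: cvg_trans c1; apply: near_eq_cvg; apply: nearW => j.
  by apply: eq_integral => x _; rewrite sqnB.
have ck : E2 n (fun t => ktr (clip j f) t - ktr f t) @[j --> \oo] --> 0%E.
  apply: (@squeeze_cvge _ _ _ _ (cst 0%E) _ (fun j => c%:E * E2 m (fun s => f s - clip j f s)%R)%E).
  - apply: nearW => j; rewrite E2_ge0/=; apply: le_trans (appr j).
    by rewrite le_eqVlt; apply/orP; left; apply/eqP/eq_integral => x _; rewrite sqnB.
  - exact: cvg_cst.
  - by rewrite -(mule0 c%:E); apply: cvgeZl.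
have koo : (E2 n (ktr f) < +oo)%E.
  have [N _ NP] := cvge0_le ck (fun j => E2_ge0 n _) ltr01.
  have := NP N (leqnn N) => h.
  have := E2D_le2 n (mkj N) (mC_B mk (mkj N)).
  have -> : E2 n (fun x => ktr (clip N f) x + (ktr f x - ktr (clip N f) x)) = E2 n (ktr f).
    by apply: E2_ext => t; rewrite addrC subrK.
  move=> h2; apply: (le_lt_trans h2); rewrite lte_add_pinfty// lte_mul_pinfty//.
    by rewrite Eiso lte_mul_pinfty.
  have -> : E2 n (fun x => ktr f x - ktr (clip N f) x) = E2 n (fun x => ktr (clip N f) x - ktr f x).
    by apply: eq_integral => x _; rewrite sqnB.
  by apply: le_lt_trans h _; exact: ltry.
have l1 : E2 n (ktr (clip j f)) @[j --> \oo] --> E2 n (ktr f) by exact: E2_cvg.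
have l2 : E2 n (ktr (clip j f)) @[j --> \oo] --> (c%:E * E2 m f)%E.
  by under eq_fun do rewrite Eiso; apply: cvgeZl.
by rewrite (cvg_unique _ l1 l2).
Qed.

End isometry_extend.

(** * Plancherel in several variables, and with a parameter *)

Section plancherel_m.
Context {R : realType}.
Local Notation C := R[i].
Local Notation RR := (measurableTypeR R).
Notation leb := (@lebesgue_measure R).
Notation mm := (@lebesgue_rV R).

Lemma measurable_rV_dot m d (T : measurableType d) (f g : T -> 'rV[R]_m) :
  measurable_fun setT f -> measurable_fun setT g ->
  measurable_fun setT (fun x => \sum_i f x 0 i * g x 0 i : R).
Proof.
move=> mf mg; apply: measurable_sum => i; apply: measurable_funM.
  exact: (measurableT_comp (measurable_coord i) mf).
exact: (measurableT_comp (measurable_coord i) mg).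
Qed.

(** A cube in the coordinates: its preimage under [rV_cons] is a product, as the induction on the
    dimension demands. *)
Definition box (m : nat) (K : R) : set 'rV[R]_m := [set s | forall i, `|s 0 i| < K].
Arguments box : clear implicits.

Lemma measurable_box m K : measurable (box m K).
Proof.
rewrite (_ : box m K = \bigcap_(i in [set: 'I_m]) ((fun s : 'rV[R]_m => s ord0 i : RR) @^-1` `]- K, K[%classic)).
  apply: fin_bigcap_measurable => // i _; rewrite -[X in measurable X]setTI.
  by apply: measurable_coord => //; exact: measurable_itv.
apply/seteqP; split => s h i; first by move=> _; rewrite /= in_itv/= -ltr_norml; exact: h.
by have := h i I; rewrite /= in_itv/= -ltr_norml.
Qed.

Arguments measurable_box : clear implicits.

Lemma rV_cons0 m (t : R) (s : 'rV[R]_m) : rV_cons (t, s) 0 ord0 = t.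
Proof. by rewrite mxE unlift_none. Qed.

Lemma rV_consS m (t : R) (s : 'rV[R]_m) j : rV_cons (t, s) 0 (lift ord0 j) = s 0 j.
Proof. by rewrite mxE liftK. Qed.

Lemma box_cons m K (t : R) (s : 'rV[R]_m) : box m.+1 K (rV_cons (t, s)) <-> `|t| < K /\ box m K s.
Proof.
split => [h|[h1 h2] i].
  split; first by have := h ord0; rewrite rV_cons0.
  by move=> i; have := h (lift ord0 i); rewrite rV_consS.
by case: (unliftP ord0 i) => [j|] ->; rewrite ?rV_consS ?rV_cons0.
Qed.

Lemma box_lty m K : (mm m (box m K) < +oo)%E.
Proof.
elim: m => [|m IH] /=; first by rewrite diracE ltry.
rewrite /lebesgue_rV_step /pushforward.
rewrite (_ : _ @^-1` _ = `]- K, K[%classic `*` box m K).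
  rewrite product_measure1E; [|exact: measurable_itv|exact: measurable_box].
  have h : (leb (`](- K)%R, K[%classic : set RR) < +oo)%E.
    by rewrite lebesgue_measure_itv /=; case: ifP => _; rewrite ?ltry.
  by rewrite lte_mul_pinfty// ge0_fin_numE.
apply/seteqP; split => -[t s] /=; rewrite in_itv/= -ltr_norml.
  by move=> /box_cons.
by move=> h; apply/box_cons.
Qed.

Arguments box_lty : clear implicits.

Lemma E2_rV_cons m (f : 'rV[R]_m.+1 -> C) : mC f ->
  E2 (mm m.+1) f = E2 (leb \x mm m)%E (fun p => f (rV_cons p)).
Proof.
move=> mf; rewrite /E2 /= (@ge0_integral_pushforward _ _ _ _ _ (@rV_cons R m) _ _ setT (fun s => (sqn (f s))%:E))//.
- exact: measurable_rV_cons.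
- exact: measurable_sqnE.
- by move=> s _; rewrite lee_fin sqn_ge0.
Qed.

Lemma rint_rV_cons m (f : 'rV[R]_m.+1 -> R) : rint (mm m.+1) f ->
  rint (leb \x mm m)%E (fun p => f (rV_cons p)).
Proof.
move=> iF; have mf := rint_measurable iF; apply/integrableP; split.
  by apply/measurable_EFinP; apply: (measurableT_comp mf); exact: measurable_rV_cons.
move/integrableP : iF => [_]; rewrite /= (@ge0_integral_pushforward _ _ _ _ _ (@rV_cons R m) _ _ setT (fun s => `|f s|%:E))//.
- exact: measurable_rV_cons.
- by apply/measurable_EFinP; exact: measurableT_comp.
Qed.

Lemma Rint_rV_cons m (f : 'rV[R]_m.+1 -> R) : rint (mm m.+1) f ->
  \int[mm m.+1]_s f s = \int[(leb \x mm m)%E]_p f (rV_cons p).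
Proof.
move=> iF; rewrite /Rintegral; congr fine.
rewrite /= (@integral_pushforward _ _ _ _ _ (@rV_cons R m) _ _ setT (EFin \o f))//.
- exact: measurable_rV_cons.
- exact: measurable_int iF.
- exact: rint_rV_cons.
Qed.

Lemma Cint_rV_cons m (f : 'rV[R]_m.+1 -> C) : rC (mm m.+1) f ->
  Cint (mm m.+1) f = Cint leb (fun t => Cint (mm m) (fun s => f (rV_cons (t, s)))).
Proof.
move=> [f1 f2]; rewrite -(Cint_prod1 (m1 := leb) (m2 := mm m) (f := fun p => f (rV_cons p))).
  by apply: eq_ReIm; rewrite /= Rint_rV_cons.
by split; [exact: (rint_rV_cons f1)|exact: (rint_rV_cons f2)].
Qed.

(** The frequency comes first, the point second, in the order of the arguments of the kernel of
    [ktr]. *)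
Definition chr m (z : 'rV[R]_m * 'rV[R]_m) : C := expi (- \sum_i z.2 0 i * z.1 0 i).

Definition ftm m (f : 'rV[R]_m -> C) (th : 'rV[R]_m) : C :=
  Cint (mm m) (fun s => expi (- \sum_i s 0 i * th 0 i) * f s).

Lemma mC_chr m : mC (@chr m).
Proof.
apply: mC_expi; apply: measurable_funN.
by apply: (@measurable_rV_dot m _ _ snd fst); [exact: measurable_snd|exact: measurable_fst].
Qed.

Lemma sqn_chr m z : sqn (@chr m z) = 1. Proof. exact: sqn_expi. Qed.

Lemma ftmE m f : @ftm m f = ktr (mm m) (@chr m) f. Proof. by []. Qed.

Lemma dot_cons m (t u : R) (s th : 'rV[R]_m) :
  \sum_i (rV_cons (t, s)) 0 i * (rV_cons (u, th)) 0 i = t * u + \sum_i s 0 i * th 0 i.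
Proof.
rewrite big_ord_recl !rV_cons0; congr (_ + _).
by apply: eq_bigr => i _; rewrite !rV_consS.
Qed.

Lemma E2_bounded_box m (f : 'rV[R]_m -> C) (M K : R) : mC f -> 0 <= M ->
  (forall s, sqn (f s) <= M ^+ 2) -> (forall s, ~ box m K s -> f s = 0) -> (E2 (mm m) f < +oo)%E.
Proof.
move=> mf M0 fM fK.
apply: (@le_lt_trans _ _ (\int[mm m]_s ((M ^+ 2)%:E * (\1_(box m K) s)%:E)))%E.
  apply: ge0_int_le; first exact: measurable_sqnE.
  - by apply: measurable_funeM; apply/measurable_EFinP; apply: measurable_indic; exact: measurable_box.
  - by move=> s; rewrite lee_fin sqn_ge0.
  - move=> s; rewrite -EFinM lee_fin indicE; have [h|h] := pselect (box m K s).
      by rewrite mem_set//= mulr1.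
    by rewrite fK// sqn0 mulr_ge0// sqr_ge0.
rewrite ge0_integralZl_EFin ?sqr_ge0//.
  rewrite integral_indic//; last exact: measurable_box.
  by rewrite setIT; apply: lte_mul_pinfty => //; [rewrite lee_fin sqr_ge0|exact: box_lty].
by apply/measurable_EFinP; apply: measurable_indic; exact: measurable_box.
Qed.

(** The real and the imaginary part are each at most [M] times the volume of the cube. This bound
    makes the partial transform an admissible function for the one-dimensional theorem. *)
Lemma ftm_bounded m (f : 'rV[R]_m -> C) (M K : R) : mC f -> 0 <= M ->
  (forall s, sqn (f s) <= M ^+ 2) -> (forall s, ~ box m K s -> f s = 0) ->
  forall th, sqn (ftm f th) <= (2 * (M * fine (mm m (box m K)))) ^+ 2.
Proof.
move=> mf M0 fM fK th.
have mg : mC (fun s : 'rV[R]_m => expi (- \sum_i s 0 i * th 0 i) * f s).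
  by apply: mC_M => //; exact: (mC_slice1 th (@mC_chr m)).
have iB := rint_indic (measurable_box m K) (box_lty m K).
have B (s : 'rV[R]_m) : sqn (expi (- \sum_i s 0 i * th 0 i) * f s) <= (M * (\1_(box m K) s : R)) ^+ 2.
  rewrite sqnM sqn_expi mul1r indicE; have [h|h] := pselect (box m K s).
    by rewrite mem_set//= mulr1.
  by rewrite fK// sqn0 sqr_ge0.
have B0 (s : 'rV[R]_m) : 0 <= M * (\1_(box m K) s : R) by rewrite mulr_ge0// indicE.
have iM := rintZ M iB.
have E : \int[mm m]_s (M * \1_(box m K) s) = M * fine (mm m (box m K)).
  rewrite RintZ//; congr (_ * _); rewrite /Rintegral integral_indic ?setIT//.
  exact: measurable_box.
have V0 : 0 <= M * fine (mm m (box m K)) by rewrite mulr_ge0// fine_ge0.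
have h (g : 'rV[R]_m -> R) : measurable_fun setT g -> (forall s : 'rV[R]_m, `|g s| <= M * (\1_(box m K) s : R)) ->
    (\int[mm m]_s g s) ^+ 2 <= (M * fine (mm m (box m K))) ^+ 2.
  move=> mgg gb; have ig : rint (mm m) g.
    by apply: (rint_le mgg iM) => s; apply: le_trans (gb s) (ler_norm _).
  rewrite -(real_normK (num_real (\int[mm m]_s g s))) ler_sqr ?nnegrE// -E.
  by apply: (le_trans (Rint_norm ig)); apply: Rint_le => //; exact: rint_norm.
rewrite /sqn exprMn [2 ^+ 2](_ : _ = 2 + 2); last by ring.
have h1 := h _ mg.1 (fun s => norm_sqr_le (le_trans (sqn_Re_le _) (B s)) (B0 s)).
have h2 := h _ mg.2 (fun s => norm_sqr_le (le_trans (sqn_Im_le _) (B s)) (B0 s)).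
apply: (le_trans (lerD h1 h2)).
have := sqr_ge0 (M * fine (mm m (box m K))).
by move: (_ ^+ 2) => q; lra.
Qed.

(* Induction on the dimension: partial transform in the last m variables for each
   value of the first one, then the one-dimensional theorem. *)
Lemma plancherel_m_bounded m (f : 'rV[R]_m -> C) (M K : R) : mC f -> 0 <= M ->
  (forall s, sqn (f s) <= M ^+ 2) -> (forall s, ~ box m K s -> f s = 0) ->
  E2 (mm m) (ftm f) = (((2 * pi) ^+ m)%:E * E2 (mm m) f)%E.
Proof.
elim: m f M => [|m IH] f M mf M0 fM fK.
  (* In dimension 0 the measure is a Dirac mass and the transform is the identity. *)
  rewrite expr0 mul1e; apply: eq_integral => th _; congr EFin.
  rewrite /ftm /Cint /Rintegral /= !integral_dirac//; last 2 first.
  - by apply/measurable_EFinP; have [] := (mC_M (mC_slice1 th (@mC_chr 0)) mf).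
  - by apply/measurable_EFinP; have [] := (mC_M (mC_slice1 th (@mC_chr 0)) mf).
  rewrite diracT !mul1e big_ord0 oppr0 /expi cos0 sin0.
  have -> : th = 0 by apply/rowP => -[].
  by congr sqn; apply: eq_ReIm => /=; rewrite ?cReM ?cImM /=; ring.
have p0 := @pi_gt0 R.
have foo := E2_bounded_box mf M0 fM fK.
have rf : rC (mm m.+1) f := rC_finite_supp (measurable_box m.+1 K) (box_lty m.+1 K) mf foo fK.
have mfc : mC (fun p : RR * 'rV[R]_m => f (rV_cons p)) by exact: (mC_comp mf (@measurable_rV_cons R m)).
pose g (z : 'rV[R]_m * RR) : C := ftm (fun s => f (rV_cons (z.2, s))) z.1.
have mg : mC g.
  apply: (mC_Cint_param (mm m) (f := fun z : ('rV[R]_m * RR) * 'rV[R]_m =>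
     chr (z.1.1, z.2) * f (rV_cons (z.1.2, z.2)))).
  apply: mC_M.
    apply: (mC_comp (@mC_chr m)); apply: measurable_fun_pair; last exact: measurable_snd.
    exact: (measurableT_comp measurable_fst measurable_fst).
  apply: (mC_comp mfc); apply: measurable_fun_pair; last exact: measurable_snd.
  exact: (measurableT_comp measurable_snd measurable_fst).
pose V := 2 * (M * fine (mm m (box m K))).
have V0 : 0 <= V by rewrite !mulr_ge0// fine_ge0.
have slice t : mC (fun s => f (rV_cons (t, s))) by exact: (mC_slice1 t mfc).
have sliceK t s : ~ box m K s -> f (rV_cons (t, s)) = 0.
  by move=> h; apply: fK => /box_cons[].
have gV z : sqn (g z) <= V ^+ 2.
  by apply: ftm_bounded => // s; exact: sliceK.
have gK th (t : R) : K <= `|t| -> g (th, t) = 0.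
  move=> Kt; rewrite /g /ftm -[RHS](Cint0 (mm m)); apply: Cint_ext => s /=.
  by rewrite fK ?mulr0// => /box_cons[]; rewrite ltNge Kt.
(* The character factors along [rV_cons], so the full transform is the one-dimensional transform of
   the partial one. *)
have E u th : ftm f (rV_cons (u, th)) = ft1 (fun t => g (th, t)) u.
  rewrite /ftm Cint_rV_cons; last first.
    apply: (rC_mul_bounded (M := 1) _ rf) => //; first exact: (mC_slice1 (rV_cons (u, th)) (@mC_chr m.+1)).
    by move=> s; rewrite sqn_expi expr1n.
  apply: Cint_ext => t; rewrite /g /ftm /= -CintZ; last first.
    have rs : rC (mm m) (fun s => f (rV_cons (t, s))).
      apply: (rC_finite_supp (measurable_box m K) (box_lty m K)) => //.
        by apply: (E2_bounded_box (slice t) M0) => // s; exact: sliceK.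
      by move=> s; exact: sliceK.
    apply: (rC_mul_bounded (M := 1) _ rs) => //; first exact: (mC_slice1 th (@mC_chr m)).
    by move=> s; rewrite sqn_expi expr1n.
  by apply: Cint_ext => s; rewrite dot_cons opprD expiD mulrA.
have mft : mC (ftm f) by rewrite ftmE; apply: mC_ktr => //; exact: mC_chr.
rewrite E2_rV_cons// (E2_prod2 (leb) (mm m)); last exact: (mC_comp mft (@measurable_rV_cons R m)).
transitivity (\int[mm m]_th ((2 * pi)%:E * E2 leb (fun t => g (th, t))))%E.
  apply: eq_integral => th _; rewrite -(@plancherel1 R (fun t => g (th, t)) V K) //.
  - by apply: E2_ext => u; rewrite E.
  - exact: (mC_slice1 th mg).
  - exact: gK.
rewrite ge0_integralZl_EFin//; last 3 first.
- by move=> th _; exact: E2_ge0.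
- exact: (measurable_E2_slice1 leb mg).
- by rewrite mulr_ge0// ltW.
rewrite -(E2_prod1 (mm m) (leb) mg) (E2_prod2 (mm m) (leb) mg).
transitivity ((2 * pi)%:E * \int[leb]_t (((2 * pi) ^+ m)%:E * E2 (mm m) (fun s => f (rV_cons (t, s)))))%E.
  congr (_ * _)%E; apply: eq_integral => t _.
  exact: (IH _ M (slice t) M0 (fun s => fM _) (sliceK t)).
rewrite ge0_integralZl_EFin//; last 3 first.
- by move=> th _; exact: E2_ge0.
- exact: (measurable_E2_slice1 (mm m) mfc).
- by rewrite exprn_ge0// mulr_ge0// ltW.
by rewrite muleA -EFinM -exprS -(E2_prod1 (leb) (mm m) mfc) E2_rV_cons.
Qed.

Lemma twopi_ge0 m : 0 <= (2 * pi) ^+ m :> R.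
Proof. by rewrite exprn_ge0// mulr_ge0// ltW// pi_gt0. Qed.

Lemma plancherel_m m (f : 'rV[R]_m -> C) (K : R) : mC f -> (E2 (mm m) f < +oo)%E ->
  (forall s, ~ box m K s -> f s = 0) ->
  E2 (mm m) (ftm f) = (((2 * pi) ^+ m)%:E * E2 (mm m) f)%E.
Proof.
move=> mf foo fK; rewrite ftmE.
apply: (isom_L2 (B := box m K) (@mC_chr m) (@sqn_chr m)) => //.
- exact: measurable_box.
- exact: box_lty.
- exact: twopi_ge0.
- by move=> h M mh M0 hM hK; rewrite -ftmE; exact: (plancherel_m_bounded mh M0 hM hK).
Qed.

Definition tft m (w : 'rV[R]_m * RR -> C) (z : 'rV[R]_m * RR) : C := ftm (fun s => w (s, z.2)) z.1.

Lemma mC_tft m (w : 'rV[R]_m * RR -> C) : mC w -> mC (tft w).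
Proof.
move=> mw; apply: (mC_Cint_param (mm m) (f := fun z : ('rV[R]_m * RR) * 'rV[R]_m =>
     chr (z.1.1, z.2) * w (z.2, z.1.2))).
apply: mC_M.
  apply: (mC_comp (@mC_chr m)); apply: measurable_fun_pair; last exact: measurable_snd.
  exact: (measurableT_comp measurable_fst measurable_fst).
apply: (mC_comp mw); apply: measurable_fun_pair; first exact: measurable_snd.
exact: (measurableT_comp measurable_snd measurable_fst).
Qed.

Lemma ae_E2_slice2 d1 d2 (T1 : measurableType d1) (T2 : measurableType d2)
  (m1 : {sigma_finite_measure set T1 -> \bar R}) (m2 : {sigma_finite_measure set T2 -> \bar R})
  (w : T1 * T2 -> C) : mC w -> (E2 (m1 \x m2)%E w < +oo)%E ->
  {ae m2, forall x, (E2 m1 (fun s => w (s, x)) < +oo)%E}.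
Proof.
move=> mw; rewrite (E2_prod2 m1 m2 mw) => woo.
have iw : m2.-integrable setT (fun x => E2 m1 (fun s => w (s, x))).
  apply/integrableP; split; first exact: measurable_E2_slice2.
  by under eq_integral do rewrite gee0_abs ?E2_ge0//.
by apply: filterS (integrable_ae measurableT iw) => x /(_ I); rewrite ge0_fin_numE ?E2_ge0.
Qed.

Lemma ae_E2_slice1 d1 d2 (T1 : measurableType d1) (T2 : measurableType d2)
  (m1 : {sigma_finite_measure set T1 -> \bar R}) (m2 : {sigma_finite_measure set T2 -> \bar R})
  (w : T1 * T2 -> C) : mC w -> (E2 (m1 \x m2)%E w < +oo)%E ->
  {ae m1, forall s, (E2 m2 (fun x => w (s, x)) < +oo)%E}.
Proof.
move=> mw; rewrite (E2_prod1 m1 m2 mw) => woo.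
have iw : m1.-integrable setT (fun s => E2 m2 (fun x => w (s, x))).
  apply/integrableP; split; first exact: measurable_E2_slice1.
  by under eq_integral do rewrite gee0_abs ?E2_ge0//.
by apply: filterS (integrable_ae measurableT iw) => x /(_ I); rewrite ge0_fin_numE ?E2_ge0.
Qed.

Lemma plancherel_t m (w : 'rV[R]_m * RR -> C) (K : R) : mC w -> (E2 (lebesgue_ty m) w < +oo)%E ->
  (forall z, ~ box m K z.1 -> w z = 0) ->
  E2 (lebesgue_ty m) (tft w) = (((2 * pi) ^+ m)%:E * E2 (lebesgue_ty m) w)%E.
Proof.
move=> mw woo wK.
rewrite [LHS](E2_prod2 (mm m) (leb) (mC_tft mw)) [in RHS](E2_prod2 (mm m) (leb) mw).
rewrite -ge0_integralZl_EFin//; last 3 first.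
- by move=> th _; exact: E2_ge0.
- exact: (measurable_E2_slice2 (mm m) mw).
- exact: twopi_ge0.
apply: ae_eq_integral => //.
- exact: (measurable_E2_slice2 (mm m) (mC_tft mw)).
- by apply: measurable_funeM; exact: (measurable_E2_slice2 (mm m) mw).
- apply: filterS (ae_E2_slice2 (m1 := mm m) (m2 := leb) mw woo) => x xoo _.
  exact: (plancherel_m (mC_slice2 x mw) xoo (fun s h => wK (s, x) h)).
Qed.

End plancherel_m.

(** * Tangential transform of square-integrable functions *)

Lemma mC_axpy (R : realType) d (T : measurableType d) (k : R[i]) (a b : T -> R[i]) :
  mC a -> mC b -> mC (fun z => a z + k * b z).
Proof. by move=> ma mb; apply: mC_D => //; apply: mC_M => //; exact: mC_cst. Qed.

Lemma cvge0_comb (R : realType) (f g : nat -> \bar R) (a b : R) :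
  f k @[k --> \oo] --> 0%E -> g k @[k --> \oo] --> 0%E ->
  (a%:E * f k + b%:E * g k)%E @[k --> \oo] --> 0%E.
Proof.
move=> f0 g0.
have fa : (a%:E * f k)%E @[k --> \oo] --> 0%E.
  by rewrite -[X in _ --> X](mule0 a%:E); exact: cvgeZl.
have gb : (b%:E * g k)%E @[k --> \oo] --> 0%E.
  by rewrite -[X in _ --> X](mule0 b%:E); exact: cvgeZl.
by rewrite -[X in _ --> X](adde0 0%E); apply: cvgeD.
Qed.

(* The L2 extension of an integral transform F defined on functions vanishing off
   some BB K, as the limit of the transforms of cut-off functions. *)
Section L2_transform.
Context {R : realType} d d' (T : measurableType d) (T' : measurableType d').
Variables (mu : {measure set T -> \bar R}) (nu : {measure set T' -> \bar R}).
Local Notation C := R[i].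
Variables (F : (T -> C) -> T' -> C) (BB : R -> set T) (c : R).
Hypothesis c0 : 0 < c.
Hypothesis BB_mono : forall K K', K <= K' -> BB K `<=` BB K'.
Hypothesis F_meas : forall w, mC w -> mC (F w).
Hypothesis F_iso : forall w K, mC w -> (E2 mu w < +oo)%E -> (forall z, ~ BB K z -> w z = 0) ->
  E2 nu (F w) = (c%:E * E2 mu w)%E.
Hypothesis F_lin : forall w1 w2 K (k : C), mC w1 -> mC w2 ->
  (E2 mu w1 < +oo)%E -> (E2 mu w2 < +oo)%E ->
  (forall z, ~ BB K z -> w1 z = 0) -> (forall z, ~ BB K z -> w2 z = 0) ->
  {ae nu, forall th, F (fun z => w1 z + k * w2 z) th = F w1 th + k * F w2 th}.

Definition is_cutoff (kap : nat -> T -> R) := [/\ forall k, measurable_fun setT (kap k),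
  forall k z, `|kap k z| <= 1, forall k, exists K, forall z, ~ BB K z -> kap k z = 0
  & forall z, kap k z @[k --> \oo] --> (1 : R)].

Definition cutf (kap : nat -> T -> R) k (w : T -> C) z : C := (kap k z)%:C * w z.

Variable chi : nat -> T -> R.
Hypothesis chi_cut : is_cutoff chi.

(** One cut-off sequence [chi] is fixed here; by [FT_cut] every other one leads to the same
    transform. *)
Definition FT (w : T -> C) (W : T' -> C) := [/\ mC w, mC W, (E2 mu w < +oo)%E, (E2 nu W < +oo)%E
  & E2 nu (fun th => W th - F (cutf chi k w) th) @[k --> \oo] --> 0%E].

Lemma E2_lty_le (w v : T -> C) : mC w -> mC v -> (forall z, sqn (w z) <= sqn (v z)) ->
  (E2 mu v < +oo)%E -> (E2 mu w < +oo)%E.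
Proof.
move=> mw mv wv; apply: le_lt_trans; apply: ge0_int_le; try exact: measurable_sqnE.
  by move=> z; rewrite lee_fin sqn_ge0.
by move=> z; rewrite lee_fin.
Qed.

Lemma mC_cutf kap k w : is_cutoff kap -> mC w -> mC (cutf kap k w).
Proof. by move=> [mk _ _ _] mw; apply: mC_M => //; apply: mC_R. Qed.

Lemma sqn_cutf kap k w z : is_cutoff kap -> sqn (cutf kap k w z) <= sqn (w z).
Proof.
move=> [_ k1 _ _]; rewrite sqnM sqnR ler_piMl ?sqn_ge0//.
rewrite -(real_normK (num_real (kap k z))) expr_le1//.
Qed.

Lemma cutf_lty kap k w : is_cutoff kap -> mC w -> (E2 mu w < +oo)%E -> (E2 mu (cutf kap k w) < +oo)%E.
Proof.
by move=> ck mw; apply: E2_lty_le => // [|z]; [exact: mC_cutf|exact: sqn_cutf].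
Qed.

Lemma cutf_supp kap k : is_cutoff kap -> exists K, forall w z, ~ BB K z -> cutf kap k w z = 0.
Proof. by move=> [_ _ kK _]; have [K h] := kK k; exists K => w z /h hz; rewrite /cutf hz mul0r. Qed.

Lemma cut_cvg kap w : is_cutoff kap -> mC w -> (E2 mu w < +oo)%E ->
  E2 mu (fun z => w z - cutf kap k w z) @[k --> \oo] --> 0%E.
Proof.
move=> ck mw woo; have [mk k1 _ kc] := ck; have i2 := E2_fin mw woo.
have mj k : measurable_fun setT (fun z => sqn (w z - cutf kap k w z)).
  by apply: measurable_sqn; apply: mC_B => //; exact: mC_cutf.
have E k z : sqn (w z - cutf kap k w z) = (1 - kap k z) ^+ 2 * sqn (w z).
  rewrite /cutf (_ : w z - _ = (1 - kap k z)%:C * w z); first by rewrite sqnM sqnR.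
  by apply: eq_ReIm; rewrite ?cReB ?cImB !(cReM, cImM) /=; ring.
have B k z : `|sqn (w z - cutf kap k w z)| <= 4 * sqn (w z).
  rewrite ger0_norm ?sqn_ge0// E ler_wpM2r ?sqn_ge0//.
  by have := k1 k z; rewrite ler_norml => /andP[]; set q := kap k z => ? ?; nra.
have ij k : rint mu (fun z => sqn (w z - cutf kap k w z)).
  apply: (rint_le (mj k) (rintZ 4 i2)) => z; rewrite [leRHS]ger0_norm ?B//.
  by rewrite mulr_ge0// sqn_ge0.
have : \int[mu]_z sqn (w z - cutf kap k w z) @[k --> \oo] --> \int[mu]_z (0 : R).
  apply: (@Rint_dominated _ _ _ mu (fun k z => sqn (w z - cutf kap k w z)) (fun=> 0) (fun z => 4 * sqn (w z))) => //.
  - apply: aeW => z; under eq_fun do rewrite E.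
    rewrite -(mul0r (sqn (w z))); apply: cvgMr_tmp.
    have -> : (0 : R) = (1 - 1) ^+ 2 by rewrite subrr expr0n.
    under eq_fun do rewrite expr2; rewrite expr2.
    by apply: cvgM; apply: cvgB => //; exact: cvg_cst.
  - exact: rintZ.
rewrite Rint_zero => h; under eq_fun => j do rewrite /E2 -(EFin_Rint (ij j)).
by apply: cvg_EFin => //; exact: nearW.
Qed.

(** Linearity of [F] is available only almost everywhere: in the application with a parameter, a
    slice of an L2 function is in L2 only for almost every value of it. *)
Lemma E2_F_diff w1 w2 K : mC w1 -> mC w2 -> (E2 mu w1 < +oo)%E -> (E2 mu w2 < +oo)%E ->
  (forall z, ~ BB K z -> w1 z = 0) -> (forall z, ~ BB K z -> w2 z = 0) ->
  E2 nu (fun th => F w1 th - F w2 th) = (c%:E * E2 mu (fun z => w1 z - w2 z)%R)%E.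
Proof.
move=> m1 m2 o1 o2 K1 K2.
have mD : mC (fun z => w1 z - w2 z) by exact: mC_B.
have E : (fun z => w1 z + (-1) * w2 z) = (fun z => w1 z - w2 z).
  by apply/funext => z; rewrite mulN1r.
rewrite -(@F_iso _ K)//.
- apply: E2_ae_eq; [by apply: mC_B; exact: F_meas|exact: F_meas|].
  have := F_lin (-1) m1 m2 o1 o2 K1 K2; rewrite E.
  by apply: filterS => th ->; rewrite mulN1r.
- apply: (le_lt_trans (E2D_le2 mu m1 (mC_N m2))).
  have -> : E2 mu (fun z => - w2 z) = E2 mu w2 by apply: eq_integral => z _; rewrite sqnN.
  by rewrite lte_add_pinfty// lte_mul_pinfty.
- by move=> z h; rewrite K1// K2// subrr.
Qed.

(** Two cut-offs of [w] are close in L2, and the isometry carries this over to their transforms.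
    This is what replaces the sharp truncations of the statement by smooth cut-offs, which can enter
    a test function. *)
Lemma FT_cut kap w W : is_cutoff kap -> FT w W ->
  E2 nu (fun th => W th - F (cutf kap k w) th) @[k --> \oo] --> 0%E.
Proof.
move=> ck [mw mW woo Woo cv].
have mck k := mC_cutf k ck mw; have mch k := mC_cutf k chi_cut mw.
have ock k := cutf_lty k ck mw woo; have och k := cutf_lty k chi_cut mw woo.
have D k : E2 nu (fun th => F (cutf chi k w) th - F (cutf kap k w) th) =
    (c%:E * E2 mu (fun z => cutf chi k w z - cutf kap k w z)%R)%E.
  have [K1 h1] := cutf_supp k chi_cut; have [K2 h2] := cutf_supp k ck.
  apply: (@E2_F_diff _ _ (Num.max K1 K2)) => // z h.
    by apply: h1 => /(BB_mono (K' := Num.max K1 K2)) hh; apply: h; apply: hh; rewrite le_max lexx.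
  by apply: h2 => /(BB_mono (K' := Num.max K1 K2)) hh; apply: h; apply: hh; rewrite le_max lexx orbT.
apply: (@squeeze_cvge _ _ _ _ (cst 0%E) _ (fun k => 2%:E * E2 nu (fun th => W th - F (cutf chi k w) th)%R +
   2%:E * (c%:E * (2%:E * E2 mu (fun z => w z - cutf chi k w z)%R + 2%:E * E2 mu (fun z => w z - cutf kap k w z)%R)))%E).
- apply: nearW => k; rewrite E2_ge0/=.
  have -> : E2 nu (fun th => W th - F (cutf kap k w) th) =
      E2 nu (fun th => (W th - F (cutf chi k w) th) + (F (cutf chi k w) th - F (cutf kap k w) th)).
    by apply: E2_ext => th; rewrite addrA subrK.
  apply: le_trans (E2D_le2 nu _ _) _.
  + by apply: mC_B => //; exact: F_meas.
  + by apply: mC_B; exact: F_meas.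
  rewrite leeD2l// lee_wpmul2l// D lee_wpmul2l ?lee_fin ?(ltW c0)//.
  have -> : E2 mu (fun z => cutf chi k w z - cutf kap k w z) =
      E2 mu (fun z => (w z - cutf kap k w z) + - (w z - cutf chi k w z)).
    by apply: E2_ext => z; ring.
  have -> : E2 mu (fun z => w z - cutf chi k w z) = E2 mu (fun z => - (w z - cutf chi k w z)).
    by apply: eq_integral => z _; rewrite sqnN.
  rewrite addeC; apply: E2D_le2; first exact: mC_B.
  by apply: mC_N; exact: mC_B.
- exact: cvg_cst.
- apply: cvge0_comb => //; rewrite -[X in _ --> X](mule0 c%:E); apply: cvgeZl => //.
  by apply: cvge0_comb; exact: cut_cvg.
Qed.

Lemma FT_isometry w W : FT w W -> E2 nu W = (c%:E * E2 mu w)%E.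
Proof.
move=> [mw mW woo Woo cv].
have mch k := mC_cutf k chi_cut mw.
have och k := cutf_lty k chi_cut mw woo.
have l1 : E2 nu (F (cutf chi k w)) @[k --> \oo] --> E2 nu W.
  apply: E2_cvg => //; first by move=> k; exact: F_meas.
  apply: cvg_trans cv; apply: near_eq_cvg; apply: nearW => k.
  by apply: eq_integral => th _; rewrite sqnB.
have l2 : E2 nu (F (cutf chi k w)) @[k --> \oo] --> (c%:E * E2 mu w)%E.
  have Ei k : E2 nu (F (cutf chi k w)) = (c%:E * E2 mu (cutf chi k w))%E.
    by have [K1 h1] := cutf_supp k chi_cut; apply: (@F_iso _ K1) => // z; exact: h1.
  under eq_fun do rewrite Ei.
  apply: cvgeZl => //; apply: E2_cvg => //.
  apply: cvg_trans (cut_cvg chi_cut mw woo); apply: near_eq_cvg; apply: nearW => k.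
  by apply: eq_integral => z _; rewrite sqnB.
by rewrite (cvg_unique _ l1 l2).
Qed.

(** By the isometry the transforms of the cut-off functions form a Cauchy sequence. *)
Lemma FT_exists w : mC w -> (E2 mu w < +oo)%E -> exists W, FT w W.
Proof.
move=> mw woo.
have mch k := mC_cutf k chi_cut mw.
have och k := cutf_lty k chi_cut mw woo.
have cc := cut_cvg chi_cut mw woo.
have [|e e0|W mW cv] := @L2_complete R _ T' nu (fun k => F (cutf chi k w)).
- by move=> k; exact: F_meas.
(* Two such errors, each doubled by [E2D_le2] and then multiplied by [c], add up to [e]. *)
- have e1 : 0 < e / (4 * c) by rewrite divr_gt0// mulr_gt0.
  have [N _ NP] := cvge0_le cc (fun k => E2_ge0 mu _) e1.
  exists N => k l Nk Nl.
  have -> : E2 nu (fun x => F (cutf chi k w) x - F (cutf chi l w) x) =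
      (c%:E * E2 mu (fun z => cutf chi k w z - cutf chi l w z)%R)%E.
    have [K1 h1] := cutf_supp k chi_cut; have [K2 h2] := cutf_supp l chi_cut.
    apply: (@E2_F_diff _ _ (Num.max K1 K2)) => // z h.
      by apply: h1 => /(BB_mono (K' := Num.max K1 K2)) hh; apply: h; apply: hh; rewrite le_max lexx.
    by apply: h2 => /(BB_mono (K' := Num.max K1 K2)) hh; apply: h; apply: hh; rewrite le_max lexx orbT.
  have -> : E2 mu (fun z => cutf chi k w z - cutf chi l w z) =
      E2 mu (fun z => (w z - cutf chi l w z) + - (w z - cutf chi k w z)).
    by apply: E2_ext => z; ring.
  have h : (E2 mu (fun z => (w z - cutf chi l w z) + - (w z - cutf chi k w z))%R <= (e / c)%:E)%E.
    apply: le_trans (E2D_le2 mu _ _) _; [exact: mC_B|by apply: mC_N; exact: mC_B|].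
    have -> : E2 mu (fun z => - (w z - cutf chi k w z)) = E2 mu (fun z => w z - cutf chi k w z).
      by apply: eq_integral => z _; rewrite sqnN.
    apply: (@le_trans _ _ (2%:E * (e / (4 * c))%:E + 2%:E * (e / (4 * c))%:E)%E).
      by apply: leeD; apply: lee_wpmul2l => //; exact: NP.
    by rewrite -!EFinM -EFinD lee_fin le_eqVlt; apply/orP; left; apply/eqP; field; rewrite gt_eqF.
  apply: (le_trans (lee_wpmul2l _ h)); first by rewrite lee_fin ltW.
  by rewrite -EFinM lee_fin mulrC divfK// gt_eqF.
exists W; split => //.
have [N _ NP] := cvge0_le cv (fun k => E2_ge0 nu _) ltr01.
have -> : E2 nu W = E2 nu (fun x => (W x - F (cutf chi N w) x) + F (cutf chi N w) x).
  by apply: E2_ext => x; rewrite subrK.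
apply: (le_lt_trans (E2D_le2 nu _ _)); [by apply: mC_B => //; exact: F_meas|exact: F_meas|].
have [K1 h1] := cutf_supp N chi_cut; rewrite (@F_iso _ K1)//; last by move=> z; exact: h1.
rewrite lte_add_pinfty// lte_mul_pinfty//; last by rewrite lte_mul_pinfty// lee_fin ltW.
by apply: le_lt_trans (NP N (leqnn N)) _; exact: ltry.
Qed.

Lemma FT_lin w W v V (k : C) : FT w W -> FT v V -> FT (fun z => w z + k * v z) (fun z => W z + k * V z).
Proof.
move=> [mw mW woo Woo cw] [mv mV voo Voo cv].
have sk0 : 0 <= sqn k by exact: sqn_ge0.
have lty d1 (T1 : measurableType d1) (m : {measure set T1 -> \bar R}) (a b : T1 -> C) :
    mC a -> mC b -> (E2 m a < +oo)%E -> (E2 m b < +oo)%E -> (E2 m (fun z => a z + k * b z)%R < +oo)%E.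
  move=> ma mb oa ob.
  have mkb : mC (fun z => k * b z) by apply: mC_M => //; exact: mC_cst.
  apply: (le_lt_trans (E2D_le2 m ma mkb)).
  have h : (E2 m (fun z => k * b z)%R <= (sqn k)%:E * E2 m b)%E.
    by apply: E2_le => // x; rewrite sqnM.
  rewrite lte_add_pinfty// lte_mul_pinfty//; apply: (le_lt_trans h).
  by rewrite lte_mul_pinfty// lee_fin.
have mwv : mC (fun z => w z + k * v z) by exact: mC_axpy.
split => //; [exact: mC_axpy|exact: lty|exact: lty|].
apply: (@squeeze_cvge _ _ _ _ (cst 0%E) _ (fun j => 2%:E * E2 nu (fun th => W th - F (cutf chi j w) th)%R +
   2%:E * ((sqn k)%:E * E2 nu (fun th => V th - F (cutf chi j v) th)%R))%E).
- apply: nearW => j; rewrite E2_ge0/=.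
  have m1 := mC_cutf j chi_cut mw; have m2 := mC_cutf j chi_cut mv.
  have [K h] := cutf_supp j chi_cut.
  have mFw : mC (F (cutf chi j w)) by exact: F_meas.
  have mFv : mC (F (cutf chi j v)) by exact: F_meas.
  have -> : E2 nu (fun th => W th + k * V th - F (cutf chi j (fun z => w z + k * v z)) th) =
      E2 nu (fun th => (W th - F (cutf chi j w) th) + k * (V th - F (cutf chi j v) th)).
    apply: E2_ae_eq.
    + apply: mC_B; first exact: mC_axpy.
      by apply: F_meas; exact: mC_cutf.
    + by apply: mC_axpy; exact: mC_B.
    + have := F_lin (K := K) k m1 m2 (cutf_lty j chi_cut mw woo) (cutf_lty j chi_cut mv voo) (h w) (h v).
      apply: filterS => th.
      have -> : cutf chi j (fun z => w z + k * v z) = (fun z => cutf chi j w z + k * cutf chi j v z).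
        by apply/funext => z; rewrite /cutf mulrDr; congr (_ + _); rewrite mulrCA.
      by move=> ->; ring.
  apply: (le_trans (E2D_le2 nu _ _)); [exact: mC_B|by apply: mC_M; [exact: mC_cst|exact: mC_B]|].
  rewrite leeD2l// lee_wpmul2l//; apply: E2_le => //.
  + by apply: mC_M; [exact: mC_cst|exact: mC_B].
  + exact: mC_B.
  + by move=> th; rewrite sqnM.
- exact: cvg_cst.
- apply: cvge0_comb => //; rewrite -[X in _ --> X](mule0 (sqn k)%:E); exact: cvgeZl.
Qed.

End L2_transform.

Lemma cvge0_squeeze (R : realType) (f g : nat -> \bar R) : (forall k, 0 <= f k)%E ->
  (forall k, f k <= g k)%E -> g k @[k --> \oo] --> 0%E -> f k @[k --> \oo] --> 0%E.
Proof.
move=> f0 fg g0; apply: (squeeze_cvge _ (@cvg_cst _ 0%E _ _ _) g0).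
by apply: nearW => k; rewrite f0 fg.
Qed.

(** * Vector-valued functions and the transforms of the statement *)

Section vectors.
Context {R : realType} {N : nat}.
Local Notation C := R[i].
Implicit Types v : 'cV[C]_N.

Definition vsq v : R := \sum_i sqn (v i 0).

Lemma vsq_ge0 v : 0 <= vsq v.
Proof. by apply: sumr_ge0 => i _; exact: sqn_ge0. Qed.

Lemma vsq0 : vsq 0 = 0.
Proof. by rewrite /vsq big1// => i _; rewrite mxE sqn0. Qed.

Lemma vsq_eq0 v : vsq v = 0 -> v = 0.
Proof.
move=> h; apply/colP => i; rewrite mxE.
have : sqn (v i 0) <= 0 by rewrite -h /vsq (bigD1 i)//= lerDl sumr_ge0// => j _; exact: sqn_ge0.
rewrite /sqn; set a := complex.Re _; set b := complex.Im _ => ab.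
have a0 : a ^+ 2 = 0 by apply/eqP; rewrite eq_le sqr_ge0 andbT (le_trans _ ab)// lerDl sqr_ge0.
have b0 : b ^+ 2 = 0 by apply/eqP; rewrite eq_le sqr_ge0 andbT (le_trans _ ab)// lerDr sqr_ge0.
by apply: eq_ReIm => /=; apply/eqP; rewrite -sqrf_eq0 -/a -/b ?a0 ?b0.
Qed.

Lemma vsqN v : vsq (- v) = vsq v.
Proof. by apply: eq_bigr => i _; rewrite mxE sqnN. Qed.

Lemma vsqZ (k : C) v : vsq (k *: v) = sqn k * vsq v.
Proof. by rewrite /vsq mulr_sumr; apply: eq_bigr => i _; rewrite mxE sqnM. Qed.

Lemma vsqD_le2 v w : vsq (v + w) <= 2 * vsq v + 2 * vsq w.
Proof. by rewrite /vsq !mulr_sumr -big_split/=; apply: ler_sum => i _; rewrite mxE; exact: sqnD_le2. Qed.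

Lemma cvnorm_sqr v : cvnorm v ^+ 2 = vsq v.
Proof. by rewrite sqr_sqrtr// -/(vsq v) vsq_ge0. Qed.

Definition restrict0 {X : Type} (D : set X) (u : X -> 'cV[C]_N) z := if z \in D then u z else 0.

Section measure.
Context d (T : measurableType d) (mu : {measure set T -> \bar R}).
Implicit Types u : T -> 'cV[C]_N.

Definition mV u := forall i, mC (fun z => u z i 0).
Definition VL u : \bar R := (\int[mu]_z (vsq (u z))%:E)%E.

Lemma VL_ge0 u : (0 <= VL u)%E.
Proof. by apply: integral_ge0 => z _; rewrite lee_fin vsq_ge0. Qed.

Lemma measurable_vsq u : mV u -> measurable_fun setT (fun z => vsq (u z)).
Proof. by move=> mu'; apply: measurable_sum => i; exact: measurable_sqn. Qed.

Lemma VL_sum u : mV u -> (VL u = \sum_i E2 mu (fun z => u z i 0%R))%E.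
Proof.
move=> mu'; rewrite /VL; under eq_integral do rewrite -sumEFin.
rewrite ge0_integral_sum// => [i|i z _]; [exact: measurable_sqnE|by rewrite lee_fin sqn_ge0].
Qed.

Lemma VL_lty u : mV u -> (VL u < +oo)%E -> forall i, (E2 mu (fun z => u z i 0%R) < +oo)%E.
Proof.
move=> mu'; rewrite VL_sum// => h i; apply: le_lt_trans h.
by rewrite (bigD1 i)//= leeDl// sume_ge0// => j _; exact: E2_ge0.
Qed.

Lemma lty_VL u : mV u -> (forall i, (E2 mu (fun z => u z i 0%R) < +oo)%E) -> (VL u < +oo)%E.
Proof. by move=> mu' h; rewrite VL_sum//; apply/lte_sum_pinfty => i _. Qed.

(** Passage from the norm of the statement, a square root, to the integral of squares on which all
    estimates are made. *)
Lemma L2norm_VL D u : L2norm mu D u = (VL (restrict0 D u) `^ 2^-1)%E.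
Proof.
rewrite /L2norm unlock /VL; congr poweR; apply: eq_integral => z _.
rewrite /= -[2]/(2%:R) powR_mulrn// real_normK ?num_real// exprMn cvnorm_sqr.
rewrite indicE /restrict0; case: ifP => _; rewrite ?expr1n ?mul1r//.
by rewrite vsq0 expr0n mul0r.
Qed.

Lemma L2norm_ge0 D u : (0 <= L2norm mu D u)%E.
Proof. by rewrite L2norm_VL poweR_ge0. Qed.

Lemma L2norm_le D u (e : R) : 0 <= e ->
  (L2norm mu D u <= e%:E)%E = (VL (restrict0 D u) <= (e ^+ 2)%:E)%E.
Proof.
move=> e0; rewrite L2norm_VL; have := VL_ge0 (restrict0 D u); case: (VL _) => [r||]//.
  rewrite lee_fin => r0; rewrite poweR_EFin !lee_fin powR12_sqrt//.
  by rewrite -[in RHS](sqr_sqrtr r0) ler_sqr ?nnegrE ?sqrtr_ge0.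
by move=> _; rewrite poweRyr ?invr_eq0.
Qed.

Lemma L2norm_cvg0 D (u : nat -> T -> 'cV[C]_N) :
  (VL (restrict0 D (u k)) @[k --> \oo] --> 0)%E <-> L2norm mu D (u k) @[k --> \oo] --> 0%E.
Proof.
split => h; apply: cvge0P => [n|e e0]; rewrite ?VL_ge0 ?L2norm_ge0//.
  have := cvge0_le h (fun k => VL_ge0 _) (exprn_gt0 2 e0); apply: filterS => k.
  by rewrite L2norm_le// ltW.
have := cvge0_le h (fun k => L2norm_ge0 _ _) (e := Num.sqrt e); rewrite sqrtr_gt0 => /(_ e0).
by apply: filterS => k; rewrite L2norm_le ?sqrtr_ge0// sqr_sqrtr// ltW.
Qed.

Lemma mem_L2P D u : measurable D -> mem_L2 mu D u ->
  mV (restrict0 D u) /\ (VL (restrict0 D u) < +oo)%E.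
Proof.
move=> mD [mu' h]; split.
  move=> i; have [m1 m2] := mu' i; split.
    have -> : (fun z => complex.Re (restrict0 D u z i 0)) = (fun z => complex.Re (u z i 0)) \_ D.
      by apply/funext => z; rewrite /restrict0 patchE; case: ifP => //; rewrite mxE.
    exact/(measurable_restrictT _ mD).
  have -> : (fun z => complex.Im (restrict0 D u z i 0)) = (fun z => complex.Im (u z i 0)) \_ D.
    by apply/funext => z; rewrite /restrict0 patchE; case: ifP => //; rewrite mxE.
  exact/(measurable_restrictT _ mD).
move: h; rewrite L2norm_VL; case: (VL _) (VL_ge0 (restrict0 D u)) => [r||]//.
  by move=> _ _; exact: ltry.
by move=> _; rewrite poweRyr ?invr_eq0.
Qed.

Lemma restrict0T X (u : X -> 'cV[C]_N) : restrict0 setT u = u.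
Proof. by apply/funext => z; rewrite /restrict0 in_setT. Qed.

Lemma mem_L2T u : mem_L2 mu setT u -> mV u /\ (VL u < +oo)%E.
Proof. by move=> /(mem_L2P measurableT); rewrite restrict0T. Qed.

End measure.
End vectors.

Section instances.
Context {R : realType}.
Local Notation C := R[i].
Local Notation RR := (measurableTypeR R).
Local Notation leb := (@lebesgue_measure R).
Local Notation mm := (@lebesgue_rV R).
Local Notation bx m := (@box R m).

Lemma norm_rV_le m (s : 'rV[R]_m) (k : R) : 0 <= k -> (`|s| <= k) <-> forall i, `|s 0 i| <= k.
Proof.
move=> k0; split => [h i|h].
  by apply: le_trans h; rewrite /Num.norm /= mx_normrE; apply: (le_bigmax _ (fun ij : 'I_1 * 'I_m => `|s ij.1 ij.2|) (0, i)).
rewrite /Num.norm /= mx_normrE; apply/bigmax_leP; split => // -[i j] _ /=.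
by rewrite (ord1 i).
Qed.

Lemma measurable_norm_le m (k : nat) : measurable [set s : 'rV[R]_m | `|s| <= k%:R].
Proof.
have -> : [set s : 'rV[R]_m | `|s| <= k%:R] =
    \big[setI/setT]_(i < m) ((fun s : 'rV[R]_m => s ord0 i : RR) @^-1` [set t | `|t| <= k%:R]).
  apply/seteqP; split => s /=.
    move=> /(norm_rV_le _ (ler0n _ k)) h; rewrite -bigcap_seq => i _; exact: h.
  by rewrite -bigcap_seq => h; apply/(norm_rV_le _ (ler0n _ k)) => i; apply: (h i); rewrite /= mem_index_enum.
apply: bigsetI_measurable => i _; rewrite -[X in measurable X]setTI.
apply: measurable_coord => //.
have -> : [set t : RR | `|t| <= k%:R] = `[- k%:R, k%:R]%classic.
  by apply/seteqP; split => t /=; rewrite in_itv/= ler_norml.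
exact: measurable_itv.
Qed.

Definition trunc m (k : nat) (s : 'rV[R]_m) : R := if `|s| <= k%:R then 1 else 0.

Lemma measurable_trunc m k : measurable_fun setT (@trunc m k).
Proof.
have -> : @trunc m k = \1_[set s | `|s| <= k%:R].
  by apply/funext => s; rewrite indicE /trunc; case: ifPn => h; [rewrite mem_set|rewrite memNset//; exact/negP].
by apply: measurable_indic; exact: measurable_norm_le.
Qed.

Lemma trunc_norm m k (s : 'rV[R]_m) : `|trunc k s| <= 1.
Proof. by rewrite /trunc; case: ifP; rewrite ?normr1 ?normr0. Qed.

(** The radius is [k + 1] because [box] is open while the truncation keeps the closed ball of radius
    [k]. *)
Lemma trunc_supp m k (s : 'rV[R]_m) : ~ bx m (k%:R + 1) s -> trunc k s = 0.
Proof.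
move=> h; rewrite /trunc; case: ifPn => // /(norm_rV_le _ (ler0n _ k)) hs.
by exfalso; apply: h => i; apply: le_lt_trans (hs i) _; rewrite ltrDl.
Qed.

Lemma trunc_cvg m (s : 'rV[R]_m) : trunc k s @[k --> \oo] --> (1 : R).
Proof.
apply: cvg_near_cst; near=> k; rewrite /trunc; suff -> : `|s| <= k%:R by [].
by near: k; exact: nbhs_infty_ger.
Unshelve. all: by end_near. Qed.

Definition boxt m (K : R) : set ('rV[R]_m * RR) := [set z | bx m K z.1].
Definition trunct m k (z : 'rV[R]_m * RR) := trunc k z.1.

Lemma cutoff_rV m (kap : nat -> 'rV[R]_m -> R) : is_cutoff (bx m) kap ->
  is_cutoff (@boxt m) (fun k z => kap k z.1).
Proof.
move=> [mk k1 ks kc]; split => //.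
- by move=> k; exact: (measurableT_comp (mk k) measurable_fst).
- by move=> k; have [K h] := ks k; exists K => z /h.
Qed.

Lemma trunc_cutoff m : is_cutoff (bx m) (@trunc m).
Proof.
split; [exact: measurable_trunc|exact: trunc_norm| |exact: trunc_cvg].
by move=> k; exists (k%:R + 1); exact: trunc_supp.
Qed.

Lemma trunct_cutoff m : is_cutoff (@boxt m) (@trunct m).
Proof. exact: cutoff_rV (@trunc_cutoff m). Qed.

Lemma box_mono m K K' : K <= K' -> bx m K `<=` bx m K'.
Proof. by move=> KK s h i; exact: lt_le_trans (h i) KK. Qed.

Lemma rC_chr m (f : 'rV[R]_m -> C) th K : mC f -> (E2 (mm m) f < +oo)%E ->
  (forall z, ~ bx m K z -> f z = 0) -> rC (mm m) (fun s => chr (th, s) * f s).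
Proof.
move=> mf foo fK.
have rf : rC (mm m) f := rC_finite_supp (@measurable_box R m K) (@box_lty R m K) mf foo fK.
apply: (@rC_mul_bounded _ _ _ _ _ _ 1) => //.
- by apply: (mC_slice1 th (@mC_chr R m)).
- by move=> x; rewrite sqn_chr expr1n.
Qed.

Lemma ftm_lin m (w1 w2 : 'rV[R]_m -> C) K (k : C) : mC w1 -> mC w2 ->
  (E2 (mm m) w1 < +oo)%E -> (E2 (mm m) w2 < +oo)%E ->
  (forall z, ~ bx m K z -> w1 z = 0) -> (forall z, ~ bx m K z -> w2 z = 0) ->
  forall th, ftm (fun z => w1 z + k * w2 z) th = ftm w1 th + k * ftm w2 th.
Proof.
move=> m1 m2 o1 o2 k1 k2 th; rewrite /ftm.
have r1 := rC_chr th m1 o1 k1; have r2 := rC_chr th m2 o2 k2.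
rewrite -CintZ// -CintD//; last exact: rC_Z.
by apply: Cint_ext => s; rewrite mulrDr; congr (_ + _); rewrite mulrCA.
Qed.

Lemma ae_prod2 d1 d2 (T1 : measurableType d1) (T2 : measurableType d2)
  (m1 : {sigma_finite_measure set T1 -> \bar R}) (m2 : {sigma_finite_measure set T2 -> \bar R})
  (P : T2 -> Prop) : {ae m2, forall x, P x} -> {ae (m1 \x m2)%E, forall z, P z.2}.
Proof.
move=> [A [mA A0 PA]]; exists (setT `*` A); split.
- exact: measurableX.
- by rewrite product_measure1E// A0 mule0.
- by move=> z /= h; split => //; apply: PA.
Qed.

Lemma tft_lin m (w1 w2 : 'rV[R]_m * RR -> C) K (k : C) : mC w1 -> mC w2 ->
  (E2 (lebesgue_ty m) w1 < +oo)%E -> (E2 (lebesgue_ty m) w2 < +oo)%E ->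
  (forall z, ~ boxt K z -> w1 z = 0) -> (forall z, ~ boxt K z -> w2 z = 0) ->
  {ae lebesgue_ty m, forall th, tft (fun z => w1 z + k * w2 z) th = tft w1 th + k * tft w2 th}.
Proof.
move=> m1 m2 o1 o2 k1 k2.
have a1 := ae_prod2 (mm m) (ae_E2_slice2 (m1 := mm m) (m2 := leb) m1 o1).
have a2 := ae_prod2 (mm m) (ae_E2_slice2 (m1 := mm m) (m2 := leb) m2 o2).
apply: filterS2 a1 a2 => z s1 s2; rewrite /tft.
by apply: (@ftm_lin _ _ _ K) => // [||s h|s h]; [exact: mC_slice2|exact: mC_slice2|exact: k1|exact: k2].
Qed.

Definition FTt m (w W : 'rV[R]_m * RR -> C) :=
  FT (lebesgue_ty m) (lebesgue_ty m) (@tft R m) (@trunct m) w W.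
Definition FTm m (w W : 'rV[R]_m -> C) := FT (mm m) (mm m) (@ftm R m) (@trunc m) w W.

Lemma mC_ftm m (f : 'rV[R]_m -> C) : mC f -> mC (ftm f).
Proof. by move=> mf; rewrite ftmE; apply: mC_ktr => //; exact: mC_chr. Qed.

Lemma plancherel_t' m (w : 'rV[R]_m * RR -> C) (K : R) : mC w -> (E2 (lebesgue_ty m) w < +oo)%E ->
  (forall z, ~ boxt K z -> w z = 0) ->
  E2 (lebesgue_ty m) (tft w) = (((2 * pi) ^+ m)%:E * E2 (lebesgue_ty m) w)%E.
Proof. exact: plancherel_t. Qed.

Lemma twopi_gt0 m : 0 < (2 * pi) ^+ m :> R.
Proof. by rewrite exprn_gt0// mulr_gt0// pi_gt0. Qed.

Lemma boxt_mono m K K' : K <= K' -> @boxt m K `<=` @boxt m K'.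
Proof. by move=> h z; exact: box_mono. Qed.

Lemma FTt_cut m kap (w W : 'rV[R]_m * RR -> C) : is_cutoff (@boxt m) kap -> FTt w W ->
  E2 (lebesgue_ty m) (fun th => W th - tft (cutf kap k w) th) @[k --> \oo] --> 0%E.
Proof.
exact: (FT_cut (twopi_gt0 m) (@boxt_mono m) (@mC_tft R m) (@plancherel_t' m) (@tft_lin m) (@trunct_cutoff m)).
Qed.

Lemma FTt_iso m (w W : 'rV[R]_m * RR -> C) : FTt w W ->
  E2 (lebesgue_ty m) W = (((2 * pi) ^+ m)%:E * E2 (lebesgue_ty m) w)%E.
Proof.
exact: (FT_isometry (@mC_tft R m) (@plancherel_t' m) (@trunct_cutoff m)).
Qed.

Lemma FTt_exists m (w : 'rV[R]_m * RR -> C) : mC w -> (E2 (lebesgue_ty m) w < +oo)%E ->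
  exists W, FTt w W.
Proof.
exact: (FT_exists (twopi_gt0 m) (@boxt_mono m) (@mC_tft R m) (@plancherel_t' m) (@tft_lin m) (@trunct_cutoff m)).
Qed.

Lemma FTt_lin m (w W v V : 'rV[R]_m * RR -> C) (k : C) : FTt w W -> FTt v V ->
  FTt (fun z => w z + k * v z) (fun z => W z + k * V z).
Proof. exact: (FT_lin (@mC_tft R m) (@tft_lin m) (@trunct_cutoff m)). Qed.

Lemma FTm_cut m kap (w W : 'rV[R]_m -> C) : is_cutoff (bx m) kap -> FTm w W ->
  E2 (mm m) (fun th => W th - ftm (cutf kap k w) th) @[k --> \oo] --> 0%E.
Proof.
apply: (FT_cut (twopi_gt0 m) (@box_mono m) (@mC_ftm m) (@plancherel_m R m) _ (@trunc_cutoff m)).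
by move=> w1 w2 K k m1 m2 o1 o2 h1 h2; apply: aeW => th; exact: (ftm_lin (K := K)).
Qed.

(* The x variable is only a parameter of the tangential transform. *)
Lemma FTt_restrict m (D : set R) (w W : 'rV[R]_m * RR -> C) : measurable (D : set RR) -> FTt w W ->
  FTt (fun z => (\1_D z.2 : R)%:C * w z) (fun z => (\1_D z.2 : R)%:C * W z).
Proof.
move=> mD [mw mW woo Woo cv].
have mI : mC (fun z : 'rV[R]_m * RR => (\1_D z.2 : R)%:C).
  by apply: mC_R; apply: (measurableT_comp _ measurable_snd); exact: measurable_indic.
have sI (a : C) (x : R) : sqn ((\1_D x : R)%:C * a) <= sqn a.
  by rewrite sqnM sqnR indicE; case: (_ \in _); rewrite ?expr1n ?mul1r// expr0n mul0r sqn_ge0.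
have leI v : mC v -> (E2 (lebesgue_ty m) (fun z => (\1_D z.2 : R)%:C * v z)%R <= E2 (lebesgue_ty m) v)%E.
  move=> mv; rewrite -[leRHS]mul1e; apply: E2_le => //; first exact: mC_M.
  by move=> z; rewrite mul1r.
split; [exact: mC_M|exact: mC_M|exact: le_lt_trans (leI _ mw) woo|exact: le_lt_trans (leI _ mW) Woo|].
apply: (cvge0_squeeze _ _ cv) => k; first exact: E2_ge0.
have mk := mC_cutf k (@trunct_cutoff m) mw.
apply: le_trans (leI _ (mC_B mW (mC_tft mk))); rewrite le_eqVlt; apply/orP; left; apply/eqP.
apply: E2_ext => z; rewrite mulrBr; congr (_ - _).
rewrite /tft /ftm indicE; case E : (z.2 \in D).
  by rewrite mul1r; apply: Cint_ext => s; rewrite /cutf /= indicE E mul1r.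
rewrite mul0r -[RHS](@Cint0 _ _ _ (mm m)); apply: Cint_ext => s.
by rewrite /cutf /= indicE E mul0r !mulr0.
Qed.

End instances.

Section bridge.
Context {R : realType} {m N : nat}.
Local Notation C := R[i].
Local Notation RR := (measurableTypeR R).
Local Notation mm := (@lebesgue_rV R).

Lemma fourier_truncE (w : 'rV[R]_m -> 'cV[C]_N) k th i :
  fourier_trunc w k th i 0 = ftm (cutf (@trunc R m) k (fun s => w s i 0)) th.
Proof.
have mk := @measurable_norm_le R m k.
rewrite mxE; apply: eq_ReIm => /=; rewrite Rintegral_mkcond; apply: Rint_ext => s;
  rewrite patchE /cutf /trunc /chr /=; have <- : (s \in [set s | `|s| <= k%:R]) = (`|s| <= k%:R :> R);
  try (by apply/idP/idP; rewrite inE); case: ifP => _; rewrite ?mul1r ?mul0r ?mulr0// mxE//.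
Qed.

Lemma fourier_FT (w W : 'rV[R]_m -> 'cV[C]_N) : fourier w W ->
  forall i, FTm (fun s => w s i 0) (fun s => W s i 0).
Proof.
move=> [/mem_L2T[mw woo] /mem_L2T[mW Woo] cv] i; split; [exact: mw|exact: mW|exact: (VL_lty mw woo)|exact: (VL_lty mW Woo)|].
move/L2norm_cvg0 : cv => cv.
apply: (cvge0_squeeze _ _ cv) => k; first exact: E2_ge0.
rewrite restrict0T.
have E th j : (W th - fourier_trunc w k th) j 0 = W th j 0 - ftm (cutf (@trunc R m) k (fun s => w s j 0)) th.
  by rewrite -fourier_truncE !mxE.
have mD : mV (fun th => W th - fourier_trunc w k th).
  move=> j; under eq_fun do rewrite E; apply: mC_B; first exact: mW.
  by apply: mC_ftm; exact: mC_cutf (@trunc_cutoff R m) (mw j).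
rewrite (VL_sum _ mD) (bigD1 i)//= (E2_ext _ (E^~ i)).
by apply: leeDl; apply: sume_ge0 => j _; exact: E2_ge0.
Qed.

Lemma tfourier_FT (w W : 'rV[R]_m * R -> 'cV[C]_N) : tfourier w W ->
  forall i, FTt (fun s => w s i 0) (fun s => W s i 0).
Proof.
move=> [/mem_L2T[mw woo] /mem_L2T[mW Woo] cv] i; split; [exact: mw|exact: mW|exact: (VL_lty mw woo)|exact: (VL_lty mW Woo)|].
move/L2norm_cvg0 : cv => cv.
apply: (cvge0_squeeze _ _ cv) => k; first exact: E2_ge0.
rewrite restrict0T.
have E (z : 'rV[R]_m * RR) j : (W z - fourier_trunc (fun s => w (s, z.2)) k z.1) j 0 =
    W z j 0 - tft (cutf (@trunct R m) k (fun z => w z j 0)) z.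
  by rewrite /tft -[ftm _ _]/(ftm (cutf (@trunc R m) k (fun s => w (s, z.2) j 0)) z.1) -fourier_truncE !mxE.
have mD : mV (fun z : 'rV[R]_m * RR => W z - fourier_trunc (fun s => w (s, z.2)) k z.1).
  move=> j; under eq_fun do rewrite E; apply: mC_B; first exact: mW.
  by apply: mC_tft; exact: mC_cutf (@trunct_cutoff R m) (mw j).
rewrite (VL_sum _ mD) (bigD1 i)//= (E2_ext _ (E^~ i)).
by apply: leeDl; apply: sume_ge0 => j _; exact: E2_ge0.
Qed.

End bridge.

(** * Smooth test functions *)

Section smooth_functions.
Context {R : realType} {V : normedModType R}.
Implicit Types f g : V -> R.

Definition smooth f := forall k, Ck_on k setT f.

Lemma Ck_onW k f : Ck_on k.+1 setT f -> Ck_on k setT f.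
Proof.
elim: k f => [|k IH] f [cf df]; first by split.
by split => // v; have [d1 c1] := df v; split => //; exact: IH.
Qed.

Lemma Ck_cst k (c : R) : Ck_on k setT (fun _ : V => c).
Proof.
elim: k c => [|k IH] c; first by split => // z _; exact: cvg_cst.
split => [z _|v]; first exact: cvg_cst.
split; first by move=> z _; exact: derivable_cst.
have -> : (fun z => 'D_v (fun _ : V => c) z) = (fun _ => 0) by apply/funext => z; rewrite derive_cst.
exact: IH.
Qed.

Lemma Ck_D k f g : Ck_on k setT f -> Ck_on k setT g -> Ck_on k setT (fun z => f z + g z).
Proof.
elim: k f g => [|k IH] f g [cf df] [cg dg].
  by split => // z _; apply: continuousD; [exact: cf|exact: cg].
split => [z _|v]; first by apply: continuousD; [exact: cf|exact: cg].
have [f1 f2] := df v; have [g1 g2] := dg v; split.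
  by move=> z _; apply: derivableD; [exact: f1|exact: g1].
have -> : (fun z => 'D_v (fun z => f z + g z) z) = (fun z => 'D_v f z + 'D_v g z).
  by apply/funext => z; apply: deriveD; [exact: f1|exact: g1].
exact: IH.
Qed.

Lemma Ck_M k f g : Ck_on k setT f -> Ck_on k setT g -> Ck_on k setT (fun z => f z * g z).
Proof.
elim: k f g => [|k IH] f g /[dup] Cf [cf df] /[dup] Cg [cg dg].
  by split => // z _; apply: continuousM; [exact: cf|exact: cg].
split => [z _|v]; first by apply: continuousM; [exact: cf|exact: cg].
have [f1 f2] := df v; have [g1 g2] := dg v; split.
  by move=> z _; apply: derivableM; [exact: f1|exact: g1].
have -> : (fun z => 'D_v (fun z => f z * g z) z) = (fun z => f z * 'D_v g z + g z * 'D_v f z).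
  by apply/funext => z; apply: deriveM; [exact: f1|exact: g1].
by apply: Ck_D; apply: IH => //; exact: Ck_onW.
Qed.

Lemma smooth_cst (c : R) : smooth (fun _ => c). Proof. by move=> k; exact: Ck_cst. Qed.
Lemma smoothM f g : smooth f -> smooth g -> smooth (fun z => f z * g z).
Proof. by move=> sf sg k; exact: Ck_M. Qed.
Lemma smoothZ c f : smooth f -> smooth (fun z => c * f z).
Proof. by move=> sf; apply: smoothM => //; exact: smooth_cst. Qed.
Lemma smooth_prod (I : Type) (s : seq I) (F : I -> V -> R) : (forall i, smooth (F i)) ->
  smooth (fun z => \prod_(i <- s) F i z).
Proof.
move=> sF; elim: s => [|i s IH].
  by under eq_fun do rewrite big_nil; exact: smooth_cst.
by under eq_fun do rewrite big_cons; exact: smoothM.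
Qed.

Lemma smooth_continuous f : smooth f -> continuous f.
Proof. by move=> /(_ 0%N)[cf _] z; exact: cf. Qed.
Lemma smooth_derivable f v z : smooth f -> derivable f z v.
Proof. by move=> /(_ 1%N)[_ /(_ v)[h _]]; exact: h. Qed.
Lemma smooth_derive f v : smooth f -> smooth (fun z => 'D_v f z).
Proof. by move=> sf k; have [_ /(_ v)[]] := sf k.+1. Qed.

Variable l : V -> R.
Hypothesis l_lin : forall (t : R) v z, l (t *: v + z) = t * l v + l z.
Hypothesis l_cont : continuous l.

(** Linearity of [l] makes the two difference quotients identical, hence also their limits. *)
Lemma derive_comp_lin (h : R -> R) z v : 'D_v (fun z => h (l z)) z = 'D_(l v) h (l z).
Proof.
rewrite /derive; set a := (X in lim (X @ _)); set b := (X in _ = lim (X @ _)).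
by suff -> : a = b by []; apply/funext => t; rewrite /a /b /= l_lin.
Qed.

Lemma derivable_comp_lin (h : R -> R) z v : derivable h (l z) (l v) -> derivable (fun z => h (l z)) z v.
Proof.
rewrite /derivable; set a := (X in cvg (X @ _)); set b := (X in _ -> cvg (X @ _)).
by suff -> : a = b by []; apply/funext => t; rewrite /a /b /= l_lin.
Qed.

Lemma Ck_comp_lin k (h : R -> R) : Ck_on k setT h -> Ck_on k setT (fun z => h (l z)).
Proof.
elim: k h => [|k IH] h [ch dh].
  by split => // z _; apply: (@continuous_comp _ _ _ l h z); [exact: l_cont|exact: ch].
split => [z _|v]; first by apply: (@continuous_comp _ _ _ l h z); [exact: l_cont|exact: ch].
have [h1 h2] := dh (l v); split.
  by move=> z _; apply: derivable_comp_lin; exact: h1.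
have -> : (fun z => 'D_v (fun z => h (l z)) z) = (fun z => 'D_(l v) h (l z)).
  by apply/funext => z; exact: derive_comp_lin.
exact: (IH (fun y => 'D_(l v) h y)).
Qed.

Lemma smooth_comp_lin (h : R -> R) : (forall k, Ck_on k setT h) -> smooth (fun z => h (l z)).
Proof. by move=> sh k; exact: Ck_comp_lin. Qed.

End smooth_functions.

Section smooth_line.
Context {R : realType}.
Implicit Types h : R -> R.

Lemma derive_line h x v (dh : R) : is_derive x (1 : R) h dh -> derivable h x v /\ 'D_v h x = v * dh.
Proof.
move=> [dx <-]; have /derivable1_diffP df := dx; split; first exact: diff_derivable.
rewrite (deriveE v df) (deriveE (1 : R) df).
by rewrite -[in LHS](mulr1 v) -[v * 1]/(v *: (1 : R)) linearZ.
Qed.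

Lemma Ck_line k h h' : (forall x, is_derive x (1 : R) h (h' x)) -> Ck_on k setT h' -> Ck_on k.+1 setT h.
Proof.
move=> dh ch'; split.
  move=> z _; apply/differentiable_continuous/derivable1_diffP; exact: (@ex_derive _ _ _ _ _ _ _ (dh z)).
move=> v; split; first by move=> z _; have [] := derive_line v (dh z).
have -> : (fun z => 'D_v h z) = (fun z => v * h' z).
  by apply/funext => z; have [] := derive_line v (dh z).
by apply: Ck_M => //; exact: Ck_cst.
Qed.

Lemma smooth_expR : smooth (@expR R).
Proof.
elim => [|k IH]; first by split => // z _; exact: continuous_expR.
by apply: (Ck_line (h' := expR)).
Qed.

Lemma smooth_cos_sin k : Ck_on k setT (@cos R) /\ Ck_on k setT (@sin R).
Proof.
elim: k => [|k [IHc IHs]].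
  by split; split => // z _; [exact: continuous_cos|exact: continuous_sin].
split; last by apply: (Ck_line (h' := cos)).
apply: (Ck_line (h' := fun x => -1 * sin x)); last by apply: Ck_M => //; exact: Ck_cst.
by move=> x; rewrite mulN1r; exact: is_derive_cos.
Qed.

(* exp(-1/x) times a polynomial in 1/x, extended by 0; this class is stable under differentiation. *)
Definition flat (P : {poly R}) (x : R) : R := if 0 < x then P.[x^-1] * expR (- x^-1) else 0.

(** Term by term, [y^i e^{-y} <= i!] by the exponential series. *)
Lemma poly_expRN_bounded (P : {poly R}) : exists2 C : R, 0 <= C & forall y, 0 <= y -> `|P.[y] * expR (- y)| <= C.
Proof.
exists (\sum_(i < size P) `|P`_i| * (i`!)%:R); first by apply: sumr_ge0 => i _; rewrite mulr_ge0.
move=> y y0; rewrite horner_coef mulr_suml; apply: le_trans (ler_norm_sum _ _ _) _.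
apply: ler_sum => i _; rewrite -mulrA normrM ler_wpM2l//.
rewrite ger0_norm ?mulr_ge0 ?exprn_ge0 ?expR_ge0// expRN ler_pdivrMr ?expR_gt0//.
case: (nat_of_ord i) => [|j].
  by rewrite expr0 fact0 mul1r; have := expR_ge1Dx y; lra.
have := expR_ge1Dxn j y0; set q := y ^+ _; set f := (_`!)%:R => h.
have f0 : 0 < f by rewrite ltr0n fact_gt0.
rewrite -ler_pdivrMl// mulrC; apply: le_trans h; lra.
Qed.

Lemma is_derive0_sqr (f : R -> R) (C : R) : 0 <= C -> f 0 = 0 -> (forall t, `|f t| <= C * t ^+ 2) ->
  is_derive 0 (1 : R) f 0.
Proof.
move=> C0 f0 fC.
have c0 : h^-1 *: ((f \o shift 0) (h *: (1 : R)) - f 0) @[h --> 0^'] --> (0 : R).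
  apply/cvgrPdist_le => e e0; near=> t.
  have t0 : t != 0 by near: t; exact: nbhs_dnbhs_neq.
  have tl : `|t| <= e / (C + 1).
    by near: t; apply: dnbhs0_le; rewrite divr_gt0// ltr_wpDl.
  rewrite sub0r normrN /= f0 subr0 addr0 /GRing.scale /= mulr1 normrM normfV.
  rewrite ler_pdivrMl ?normr_gt0//; apply: le_trans (fC t) _.
  move: tl; rewrite ler_pdivlMr ?ltr_wpDl// -(real_normK (num_real t)).
  by have := normr_ge0 t; set q := `|t|; nra.
by apply: DeriveDef; [apply/cvg_ex; exists 0|apply: cvg_lim].
Unshelve. all: by end_near. Qed.

(** For [x > 0] both factors depend on [1/x], whose derivative [- x^-2] accounts for ['X^2]. *)
Lemma is_derive_flat P x : is_derive x (1 : R) (flat P) (flat ('X^2 * (P - P^`())) x).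
Proof.
have [x0|x0|->] := ltgtP x 0.
- apply: (@near_eq_is_derive _ _ _ (cst 0)).
    near=> t; rewrite /flat ifF//; apply/negP/negP; rewrite -leNgt ltW//.
    by near: t; exact: lt_nbhsl.
  by rewrite /flat ifF; [exact: is_derive_cst|exact: lt_gtF].
- have dV : is_derive x (1 : R) (fun t => t^-1) (- x ^- 2).
    by apply: is_derive_eq; [apply: is_deriveV; rewrite gt_eqF|rewrite /GRing.scale /= mulr1].
  have dP := is_derive1_comp (is_derive_poly P (x^-1)) dV.
  have dN : is_derive x (1 : R) (fun t => - t^-1) (- - x ^- 2) := is_deriveN dV.
  have dE := @is_derive1_comp _ expR (fun t => - t^-1) x _ _ (is_derive_expR _) dN.
  apply: (@near_eq_is_derive _ _ _ (fun t : R => P.[t^-1] * expR (- t^-1))).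
    by near=> t; rewrite /flat ifT//; near: t; exact: lt_nbhsr.
  apply: is_derive_eq (is_deriveM dP dE) _.
  rewrite /flat x0 !hornerE /GRing.scale /= exprVn opprK.
  by ring.
(* Bounding ['X^2 * P] rather than [P] gives [|flat P t| <= C t^2], hence a zero derivative at the
   origin. *)
- have [C C0 CP] := poly_expRN_bounded ('X^2 * P).
  have -> : flat ('X^2 * (P - P^`())) 0 = 0 by rewrite /flat ltxx.
  apply: (is_derive0_sqr C0); first by rewrite /flat ltxx.
  move=> t; rewrite /flat; case: ifPn => [t0|_]; last by rewrite normr0 mulr_ge0// sqr_ge0.
  have := CP _ (ltW _ : 0 <= t^-1); rewrite invr_gt0 => /(_ t0).
  rewrite hornerM hornerXn exprVn -mulrA normrM gtr0_norm ?invr_gt0 ?exprn_gt0//.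
  by rewrite ler_pdivrMl ?exprn_gt0// [X in _ <= X]mulrC.
Unshelve. all: by end_near. Qed.

Lemma smooth_flat P : smooth (flat P).
Proof.
move=> k; elim: k P => [|k IH] P; last exact: Ck_line (is_derive_flat P) (IH _).
by split => // z _; apply/differentiable_continuous/derivable1_diffP; exact: (@ex_derive _ _ _ _ _ _ _ (is_derive_flat P z)).
Qed.

(** On [(-1, 1)] this is [exp (2 - 1/(1+x) - 1/(1-x))]; the factor [expR 2] normalizes its maximum,
    reached at 0, to 1. *)
Definition bump (x : R) : R := expR 2 * (flat 1 (1 + x) * flat 1 (1 - x)).

Lemma smooth_affine (h : R -> R) (a b : R) : smooth h -> smooth (fun x => h (a + b * x)).
Proof.
move=> sh k; elim: k h sh => [|k IH] h sh.
  split => // z _; apply: continuous_comp; last exact: smooth_continuous.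
  by apply: cvgD; [exact: cvg_cst|apply: cvgMl_tmp; exact: cvg_id].
apply: (Ck_line (h' := fun x => b * 'D_1 h (a + b * x))).
  move=> x; have d1 : is_derive x (1 : R) (fun x => a + b * x) b.
    by apply: is_derive_eq (is_deriveD (is_derive_cst a x 1) (is_deriveZ b (is_derive_id x 1))) _; rewrite /GRing.scale /= mulr1 add0r.
  have d2 : is_derive (a + b * x) (1 : R) h ('D_1 h (a + b * x)) by apply: DeriveDef => //; exact: smooth_derivable.
  have := @is_derive1_comp _ h (fun x => a + b * x) x _ _ d2 d1; rewrite mulrC; exact.
apply: (@Ck_M _ _ k (fun=> b) (fun x => 'D_1 h (a + b * x))); first exact: Ck_cst.
by apply: (IH (fun y => 'D_1 h y)); exact: smooth_derive.
Qed.

Lemma smooth_bump : smooth bump.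
Proof.
apply: smoothZ; apply: smoothM.
  have := @smooth_affine (flat 1) 1 1 (@smooth_flat 1).
  by under eq_fun do rewrite mul1r.
have := @smooth_affine (flat 1) 1 (-1) (@smooth_flat 1).
by under eq_fun do rewrite mulN1r.
Qed.

Lemma bump0 : bump 0 = 1.
Proof.
rewrite /bump /flat addr0 subr0 ltr01 hornerC mul1r invr1 -!expRD -[RHS]expR0.
by congr expR; ring.
Qed.

Lemma bump_supp x : ~ (`|x| < 1) -> bump x = 0.
Proof.
move=> /negP; rewrite ltr_norml negb_and -!leNgt => /orP[h|h]; rewrite /bump /flat.
  by rewrite ifF ?mul0r ?mulr0//; apply/negP/negP; rewrite -leNgt; lra.
by rewrite (@ifF _ (0 < 1 - x)) ?mulr0//; apply/negP/negP; rewrite -leNgt; lra.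
Qed.

Lemma bump_ge0 x : 0 <= bump x.
Proof.
have f0 y : 0 <= flat 1 y by rewrite /flat; case: ifP => // _; rewrite hornerC mul1r expR_ge0.
by rewrite /bump !mulr_ge0 ?expR_ge0.
Qed.

Lemma bump_le1 x : bump x <= 1.
Proof.
have [h|h] := boolP (`|x| < 1); last by rewrite bump_supp//; exact/negP.
move: h; rewrite ltr_norml => /andP[x1 x2].
rewrite /bump /flat !ifT; [|lra|lra].
rewrite !hornerC !mul1r -!expRD -[leRHS]expR0 ler_expR.
(* The tangent line of [1/y] at 1; its values at [1 + x] and [1 - x] add up to 2. *)
have inv2 (y : R) : 0 < y -> 2 - y <= y^-1.
  move=> y0; rewrite -(ler_pM2r y0) mulVf ?gt_eqF//.
  by have := sqr_ge0 (y - 1); nra.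
have := inv2 (1 + x); have := inv2 (1 - x).
set p := (1 - x)^-1; set q := (1 + x)^-1 => h1 h2.
have := h1 ltac:(lra); have := h2 ltac:(lra); lra.
Qed.

Lemma norm_bump x : `|bump x| <= 1.
Proof. by rewrite ger0_norm ?bump_ge0 ?bump_le1. Qed.

Definition bumpk (k : nat) (x : R) : R := bump (k.+1%:R^-1 * x).

Lemma smooth_cut k : smooth (bumpk k).
Proof. by have := smooth_affine 0 k.+1%:R^-1 smooth_bump; under eq_fun do rewrite add0r. Qed.

Lemma norm_cut k x : `|bumpk k x| <= 1. Proof. exact: norm_bump. Qed.

Lemma cut_supp k x : ~ (`|x| < k.+1%:R) -> bumpk k x = 0.
Proof.
move=> h; apply: bump_supp; rewrite normrM gtr0_norm ?invr_gt0//.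
by rewrite mulrC ltr_pdivrMr// mul1r.
Qed.

Lemma cut_cvg1 x : bumpk k x @[k --> \oo] --> (1 : R).
Proof.
rewrite -bump0; apply: continuous_cvg; first exact: smooth_continuous smooth_bump _.
rewrite -[X in _ --> X](mul0r x); apply: cvgMr_tmp.
exact: cvg_harmonic.
Qed.

Definition dbump : R -> R := fun x => 'D_1 bump x.

Lemma is_derive_cut k x : is_derive x (1 : R) (bumpk k) (k.+1%:R^-1 * dbump (k.+1%:R^-1 * x)).
Proof.
have d1 : is_derive x (1 : R) (fun x => k.+1%:R^-1 * x) k.+1%:R^-1.
  by apply: is_derive_eq; rewrite /GRing.scale /= mulr1.
have d2 : is_derive (k.+1%:R^-1 * x) (1 : R) bump (dbump (k.+1%:R^-1 * x)).
  by apply: DeriveDef => //; exact: smooth_derivable smooth_bump.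
by apply: is_derive_eq (is_derive1_comp d2 d1) _; rewrite mulrC.
Qed.

Lemma derive_supp (f : R -> R) (M : R) : (forall x, ~ (`|x| <= M) -> f x = 0) ->
  forall x, ~ (`|x| <= M) -> 'D_1 f x = 0.
Proof.
move=> fM x /negP; rewrite -ltNge => h.
rewrite (@near_eq_derive _ _ _ f (cst 0)) ?derive_cst//.
have : nbhs x [set y | M < `|y|].
  have := @cvgr_gt _ _ (nbhs x) _ (fun y : R => `|y|) `|x|.
  by apply => //; exact: (@norm_continuous _ R x).
by apply: filterS => y /= y1; rewrite fM//; apply/negP; rewrite -ltNge.
Qed.

Lemma continuous_supp_bounded (f : R -> R) (M : R) : continuous f -> (forall x, ~ (`|x| <= M) -> f x = 0) ->
  exists2 B : R, 0 <= B & forall x, `|f x| <= B.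
Proof.
move=> cf fM; have [M0|M0] := ltP M 0.
  by exists 0 => // x; rewrite fM ?normr0//; apply/negP; rewrite -ltNge; exact: lt_le_trans M0 _.
have c : {within `[- M, M], continuous f} by exact: continuous_subspaceT.
have mM : - M <= M by lra.
have [a _ Ha] := EVT_max mM c.
have [b _ Hb] := EVT_min mM c.
exists (Num.max `|f a| `|f b|); first by rewrite le_max normr_ge0.
move=> x; have [h|/negP h] := boolP (`|x| <= M); last first.
  by rewrite fM// normr0 le_max normr_ge0.
have xI : x \in `[- M, M] by rewrite in_itv/= -ler_norml.
rewrite ler_norml; apply/andP; split.
  rewrite lerNl; apply: le_trans (_ : `|f b| <= _); last by rewrite le_max lexx orbT.
  by have := Hb _ xI; have := ler_norm (- f b); rewrite normrN; lra.
apply: le_trans (Ha _ xI) _; apply: le_trans (ler_norm _) _; by rewrite le_max lexx.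
Qed.

Lemma dbump_bounded : exists2 M : R, 0 <= M & forall x, `|dbump x| <= M.
Proof.
apply: (@continuous_supp_bounded _ 1); first by apply: smooth_continuous; apply: smooth_derive; exact: smooth_bump.
apply: derive_supp => x h; apply: bump_supp => h1; apply: h; exact: ltW.
Qed.

End smooth_line.

Section test_functions.
Context {R : realType} {n : nat}.
Local Notation C := R[i].
Local Notation m := n.+1.
Local Notation space := ('rV[R]_m * R)%type.
Implicit Types (z : space) (th : 'rV[R]_m).

Definition pr (i : 'I_m) z : R := z.1 0 i.
Definition phase th z : R := - \sum_i z.1 0 i * th 0 i.
Definition dir (l : 'I_m) : space := (delta_mx 0 l, 0).

Lemma pr_lin i (t : R) v z : pr i (t *: v + z) = t * pr i v + pr i z.
Proof. by rewrite /pr /= !mxE. Qed.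

Lemma phase_lin th (t : R) v z : phase th (t *: v + z) = t * phase th v + phase th z.
Proof.
rewrite /phase mulrN -opprD mulr_sumr -big_split/=; congr (- _); apply: eq_bigr => i _.
by rewrite !mxE; ring.
Qed.

Lemma snd_lin (t : R) (v z : space) : (t *: v + z).2 = t * v.2 + z.2. Proof. by []. Qed.

Lemma pr_cont i : continuous (pr i).
Proof.
move=> z; apply: (@continuous_comp _ _ _ (fst : space -> 'rV[R]_m) (fun s : 'rV[R]_m => s 0 i)).
  exact: cvg_fst.
exact: coord_continuous.
Qed.

Lemma phase_cont th : continuous (phase th).
Proof.
move=> z; apply: cvgN; elim: (index_enum _) => [|i s IH].
  by under eq_fun do rewrite big_nil; rewrite big_nil; exact: cvg_cst.
under eq_fun do rewrite big_cons; rewrite big_cons; apply: cvgD => //.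
by apply: cvgM; [exact: pr_cont|exact: cvg_cst].
Qed.

Lemma snd_cont : continuous (snd : space -> R). Proof. by move=> z; exact: cvg_snd. Qed.

Lemma pr_dir i l : pr i (dir l) = (i == l)%:R.
Proof. by rewrite /pr /= mxE eqxx. Qed.

Lemma phase_dir th l : phase th (dir l) = - th 0 l.
Proof.
rewrite /phase (bigD1 l)//= big1 ?addr0; first by rewrite mxE !eqxx mul1r.
by move=> i il; rewrite mxE eqxx (negbTE il) mul0r.
Qed.

Lemma derive_invariant (f : space -> R) z v : (forall t w, f (t *: v + w) = f w) -> 'D_v f z = 0.
Proof.
move=> fv; rewrite /derive (_ : (fun _ => _) = fun=> 0); first exact: lim_cst.
by apply/funext => t; rewrite /= fv subrr scaler0.
Qed.

Lemma deriveM_invariant (f h : space -> R) z v : smooth f -> smooth h ->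
  (forall t w, h (t *: v + w) = h w) -> 'D_v (fun z => f z * h z) z = 'D_v f z * h z.
Proof.
move=> sf sh hv; rewrite [LHS]deriveM; [|exact: smooth_derivable..].
by rewrite (derive_invariant z hv) scaler0 add0r /GRing.scale /= mulrC.
Qed.

(** Smooth product cut-off in the tangential variables; [dkcut k l] is its derivative along the
    [l]-th axis. *)
Definition kcut (k : nat) (s : 'rV[R]_m) : R := \prod_i bumpk k (s 0 i).
Definition dkcut (k : nat) l (s : 'rV[R]_m) : R :=
  k.+1%:R^-1 * dbump (k.+1%:R^-1 * s 0 l) * \prod_(i | i != l) bumpk k (s 0 i).

Variables (g : R) (k : nat) (th : 'rV[R]_m) (h chi : R -> R).
Hypotheses (sh : smooth h) (schi : smooth chi).

(** For [h] the cosine or the sine, this is the real or imaginary part of [e^{-g t} e^{-i s.th}]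
    times cut-offs. The split is imposed by test functions being real-valued. *)
Definition tfun z : R := (expR (- g * z.1 0 ord0) * h (phase th z)) * (kcut k z.1 * chi z.2).

Lemma smooth_pr (f : R -> R) i : smooth f -> smooth (fun z : space => f (z.1 0 i)).
Proof. by move=> sf; apply: (smooth_comp_lin (@pr_lin i) (@pr_cont i)). Qed.

Lemma smooth_eg : smooth (fun z : space => expR (- g * z.1 0 ord0)).
Proof.
apply: (@smooth_pr (fun t => expR (- g * t))).
by have := smooth_affine 0 (- g) (@smooth_expR R); under eq_fun do rewrite add0r.
Qed.

Lemma smooth_phase : smooth (fun z : space => h (phase th z)).
Proof. exact: (smooth_comp_lin (@phase_lin th) (@phase_cont th)). Qed.

Lemma smooth_snd (f : R -> R) : smooth f -> smooth (fun z : space => f z.2).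
Proof. by move=> sf; apply: (smooth_comp_lin (@snd_lin) (@snd_cont)). Qed.

Lemma smooth_tfun : smooth tfun.
Proof.
apply: smoothM; first by apply: smoothM; [exact: smooth_eg|exact: smooth_phase].
apply: smoothM; last exact: smooth_snd.
by apply: smooth_prod => i; apply: smooth_pr; exact: smooth_cut.
Qed.

Lemma kcut_supp j s : ~ box j.+1%:R s -> kcut j s = 0.
Proof.
move=> hs; have [i hi] : exists i, ~ (`|s 0 i| < j.+1%:R).
  by apply: contra_notP hs => H i; apply: contrapT => hi; apply: H; exists i.
by rewrite /kcut (bigD1 i)//= cut_supp// mul0r.
Qed.

Lemma test_tfun : (exists2 K, compact K & forall x, ~ K x -> chi x = 0) -> test_function tfun.
Proof.
move=> [K cK Kchi]; split; first exact: smooth_tfun.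
exists ([set s : 'rV[R]_m | forall i, `[- k.+1%:R, k.+1%:R]%classic (s ord0 i)] `*` K).
  apply: compact_setX => //.
  by apply: (@rV_compact R m (fun=> `[- k.+1%:R, k.+1%:R]%classic)) => i; exact: segment_compact.
move=> z /not_andP[hz|/Kchi hz]; last by rewrite /tfun hz !mulr0.
rewrite /tfun kcut_supp ?mul0r ?mulr0// => b; apply: hz => i /=.
by rewrite in_itv/= -ler_norml ltW.
Qed.

Lemma derive_tfun_x z : 'D_((0, 1) : space) tfun z =
  (expR (- g * z.1 0 ord0) * h (phase th z)) * (kcut k z.1 * 'D_1 chi z.2).
Proof.
have E : tfun = (fun z => chi z.2 * ((expR (- g * z.1 0 ord0) * h (phase th z)) * kcut k z.1)).
  by apply/funext => w; rewrite /tfun; ring.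
rewrite E deriveM_invariant; first last.
- move=> t w; have e : (t *: ((0, 1) : space) + w).1 = w.1 by rewrite /= scaler0 add0r.
  by rewrite /phase e.
- apply: smoothM; first by apply: smoothM; [exact: smooth_eg|exact: smooth_phase].
  by apply: smooth_prod => i; apply: smooth_pr; exact: smooth_cut.
- exact: smooth_snd.
by rewrite (derive_comp_lin (@snd_lin) chi z (0, 1)) /=; ring.
Qed.

Lemma derive_tfun_l l z : 'D_(dir l) tfun z = expR (- g * z.1 0 ord0) *
  ((- g * (l == ord0)%:R * h (phase th z) - th 0 l * 'D_1 h (phase th z)) * (kcut k z.1 * chi z.2)
   + h (phase th z) * (dkcut k l z.1 * chi z.2)).
Proof.
have dE y v : derivable (fun t : R => expR (- g * t)) y v /\
    'D_v (fun t : R => expR (- g * t)) y = v * (- g * expR (- g * y)).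
  have d1 : is_derive y (1 : R) (fun t => - g * t) (- g).
    by apply: is_derive_eq (is_deriveZ (- g) (is_derive_id y 1)) _; rewrite /GRing.scale /= mulr1.
  have d2 := @is_derive1_comp _ expR (fun t => - g * t) y _ _ (is_derive_expR _) d1.
  by have [? ->] := derive_line v d2; split => //; rewrite [X in v * X]mulrC.
have dh y v : 'D_v h y = v * 'D_1 h y.
  have d1 : is_derive y (1 : R) h ('D_1 h y) by apply: DeriveDef => //; exact: smooth_derivable.
  by have [] := derive_line v d1.
have dc (y v : R) : 'D_v (bumpk k) y = v * (k.+1%:R^-1 * dbump (k.+1%:R^-1 * y)).
  by have [] := derive_line v (@is_derive_cut R k y).
(* Only [a], [b] and [c] vary along the [l]-th axis; [r] collects the factors that do not. *)
pose a z := expR (- g * z.1 0 ord0). pose b z := h (phase th z). pose c z := bumpk k (z.1 0 l).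
pose r (z : space) := (\prod_(i | i != l) bumpk k (z.1 0 i)) * chi z.2.
have E : tfun = (fun z => (a z * b z * c z) * r z).
  by apply/funext => w; rewrite /tfun /kcut (bigD1 l)//= /a /b /c /r; ring.
have sa : smooth a := smooth_eg.
have sb : smooth b := smooth_phase.
have sc : smooth c by apply: smooth_pr; exact: smooth_cut.
have sr : smooth r.
  apply: smoothM; last exact: smooth_snd.
  under eq_fun do rewrite -big_filter.
  by apply: smooth_prod => i; apply: smooth_pr; exact: smooth_cut.
rewrite E deriveM_invariant//; first last.
- move=> t w; rewrite /r /= scaler0 add0r; congr (_ * _); apply: eq_bigr => i il.
  by rewrite !mxE eqxx (negbTE il) mulr0 add0r.
- by apply: smoothM => //; exact: smoothM.
rewrite [X in X * _]deriveM; [|by apply: smooth_derivable; exact: smoothM|exact: smooth_derivable].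
rewrite [X in _ + _ *: X]deriveM; [|exact: smooth_derivable..].
have -> : 'D_(dir l) a z = (l == ord0)%:R * (- g * a z).
  rewrite (derive_comp_lin (@pr_lin ord0) (fun t => expR (- g * t)) z (dir l)).
  by rewrite (dE _ _).2 pr_dir eq_sym.
have -> : 'D_(dir l) b z = - th 0 l * 'D_1 h (phase th z).
  by rewrite (derive_comp_lin (@phase_lin th) h z (dir l)) dh phase_dir.
have -> : 'D_(dir l) c z = k.+1%:R^-1 * dbump (k.+1%:R^-1 * z.1 0 l).
  by rewrite (derive_comp_lin (@pr_lin l) (bumpk k) z (dir l)) dc pr_dir eqxx mul1r.
rewrite /kcut (bigD1 l)//= /dkcut /GRing.scale /= /r -/(a z) /b /c.
by ring.
Qed.

End test_functions.

(** * Frequency-wise weak equations *)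

Section weights.
Context {R : realType} d (T : measurableType d) (mu : {measure set T -> \bar R}).
Local Notation C := R[i].
Implicit Types (q w : T -> C).

(** The weights against which every L2 function is integrable, see [bounded_supp_rC]. *)
Definition bounded_supp q := [/\ mC q, exists M : R, forall z, sqn (q z) <= M
  & exists B, [/\ measurable B, (mu B < +oo)%E & forall z, ~ B z -> q z = 0]].

Lemma bounded_supp_rC q w : bounded_supp q -> mC w -> (E2 mu w < +oo)%E -> rC mu (fun z => q z * w z).
Proof.
move=> [mq [M qM] [B [mB Boo qB]]] mw woo.
have M0 : 0 <= `|M| by [].
apply: (rC_finite_supp mB Boo) => [||z /qB ->]; last by rewrite mul0r.
- exact: mC_M.
- have : (E2 mu (fun z => q z * w z)%R <= (`|M|)%:E * E2 mu w)%E.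
    apply: E2_le => //; first exact: mC_M.
    move=> z; rewrite sqnM ler_wpM2r ?sqn_ge0//; apply: le_trans (qM z) _; exact: ler_norm.
  by move=> h; apply: le_lt_trans h _; rewrite lte_mul_pinfty// lee_fin.
Qed.

Lemma bounded_supp_Re q : bounded_supp q -> bounded_supp (fun z => (complex.Re (q z))%:C).
Proof.
move=> [mq [M qM] [B [mB Boo qB]]]; split; first by apply: mC_R; case: mq.
  by exists M => z; apply: le_trans (qM z); rewrite sqnR sqn_Re_le.
by exists B; split => // z /qB ->.
Qed.

Lemma bounded_supp_Im q : bounded_supp q -> bounded_supp (fun z => (complex.Im (q z))%:C).
Proof.
move=> [mq [M qM] [B [mB Boo qB]]]; split; first by apply: mC_R; case: mq.
  by exists M => z; apply: le_trans (qM z); rewrite sqnR sqn_Im_le.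
by exists B; split => // z /qB ->.
Qed.

Lemma bounded_supp_axpy (c : C) q q' : bounded_supp q -> bounded_supp q' ->
  bounded_supp (fun z => q' z + c * q z).
Proof.
move=> [mq [M qM] [B [mB Boo qB]]] [mq' [M' qM'] [B' [mB' Boo' qB']]]; split.
- exact: mC_axpy.
- exists (2 * M' + 2 * (sqn c * M)) => z; apply: le_trans (sqnD_le2 _ _) _.
  by rewrite sqnM lerD// ler_wpM2l// ler_wpM2l// sqn_ge0.
- exists (B `|` B'); split; first exact: measurableU.
    by apply: (@le_lt_trans _ _ (mu B + mu B')%E); [exact: measureU2|exact: lte_add_pinfty].
  by move=> z /not_orP[/qB -> /qB' ->]; rewrite mulr0 addr0.
Qed.

Lemma Cint_ae_eq w1 w2 : mC w1 -> mC w2 -> {ae mu, forall z, w1 z = w2 z} -> Cint mu w1 = Cint mu w2.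
Proof.
move=> [r1 i1] [r2 i2] h; apply: eq_ReIm => /=; rewrite /Rintegral; congr fine.
  by apply: ae_eq_integral => //; [exact/measurable_EFinP|exact/measurable_EFinP|apply: filterS h => z -> _].
by apply: ae_eq_integral => //; [exact/measurable_EFinP|exact/measurable_EFinP|apply: filterS h => z -> _].
Qed.

End weights.

Section vector_L2.
Context {R : realType} {N : nat} d (T : measurableType d) (mu : {measure set T -> \bar R}).
Local Notation C := R[i].
Implicit Types (u : T -> 'cV[C]_N) (q : T -> C).

Definition L2v u := forall i, mC (fun z => u z i 0) /\ (E2 mu (fun z => u z i 0%R) < +oo)%E.

Lemma L2v_sum (I : Type) (s : seq I) (w : I -> T -> C) :
  (forall i, mC (w i) /\ (E2 mu (w i) < +oo)%E) ->
  mC (fun z => \sum_(i <- s) w i z) /\ (E2 mu (fun z => \sum_(i <- s) w i z)%R < +oo)%E.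
Proof.
move=> h; elim: s => [|i s [IH1 IH2]].
  under eq_fun do rewrite big_nil; split; first exact: mC_cst.
  by rewrite /E2 integral0_eq// => z _; rewrite sqn0.
have [mi oi] := h i.
under eq_fun do rewrite big_cons; split; first exact: mC_D.
by apply: le_lt_trans (E2D_le2 mu mi IH1) _; rewrite lte_add_pinfty// lte_mul_pinfty.
Qed.

Lemma L2v_mul (M : 'M[C]_N) u : L2v u -> L2v (fun z => M *m u z).
Proof.
move=> hu i; under eq_fun do rewrite mxE; apply: (@L2v_sum _ _ (fun j z => M i j * u z j 0)) => j.
have [mj oj] := hu j; split; first by apply: mC_M => //; exact: mC_cst.
have : (E2 mu (fun z => M i j * u z j 0%R)%R <= (sqn (M i j))%:E * E2 mu (fun z => u z j 0%R))%E.
  by apply: E2_le => //; [apply: mC_M => //; exact: mC_cst|exact: sqn_ge0|move=> z; rewrite sqnM].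
by move=> h; apply: le_lt_trans h _; rewrite lte_mul_pinfty// lee_fin sqn_ge0.
Qed.

Definition wint q u : 'cV[C]_N := \col_j Cint mu (fun z => q z * u z j 0).

Lemma wint_mul q (M : 'M[C]_N) u i : bounded_supp mu q -> L2v u ->
  Cint mu (fun z => q z * (M *m u z) i 0) = (M *m wint q u) i 0.
Proof.
move=> bq hu; rewrite mxE.
have rj j : rC mu (fun z => q z * u z j 0) by have [mj oj] := hu j; exact: bounded_supp_rC.
rewrite (@Cint_ext _ _ _ mu _ (fun z => \sum_j M i j * (q z * u z j 0))).
  rewrite Cint_sum => [|j]; last exact: rC_Z.
  by apply: eq_bigr => j _; rewrite mxE CintZ.
by move=> z; rewrite mxE mulr_sumr; apply: eq_bigr => j _; rewrite mulrCA.
Qed.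

Lemma wint_axpy (c : C) q q' u : bounded_supp mu q -> bounded_supp mu q' -> L2v u ->
  wint (fun z => q' z + c * q z) u = wint q' u + c *: wint q u.
Proof.
move=> bq bq' hu; apply/colP => j; rewrite !mxE; have [mj oj] := hu j.
have r1 := bounded_supp_rC bq mj oj; have r2 := bounded_supp_rC bq' mj oj.
rewrite -CintZ// -CintD//; last exact: rC_Z.
by apply: Cint_ext => z; ring.
Qed.

End vector_L2.

Section fubini_weights.
Context {R : realType} {m : nat}.
Local Notation C := R[i].
Local Notation RR := (measurableTypeR R).
Local Notation leb := (@lebesgue_measure R).
Local Notation mm := (@lebesgue_rV R).

Lemma Cint_prod2 d1 d2 (T1 : measurableType d1) (T2 : measurableType d2)
  (m1 : {sigma_finite_measure set T1 -> \bar R}) (m2 : {sigma_finite_measure set T2 -> \bar R})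
  (f : T1 * T2 -> C) : rC (m1 \x m2)%E f ->
  Cint (m1 \x m2)%E f = Cint m2 (fun y => Cint m1 (fun x => f (x, y))).
Proof. by move=> [r i]; rewrite /Cint (Rint_prod2 r) (Rint_prod2 i). Qed.

Lemma bounded_supp_prod (a : 'rV[R]_m -> C) (chi : RR -> C) :
  bounded_supp (mm m) a -> bounded_supp leb chi ->
  bounded_supp (lebesgue_ty m) (fun z => a z.1 * chi z.2).
Proof.
move=> [mq [M qM] [B [mB Boo qB]]] [mq' [M' qM'] [B' [mB' Boo' qB']]]; split.
- by apply: mC_M; [exact: (mC_comp mq measurable_fst)|exact: (mC_comp mq' measurable_snd)].
- exists (M * M') => z; rewrite sqnM ler_pM ?sqn_ge0//.
- exists (B `*` B'); split; first exact: measurableX.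
    by rewrite [X in (X < _)%E]product_measure1E// lte_mul_pinfty// ge0_fin_numE.
  by move=> z /not_andP[/qB ->|/qB' ->]; rewrite ?mul0r ?mulr0.
Qed.

(* Integrating first in the tangential variables turns the weight into a transform. *)
Lemma Cint_chr (th : 'rV[R]_m) (a : 'rV[R]_m -> R) (chi : RR -> C) (w : 'rV[R]_m * RR -> C) :
  bounded_supp (mm m) (fun s => (a s)%:C) -> bounded_supp leb chi -> mC w -> (E2 (lebesgue_ty m) w < +oo)%E ->
  Cint (lebesgue_ty m) (fun z => (chr (th, z.1) * (a z.1)%:C * chi z.2) * w z) =
  Cint leb (fun x => chi x * tft (fun z => (a z.1)%:C * w z) (th, x)).
Proof.
move=> ba bc mw woo.
have bca : bounded_supp (mm m) (fun s => chr (th, s) * (a s)%:C).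
  have [ma [M aM] [B [mB Boo aB]]] := ba; split.
  - by apply: mC_M => //; exact: (mC_slice1 th (@mC_chr R m)).
  - by exists M => s; rewrite sqnM sqn_chr mul1r.
  - by exists B; split => // s /aB ->; rewrite mulr0.
have ma : mC (fun s => (a s)%:C) by case: ba.
have mchi : mC chi by case: bc.
have r1 := bounded_supp_rC (bounded_supp_prod bca bc) mw woo.
rewrite (Cint_prod2 (m1 := mm m) (m2 := leb) r1).
have mt : mC (tft (fun z : 'rV[R]_m * RR => (a z.1)%:C * w z)).
  by apply: mC_tft; apply: mC_M => //; exact: (mC_comp ma measurable_fst).
have mca : mC (fun z : 'rV[R]_m * RR => chr (th, z.1) * (a z.1)%:C * chi z.2 * w z).
  by apply: mC_M => //; case: (bounded_supp_prod bca bc).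
apply: Cint_ae_eq.
- pose f' := fun z : RR * 'rV[R]_m => chr (th, z.2) * (a z.2)%:C * chi z.1 * w (z.2, z.1).
  apply: (mC_Cint_param (mm m) (f := f')).
  by apply: (mC_comp mca (g := fun z => (z.2, z.1))); exact: measurable_swap.
- by apply: mC_M => //; exact: (mC_slice1 th mt).
apply: filterS (ae_E2_slice2 (m1 := mm m) (m2 := leb) mw woo) => x xoo.
rewrite /tft /ftm /= -CintZ; last first.
  have := bounded_supp_rC bca (mC_slice2 x mw) xoo.
  by under eq_fun do rewrite -mulrA.
by apply: Cint_ext => s; rewrite /chr /=; ring.
Qed.

End fubini_weights.

Section weight_examples.
Context {R : realType} {n : nat}.
Local Notation C := R[i].
Local Notation RR := (measurableTypeR R).
Local Notation leb := (@lebesgue_measure R).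
Local Notation mm := (@lebesgue_rV R).
Local Notation m := n.+1.

Definition line_test (chi : R -> R) := smooth chi /\ exists M, forall x, ~ (`|x| <= M) -> chi x = 0.

Lemma line_test_derive chi : line_test chi -> line_test (fun x => 'D_1 chi x).
Proof. by move=> [sc [M h]]; split; [exact: smooth_derive|exists M; exact: derive_supp]. Qed.

Lemma line_test_test chi : line_test chi -> exists2 K, compact K & forall x, ~ K x -> chi x = 0.
Proof.
move=> [_ [M h]]; exists `[- M, M]%classic; first exact: segment_compact.
by move=> x hx; apply: h => h; apply: hx; rewrite /= in_itv/= -ler_norml.
Qed.

Lemma measurable_continuous (f : R -> R) : continuous f -> measurable_fun setT (f : RR -> RR).
Proof. exact: continuous_measurable_fun. Qed.

Lemma segment_lty (a b : R) : (@lebesgue_measure R `[a, b]%classic < +oo)%E.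
Proof. by rewrite lebesgue_measure_itv/=; case: ifP => _; rewrite ?ltry// -EFinB ltry. Qed.

Lemma line_test_weight chi : line_test chi -> bounded_supp leb (fun x : RR => (chi x)%:C).
Proof.
move=> [sc [M h]]; have cc := smooth_continuous sc; split.
- by apply: mC_R; exact: measurable_continuous.
- have [B B0 hB] := continuous_supp_bounded cc h; exists (B ^+ 2) => x.
  by rewrite sqnR -(real_normK (num_real (chi x))) ler_sqr ?nnegrE.
- exists `[- M, M]%classic; split; first exact: measurable_itv.
    exact: segment_lty.
  by move=> x hx; rewrite h// => h'; apply: hx; rewrite /= in_itv/= -ler_norml.
Qed.

Lemma measurable_coordR (l : 'I_m) (f : R -> R) : continuous f -> measurable_fun setT (fun s : 'rV[R]_m => f (s 0 l)).
Proof. by move=> cf; apply: (measurableT_comp (measurable_continuous cf)); exact: measurable_coord. Qed.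

Lemma measurable_prod_coord k (P : pred 'I_m) :
  measurable_fun setT (fun s : 'rV[R]_m => \prod_(i | P i) bumpk k (s 0 i)).
Proof.
elim: (index_enum _) => [|i s IH]; first by under eq_fun do rewrite big_nil; exact: measurable_cst.
under eq_fun do rewrite big_cons; case: (P i) => //; apply: measurable_funM => //.
by apply: measurable_coordR; exact: smooth_continuous (@smooth_cut R k).
Qed.

Lemma norm_prod_bumpk k (P : pred 'I_m) (s : 'rV[R]_m) : `|\prod_(i | P i) bumpk k (s 0 i)| <= 1.
Proof.
by rewrite normr_prod; apply: prodr_ile1 => i _; rewrite normr_ge0 norm_cut.
Qed.

Lemma kcut_cutoff : is_cutoff (@box R m) (@kcut R n).
Proof.
split.
- by move=> k; exact: measurable_prod_coord.
- by move=> k z; exact: norm_prod_bumpk.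
- by move=> k; exists k.+1%:R; exact: kcut_supp.
- move=> z; rewrite /kcut; elim: (index_enum _) => [|i s IH].
    by under eq_fun do rewrite big_nil; exact: cvg_cst.
  have h := cvgM (cut_cvg1 (z 0 i)) IH; rewrite mulr1 in h.
  by under eq_fun do rewrite big_cons; apply: h.
Qed.

Lemma box_weight (a : 'rV[R]_m -> R) K M : measurable_fun setT a -> (forall s, `|a s| <= M) ->
  (forall s, ~ box K s -> a s = 0) -> bounded_supp (mm m) (fun s => (a s)%:C).
Proof.
move=> ma aM aK; split; first exact: mC_R.
- exists (M ^+ 2) => s; rewrite sqnR -(real_normK (num_real (a s))) ler_sqr ?nnegrE//.
  exact: le_trans (aM s).
- exists (box K); split; [exact: measurable_box|exact: box_lty|by move=> s /aK ->].
Qed.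

Lemma kcut_weight k : bounded_supp (mm m) (fun s : 'rV[R]_m => (kcut k s)%:C).
Proof.
have [mk k1 _ _] := kcut_cutoff.
exact: (box_weight (mk k) (k1 k) (@kcut_supp R n k)).
Qed.

(** The factor [1 / (k + 1)] of the dilation makes the derivatives of the cut-off disappear in the
    limit. *)
Lemma dkcut_bound : exists2 M : R, 0 <= M & forall k l (s : 'rV[R]_m), `|dkcut k l s| <= k.+1%:R^-1 * M.
Proof.
have [M M0 h] := @dbump_bounded R; exists M => // k l s.
rewrite /dkcut -mulrA normrM ger0_norm// ler_wpM2l//.
rewrite normrM -[leRHS]mulr1; apply: ler_pM => //; exact: norm_prod_bumpk.
Qed.

Lemma measurable_dkcut k l : measurable_fun setT (fun s : 'rV[R]_m => dkcut k l s).
Proof.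
apply: measurable_funM; last exact: measurable_prod_coord.
apply: (@measurable_coordR l (fun t => k.+1%:R^-1 * dbump (k.+1%:R^-1 * t))).
have -> : (fun t => k.+1%:R^-1 * dbump (k.+1%:R^-1 * t)) = (fun t : R => k.+1%:R^-1 * dbump (0 + k.+1%:R^-1 * t)).
  by apply/funext => t; rewrite add0r.
apply: smooth_continuous; apply: smoothZ; apply: smooth_affine.
by apply: smooth_derive; exact: smooth_bump.
Qed.

(** The derivative of [bump] is only shown to vanish off a closed interval, so the open cube is
    enlarged by 1. *)
Lemma dkcut_supp k l (s : 'rV[R]_m) : ~ box (k.+1%:R + 1) s -> dkcut k l s = 0.
Proof.
move=> hs; have [i hi] : exists i, ~ (`|s 0 i| < k.+1%:R + 1).
  by apply: contra_notP hs => H i; apply: contrapT => hi; apply: H; exists i.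
have hi' : k.+1%:R + 1 <= `|s 0 i| by rewrite leNgt; exact/negP.
rewrite /dkcut; have [il|il] := eqVneq i l.
  rewrite /dbump (derive_supp (M := 1)) ?mulr0 ?mul0r//.
    by move=> x h; apply: bump_supp => h1; apply: h; exact: ltW.
  rewrite -il => h; have : `|s 0 i| <= k.+1%:R.
    by move: h; rewrite normrM gtr0_norm ?invr_gt0// ler_pdivrMl// mulr1.
  by move: hi'; lra.
rewrite (bigD1 i)//= cut_supp ?mul0r ?mulr0// => h; apply: hi.
by apply: lt_trans h _; rewrite ltrDl.
Qed.

Lemma dkcut_weight k l : bounded_supp (mm m) (fun s : 'rV[R]_m => (dkcut k l s)%:C).
Proof.
have [M M0 h] := dkcut_bound.
exact: (box_weight (@measurable_dkcut k l) (h k l) (@dkcut_supp k l)).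
Qed.

End weight_examples.

Section weak_identity.
Context {R : realType} {n N : nat}.
Local Notation C := R[i].
Local Notation RR := (measurableTypeR R).
Local Notation leb := (@lebesgue_measure R).
Local Notation mm := (@lebesgue_rV R).
Local Notation m := n.+1.
Local Notation space := ('rV[R]_m * R)%type.
Local Notation dd := (lebesgue_ty m).
Variables (A : 'I_n -> 'M[R]_N) (Ad : 'M[R]_N).

(* A_0 = Id is the coefficient of the time derivative. *)
Definition coef (l : 'I_m) : 'M[C]_N := oapp (fun j => Cmx (A j)) 1%:M (unlift ord0 l).

Lemma transportE phi u (z : space) : transport A Ad phi u z =
  \sum_l ('D_(dir l) phi z)%:C *: (coef l *m u z) + ('D_((0, 1) : space) phi z)%:C *: (Cmx Ad *m u z).
Proof.
rewrite /transport [in RHS]big_ord_recl; congr (_ + _ + _).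
  by rewrite /coef unlift_none /= mul1mx.
by apply: eq_bigr => j _; rewrite /coef liftK.
Qed.

Lemma AsymE g (th : 'rV[R]_m) : Asym A Ad (g, th) =
  - (invmx (Cmx Ad) *m (g%:C%:M + \sum_l (0 +i* th 0 l) *: coef l)).
Proof.
rewrite /Asym mulNmx; congr (- (_ *m _)); rewrite big_ord_recl /coef unlift_none /= addrA; congr (_ + _).
  by rewrite scalemx1 -raddfD/=; congr (_%:M); apply: eq_ReIm => /=; rewrite ?addr0 ?add0r.
by apply: eq_bigr => j _; rewrite liftK.
Qed.

(** One weak form for both problems, written for [e^{-g t}] times the solution and the source. [U0]
    is the trace for the boundary value problem, whose solution is extended by 0, and 0 for the
    penalized one. The integrability clause on [phi] allows the sources to be split under the
    integral. *)
Definition weak_transport g (U G : space -> 'cV[C]_N) (U0 : 'rV[R]_m -> 'cV[C]_N) :=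
  forall phi, test_function phi -> bounded_supp dd (fun z => (phi z * expR (g * z.1 0 ord0))%:C) ->
  - cvint dd setT (transport A Ad phi (weight g U)) =
  cvint dd setT (fun z => (phi z)%:C *: weight g G z) +
  cvint (mm m) setT (fun s => (phi (s, 0))%:C *: (Cmx Ad *m bweight g U0 s)).

Variables (g : R) (k : nat) (th : 'rV[R]_m) (chi : R -> R).
Hypothesis lchi : line_test chi.

(** Complex weights left once the [e^{g t}] of [weight g] cancels the [e^{-g t}] of the test
    function: [q0] comes from the function itself, [qx] and [ql l] from its derivatives. In [ql l]
    the part [qb l] differentiates the cut-off, and the factor of [q0], with [-g] in time and
    [-i th_l], differentiates the exponentials. *)
Definition q0 (z : space) : C := chr (th, z.1) * (kcut k z.1)%:C * (chi z.2)%:C.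
Definition qb l (z : space) : C := chr (th, z.1) * (dkcut k l z.1)%:C * (chi z.2)%:C.
Definition qx (z : space) : C := chr (th, z.1) * (kcut k z.1)%:C * ('D_1 chi z.2)%:C.
Definition ql l (z : space) : C := qb l z + (- g * (l == ord0)%:R +i* - th 0 l) * q0 z.

Lemma chr_weight (a : 'rV[R]_m -> R) : bounded_supp (mm m) (fun s => (a s)%:C) ->
  bounded_supp (mm m) (fun s => chr (th, s) * (a s)%:C).
Proof.
move=> [ma [M aM] [B [mB Boo aB]]]; split.
- by apply: mC_M => //; exact: (mC_slice1 th (@mC_chr R m)).
- by exists M => s; rewrite sqnM sqn_chr mul1r.
- by exists B; split => // s /aB ->; rewrite mulr0.
Qed.

Lemma q0_weight : bounded_supp dd q0.
Proof. exact: (bounded_supp_prod (chr_weight (@kcut_weight R n k)) (line_test_weight lchi)). Qed.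
Lemma qb_weight l : bounded_supp dd (qb l).
Proof. exact: (bounded_supp_prod (chr_weight (@dkcut_weight R n k l)) (line_test_weight lchi)). Qed.
Lemma qx_weight : bounded_supp dd qx.
Proof.
exact: (bounded_supp_prod (chr_weight (@kcut_weight R n k)) (line_test_weight (line_test_derive lchi))).
Qed.
Lemma ql_weight l : bounded_supp dd (ql l).
Proof. by apply: bounded_supp_axpy; [exact: q0_weight|exact: qb_weight]. Qed.

Lemma chrE (z : space) : chr (th, z.1) = cos (phase th z) +i* sin (phase th z).
Proof. by []. Qed.

Local Notation tc := (tfun g k th cos chi).
Local Notation ts := (tfun g k th sin chi).
Local Notation eg := (fun z : space => expR (g * z.1 0 ord0)).

Lemma eg_inv (z : space) : expR (g * z.1 0 ord0) * expR (- g * z.1 0 ord0) = 1.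
Proof. by rewrite mulNr expRxMexpNx_1. Qed.

Lemma smooth_cos' : smooth (@cos R). Proof. by move=> j; have [] := @smooth_cos_sin R j. Qed.
Lemma smooth_sin' : smooth (@sin R). Proof. by move=> j; have [] := @smooth_cos_sin R j. Qed.

Lemma D1cos (y : R) : 'D_1 cos y = - sin y. Proof. by rewrite derive_val. Qed.
Lemma D1sin (y : R) : 'D_1 sin y = cos y. Proof. by rewrite derive_val. Qed.

Lemma q0_Re z : complex.Re (q0 z) = tc z * eg z.
Proof.
rewrite /q0 chrE /tfun cReM cReM cImM /=; have := eg_inv z.
set a := expR _; set b := expR _ => ab.
by transitivity ((a * b) * (cos (phase th z) * kcut k z.1 * chi z.2)); [rewrite ab|]; ring.
Qed.
Lemma q0_Im z : complex.Im (q0 z) = ts z * eg z.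
Proof.
rewrite /q0 chrE /tfun cImM cReM cImM /=; have := eg_inv z.
set a := expR _; set b := expR _ => ab.
by transitivity ((a * b) * (sin (phase th z) * kcut k z.1 * chi z.2)); [rewrite ab|]; ring.
Qed.
Lemma qx_Re z : complex.Re (qx z) = 'D_((0, 1) : space) tc z * eg z.
Proof.
rewrite (derive_tfun_x _ _ _ smooth_cos' lchi.1) /qx chrE cReM cReM cImM /=; have := eg_inv z.
set a := expR _; set b := expR _ => ab.
by transitivity ((a * b) * (cos (phase th z) * kcut k z.1 * 'D_1 chi z.2)); [rewrite ab|]; ring.
Qed.
Lemma qx_Im z : complex.Im (qx z) = 'D_((0, 1) : space) ts z * eg z.
Proof.
rewrite (derive_tfun_x _ _ _ smooth_sin' lchi.1) /qx chrE cImM cReM cImM /=; have := eg_inv z.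
set a := expR _; set b := expR _ => ab.
by transitivity ((a * b) * (sin (phase th z) * kcut k z.1 * 'D_1 chi z.2)); [rewrite ab|]; ring.
Qed.
Lemma ql_Re l z : complex.Re (ql l z) = 'D_(dir l) tc z * eg z.
Proof.
rewrite (derive_tfun_l _ _ _ smooth_cos' lchi.1) D1cos /ql /qb /q0 chrE.
rewrite !(cReD, cReM, cImM) /=; have := eg_inv z.
set a := expR _; set b := expR _ => ab.
rewrite [RHS]mulrC [RHS]mulrA ab; ring.
Qed.
Lemma ql_Im l z : complex.Im (ql l z) = 'D_(dir l) ts z * eg z.
Proof.
rewrite (derive_tfun_l _ _ _ smooth_sin' lchi.1) D1sin /ql /qb /q0 chrE.
rewrite !(cImD, cReM, cImM) /=; have := eg_inv z.
set a := expR _; set b := expR _ => ab.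
rewrite [RHS]mulrC [RHS]mulrA ab; ring.
Qed.

Lemma CintE d (T : measurableType d) (mu : {measure set T -> \bar R}) (f : T -> 'cV[C]_N) i :
  cvint mu setT f i 0 = Cint mu (fun z => f z i 0).
Proof. by rewrite mxE. Qed.

Lemma Cint_ReIm d (T : measurableType d) (mu : {measure set T -> \bar R}) (q w : T -> C) :
  bounded_supp mu q -> mC w -> (E2 mu w < +oo)%E ->
  Cint mu (fun z => (complex.Re (q z))%:C * w z) + (0 +i* 1) * Cint mu (fun z => (complex.Im (q z))%:C * w z) =
  Cint mu (fun z => q z * w z).
Proof.
move=> bq mw woo.
have r1 := bounded_supp_rC (bounded_supp_Re bq) mw woo.
have r2 := bounded_supp_rC (bounded_supp_Im bq) mw woo.
rewrite -CintZ// -CintD//; last exact: rC_Z.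
by apply: Cint_ext => z; apply: eq_ReIm; rewrite ?(cReD, cImD, cReM, cImM) /=; ring.
Qed.

Lemma Cint_sum_add d (T : measurableType d) (mu : {measure set T -> \bar R}) (f : 'I_m -> T -> C) (h : T -> C) :
  (forall l, rC mu (f l)) -> rC mu h ->
  Cint mu (fun z => \sum_l f l z + h z) = \sum_l Cint mu (f l) + Cint mu h.
Proof. by move=> rf rh; rewrite CintD//; [rewrite Cint_sum|exact: rC_sum]. Qed.

(** The weak form tested with the cosine and with the sine, recombined as real part plus [i] times
    imaginary part. *)
Lemma weak_identity U G U0 : L2v dd U -> L2v dd G -> L2v (mm m) U0 -> weak_transport g U G U0 ->
  - (\sum_l coef l *m wint dd (ql l) U + Cmx Ad *m wint dd qx U) =
  wint dd q0 G + (chi 0)%:C *: (Cmx Ad *m wint (mm m) (fun s => chr (th, s) * (kcut k s)%:C) U0).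
Proof.
move=> hU hG hU0 hw; apply/colP => i.
have hAU l : L2v dd (fun z => coef l *m U z) := L2v_mul (coef l) hU.
have hAx : L2v dd (fun z => Cmx Ad *m U z) := L2v_mul (Cmx Ad) hU.
have hA0 : L2v (mm m) (fun s => Cmx Ad *m U0 s) := L2v_mul (Cmx Ad) hU0.
have q00 : bounded_supp (mm m) (fun s => q0 (s, 0)).
  have [mq [M qM] [B [mB Boo qB]]] := chr_weight (@kcut_weight R n k).
  have mc : mC (fun _ : 'rV[R]_m => (chi 0)%:C) by exact: mC_cst.
  split; first exact: (mC_M mq mc).
    by exists (M * sqn (chi 0)%:C) => s; rewrite sqnM ler_wpM2r ?sqn_ge0.
  by exists B; split => // s /qB h; rewrite /q0 h mul0r.
(* The computation common to both real test functions: [r0], [rx], [rl] are the function and its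
   derivatives with the factor [e^{g t}] absorbed. *)
have key (phi r0 rx : space -> R) (rl : 'I_m -> space -> R) : test_function phi ->
    bounded_supp dd (fun z => (r0 z)%:C) ->
    (forall z, r0 z = phi z * eg z) -> (forall z, rx z = 'D_((0, 1) : space) phi z * eg z) ->
    (forall l z, rl l z = 'D_(dir l) phi z * eg z) ->
    bounded_supp dd (fun z => (rx z)%:C) -> (forall l, bounded_supp dd (fun z => (rl l z)%:C)) ->
    - (\sum_l Cint dd (fun z => (rl l z)%:C * (coef l *m U z) i 0) + Cint dd (fun z => (rx z)%:C * (Cmx Ad *m U z) i 0)) =
    Cint dd (fun z => (r0 z)%:C * G z i 0) + Cint (mm m) (fun s => (r0 (s, 0))%:C * (Cmx Ad *m U0 s) i 0).
  move=> tphi b0 e0 ex el bx bl; rewrite (_ : (fun z => _) = (fun z => (phi z * eg z)%:C)) in b0; last first.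
    by apply/funext => z; rewrite e0.
  have := congr1 (fun v : 'cV[C]_N => v i 0) (hw _ tphi b0).
  rewrite [LHS]mxE [RHS]mxE !CintE => H.
  rewrite -Cint_sum_add; first last.
  - by have [? ?] := hAx i; exact: bounded_supp_rC.
  - by move=> l; have [? ?] := hAU l i; exact: bounded_supp_rC.
  transitivity (- Cint dd (fun z => transport A Ad phi (weight g U) z i 0)).
    congr (- _); apply: Cint_ext => z; rewrite transportE [RHS]mxE [X in _ = X + _]summxE.
    congr (_ + _).
      apply: eq_bigr => l _; rewrite el /weight -scalemxAr [RHS]mxE [X in _ = _ * X]mxE mulrA.
      by congr (_ * _); apply: eq_ReIm; rewrite ?cReM ?cImM /=; ring.
    rewrite ex /weight -scalemxAr [RHS]mxE [X in _ = _ * X]mxE mulrA; congr (_ * _).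
    by apply: eq_ReIm; rewrite ?cReM ?cImM /=; ring.
  rewrite H; congr (_ + _); apply: Cint_ext => z.
    rewrite e0 /weight [LHS]mxE [X in _ * X = _]mxE mulrA; congr (_ * _).
    by apply: eq_ReIm; rewrite ?cReM ?cImM /=; ring.
  rewrite e0 /bweight -scalemxAr [LHS]mxE [X in _ * X = _]mxE mulrA; congr (_ * _).
  by apply: eq_ReIm; rewrite ?cReM ?cImM /=; ring.
have K1 := key _ _ _ _ (test_tfun g k th smooth_cos' lchi.1 (line_test_test lchi)) (bounded_supp_Re q0_weight) q0_Re qx_Re ql_Re
  (bounded_supp_Re qx_weight) (fun l => bounded_supp_Re (ql_weight l)).
have K2 := key _ _ _ _ (test_tfun g k th smooth_sin' lchi.1 (line_test_test lchi)) (bounded_supp_Im q0_weight) q0_Im qx_Im ql_Im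
  (bounded_supp_Im qx_weight) (fun l => bounded_supp_Im (ql_weight l)).
have K := congr2 (fun a b => a + (0 +i* 1) * b) K1 K2.
rewrite mulrN -opprD mulrDr addrACA mulr_sumr -big_split/= mulrDr [in RHS]addrACA in K.
have [m1 o1] := hAx i; have [m2 o2] := hG i; have [m3 o3] := hA0 i.
rewrite (Cint_ReIm qx_weight m1 o1) (Cint_ReIm q0_weight m2 o2) (Cint_ReIm q00 m3 o3) in K.
rewrite [LHS]mxE [X in - X]mxE summxE [RHS]mxE [X in _ = X + _]mxE.
rewrite -(wint_mul (Cmx Ad) i qx_weight hU).
transitivity (- (\sum_l (Cint dd (fun z => (complex.Re (ql l z))%:C * (coef l *m U z) i 0) +
    (0 +i* 1) * Cint dd (fun z => (complex.Im (ql l z))%:C * (coef l *m U z) i 0)) +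
    Cint dd (fun z => qx z * (Cmx Ad *m U z) i 0))).
  congr (- (_ + _)); apply: eq_bigr => l _; have [ml ol] := hAU l i.
  by rewrite (Cint_ReIm (ql_weight l) ml ol) wint_mul//; exact: ql_weight.
rewrite K; congr (_ + _); rewrite mxE -(wint_mul (Cmx Ad) i (chr_weight (@kcut_weight R n k)) hU0).
rewrite -CintZ; first by apply: Cint_ext => s; rewrite /q0 /=; ring.
exact: bounded_supp_rC (chr_weight (@kcut_weight R n k)) m3 o3.
Qed.

End weak_identity.

(** The infimum over [k] has integral 0, hence vanishes almost everywhere. This takes the place of
    extracting an almost everywhere convergent subsequence. *)
Lemma ae_small (R : realType) d (T : measurableType d) (mu : {measure set T -> \bar R})
  (D : nat -> T -> \bar R) : (forall k, measurable_fun setT (D k)) -> (forall k x, 0 <= D k x)%E ->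
  (\int[mu]_x D k x)%E @[k --> \oo] --> 0%E ->
  {ae mu, forall x, forall eta : R, 0 < eta -> exists k, (D k x <= eta%:E)%E}.
Proof.
move=> mD D0 iD; pose f x := einfs (D ^~ x) 0.
have mf : measurable_fun setT f by exact: (measurable_fun_einfs mD).
have fD k x : (f x <= D k x)%E by apply: ereal_inf_lbound; exists k.
have f0 x : (0 <= f x)%E by apply: le_ereal_inf_tmp => _ [k _ <-].
have if0 : (\int[mu]_x `|f x| = 0)%E.
  apply/eqP; rewrite eq_le; apply/andP; split; last exact: integral_ge0.
  apply/lee_addgt0Pr => e e0; rewrite add0e.
  have [k _ Dk] := cvge0_le iD (fun k => integral_ge0 _ (fun x _ => D0 k x)) e0.
  apply: le_trans (Dk k (leqnn k)).
  under eq_integral do rewrite gee0_abs//.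
  exact: ge0_int_le.
have /ae_eq_integral_abs h := if0.
apply: filterS (h measurableT mf) => x /(_ I) fx eta eta0.
have : (f x < eta%:E)%E by rewrite fx lte_fin.
by move=> /ereal_inf_lt[_ [k _ <-] /ltW]; exists k.
Qed.

Section matrix_bounds.
Context {R : realType} {N : nat}.
Local Notation C := R[i].

Lemma vsq_component (v : 'cV[C]_N) i : sqn (v i 0) <= vsq v.
Proof. by rewrite /vsq (bigD1 i)//= lerDl sumr_ge0// => j _; exact: sqn_ge0. Qed.

(** The constant depends only on the bound on the entries, which yields bounds uniform over the
    frequencies. *)
Lemma vsq_mul_unif (K : R) : 0 <= K -> exists2 c : R, 0 <= c & forall (M : 'M[C]_N) (v : 'cV[C]_N),
  (forall i j, sqn (M i j) <= K) -> vsq (M *m v) <= c * vsq v.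
Proof.
move=> K0; suff [c c0 h] : exists2 c : R, 0 <= c & forall (M : 'M[C]_N) (v : 'cV[C]_N) i,
    (forall i j, sqn (M i j) <= K) -> sqn (\sum_(j <- index_enum 'I_N) M i j * v j 0) <= c * vsq v.
  exists (N%:R * c); first by rewrite mulr_ge0.
  move=> M v MK; rewrite -mulrA mulr_natl -[X in _ *+ X](card_ord N) -sumr_const.
  by apply: ler_sum => i _; rewrite [X in sqn X]mxE h.
elim: (index_enum _) => [|j s [c c0 IH]].
  by exists 0 => // M v i _; rewrite big_nil sqn0 mul0r.
exists (2 * K + 2 * c) => [|M v i MK]; first by rewrite addr_ge0 ?mulr_ge0.
rewrite big_cons; apply: le_trans (sqnD_le2 _ _) _.
rewrite [leRHS]mulrDl; apply: lerD; last by rewrite -mulrA ler_wpM2l// IH.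
by rewrite sqnM -mulrA ler_wpM2l// ler_pM ?sqn_ge0// vsq_component.
Qed.

Lemma vsq_mul_le (M : 'M[C]_N) : exists2 c : R, 0 <= c & forall v : 'cV[C]_N, vsq (M *m v) <= c * vsq v.
Proof.
have M0 x : 0 <= sqn (M x.1 x.2) by exact: sqn_ge0.
have [c c0 h] := @vsq_mul_unif (\sum_(x : 'I_N * 'I_N) sqn (M x.1 x.2)) (sumr_ge0 _ (fun x _ => M0 x)).
by exists c => // v; apply: h => i j; rewrite (bigD1 (i, j))//= lerDl sumr_ge0.
Qed.

End matrix_bounds.

Section small.
Context {R : realType} {N : nat}.
Local Notation C := R[i].
Variable D : nat -> \bar R.

(** Says that [vsq (f k)] is [O(D k)]; finite majorants [eta] are used because [D k] may be
    infinite. *)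
Definition small (f : nat -> 'cV[C]_N) := exists2 c : R, 0 <= c &
  forall k (eta : R), 0 < eta -> (D k <= eta%:E)%E -> vsq (f k) <= c * eta.

Lemma smallD f h : small f -> small h -> small (fun k => f k + h k).
Proof.
move=> [c c0 fc] [c' c'0 hc]; exists (2 * c + 2 * c'); first by rewrite addr_ge0 ?mulr_ge0.
move=> k eta e0 De; apply: le_trans (vsqD_le2 _ _) _.
by rewrite [leRHS]mulrDl; apply: lerD; rewrite -mulrA ler_wpM2l//; [exact: fc|exact: hc].
Qed.

Lemma small_mul (M : 'M[C]_N) f : small f -> small (fun k => M *m f k).
Proof.
move=> [c c0 fc]; have [b b0 hb] := vsq_mul_le M; exists (b * c); first exact: mulr_ge0.
by move=> k eta e0 De; apply: le_trans (hb _) _; rewrite -mulrA ler_wpM2l// fc.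
Qed.

Lemma smallZ (a : C) f : small f -> small (fun k => a *: f k).
Proof. by move=> sf; under eq_fun do rewrite -mul_scalar_mx; exact: small_mul. Qed.

Lemma small0 : small (fun=> 0).
Proof. by exists 0 => // k eta _ _; rewrite vsq0 mul0r. Qed.

Lemma small_sum (I : Type) (s : seq I) (f : I -> nat -> 'cV[C]_N) : (forall i, small (f i)) ->
  small (fun k => \sum_(i <- s) f i k).
Proof.
move=> sf; elim: s => [|i s IH]; first by under eq_fun do rewrite big_nil; exact: small0.
by under eq_fun do rewrite big_cons; exact: smallD.
Qed.

Lemma small_components (c : R) (f : nat -> 'cV[C]_N) : 0 <= c ->
  (forall k (eta : R), 0 < eta -> (D k <= eta%:E)%E -> forall i, sqn (f k i 0) <= c * eta) -> small f.
Proof.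
move=> c0 h; exists (N%:R * c); first exact: mulr_ge0.
move=> k eta e0 De; rewrite /vsq -mulrA -[N%:R]/(N%:R : R).
rewrite [leRHS](_ : _ = \sum_(i < N) c * eta); last by rewrite sumr_const card_ord mulr_natl.
by apply: ler_sum => i _; exact: h.
Qed.

Lemma small_const v : small (fun=> v) -> (forall eta : R, 0 < eta -> exists k, (D k <= eta%:E)%E) -> v = 0.
Proof.
move=> [c c0 h] De; apply: vsq_eq0; apply/eqP; rewrite eq_le vsq_ge0 andbT.
apply/ler_addgt0Pr => e e0; rewrite add0r.
have e1 : 0 < e / (c + 1) by rewrite divr_gt0// ltr_wpDl.
have [k Dk] := De _ e1; apply: le_trans (h k _ e1 Dk) _.
by rewrite mulrA ler_pdivrMr ?ltr_wpDl// mulrC ler_wpM2l ?lerDl// ltW.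
Qed.
End small.

Lemma bounded_supp_lty (R : realType) d (T : measurableType d) (mu : {measure set T -> \bar R}) (q : T -> R[i]) :
  bounded_supp mu q -> (E2 mu q < +oo)%E.
Proof.
move=> [mq [M qM] [B [mB Boo qB]]].
have h : rint mu (fun z => sqn (q z)).
  apply: (rint_le (measurable_sqn mq) (rintZ `|M| (rint_indic mB Boo))) => z.
  have [zB|zB] := pselect (B z); last by rewrite qB// sqn0 normr0.
  by rewrite indicE mem_set// mulr1 normr_id ger0_norm ?sqn_ge0//; exact: le_trans (ler_norm _).
by have := rint_lty h; under eq_integral do rewrite ger0_norm ?sqn_ge0//.
Qed.

Section line_integrals.
Context {R : realType}.
Local Notation C := R[i].
Local Notation RR := (measurableTypeR R).
Local Notation leb := (@lebesgue_measure R).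

(* |int chi w| <= (eta^(1/2) X + eta^(-1/2) int |w|^2) / 2 by AM-GM. *)
Lemma Cint_small (chi : R -> R) : line_test chi -> exists2 c : R, 0 <= c &
  forall (w : RR -> C) (eta : R), mC w -> 0 < eta -> (E2 leb w <= eta%:E)%E ->
  sqn (Cint leb (fun x => (chi x)%:C * w x)) <= c * eta.
Proof.
move=> lchi; have bw := line_test_weight lchi.
have [mchi [M hM] _] := bw.
have ic : rint leb (fun x => chi x ^+ 2).
  have := E2_fin mchi (bounded_supp_lty bw).
  by under eq_fun do rewrite sqnR.
pose X := \int[leb]_x (chi x ^+ 2).
have X0 : 0 <= X by apply: Rintegral_ge0 => x _; exact: sqr_ge0.
have rb (a : RR -> R) (eta : R) : rint leb (fun x => chi x * a x) -> rint leb (fun x => a x ^+ 2) ->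
    0 < eta -> \int[leb]_x (a x ^+ 2) <= eta -> (\int[leb]_x (chi x * a x)) ^+ 2 <= ((X + 1) / 2) ^+ 2 * eta.
  move=> i1 i2 e0 ae; set s := Num.sqrt eta.
  have s0 : 0 < s by rewrite sqrtr_gt0.
  have se : s ^+ 2 = eta by rewrite sqr_sqrtr// ltW.
  have p x : `|chi x * a x| <= s / 2 * chi x ^+ 2 + s^-1 / 2 * a x ^+ 2.
    rewrite ler_norml.
    have h1 := sqr_ge0 (s * chi x - a x); have h2 := sqr_ge0 (s * chi x + a x).
    have e : s / 2 * chi x ^+ 2 + s^-1 / 2 * a x ^+ 2 = s^-1 / 2 * (s ^+ 2 * chi x ^+ 2 + a x ^+ 2).
      by field; rewrite gt_eqF.
    have si : 0 < s^-1 / 2 by rewrite divr_gt0 ?invr_gt0.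
    have e2 : chi x * a x = s^-1 / 2 * (2 * (s * chi x * a x)) by field; rewrite gt_eqF.
    rewrite e [X in _ <= X <= _]e2 -mulrN !ler_pM2l//; apply/andP; split; lra.
  have : `|\int[leb]_x (chi x * a x)| <= s * ((X + 1) / 2).
    apply: le_trans (Rint_norm i1) _.
    apply: le_trans (Rint_le (rint_norm i1) (rintD (rintZ (s / 2) ic) (rintZ (s^-1 / 2) i2)) p) _.
    rewrite RintD; [|exact: rintZ|exact: rintZ]; rewrite !RintZ// -/X.
    have : s^-1 / 2 * \int[leb]_x (a x ^+ 2) <= s^-1 / 2 * s ^+ 2.
      by rewrite ler_wpM2l ?se// divr_ge0// invr_ge0 ltW.
    have -> : s^-1 / 2 * s ^+ 2 = s / 2 by field; rewrite gt_eqF.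
    have -> : s * ((X + 1) / 2) = s / 2 * X + s / 2 by field.
    by rewrite lerD2l.
  move=> h; rewrite -(real_normK (num_real (\int[leb]_x (chi x * a x)))) -se -exprMn mulrC.
  rewrite ler_sqr ?nnegrE//.
  by rewrite mulr_ge0 ?(ltW s0)// divr_ge0// addr_ge0.
exists (2 * ((X + 1) / 2) ^+ 2); first by rewrite mulr_ge0// sqr_ge0.
move=> w eta mw e0 we.
have woo : (E2 leb w < +oo)%E by apply: le_lt_trans we _; exact: ltry.
have [r1 r2] := bounded_supp_rC bw mw woo.
have i2 := E2_fin mw woo.
have sl : \int[leb]_x sqn (w x) <= eta by rewrite -lee_fin EFin_Rint.
have [m1 m2] := mw.
have j1 : rint leb (fun x => complex.Re (w x) ^+ 2).
  apply: (rint_le _ i2); first exact: measurable_funX.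
  by move=> x; rewrite !ger0_norm ?sqn_ge0 ?sqr_ge0// sqn_Re_le.
have j2 : rint leb (fun x => complex.Im (w x) ^+ 2).
  apply: (rint_le _ i2); first exact: measurable_funX.
  by move=> x; rewrite !ger0_norm ?sqn_ge0 ?sqr_ge0// sqn_Im_le.
have E1 : (fun x => complex.Re ((chi x)%:C * w x)) = (fun x => chi x * complex.Re (w x)).
  by apply/funext => x; rewrite cReM /= mul0r subr0.
have E3 : (fun x => complex.Im ((chi x)%:C * w x)) = (fun x => chi x * complex.Im (w x)).
  by apply/funext => x; rewrite cImM /= mul0r addr0.
rewrite E1 in r1; rewrite E3 in r2.
rewrite /sqn /Cint /= E1 E3 -mulrA mulr_natl mulr2n; apply: lerD; apply: rb => //.
  by apply: le_trans sl; apply: Rint_le => // x; exact: sqn_Re_le.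
by apply: le_trans sl; apply: Rint_le => // x; exact: sqn_Im_le.
Qed.

End line_integrals.

Section tangential.
Context {R : realType} {n N : nat}.
Local Notation C := R[i].
Local Notation RR := (measurableTypeR R).
Local Notation leb := (@lebesgue_measure R).
Local Notation mm := (@lebesgue_rV R).
Local Notation m := n.+1.
Local Notation space := ('rV[R]_m * RR)%type.
Local Notation dd := (lebesgue_ty m).
Variables (A : 'I_n -> 'M[R]_N) (Ad : 'M[R]_N) (g : R).
Hypothesis uAd : Ad \in unitmx.

(** The distributional equation [z' = M z + A_d^{-1} G + h delta_0] on the whole line, where [h] is
    the jump of [z] at 0: the trace when [z] is extended by 0 to the left, and 0 for a solution
    across the interface. *)
Definition weak_ode (M : 'M[C]_N) (z G : RR -> 'cV[C]_N) (h : 'cV[C]_N) := forall chi, line_test chi ->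
  - wint leb (fun x => ('D_1 chi x)%:C) z =
  M *m wint leb (fun x => (chi x)%:C) z + invmx (Cmx Ad) *m wint leb (fun x => (chi x)%:C) G + (chi 0)%:C *: h.

Lemma Cmx_unit : (Cmx Ad : 'M[C]_N) \in unitmx.
Proof. by rewrite /Cmx map_unitmx. Qed.

Lemma rearrange (a b y z h : 'cV[C]_N) : - (a - b + y) = z + h -> - y = - b + (z + a) + h.
Proof.
move=> E; apply/colP => i; have := congr1 (fun v : 'cV[C]_N => v i 0) E; rewrite !mxE => e.
have -> : h i 0 = - (a i 0 - b i 0 + y i 0) - z i 0 by rewrite e; ring.
by ring.
Qed.

(** The equation at frequency [th] before the cut-off is removed. The multiples of [q0] in the
    weights [ql] assemble into the symbol [Asym]; the terms in [qb] are the error due to the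
    cut-off. *)
Lemma weak_ode_cut U G U0 k th : L2v dd U -> L2v dd G -> L2v (mm m) U0 -> weak_transport A Ad g U G U0 ->
  forall chi, line_test chi ->
  - wint dd (qx k th chi) U = Asym A Ad (g, th) *m wint dd (q0 k th chi) U +
    invmx (Cmx Ad) *m (wint dd (q0 k th chi) G + \sum_l coef A l *m wint dd (qb k th chi l) U) +
    (chi 0)%:C *: wint (mm m) (fun s => chr (th, s) * (kcut k s)%:C) U0.
Proof.
move=> hU hG hU0 hw chi lchi.
have id := weak_identity k th lchi hU hG hU0 hw.
set X := wint dd (q0 k th chi) U in id *; set Y := wint dd (qx k th chi) U in id *.
set B := fun l => wint dd (qb k th chi l) U.
have El l : wint dd (ql g k th chi l) U = B l + (- g * (l == ord0)%:R +i* - th 0 l) *: X.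
  exact: (wint_axpy _ (q0_weight k th lchi) (qb_weight k th lchi l) hU).
have Es : \sum_l coef A l *m wint dd (ql g k th chi l) U =
    \sum_l coef A l *m B l - (g%:C%:M + \sum_l (0 +i* th 0 l) *: coef A l) *m X.
  under eq_bigr => l _ do rewrite El mulmxDr -scalemxAr.
  rewrite big_split /=; congr (_ + _); rewrite mulmxDl opprD mulmx_suml -sumrN.
  have -> : g%:C%:M *m X = \sum_l ((g * (l == ord0)%:R)%:C *: (coef A l *m X)).
    rewrite (bigD1 ord0)//= big1 ?addr0; last by move=> l /negbTE ->; rewrite mulr0 scale0r.
    by rewrite mulr1 /coef unlift_none /= mul1mx mul_scalar_mx.
  rewrite -sumrN -big_split/=; apply: eq_bigr => l _.
  rewrite -scalemxAl -opprD -scalerDl -scaleNr; congr (_ *: _).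
  by apply: eq_ReIm; rewrite ?(cReN, cImN, cReD, cImD) /= ?addr0 ?add0r ?mulNr.
have E := congr1 (fun v => invmx (Cmx Ad) *m v) id.
rewrite Es /= mulmxN !mulmxDr mulmxN -scalemxAr !mulKmx ?Cmx_unit// in E.
rewrite AsymE mulNmx -mulmxA mulmxDr.
exact: rearrange E.
Qed.

End tangential.

Lemma cvge0D (R : realType) (f g : nat -> \bar R) : f k @[k --> \oo] --> 0%E ->
  g k @[k --> \oo] --> 0%E -> (f k + g k)%E @[k --> \oo] --> 0%E.
Proof. by move=> f0 g0; have := cvge0_comb 1 1 f0 g0; under eq_fun do rewrite !mul1e. Qed.

Lemma cvge0_sum (R : realType) (I : Type) (s : seq I) (f : I -> nat -> \bar R) :
  (forall i, f i k @[k --> \oo] --> 0%E) -> (\sum_(i <- s) f i k)%E @[k --> \oo] --> 0%E.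
Proof.
move=> f0; elim: s => [|i s IH]; first by under eq_fun do rewrite big_nil; exact: cvg_cst.
by under eq_fun do rewrite big_cons; exact: cvge0D.
Qed.

(** * Removing the tangential cut-off *)

Section tangential_limit.
Context {R : realType} {n N : nat}.
Local Notation C := R[i].
Local Notation RR := (measurableTypeR R).
Local Notation leb := (@lebesgue_measure R).
Local Notation mm := (@lebesgue_rV R).
Local Notation m := n.+1.
Local Notation space := ('rV[R]_m * RR)%type.
Local Notation dd := (lebesgue_ty m).

Section slices.
Variables (w W : space -> C).
Hypothesis wW : FTt w W.
Definition kc k (z : space) : R := kcut k z.1.
(** [err] is the defect of the cut-off transform, [derr] the contribution of the derivatives of the
    cut-off; both tend to 0 in L2. *)
Definition err k (z : space) : C := W z - tft (cutf kc k w) z.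
Definition derr l k (z : space) : C := tft (fun z => (dkcut k l z.1)%:C * w z) z.

Lemma kc_cutoff : is_cutoff (@boxt R m) kc.
Proof. exact: cutoff_rV kcut_cutoff. Qed.

Lemma mC_err k : mC (err k).
Proof.
have [mw mW _ _ _] := wW; apply: mC_B => //; apply: mC_tft.
by apply: mC_cutf => //; exact: kc_cutoff.
Qed.

Lemma mC_dw l k : mC (fun z : space => (dkcut k l z.1)%:C * w z).
Proof.
have [mw _ _ _ _] := wW; apply: mC_M => //; apply: mC_R.
by apply: (measurableT_comp (@measurable_dkcut R n k l)); exact: measurable_fst.
Qed.

Lemma mC_derr l k : mC (derr l k).
Proof. by apply: mC_tft; exact: mC_dw. Qed.

Lemma err_cvg : E2 dd (err k) @[k --> \oo] --> 0%E.
Proof. exact: (FTt_cut kc_cutoff wW). Qed.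

(** By the isometry and [dkcut_bound], the squared norm is [O((k + 1)^-2)]. *)
Lemma derr_cvg l : E2 dd (derr l k) @[k --> \oo] --> 0%E.
Proof.
have [mw _ woo _ _] := wW; have [M M0 hM] := @dkcut_bound R n.
have b k : (E2 dd (fun z : space => (dkcut k l z.1)%:C * w z)%R <= ((k.+1%:R^-1 * M) ^+ 2)%:E * E2 dd w)%E.
  apply: E2_le => //; [exact: mC_dw|exact: sqr_ge0|].
  move=> z; rewrite sqnM sqnR ler_wpM2r ?sqn_ge0//.
  rewrite -(real_normK (num_real (dkcut k l z.1))) ler_sqr ?nnegrE ?mulr_ge0//.
have boo k : (E2 dd (fun z : space => (dkcut k l z.1)%:C * w z)%R < +oo)%E.
  by apply: le_lt_trans (b k) _; rewrite lte_mul_pinfty// lee_fin sqr_ge0.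
have e k : E2 dd (derr l k) = (((2 * pi) ^+ m)%:E * E2 dd (fun z : space => (dkcut k l z.1)%:C * w z)%R)%E.
  apply: (@plancherel_t' _ _ _ (k.+1%:R + 1)) => //; first exact: mC_dw.
  by move=> z hz; rewrite dkcut_supp// mul0r.
have [E Ew] : exists E : R, E2 dd w = E%:E.
  by exists (fine (E2 dd w)); rewrite fineK// ge0_fin_numE ?E2_ge0.
apply: (@cvge0_squeeze _ _ (fun k => (((2 * pi) ^+ m * (M ^+ 2 * E)) * k.+1%:R^-1 ^+ 2)%:E)).
- by move=> k; exact: E2_ge0.
- move=> k; rewrite e; apply: le_trans (lee_wpmul2l _ (b k)) _; first by rewrite lee_fin twopi_ge0.
  by rewrite Ew -!EFinM lee_fin le_eqVlt; apply/orP; left; apply/eqP; ring.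
apply: cvg_EFin; first exact: nearW.
have -> : (0 : R) = ((2 * pi) ^+ m * (M ^+ 2 * E)) * 0 ^+ 2 by rewrite expr0n mulr0.
rewrite /=; apply: cvgMl_tmp; under eq_fun do rewrite expr2; rewrite expr2.
by apply: cvgM; exact: cvg_harmonic.
Qed.

Lemma slice_fin k th : (E2 leb (fun x => err k (th, x)) < +oo)%E -> (E2 leb (fun x => W (th, x)) < +oo)%E ->
  (E2 leb (fun x => tft (cutf kc k w) (th, x)) < +oo)%E.
Proof.
move=> eoo Woo; have [_ mW _ _ _] := wW.
rewrite (_ : (fun x => tft (cutf kc k w) (th, x)) = (fun x => W (th, x) + (-1) * err k (th, x))); last first.
  by apply/funext => x; rewrite /err; ring.
have me : mC (fun x => (-1) * err k (th, x)).
  by apply: mC_M; [exact: mC_cst|exact: mC_slice1 (mC_err k)].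
apply: le_lt_trans (E2D_le2 leb (mC_slice1 th mW) me) _.
rewrite lte_add_pinfty// lte_mul_pinfty//.
by under [X in (E2 _ X < _)%E]eq_fun do rewrite mulN1r; rewrite [ltLHS](@eq_integral _ _ _ leb _ (fun x => (sqn (err k (th, x)))%:E))// => x _; rewrite sqnN.
Qed.

End slices.

Variables (A : 'I_n -> 'M[R]_N) (Ad : 'M[R]_N) (g : R).
Variables (U G Uh Gh : space -> 'cV[C]_N) (U0 h0 : 'rV[R]_m -> 'cV[C]_N).
Hypotheses (uAd : Ad \in unitmx) (ftU : forall j, FTt (fun z => U z j 0) (fun z => Uh z j 0))
  (ftG : forall j, FTt (fun z => G z j 0) (fun z => Gh z j 0))
  (ft0 : forall j, FTm (fun s => U0 s j 0) (fun s => h0 s j 0)).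
Hypothesis wt : weak_transport A Ad g U G U0.

Let eU k j := err (fun z => U z j 0) (fun z => Uh z j 0) k.
Let eG k j := err (fun z => G z j 0) (fun z => Gh z j 0) k.
Let eB k j l := derr (fun z => U z j 0) l k.
Let e0 k j th : C := h0 th j 0 - ftm (cutf (@kcut R n) k (fun s => U0 s j 0)) th.

(** All errors at frequency [th] in one sum, so that a single [k] makes every one of them small. *)
Let D k th : \bar R := (\sum_j (E2 leb (fun x => eU k j (th, x)) + (E2 leb (fun x => eG k j (th, x)) +
  (\sum_l E2 leb (fun x => eB k j l (th, x)) + (sqn (e0 k j th))%:E))))%E.

Let mC_e0 k j : mC (e0 k j).
Proof.
have [mw mW _ _ _] := ft0 j; apply: mC_B => //; apply: mC_ftm.
exact: mC_cutf (@kcut_cutoff R n) mw.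
Qed.

Let me_sl (w : space -> C) : mC w -> measurable_fun setT (fun th => E2 leb (fun x => w (th, x))).
Proof. exact: measurable_E2_slice1. Qed.

Let iD k : (\int[mm m]_th D k th = \sum_j (E2 dd (eU k j) + (E2 dd (eG k j) +
  (\sum_l E2 dd (eB k j l) + E2 (mm m) (e0 k j)))))%E.
Proof.
have mU j := mC_err (ftU j) k; have mG j := mC_err (ftG j) k; have mB j l := mC_derr (ftU j) l k.
have s0 (w : space -> C) th : (0 <= E2 leb (fun x => w (th, x)))%E by exact: E2_ge0.
have q0 j th : (0 <= (sqn (e0 k j th))%:E :> \bar R)%E by rewrite lee_fin sqn_ge0.
have mS j : measurable_fun setT (fun th => \sum_l E2 leb (fun x => eB k j l (th, x)))%E.
  by apply: emeasurable_sum => l; exact: me_sl (mB j l).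
have S0 j th : (0 <= \sum_l E2 leb (fun x => eB k j l (th, x)))%E by apply: sume_ge0 => l _; exact: E2_ge0.
have m3 j : measurable_fun setT (fun th => \sum_l E2 leb (fun x => eB k j l (th, x)) + (sqn (e0 k j th))%:E)%E.
  by apply: emeasurable_funD; [exact: mS|exact: measurable_sqnE].
have p3 j th : (0 <= \sum_l E2 leb (fun x => eB k j l (th, x)) + (sqn (e0 k j th))%:E)%E by rewrite adde_ge0.
have m2 j : measurable_fun setT (fun th => E2 leb (fun x => eG k j (th, x)) +
    (\sum_l E2 leb (fun x => eB k j l (th, x)) + (sqn (e0 k j th))%:E))%E.
  by apply: emeasurable_funD; [exact: me_sl (mG j)|exact: m3].
have p2 j th : (0 <= E2 leb (fun x => eG k j (th, x)) +
    (\sum_l E2 leb (fun x => eB k j l (th, x)) + (sqn (e0 k j th))%:E))%E by rewrite adde_ge0.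
rewrite /D ge0_integral_sum//; first last.
- by move=> j th _; rewrite adde_ge0.
- by move=> j; apply: emeasurable_funD; [exact: me_sl (mU j)|exact: m2].
apply: eq_bigr => j _; rewrite ge0_integralD//; last exact: me_sl (mU j).
congr (_ + _)%E; first by rewrite [RHS](E2_prod1 (mm m) leb (mU j)).
rewrite ge0_integralD//; last exact: me_sl (mG j).
congr (_ + _)%E; first by rewrite [RHS](E2_prod1 (mm m) leb (mG j)).
rewrite ge0_integralD//; last exact: measurable_sqnE.
congr (_ + _)%E; rewrite ge0_integral_sum//; last by move=> l; exact: me_sl (mB j l).
by apply: eq_bigr => l _; rewrite [RHS](E2_prod1 (mm m) leb (mB j l)).
Qed.

Let D_cvg : (\int[mm m]_th D k th)%E @[k --> \oo] --> 0%E.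
Proof.
under eq_fun do rewrite iD; apply: cvge0_sum => j.
apply: cvge0D; first exact: (err_cvg (ftU j)).
apply: cvge0D; first exact: (err_cvg (ftG j)).
apply: cvge0D; first by apply: cvge0_sum => l; exact: (derr_cvg (ftU j)).
exact: (FTm_cut (@kcut_cutoff R n) (ft0 j)).
Qed.

Let S_ge0 k j th : (0 <= \sum_l E2 leb (fun x => eB k j l (th, x)))%E.
Proof. by apply: sume_ge0 => l _; exact: E2_ge0. Qed.

Let q_ge0 k j th : (0 <= (sqn (e0 k j th))%:E :> \bar R)%E.
Proof. by rewrite lee_fin sqn_ge0. Qed.

Let T_ge0 k j th : (0 <= E2 leb (fun x => eU k j (th, x)) + (E2 leb (fun x => eG k j (th, x)) +
  (\sum_l E2 leb (fun x => eB k j l (th, x)) + (sqn (e0 k j th))%:E)))%E.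
Proof.
exact: (adde_ge0 (E2_ge0 _ _) (adde_ge0 (E2_ge0 _ _) (adde_ge0 (S_ge0 k j th) (q_ge0 k j th)))).
Qed.

Let D_le k th (eta : \bar R) : (D k th <= eta)%E -> forall j,
  [/\ (E2 leb (fun x => eU k j (th, x)) <= eta)%E, (E2 leb (fun x => eG k j (th, x)) <= eta)%E,
  (forall l, (E2 leb (fun x => eB k j l (th, x)) <= eta)%E) & ((sqn (e0 k j th))%:E <= eta)%E].
Proof.
move=> De j.
have h : (E2 leb (fun x => eU k j (th, x)) + (E2 leb (fun x => eG k j (th, x)) +
  (\sum_l E2 leb (fun x => eB k j l (th, x)) + (sqn (e0 k j th))%:E)) <= eta)%E.
  apply: le_trans De; rewrite /D [leRHS](bigD1 j)//=; apply: leeDl.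
  by apply: sume_ge0 => j' _; exact: T_ge0.
split.
- apply: le_trans h; apply: leeDl.
  exact: (adde_ge0 (E2_ge0 _ _) (adde_ge0 (S_ge0 k j th) (q_ge0 k j th))).
- apply: le_trans h; apply: le_trans (leeDr _ (E2_ge0 _ _)); apply: leeDl.
  exact: (adde_ge0 (S_ge0 k j th) (q_ge0 k j th)).
- move=> l; apply: le_trans h; apply: le_trans (leeDr _ (E2_ge0 _ _)).
  apply: le_trans (leeDr _ (E2_ge0 _ _)); apply: le_trans (leeDl _ (q_ge0 k j th)).
  by rewrite (bigD1 l)//=; apply: leeDl; apply: sume_ge0 => l' _; exact: E2_ge0.
- apply: le_trans h; apply: le_trans (leeDr _ (E2_ge0 _ _)).
  by apply: le_trans (leeDr _ (E2_ge0 _ _)); exact: leeDr.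
Qed.

Let D_ge0 k th : (0 <= D k th)%E.
Proof.
by apply: sume_ge0 => j _; exact: T_ge0.
Qed.

Let mD k : measurable_fun setT (D k).
Proof.
apply: emeasurable_sum => j; apply: emeasurable_funD; first exact: me_sl (mC_err (ftU j) k).
apply: emeasurable_funD; first exact: me_sl (mC_err (ftG j) k).
apply: emeasurable_funD; last exact: measurable_sqnE.
by apply: emeasurable_sum => l; exact: me_sl (mC_derr (ftU j) l k).
Qed.

Let FT_L2v d d' (T : measurableType d) (T' : measurableType d') (mu : {measure set T -> \bar R}) (nu : {measure set T' -> \bar R})
  (F : (T -> C) -> T' -> C) chi (w : T -> 'cV[C]_N) (W : T' -> 'cV[C]_N) :
  (forall j, FT mu nu F chi (fun z => w z j 0) (fun z => W z j 0)) -> L2v mu w /\ L2v nu W.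
Proof. by move=> h; split=> j; have [? ? ? ? _] := h j. Qed.

Let rearrange_limit (a y b b' z z' s h h' : 'cV[C]_N) : - y = b' + (z' + s) + h' ->
  a - y + (b - b' + (z - z' - s) + (h - h')) = a + (b + z + h).
Proof.
move=> E; apply/colP => i; have := congr1 (fun v : 'cV[C]_N => v i 0) E; rewrite !mxE => e.
by rewrite e; ring.
Qed.

(** For a given [chi] the residual is a fixed vector equal, for each [k], to a sum of terms that are
    [O(D k th)] in squared norm. At almost every [th] the numbers [D k th] get arbitrarily small, so
    the residual is 0. [D] does not involve [chi], hence the exceptional set serves all test
    functions at once. *)
Lemma tangential_ode : {ae mm m, forall th,
  weak_ode Ad (Asym A Ad (g, th)) (fun x => Uh (th, x)) (fun x => Gh (th, x)) (h0 th)}.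
Proof.
have [LU LUh] := FT_L2v ftU; have [LG LGh] := FT_L2v ftG; have [L0 _] := FT_L2v ft0.
have aU : {ae mm m, forall th, forall j, (E2 leb (fun x => Uh (th, x) j 0%R) < +oo)%E}.
  by apply: filter_forall => j; have [a b] := LUh j; exact: (ae_E2_slice1 (m1 := mm m) (m2 := leb) a b).
have aG : {ae mm m, forall th, forall j, (E2 leb (fun x => Gh (th, x) j 0%R) < +oo)%E}.
  by apply: filter_forall => j; have [a b] := LGh j; exact: (ae_E2_slice1 (m1 := mm m) (m2 := leb) a b).
have aD := ae_small mD D_ge0 D_cvg.
apply: filterS (filterI aU (filterI aG aD)) => th [Uoo [Goo Dth]] chi lchi.
pose Dt k := D k th.
(* [Cint_chr] writes the weighted integral of [w] as an integral in [x] of its cut-off transform;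
   the difference is the integral of [psi] times [err] on a line, and [Cint_small] applies. *)
have sm (psi : R -> R) (w W : space -> 'cV[C]_N) : line_test psi ->
    (forall j, FTt (fun z => w z j 0) (fun z => W z j 0)) ->
    (forall j, (E2 leb (fun x => W (th, x) j 0%R) < +oo)%E) ->
    (forall k (eta : R), (Dt k <= eta%:E)%E -> forall j, (E2 leb (fun x => err (fun z => w z j 0%R) (fun z => W z j 0%R) k (th, x)) <= eta%:E)%E) ->
    small Dt (fun k => wint leb (fun x => (psi x)%:C) (fun x => W (th, x)) -
      wint dd (fun z => chr (th, z.1) * (kcut k z.1)%:C * (psi z.2)%:C) w).
  move=> lpsi ftw Woo h; have [c c0 hc] := Cint_small lpsi; have bpsi := line_test_weight lpsi.
  apply: (small_components c0) => k eta eta0 De j.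
  have [mw mW woo _ _] := ftw j; have ej := h k eta De j.
  have me := mC_err (ftw j) k.
  rewrite !mxE (Cint_chr th (kcut_weight k) bpsi mw woo).
  have eoo : (E2 leb (fun x => err (fun z => w z j 0%R) (fun z => W z j 0%R) k (th, x)) < +oo)%E.
    by apply: le_lt_trans ej _; exact: ltry.
  have too := slice_fin (ftw j) eoo (Woo j).
  have mt : mC (tft (cutf kc k (fun z => w z j 0))) by apply: mC_tft; exact: mC_cutf kc_cutoff mw.
  rewrite -CintB; first last.
  - exact: (bounded_supp_rC bpsi (mC_slice1 th mt) too).
  - exact: (bounded_supp_rC bpsi (mC_slice1 th mW) (Woo j)).
  rewrite (@Cint_ext _ _ _ leb _ (fun x => (psi x)%:C * err (fun z => w z j 0) (fun z => W z j 0) k (th, x))).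
    by apply: hc => //; exact: (mC_slice1 th me).
  by move=> x; rewrite /err mulrBr.
have sX := sm chi U Uh lchi ftU Uoo (fun k eta De j => let: And4 a _ _ _ := D_le De j in a).
have sY := sm _ U Uh (line_test_derive lchi) ftU Uoo (fun k eta De j => let: And4 a _ _ _ := D_le De j in a).
have sZ := sm chi G Gh lchi ftG Goo (fun k eta De j => let: And4 _ a _ _ := D_le De j in a).
have sB l : small Dt (fun k => wint dd (qb k th chi l) U).
  have [c c0 hc] := Cint_small lchi; have bchi := line_test_weight lchi.
  apply: (small_components c0) => k eta eta0 De j.
  have [mw mW woo _ _] := ftU j; have [_ _ /(_ l) el _] := D_le De j.
  rewrite mxE /qb (Cint_chr th (dkcut_weight k l) bchi mw woo).
  apply: hc => //; exact: (mC_slice1 th (mC_derr (ftU j) l k)).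
have sH : small Dt (fun k => h0 th - wint (mm m) (fun s => chr (th, s) * (kcut k s)%:C) U0).
  apply: (@small_components _ _ _ 1) => // k eta eta0 De j.
  have [_ _ _] := D_le De j; rewrite lee_fin mul1r !mxE /e0; congr (sqn (_ - _) <= _).
  by apply: Cint_ext => s; rewrite /cutf -mulrA.
pose Y := wint leb (fun x => ('D_1 chi x)%:C) (fun x => Uh (th, x)).
pose X := wint leb (fun x => (chi x)%:C) (fun x => Uh (th, x)).
pose Z := wint leb (fun x => (chi x)%:C) (fun x => Gh (th, x)).
pose M := Asym A Ad (g, th). pose V := invmx (Cmx Ad : 'M[C]_N).
(* The residual of the equation, in which [k] no longer occurs. *)
suff J0 : Y + (M *m X + V *m Z + (chi 0)%:C *: h0 th) = 0.
  by rewrite -/Y -/X -/Z -/M -/V; apply/eqP; rewrite eq_sym -subr_eq0 opprK addrC J0.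
apply: (small_const _ Dth).
have := smallD sY (smallD (smallD (small_mul M sX) (small_mul V (smallD sZ (smallZ (-1) (small_sum (index_enum _) (fun l => small_mul (coef A l) (sB l)))))))
  (smallZ (chi 0)%:C sH)).
congr small; apply/funext => k.
have := weak_ode_cut uAd k th LU LG L0 wt lchi; rewrite -/M -/V !mulmxDr scaleN1r !mulmxN scalerBr.
exact: rearrange_limit.
Qed.

End tangential_limit.

Local Open Scope sesquilinear_scope.

(** * Energy identity on the line *)

Lemma cvge0_harmonic (R : realType) (f : nat -> \bar R) (a : R) (e : \bar R) : (forall k, 0 <= f k)%E ->
  0 <= a -> (e < +oo)%E -> (0 <= e)%E -> (forall k, f k <= (k.+1%:R^-1 ^+ 2 * a)%:E * e)%E -> f k @[k --> \oo] --> 0%E.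
Proof.
move=> f0 a0 eoo e0; have -> : e = (fine e)%:E by rewrite fineK// ge0_fin_numE.
move=> fe; apply: (cvge0_squeeze f0 fe).
under eq_fun do rewrite -EFinM; apply: cvg_EFin; first exact: nearW.
have -> : (0 : R) = 0 ^+ 2 * a * fine e by rewrite expr0n !mul0r.
rewrite /=; apply: cvgMr_tmp; apply: cvgMr_tmp; under eq_fun do rewrite expr2; rewrite expr2.
by apply: cvgM; exact: cvg_harmonic.
Qed.

Lemma emul_cancel (R : realType) (c : R) (a b : \bar R) : c != 0 -> (c%:E * a = c%:E * b)%E -> a = b.
Proof. by move=> c0 /(congr1 (fun e => (c^-1)%:E * e)%E); rewrite !muleA -!EFinM mulVf// !mul1e. Qed.

Lemma cvge_sum (R : realType) (I : Type) (s : seq I) (f : I -> nat -> \bar R) (l : I -> \bar R) :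
  (forall i k, 0 <= f i k)%E -> (forall i, 0 <= l i)%E ->
  (forall i, f i k @[k --> \oo] --> l i) -> (\sum_(i <- s) f i k)%E @[k --> \oo] --> (\sum_(i <- s) l i)%E.
Proof.
move=> f0 l0 fl; elim: s => [|i s IH].
  by rewrite big_nil; under eq_fun do rewrite big_nil; exact: cvg_cst.
rewrite big_cons; under eq_fun do rewrite big_cons; apply: cvgeD => //.
by rewrite ge0_adde_def// inE ?l0//; apply: sume_ge0 => j _; exact: l0.
Qed.

Section inner_product.
Context {R : realType} {N : nat}.
Local Notation C := R[i].
Implicit Types a b v : 'cV[C]_N.

(** The inner product of the underlying real vector space. *)
Definition dotv a b : R := complex.Re ((a^t* *m b) 0 0).

Lemma dotvE a b : dotv a b = \sum_i (complex.Re (a i 0) * complex.Re (b i 0) + complex.Im (a i 0) * complex.Im (b i 0)).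
Proof.
rewrite /dotv mxE Re_sum; apply: eq_bigr => i _; rewrite !mxE cReM.
by case: (a i 0) => r s /=; rewrite mulNr opprK.
Qed.

Lemma dotvv v : dotv v v = vsq v.
Proof. by rewrite dotvE; apply: eq_bigr => i _; rewrite /sqn !expr2. Qed.

Lemma vsqD a b : vsq (a + b) = vsq a + 2 * dotv a b + vsq b.
Proof.
rewrite /vsq dotvE mulr_sumr -!big_split/=; apply: eq_bigr => i _.
by rewrite mxE /sqn cReD cImD; ring.
Qed.

Lemma dotvDr a b c : dotv a (b + c) = dotv a b + dotv a c.
Proof. by rewrite /dotv mulmxDr mxE cReD. Qed.

Lemma dotvNr a b : dotv a (- b) = - dotv a b.
Proof. by rewrite /dotv mulmxN mxE cReN. Qed.

Lemma polarization a b : vsq (a + b) - vsq (a - b) = 4 * dotv a b.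
Proof. by rewrite !vsqD vsqN dotvNr; ring. Qed.

Lemma dotvC a b : dotv a b = dotv b a.
Proof. by rewrite !dotvE; apply: eq_bigr => i _; ring. Qed.

Lemma adjM p q r (X : 'M[C]_(p, q)) (Y : 'M[C]_(q, r)) : (X *m Y)^t* = Y^t* *m X^t*.
Proof. by rewrite trmx_mul map_mxM. Qed.

Lemma dotv_mul (S M : 'M[C]_N) a b : is_hermitian S -> dotv (S *m a) (M *m b) = complex.Re ((a^t* *m (S *m M) *m b) 0 0).
Proof.
by move=> hS; rewrite /dotv adjM hS !mulmxA.
Qed.

Lemma hermitian_form_real (S : 'M[C]_N) v : is_hermitian S -> complex.Im ((v^t* *m S *m v) 0 0) = 0.
Proof.
move=> hS; have e : ((v^t* *m S *m v) 0 0)^* = (v^t* *m S *m v) 0 0.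
  have h : (v^t* *m S *m v)^t* = v^t* *m S *m v by rewrite !adjM trmxCK hS mulmxA.
  by rewrite -[in RHS]h !mxE.
move: e; case: (_ 0 0) => r s /= [] /eqP; rewrite eq_sym -addr_eq0 -mulr2n mulrn_eq0 /=.
by move=> /eqP.
Qed.

(** The hermitian form at [v] is real, so [(S v, i xi v)] is purely imaginary and the cross term of
    both squares vanishes. *)
Lemma vsq_skew (S : 'M[C]_N) v (xi : R) : is_hermitian S ->
  vsq (S *m v + (0 +i* xi) *: v) = vsq (S *m v - (0 +i* xi) *: v).
Proof.
move=> hS; apply/eqP; rewrite -subr_eq0 polarization.
have -> : dotv (S *m v) ((0 +i* xi) *: v) = 0; last by rewrite mulr0.
rewrite -[X in dotv _ X]mul1mx dotv_mul// -scalemxAr mxE mulmx1 cReM /= mul0r sub0r.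
by rewrite hermitian_form_real// mulr0 oppr0.
Qed.

End inner_product.

Section fourier_line.
Context {R : realType} {N : nat}.
Local Notation C := R[i].
Local Notation RR := (measurableTypeR R).
Local Notation leb := (@lebesgue_measure R).

Lemma plancherel1_L2 (f : RR -> C) (K : R) : mC f -> (E2 leb f < +oo)%E ->
  (forall x, ~ (`|x| <= K) -> f x = 0) -> E2 leb (ft1 f) = ((2 * pi)%:E * E2 leb f)%E.
Proof.
move=> mf foo fK.
pose e (p : RR * RR) : C := expi (- (p.2 * p.1)).
have me : mC e.
  apply: mC_expi; apply: measurableT_comp => //; apply: measurable_funM; [exact: measurable_snd|exact: measurable_fst].
have mB : measurable (`[- K, K]%classic : set RR) by exact: measurable_itv.
apply: (isom_L2 (n := leb) (m := leb) (e := e) (B := `[- K, K]%classic)) => //.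
- by move=> z; exact: sqn_expi.
- exact: segment_lty.
- by rewrite mulr_ge0// pi_ge0.
(* Vanishing off the closed segment becomes vanishing for [|x| >= K + 1], the form [plancherel1]
   expects. *)
- move=> h M mh M0 hM hK; apply: (@plancherel1 R h M (K + 1)) => // x Kx; apply: hK.
  rewrite /= in_itv/= -ler_norml => hx; have := le_trans Kx hx.
  by rewrite gerDl ler10.
- by move=> x hx; apply: fK => h; apply: hx; rewrite /= in_itv/= -ler_norml.
Qed.

Definition dbumpk k (x : R) : R := k.+1%:R^-1 * dbump (k.+1%:R^-1 * x).

Lemma line_test_osc (h : R -> R) k (xi : R) : smooth h -> line_test (fun x => bumpk k x * h (xi * x)).
Proof.
move=> sh; split.
  apply: smoothM; first exact: smooth_cut.
  by have := smooth_affine 0 xi sh; under eq_fun do rewrite add0r.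
by exists k.+1%:R => x hx; rewrite cut_supp ?mul0r// => h'; apply: hx; exact: ltW.
Qed.

Lemma derive_osc (h : R -> R) k (xi x : R) : smooth h ->
  'D_1 (fun x => bumpk k x * h (xi * x)) x = dbumpk k x * h (xi * x) + bumpk k x * (xi * 'D_1 h (xi * x)).
Proof.
move=> sh.
have d1 : is_derive x (1 : R) (fun x => xi * x) xi.
  by apply: is_derive_eq (is_deriveZ xi (is_derive_id x 1)) _; rewrite /GRing.scale /= mulr1.
have d2 : is_derive (xi * x) (1 : R) h ('D_1 h (xi * x)) by apply: DeriveDef => //; exact: smooth_derivable.
have d3 := @is_derive1_comp _ h (fun x => xi * x) x _ _ d2 d1.
have d4 := is_deriveM (is_derive_cut k x) d3.
by rewrite (@derive_val _ _ _ _ _ _ _ d4) /GRing.scale /= /dbumpk; ring.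
Qed.

Variables (z K : RR -> 'cV[C]_N).
Hypotheses (Lz : L2v leb z) (LK : L2v leb K).
Hypothesis zK : forall chi, line_test chi ->
  - wint leb (fun x => ('D_1 chi x)%:C) z = wint leb (fun x => (chi x)%:C) K.

Definition zcut k x := (bumpk k x)%:C *: z x.
(** The weak derivative of [zcut k], by the product rule. *)
Definition Kcut k x := (bumpk k x)%:C *: K x + (dbumpk k x)%:C *: z x.

Lemma osc_weight (xi : R) (a : R -> R) : continuous a -> (exists M, forall x, ~ (`|x| <= M) -> a x = 0) ->
  bounded_supp leb (fun x : RR => expi (- (x * xi)) * (a x)%:C).
Proof.
move=> ca [M aM]; have [B B0 hB] := continuous_supp_bounded ca aM; split.
- apply: mC_M; last by apply: mC_R; exact: measurable_continuous.
  apply: mC_expi; apply: measurableT_comp => //; apply: measurable_funM => //; exact: measurable_cst.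
- exists (B ^+ 2) => x; rewrite sqnM sqn_expi mul1r sqnR -(real_normK (num_real (a x))).
  by rewrite ler_sqr ?nnegrE.
- exists `[- M, M]%classic; split; [exact: measurable_itv|exact: segment_lty|].
  by move=> x hx; rewrite aM ?mulr0// => h'; apply: hx; rewrite /= in_itv/= -ler_norml.
Qed.

Lemma bumpk_supp k (x : R) : ~ (`|x| <= k.+1%:R) -> bumpk k x = 0.
Proof. by move=> hx; apply: cut_supp => h; apply: hx; exact: ltW. Qed.

Lemma dbumpk_supp k (x : R) : ~ (`|x| <= k.+1%:R) -> dbumpk k x = 0.
Proof.
move=> hx; rewrite /dbumpk /dbump (derive_supp (M := 1)) ?mulr0//.
  by move=> y h; apply: bump_supp => h1; apply: h; exact: ltW.
by move=> h; apply: hx; move: h; rewrite normrM gtr0_norm ?invr_gt0// ler_pdivrMl// mulr1.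
Qed.

Lemma dbumpk_cont k : continuous (dbumpk k : R -> R).
Proof.
apply: smooth_continuous; apply: smoothZ.
have -> : (fun x => dbump (k.+1%:R^-1 * x)) = (fun x : R => dbump (0 + k.+1%:R^-1 * x)).
  by apply/funext => t; rewrite add0r.
by apply: smooth_affine; apply: smooth_derive; exact: smooth_bump.
Qed.

(* Testing with bumpk k * e^{-i x xi} turns the weak equation into multiplication by i xi. *)
Lemma fourier_weak k (xi : R) i :
  (0 +i* xi) * ft1 (fun x => zcut k x i 0) xi = ft1 (fun x => Kcut k x i 0) xi.
Proof.
have wb := osc_weight xi (smooth_continuous (@smooth_cut R k)) (ex_intro _ k.+1%:R (@bumpk_supp k)).
have wd := osc_weight xi (@dbumpk_cont k) (ex_intro _ k.+1%:R (@dbumpk_supp k)).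
pose q x : C := expi (- (x * xi)) * (bumpk k x)%:C.
pose dq x : C := expi (- (x * xi)) * (dbumpk k x)%:C + (0 +i* - xi) * q x.
have wq : bounded_supp leb q := wb.
have wdq : bounded_supp leb dq by exact: bounded_supp_axpy wb wd.
have [mz oz] := Lz i; have [mK oK] := LK i.
have rz := bounded_supp_rC wb mz oz; have rK := bounded_supp_rC wb mK oK; have rd := bounded_supp_rC wd mz oz.
have sN : smooth (fun y : R => - sin y).
  have := smoothZ (-1) (@smooth_sin' R).
  by under eq_fun do rewrite mulN1r.
have c1 x : complex.Re (q x) = bumpk k x * cos (xi * x).
  by rewrite /q cReM /= cosN (mulrC x); ring.
have c2 x : complex.Im (q x) = bumpk k x * - sin (xi * x).
  by rewrite /q cImM /= sinN (mulrC x); ring.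
have c3 x : complex.Re (dq x) = 'D_1 (fun x => bumpk k x * cos (xi * x)) x.
  rewrite (derive_osc k xi x (@smooth_cos' R)) D1cos /dq /q.
  by rewrite !(cReD, cReM, cImM) /= cosN sinN (mulrC x); ring.
have c4 x : complex.Im (dq x) = 'D_1 (fun x => bumpk k x * - sin (xi * x)) x.
  have e : 'D_1 (fun y : R => - sin y) (xi * x) = - cos (xi * x) by rewrite derive_val.
  rewrite (derive_osc k xi x sN) e /dq /q.
  by rewrite !(cImD, cReM, cImM) /= cosN sinN (mulrC x); ring.
have H1 := congr1 (fun v : 'cV[C]_N => v i 0) (zK (line_test_osc k xi (@smooth_cos' R))).
have H2 := congr1 (fun v : 'cV[C]_N => v i 0) (zK (line_test_osc k xi sN)).
rewrite [LHS]mxE [X in - X]mxE [RHS]mxE in H1.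
rewrite [LHS]mxE [X in - X]mxE [RHS]mxE in H2.
have E1 : - Cint leb (fun x => dq x * z x i 0) = Cint leb (fun x => q x * K x i 0).
  rewrite -(Cint_ReIm wdq mz oz) -(Cint_ReIm wq mK oK) opprD -mulrN.
  congr (_ + _ * _).
    under [X in - Cint _ X = _]eq_fun do rewrite c3; rewrite H1.
    by apply: Cint_ext => x; rewrite c1.
  under [X in - Cint _ X = _]eq_fun do rewrite c4; rewrite H2.
  by apply: Cint_ext => x; rewrite c2.
have E2' : Cint leb (fun x => dq x * z x i 0) = Cint leb (fun x => expi (- (x * xi)) * (dbumpk k x)%:C * z x i 0) +
    (0 +i* - xi) * Cint leb (fun x => q x * z x i 0).
  rewrite -CintZ// -CintD//; last exact: rC_Z.
  by apply: Cint_ext => x; rewrite /dq; ring.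
have Ez : ft1 (fun x => zcut k x i 0) xi = Cint leb (fun x => q x * z x i 0).
  by apply: Cint_ext => x; rewrite mxE mulrA.
have EK : ft1 (fun x => Kcut k x i 0) xi = Cint leb (fun x => q x * K x i 0) +
    Cint leb (fun x => expi (- (x * xi)) * (dbumpk k x)%:C * z x i 0).
  by rewrite -CintD//; apply: Cint_ext => x; rewrite !mxE mulrDr !mulrA.
rewrite Ez EK -E1 E2' opprD addrAC addNr add0r -mulNr; congr (_ * _).
by apply: eq_ReIm; rewrite /= ?opprK ?oppr0.
Qed.

Variable S : 'M[C]_N.
Hypothesis hS : is_hermitian S.

Lemma bumpk_line k : line_test (bumpk k : R -> R).
Proof. by split; [exact: smooth_cut|exists k.+1%:R; exact: bumpk_supp]. Qed.

Lemma bump_weight k : bounded_supp leb (fun x : RR => (bumpk k x)%:C).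
Proof. exact: line_test_weight (bumpk_line k). Qed.

Lemma dbump_weight k : bounded_supp leb (fun x : RR => (dbumpk k x)%:C).
Proof.
have := line_test_weight (line_test_derive (bumpk_line k)).
by under eq_fun do rewrite (@derive_val _ _ _ _ _ _ _ (@is_derive_cut R k _)).
Qed.

Lemma E2_bounded_mul d (T : measurableType d) (mu : {measure set T -> \bar R}) (q w : T -> C) (M : R) :
  mC q -> (forall x, sqn (q x) <= M) -> 0 <= M -> mC w ->
  (E2 mu (fun x => q x * w x)%R <= M%:E * E2 mu w)%E.
Proof.
move=> mq qM M0 mw; apply: E2_le => //; first exact: mC_M.
by move=> x; rewrite sqnM ler_wpM2r ?sqn_ge0.
Qed.

Lemma L2v_scale (q : RR -> C) (u : RR -> 'cV[C]_N) : bounded_supp leb q -> L2v leb u -> L2v leb (fun x => q x *: u x).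
Proof.
move=> [mq [M qM] _] Lu i; have [mi oi] := Lu i; under eq_fun do rewrite mxE; split; first exact: mC_M.
have M0 : 0 <= M by apply: le_trans (qM 0); exact: sqn_ge0.
apply: le_lt_trans (E2_bounded_mul leb mq qM M0 mi) _; rewrite lte_mul_pinfty//.
Qed.

Lemma L2vD d (T : measurableType d) (mu : {measure set T -> \bar R}) (u v : T -> 'cV[C]_N) :
  L2v mu u -> L2v mu v -> L2v mu (fun x => u x + v x).
Proof.
move=> Lu Lv i; have [mi oi] := Lu i; have [mj oj] := Lv i.
under eq_fun do rewrite mxE; split; first exact: mC_D.
by apply: le_lt_trans (E2D_le2 mu mi mj) _; rewrite lte_add_pinfty// lte_mul_pinfty.
Qed.

Lemma L2vN d (T : measurableType d) (mu : {measure set T -> \bar R}) (u : T -> 'cV[C]_N) :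
  L2v mu u -> L2v mu (fun x => - u x).
Proof.
move=> Lu i; have [mi oi] := Lu i; under eq_fun do rewrite mxE; split; first exact: mC_N.
by rewrite (_ : E2 mu _ = E2 mu (fun x => u x i 0%R))//; apply: eq_integral => x _; rewrite sqnN.
Qed.

Lemma L2v_zcut k : L2v leb (zcut k).
Proof. exact: L2v_scale (bump_weight k) Lz. Qed.
Lemma L2v_Kcut k : L2v leb (Kcut k).
Proof. by apply: L2vD; [exact: L2v_scale (bump_weight k) LK|exact: L2v_scale (dbump_weight k) Lz]. Qed.

Lemma L2v_mV d (T : measurableType d) (mu : {measure set T -> \bar R}) (u : T -> 'cV[C]_N) : L2v mu u -> mV u.
Proof. by move=> Lu i; have [] := Lu i. Qed.

(** After transform in [x] the function [Kcut k] is [i xi] times the transform of [zcut k];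
    [vsq_skew] gives equality at each [xi], and Plancherel brings it back, the factor [2 pi]
    cancelling. *)
Lemma energy_cut k : VL leb (fun x => S *m zcut k x + Kcut k x) = VL leb (fun x => S *m zcut k x - Kcut k x).
Proof.
have Lp := L2vD (L2v_mul S (L2v_zcut k)) (L2v_Kcut k).
have Lm := L2vD (L2v_mul S (L2v_zcut k)) (L2vN (L2v_Kcut k)).
pose ft (f : RR -> 'cV[C]_N) xi : 'cV[C]_N := \col_i ft1 (fun x => f x i 0) xi.
have pl f : L2v leb f -> (forall x, ~ (`|x| <= k.+1%:R) -> f x = 0) ->
    VL leb (ft f) = ((2 * pi)%:E * VL leb f)%E.
  move=> Lf f0; rewrite !VL_sum; [|exact: L2v_mV Lf|].
    rewrite ge0_sume_distrr; last by move=> i _; exact: E2_ge0.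
    apply: eq_bigr => i _; have [mi oi] := Lf i.
    under [X in E2 _ X]eq_fun do rewrite mxE.
    by apply: (plancherel1_L2 mi oi (K := k.+1%:R)) => x /f0 ->; rewrite mxE.
  by move=> i; under eq_fun do rewrite mxE; have [mi oi] := Lf i; exact: mC_ft1.
have zs x : ~ (`|x| <= k.+1%:R) -> zcut k x = 0 by move=> hx; rewrite /zcut bumpk_supp// scale0r.
have Ks x : ~ (`|x| <= k.+1%:R) -> Kcut k x = 0.
  by move=> hx; rewrite /Kcut bumpk_supp// dbumpk_supp// !scale0r addr0.
have wb xi := osc_weight xi (smooth_continuous (@smooth_cut R k)) (ex_intro _ k.+1%:R (@bumpk_supp k)).
have wd xi := osc_weight xi (@dbumpk_cont k) (ex_intro _ k.+1%:R (@dbumpk_supp k)).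
pose zh xi := wint leb (fun x => expi (- (x * xi)) * (bumpk k x)%:C) z.
have e1 x i : (S *m zcut k x) i 0 = (bumpk k x)%:C * (S *m z x) i 0.
  by rewrite /zcut -scalemxAr mxE.
have rS xi i : rC leb (fun x => expi (- (x * xi)) * (S *m zcut k x) i 0).
  have [mi oi] := L2v_mul S Lz i; have := bounded_supp_rC (wb xi) mi oi.
  by under eq_fun do rewrite -mulrA -e1.
have rK xi i : rC leb (fun x => expi (- (x * xi)) * (Kcut k x) i 0).
  have [mi oi] := LK i; have [mj oj] := Lz i.
  have := rC_D (bounded_supp_rC (wb xi) mi oi) (bounded_supp_rC (wd xi) mj oj).
  by under eq_fun => x do rewrite -!mulrA -mulrDr; under [X in _ -> rC _ X]eq_fun do rewrite !mxE.
have eS xi i : Cint leb (fun x => expi (- (x * xi)) * (S *m zcut k x) i 0) = (S *m zh xi) i 0.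
  rewrite -(wint_mul S i (wb xi) Lz); apply: Cint_ext => x.
  by rewrite e1 mulrA.
have eK xi i : Cint leb (fun x => expi (- (x * xi)) * (Kcut k x) i 0) = ((0 +i* xi) *: zh xi) i 0.
  rewrite -[LHS]/(ft1 (fun x => Kcut k x i 0) xi) -fourier_weak !mxE; congr (_ * _).
  by apply: Cint_ext => x; rewrite mxE mulrA.
have ep xi : ft (fun x => S *m zcut k x + Kcut k x) xi = S *m zh xi + (0 +i* xi) *: zh xi.
  apply/colP => i; rewrite mxE [RHS]mxE -eS -eK -CintD//.
  by apply: Cint_ext => x; rewrite mxE mulrDr.
have em xi : ft (fun x => S *m zcut k x - Kcut k x) xi = S *m zh xi - (0 +i* xi) *: zh xi.
  apply/colP => i; rewrite mxE [RHS]mxE [X in _ = _ + X]mxE -eS -eK -CintB//.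
  by apply: Cint_ext => x; rewrite [X in _ * X]mxE [X in _ + X]mxE mulrBr.
have E : ((2 * pi)%:E * VL leb (fun x => S *m zcut k x + Kcut k x)%R =
    (2 * pi)%:E * VL leb (fun x => S *m zcut k x - Kcut k x)%R)%E.
  rewrite -(pl _ Lp); last by move=> x hx; rewrite zs// Ks// mulmx0 addr0.
  rewrite -(pl _ Lm); last by move=> x hx; rewrite zs// Ks// mulmx0 subr0.
  by apply: eq_integral => xi _; rewrite ep em vsq_skew.
by apply: (emul_cancel _ E); rewrite mulf_neq0// gt_eqF// pi_gt0.
Qed.

Lemma bumpk_cutoff : is_cutoff (fun M : R => [set x : RR | `|x| < M]) (bumpk : nat -> RR -> R).
Proof.
split.
- by move=> k; apply: measurable_continuous; exact: smooth_continuous (@smooth_cut R k).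
- by move=> k x; exact: norm_cut.
- by move=> k; exists k.+1%:R => x; exact: cut_supp.
- by move=> x; exact: cut_cvg1.
Qed.

Lemma zcut_cvg (w : RR -> C) : mC w -> (E2 leb w < +oo)%E ->
  E2 leb (fun x => (bumpk k x)%:C * w x - w x) @[k --> \oo] --> 0%E.
Proof.
move=> mw woo; have := cut_cvg bumpk_cutoff mw woo.
apply: cvg_trans; apply: near_eq_cvg; apply: nearW => k.
by apply: eq_integral => x _; rewrite sqnB.
Qed.

Lemma dzcut_cvg (w : RR -> C) : mC w -> (E2 leb w < +oo)%E ->
  E2 leb (fun x => (dbumpk k x)%:C * w x) @[k --> \oo] --> 0%E.
Proof.
move=> mw woo; have [M M0 hM] := @dbump_bounded R.
apply: (@cvge0_harmonic _ _ (M ^+ 2) (E2 leb w) _ _ woo); [by move=> k; exact: E2_ge0|exact: sqr_ge0|exact: E2_ge0|].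
move=> k; rewrite -exprMn; apply: E2_bounded_mul; [by case: (dbump_weight k)| |exact: sqr_ge0|exact: mw].
move=> x; rewrite sqnR -(real_normK (num_real (dbumpk k x))) ler_sqr ?nnegrE ?mulr_ge0//.
by rewrite /dbumpk normrM ger0_norm// ler_wpM2l.
Qed.

Lemma VLD_le2 d (T : measurableType d) (mu : {measure set T -> \bar R}) (u v : T -> 'cV[C]_N) : mV u -> mV v ->
  (VL mu (fun x => u x + v x)%R <= 2%:E * VL mu u + 2%:E * VL mu v)%E.
Proof.
move=> mu' mv; have muv : mV (fun x => u x + v x).
  by move=> i; under eq_fun do rewrite mxE; exact: mC_D.
have p (w : T -> 'cV[C]_N) x : (0 <= 2%:E * (vsq (w x))%:E :> \bar R)%E by rewrite -EFinM lee_fin mulr_ge0// vsq_ge0.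
have q (w : T -> 'cV[C]_N) x : (0 <= (vsq (w x))%:E :> \bar R)%E by rewrite lee_fin vsq_ge0.
have m2 (w : T -> 'cV[C]_N) : mV w -> measurable_fun setT (fun x => 2%:E * (vsq (w x))%:E)%E.
  by move=> mw; apply: measurable_funeM; apply/measurable_EFinP; exact: measurable_vsq.
rewrite /VL -!ge0_integralZl_EFin//; try by apply/measurable_EFinP; exact: measurable_vsq.
rewrite -ge0_integralD//; [|exact: m2..].
apply: ge0_int_le => //.
- by apply/measurable_EFinP; exact: measurable_vsq.
- by apply: emeasurable_funD; exact: m2.
- by move=> x; rewrite lee_fin vsq_ge0.
- by move=> x; rewrite -!EFinM -EFinD lee_fin vsqD_le2.
Qed.

Lemma VL_mul_le d (T : measurableType d) (mu : {measure set T -> \bar R}) (M : 'M[C]_N) : exists2 c : R, 0 <= c &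
  forall u : T -> 'cV[C]_N, mV u -> mV (fun x => M *m u x) -> (VL mu (fun x => M *m u x)%R <= c%:E * VL mu u)%E.
Proof.
have [c c0 hc] := vsq_mul_le M; exists c => // u mu' mMu.
have m2 (w : T -> 'cV[C]_N) : mV w -> measurable_fun setT (fun x => (vsq (w x))%:E).
  by move=> mw; apply/measurable_EFinP; exact: measurable_vsq.
rewrite /VL -ge0_integralZl_EFin//; [|by move=> x _; rewrite lee_fin vsq_ge0|exact: m2].
apply: ge0_int_le; [exact: m2|by apply: measurable_funeM; exact: m2|by move=> x; rewrite lee_fin vsq_ge0|].
by move=> x; rewrite -EFinM lee_fin.
Qed.

Lemma VL_cvg (u_ : nat -> RR -> 'cV[C]_N) (u : RR -> 'cV[C]_N) : (forall k, L2v leb (u_ k)) -> L2v leb u ->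
  VL leb (fun x => u_ k x - u x) @[k --> \oo] --> 0%E -> VL leb (u_ k) @[k --> \oo] --> VL leb u.
Proof.
move=> Lk Lu h; rewrite VL_sum; last exact: L2v_mV Lu.
have Ek k := VL_sum leb (L2v_mV (Lk k)).
under eq_fun do rewrite Ek.
have Ld k : L2v leb (fun x => u_ k x - u x) by exact: L2vD (Lk k) (L2vN Lu).
apply: cvge_sum => [i k|i|i]; [exact: E2_ge0|exact: E2_ge0|].
have [mi oi] := Lu i; apply: E2_cvg => //; first by move=> k; have [] := Lk k i.
apply: (cvge0_squeeze _ _ h) => k; first exact: E2_ge0.
rewrite (VL_sum _ (L2v_mV (Ld k))) (bigD1 i)//=.
have -> : E2 leb (fun x => u_ k x i 0 - u x i 0) = E2 leb (fun x => (u_ k x - u x) i 0).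
  by apply: E2_ext => x; rewrite !mxE.
by apply: leeDl; apply: sume_ge0 => j _; exact: E2_ge0.
Qed.

(** By polarization this says that the integral of [Re (S z, z')] is 0, since [K] is the weak
    derivative of [z]. It follows from [energy_cut]: the cut-off functions converge in L2, the
    derivative of the cut-off contributing nothing in the limit. *)
Lemma energy_identity : VL leb (fun x => S *m z x + K x) = VL leb (fun x => S *m z x - K x).
Proof.
have [c c0 hc] := VL_mul_le leb S.
have zc : VL leb (fun x => zcut k x - z x) @[k --> \oo] --> 0%E.
  under eq_fun => k do rewrite (VL_sum _ (L2v_mV (L2vD (L2v_zcut k) (L2vN Lz)))).
  apply: cvge0_sum => i; have [mi oi] := Lz i.
  by under eq_fun do under [X in E2 _ X]eq_fun do rewrite !mxE; exact: zcut_cvg.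
have kc : VL leb (fun x => Kcut k x - K x) @[k --> \oo] --> 0%E.
  under eq_fun => k do rewrite (VL_sum _ (L2v_mV (L2vD (L2v_Kcut k) (L2vN LK)))).
  apply: cvge0_sum => i; have [mi oi] := Lz i; have [mj oj] := LK i.
  have h := cvge0_comb 2 2 (zcut_cvg mj oj) (dzcut_cvg mi oi).
  apply: (cvge0_squeeze _ _ h) => k; first exact: E2_ge0.
  have -> : E2 leb (fun x => (Kcut k x - K x) i 0) =
      E2 leb (fun x => ((bumpk k x)%:C * K x i 0 - K x i 0) + (dbumpk k x)%:C * z x i 0).
    by apply: E2_ext => x; rewrite !mxE; ring.
  have [mb _ _] := bump_weight k; have [md _ _] := dbump_weight k.
  by apply: E2D_le2; [apply: mC_B => //; exact: mC_M|exact: mC_M].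
have LS := L2v_mul S Lz.
have dz k := L2vD (L2v_zcut k) (L2vN Lz); have dK k := L2vD (L2v_Kcut k) (L2vN LK).
have h0 := cvge0_comb (2 * c) 2 zc kc.
have cp : VL leb (fun x => S *m zcut k x + Kcut k x) @[k --> \oo] --> VL leb (fun x => S *m z x + K x).
  apply: VL_cvg; [by move=> k; exact: L2vD (L2v_mul S (L2v_zcut k)) (L2v_Kcut k)|exact: L2vD|].
  apply: (cvge0_squeeze _ _ h0) => k; first exact: VL_ge0.
  have -> : VL leb (fun x => S *m zcut k x + Kcut k x - (S *m z x + K x)) =
      VL leb (fun x => S *m (zcut k x - z x) + (Kcut k x - K x)).
    by apply: eq_integral => x _; rewrite mulmxBr opprD addrACA.
  apply: le_trans (VLD_le2 leb (L2v_mV (L2v_mul S (dz k))) (L2v_mV (dK k))) _.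
  rewrite leeD2r// EFinM -muleA lee_wpmul2l//; apply: hc; first exact: L2v_mV (dz k).
  exact: L2v_mV (L2v_mul S (dz k)).
have cm : VL leb (fun x => S *m zcut k x - Kcut k x) @[k --> \oo] --> VL leb (fun x => S *m z x - K x).
  apply: VL_cvg; [by move=> k; exact: L2vD (L2v_mul S (L2v_zcut k)) (L2vN (L2v_Kcut k))|exact: L2vD LS (L2vN LK)|].
  apply: (cvge0_squeeze _ _ h0) => k; first exact: VL_ge0.
  have -> : VL leb (fun x => S *m zcut k x - Kcut k x - (S *m z x - K x)) =
      VL leb (fun x => S *m (zcut k x - z x) + - (Kcut k x - K x)).
    by apply: eq_integral => x _; rewrite mulmxBr !opprD !opprK addrACA.
  apply: le_trans (VLD_le2 leb (L2v_mV (L2v_mul S (dz k))) (L2v_mV (L2vN (dK k)))) _.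
  have -> : VL leb (fun x => - (Kcut k x - K x)) = VL leb (fun x => Kcut k x - K x).
    by apply: eq_integral => x _; rewrite vsqN.
  rewrite leeD2r// EFinM -muleA lee_wpmul2l//; apply: hc; first exact: L2v_mV (dz k).
  exact: L2v_mV (L2v_mul S (dz k)).
have e : (fun k => VL leb (fun x => S *m zcut k x - Kcut k x)) = (fun k => VL leb (fun x => S *m zcut k x + Kcut k x)).
  by apply/funext => k; rewrite energy_cut.
rewrite e in cm.
exact: cvg_unique cp cm.
Qed.

End fourier_line.

(** * Spectral projections of the symmetrizer *)

Section diagonalizable.
Context {R : realType}.
Local Notation C := R[i].

(** In the basis of the rows of [T] the condition reads [(e_i - a)^N x_i = 0] for each
    coordinate. *)
Lemma geigenspace_support N (X T : 'M[C]_N) (e : 'rV[C]_N) a (x : 'rV[C]_N) i : T \in unitmx ->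
  X = invmx T *m diag_mx e *m T -> (x <= geigenspace X a)%MS -> e 0 i != a -> (x *m invmx T) 0 i = 0.
Proof.
case: N X T e x i => [|N] X T e x i; first by case: i.
move=> uT XE; rewrite /geigenspace /kermxpoly => /sub_kermxP.
have uV : invmx T \is a GRing.unit by rewrite -[_ \is a _]/(_ \in unitmx) unitmx_inv.
have -> : X = invmx T *m diag_mx e *m invmx (invmx T) by rewrite invmxK.
rewrite horner_mx_uconj// invmxK horner_mx_diag !mulmxA mul_mx_diag => h ei.
have := congr1 (fun v => (v *m invmx T) 0 i) h; rewrite mulmxK// mul0mx [LHS]mxE [X in _ * X]mxE [RHS]mxE => /eqP.
rewrite mulf_eq0 => /orP[/eqP//|].
by rewrite horner_exp hornerD hornerN hornerX hornerC expf_eq0 subr_eq0 (negbTE ei) andbF.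
Qed.

Lemma sum_geigen_sub N (X Y : 'M[C]_N) (s : seq C) (P : pred C) :
  (forall a, P a -> (geigenspace X a <= Y)%MS) -> (\sum_(a <- s | P a) geigenspace X a <= Y)%MS.
Proof.
move=> h; elim: s => [|a s IH]; first by rewrite big_nil sub0mx.
by rewrite big_cons; case: ifP => // /h ha; rewrite addsmx_sub ha.
Qed.

Lemma sub_sum_geigen N (X : 'M[C]_N) (s : seq C) (P : pred C) a : a \in s -> P a ->
  (geigenspace X a <= \sum_(b <- s | P b) geigenspace X b)%MS.
Proof.
elim: s => // b s IH; rewrite inE big_cons => /orP[/eqP <- Pa|/IH h Pa].
  by rewrite Pa addsmxSl.
by case: ifP => _; [exact: submx_trans (h Pa) (addsmxSr _ _)|exact: h].
Qed.

Lemma sum_geigen_support N (X T : 'M[C]_N) (e : 'rV[C]_N) (s : seq C) (P : pred C) (x : 'rV[C]_N) i :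
  T \in unitmx -> X = invmx T *m diag_mx e *m T -> (x <= \sum_(a <- s | P a) geigenspace X a)%MS ->
  ~~ P (e 0 i) -> (x *m invmx T) 0 i = 0.
Proof.
move=> uT XE xs Pe.
(* The hyperplane of vectors whose [i]-th coordinate is 0: it contains every summand, hence the
   sum. *)
pose Y := kermx (col i (invmx T)).
have h : (\sum_(a <- s | P a) geigenspace X a <= Y)%MS.
  apply: sum_geigen_sub => a Pa; apply/row_subP => j; apply/sub_kermxP.
  rewrite colE mulmxA -colE; apply/rowP => k; rewrite (ord1 k) [LHS]mxE [RHS]mxE.
  apply: (geigenspace_support uT XE (row_sub j (geigenspace X a))).
  by apply: contraNneq Pe => ->.
have /sub_kermxP := submx_trans xs h; rewrite colE mulmxA -colE => /rowP/(_ 0).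
by rewrite [LHS]mxE [RHS]mxE.
Qed.

Lemma diagonal_eigenvalue N (X T : 'M[C]_N) (e : 'rV[C]_N) i : T \in unitmx ->
  X = invmx T *m diag_mx e *m T -> (row i T <= geigenspace X (e 0 i))%MS /\ root (char_poly X) (e 0 i).
Proof.
move=> uT XE.
have h : row i T *m X = e 0 i *: row i T.
  by rewrite XE !mulmxA -row_mul mulmxV// -row_mul mul1mx row_diag_mx -scalemxAl -rowE.
have es : (row i T <= eigenspace X (e 0 i))%MS by apply/eigenspaceP.
split; first exact: submx_trans es (eigenspace_sub_geigen _ _).
rewrite -eigenvalue_root_char; apply/eigenvalueP; exists (row i T) => //.
apply/negP => /eqP r0; have := row_mul i T (invmx T); rewrite r0 mul0mx mulmxV// => /rowP/(_ i).
by rewrite !mxE eqxx => /eqP; rewrite oner_eq0.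
Qed.

Lemma eigvals_char N (X : 'M[C]_N) a : (a \in eigvals X) = root (char_poly X) a.
Proof.
rewrite /eigvals; case: closed_field_poly_normal => s /= ->.
by rewrite (monicP (char_poly_monic X)) scale1r root_prod_XsubC.
Qed.

Lemma char_poly_tr N (X : 'M[C]_N) : char_poly X^T = char_poly X.
Proof.
rewrite /char_poly -det_tr; congr (\det _); apply/matrixP => i j; rewrite !mxE eq_sym.
by [].
Qed.

Lemma invM N (X Y : 'M[C]_N) : X \in unitmx -> Y \in unitmx -> invmx (X *m Y) = invmx Y *m invmx X.
Proof.
move=> uX uY; have uXY : X *m Y \in unitmx by rewrite unitmx_mul uX.
by apply: (can_inj (mulKmx uXY)); rewrite mulmxV// -mulmxA (mulmxA Y) mulmxV// mul1mx mulmxV.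
Qed.

Lemma conj_mul N (X D E Y : 'M[C]_N) : Y *m X = 1%:M -> (X *m D *m Y) *m (X *m E *m Y) = X *m (D *m E) *m Y.
Proof. by move=> YX; rewrite !mulmxA -(mulmxA _ Y X) YX mulmx1. Qed.

Variable (N : nat).

(* In a unitary eigenbasis of M^T the projection parallel to E_+ keeps the coordinates of negative eigenvalues. *)
Lemma projneg_spectral (M : 'M[C]_N) : is_hermitian M -> M \in unitmx ->
  exists P (d : 'rV[C]_N), [/\ P \is unitarymx, M^T = invmx P *m diag_mx d *m P,
    (forall i, d 0 i != 0 /\ complex.Im (d 0 i) = 0) &
    projneg M = (invmx P *m diag_mx (\row_i (complex.Re (d 0 i) < 0)%R%:R) *m P)^T].
Proof.
move=> hM uM.
have hW : M^T \is hermsymmx.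
  apply/is_hermitianmxP; rewrite expr0 scale1r trmxK.
  by rewrite -[in LHS]hM /= map_trmx trmxK.
have WE : M^T = invmx (spectralmx M^T) *m diag_mx (spectral_diag M^T) *m spectralmx M^T.
  exact/orthomx_spectralP/hermitian_normalmx.
set P := spectralmx M^T in WE *; set d := spectral_diag M^T in WE *.
have uP : P \is unitarymx := spectral_unitarymx _.
have uPm : P \in unitmx := unitarymx_unit uP.
have dI i : complex.Im (d 0 i) = 0.
  have /mxOverP/(_ 0 i) := hermitian_spectral_diag_real hW.
  by rewrite -/d; case: (d 0 i) => a b /=; rewrite complex_real => /eqP.
have d0 i : d 0 i != 0.
  have uW : M^T \in unitmx by rewrite unitmx_tr.
  have : diag_mx d \in unitmx.
    by move: uW; rewrite WE !unitmx_mul unitmx_inv uPm andbT.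
  rewrite unitmxE det_diag unitfE => /prodf_neq0; exact.
have dR i : complex.Re (d 0 i) != 0.
  by apply: contraNneq (d0 i) => r0; apply/eqP/eq_ReIm.
exists P, d; split => //; rewrite /projneg; congr trmx.
(* Coordinates with negative eigenvalue vanish on [Epos], the others on [Eneg]. *)
have cap0 : (Eneg M :&: Epos M = 0)%MS.
  apply/eqP; rewrite -submx0; apply/row_subP => j.
  set x := row j _; have xc : (x <= Eneg M :&: Epos M)%MS := row_sub j _.
  have xn : (x <= Eneg M)%MS := submx_trans xc (capmxSl _ _).
  have xp : (x <= Epos M)%MS := submx_trans xc (capmxSr _ _).
  suff : x *m invmx P = 0 by move=> h; rewrite -(mulmxKV uPm x) h mul0mx sub0mx.
  apply/rowP => i; rewrite [RHS]mxE; have [neg|pos] := ltP (complex.Re (d 0 i)) 0.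
    by apply: (sum_geigen_support uPm WE xp); rewrite -leNgt ltW.
  by apply: (sum_geigen_support uPm WE xn); rewrite -leNgt.
(* The rows of [P] are eigenvectors, each of which the projection keeps or kills. *)
have PQ : P *m proj_mx (Eneg M) (Epos M) = diag_mx (\row_i (complex.Re (d 0 i) < 0)%R%:R) *m P.
  apply/row_matrixP => i; rewrite row_mul.
  have [ri rc] := diagonal_eigenvalue i uPm WE.
  have ei : d 0 i \in eigvals M by rewrite eigvals_char -char_poly_tr.
  rewrite [RHS]row_mul row_diag_mx mxE -scalemxAl -rowE.
  have [neg|pos|/eqP] := ltgtP (complex.Re (d 0 i)) 0; last by rewrite (negbTE (dR i)).
    rewrite scale1r; apply: proj_mx_id => //; apply: submx_trans ri _.
    exact: (@sub_sum_geigen _ _ _ (fun a => complex.Re a < 0)).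
  rewrite scale0r; apply: proj_mx_0 => //; apply: submx_trans ri _.
  exact: (@sub_sum_geigen _ _ _ (fun a => 0 < complex.Re a)).
by rewrite -mulmxA -PQ mulKmx.
Qed.

Lemma projneg_idem (M : 'M[C]_N) : is_hermitian M -> M \in unitmx -> projneg M *m projneg M = projneg M.
Proof.
move=> hM uM; have [P [d [uP _ _ ->]]] := projneg_spectral hM uM.
have uPm := unitarymx_unit uP.
set D := diag_mx _; have DD : D *m D = D.
  by rewrite mulmx_diag; congr diag_mx; apply/rowP => i; rewrite !mxE; case: (_ < _); rewrite ?mulr1 ?mulr0.
have XX := conj_mul D D (mulmxV uPm); rewrite DD in XX.
by move: XX; set X := _ *m D *m _ => XX; rewrite -trmx_mul XX.
Qed.

Lemma projneg_herm (M : 'M[C]_N) : is_hermitian M -> M \in unitmx -> is_hermitian (projneg M).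
Proof.
move=> hM uM; have [P [d [uP _ _ ->]]] := projneg_spectral hM uM.
rewrite /is_hermitian -map_trmx; congr trmx.
rewrite (invmx_unitary uP); set Q := diag_mx _.
have hQ : Q^t* = Q.
  rewrite tr_diag_mx map_diag_mx; congr diag_mx; apply/rowP => i; rewrite !mxE.
  by case: (_ < _); rewrite ?rmorph1 ?rmorph0.
by rewrite -[LHS]/((P^t* *m Q *m P)^t*) !adjM trmxCK hQ mulmxA.
Qed.

(** Where Rauch's matrix enters. With [M = Q^{-1} S Q^{-1}] one has [S^{-1} B = Q^{-1} M^{-1} Q], so
    [Q] maps the kernel of [G] onto [E_+(M^{-1}) = E_+(M)], which the projection kills. *)
Lemma projneg_kernel p (G : 'M[R]_(p, N)) (S B Q : 'M[C]_N) (h : 'cV[C]_N) : is_hermitian S -> S \in unitmx ->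
  is_hermitian Q -> Q \in unitmx -> Q *m Q = B -> (Cker G == Epos (invmx S *m B))%MS ->
  Cmx G *m h = 0 -> projneg (invmx Q *m S *m invmx Q) *m Q *m h = 0.
Proof.
move=> hS uS hQ uQ QB GE Gh; set M := invmx Q *m S *m invmx Q.
have uM : M \in unitmx by rewrite !unitmx_mul !unitmx_inv uQ uS.
have hVQ : (invmx Q)^t* = invmx Q by rewrite trmx_inv map_invmx hQ.
have hM : is_hermitian M by rewrite /is_hermitian !adjM hVQ hS mulmxA.
have SE : S = Q *m M *m Q by rewrite /M !mulmxA mulmxV// mul1mx mulmxKV.
move: M uM hM SE => M uM hM SE.
have [P [d [uP WE dR pE]]] := projneg_spectral hM uM.
have uPm := unitarymx_unit uP.
pose e : 'rV[C]_N := \row_i (d 0 i)^-1.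
have de : diag_mx d *m diag_mx e = 1%:M.
  rewrite mulmx_diag; apply/matrixP => i j; rewrite !mxE; case: (_ == _) => //.
  by rewrite divff//; case: (dR i).
have VW : invmx M^T = invmx P *m diag_mx e *m P.
  have k : M^T *m (invmx P *m diag_mx e *m P) = 1%:M.
    by rewrite WE (conj_mul _ _ (mulmxV uPm)) de mulmx1 mulVmx.
  have uMT : M^T \in unitmx by rewrite unitmx_tr.
  by rewrite -[RHS](mulKmx uMT) k mulmx1.
have VM : invmx S *m B = invmx Q *m invmx M *m Q.
  rewrite SE.
  have uQM : Q *m M \in unitmx by rewrite unitmx_mul uQ.
  by rewrite (invM uQM uQ) (invM uQ uM) -QB !mulmxA mulmxKV.
(* Its rows diagonalize the transpose of [S^{-1} B], with the inverses of the eigenvalues of [M]. *)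
pose T := P *m invmx Q^T.
have uT : T \in unitmx by rewrite unitmx_mul uPm unitmx_inv unitmx_tr.
have VT : invmx T = Q^T *m invmx P by rewrite /T invM ?invmxK// unitmx_inv unitmx_tr.
have XE : (invmx S *m B)^T = invmx T *m diag_mx e *m T.
  by rewrite VM !trmx_mul !trmx_inv VW VT /T !mulmxA.
have yE : (h^T <= Epos (invmx S *m B))%MS.
  rewrite -(eqmxP GE); apply/sub_kermxP.
  by rewrite -trmx_mul Gh trmx0.
(* The eigenvalues are real, so [1 / d_i] has the sign of [d_i], and a negative one does not
   contribute to [Epos]. *)
have w0 i : complex.Re (d 0 i) < 0 -> (h^T *m invmx T) 0 i = 0.
  move=> di; apply: (sum_geigen_support uT XE yE); rewrite mxE -leNgt.
  have [_] := dR i; move: di; case: (d 0 i) => a b /= a0 ->.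
  by rewrite expr0n addr0 /= expr2 invfM mulrA divff ?lt_eqF// mul1r invr_le0 ltW.
apply: trmx_inj; rewrite trmx0 pE 2!trmx_mul trmxK !mulmxA -(mulmxA _ Q^T) -VT.
rewrite -[RHS](mul0mx _ P); congr (_ *m _); apply/rowP => i.
rewrite mul_mx_diag [LHS]mxE [RHS]mxE [X in _ * X]mxE.
by case: ltP => [/w0 ->|_]; rewrite ?mul0r// mulr0.
Qed.

Lemma psd_Re (X : 'M[C]_N) (v : 'cV[C]_N) : psd X -> 0 <= complex.Re ((v^t* *m X *m v) 0 0).
Proof. by move=> /(_ v); case: (_ 0 0) => a b; rewrite lecE => /andP[]. Qed.

Lemma sqrt_unit (B Q : 'M[C]_N) (b : R) : 0 < b -> mx_ge B (b%:C)%:M -> Q *m Q = B -> Q \in unitmx.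
Proof.
move=> b0 hB QB; suff : B \in unitmx by rewrite -QB unitmx_mul => /andP[].
rewrite -row_free_unit -kermx_eq0; apply/eqP/row_matrixP => i; rewrite row0.
set y := row i _; have yB : y *m B = 0 by apply/sub_kermxP; exact: row_sub.
have := psd_Re (y^t*) hB; rewrite trmxCK mulmxBr yB sub0r mulNmx mul_mx_scalar -scalemxAl.
have -> : complex.Re ((- (b%:C *: (y *m y^t*))) 0 0) = - (b * vsq (y^t*)).
  by rewrite mxE cReN [X in complex.Re X]mxE cReM /= mul0r subr0 -dotvv /dotv trmxCK.
rewrite oppr_ge0 pmulr_rle0// => v0.
have /vsq_eq0 v00 : vsq (y^t*) = 0 by apply/eqP; rewrite eq_le v0 vsq_ge0.
by rewrite -[y]trmxCK v00 trmx0 map_mx0.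
Qed.

End diagonalizable.

(** * Energy estimates at a fixed frequency *)

Section energy.
Context {R : realType} {N : nat}.
Local Notation C := R[i].
Local Notation RR := (measurableTypeR R).
Local Notation leb := (@lebesgue_measure R).
Implicit Types (a b v : 'cV[C]_N) (X Y : 'M[C]_N) (z K r : RR -> 'cV[C]_N).

Lemma dotv_adj X a b : dotv (X *m a) b = dotv a (X^t* *m b).
Proof. by rewrite /dotv adjM !mulmxA. Qed.

Lemma dotvZr (t : R) a b : dotv a (t%:C *: b) = t * dotv a b.
Proof. by rewrite /dotv -scalemxAr [X in complex.Re X]mxE cReM /= mul0r subr0. Qed.

(* AM-GM *)
Lemma dotv_ge (e : R) a b : 0 < e -> - (e * vsq a) - e^-1 / 4 * vsq b <= dotv a b.
Proof.
move=> e0; have := vsq_ge0 (((2 * e)%:C) *: a + b); rewrite vsqD vsqZ sqnR.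
have -> : dotv ((2 * e)%:C *: a) b = 2 * e * dotv a b by rewrite dotvC dotvZr dotvC.
set p := vsq a; set q := vsq b; set s := dotv a b => h.
rewrite -subr_ge0; have -> : s - (- (e * p) - e^-1 / 4 * q) = e^-1 / 4 * ((2 * e) ^+ 2 * p + 2 * (2 * e * s) + q).
  by field; rewrite gt_eqF.
by rewrite mulr_ge0// divr_ge0// invr_ge0 ltW.
Qed.

Definition weak_eq z K := forall chi, line_test chi ->
  - wint leb (fun x => ('D_1 chi x)%:C) z = wint leb (fun x => (chi x)%:C) K.

(** The pointwise inequality is integrated with [(S z, K)] written by polarization; the two squared
    norms are finite and equal by [energy_identity], so they cancel, and so does the common factor
    4. *)
Lemma energy_bound (S : 'M[C]_N) z K r (a c : R) : is_hermitian S -> L2v leb z -> L2v leb K -> L2v leb r ->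
  weak_eq z K -> 0 <= a -> 0 <= c ->
  (forall x, a * vsq (z x) <= dotv (S *m z x) (K x) + c * vsq (r x)) ->
  (a%:E * VL leb z <= c%:E * VL leb r)%E.
Proof.
move=> hS Lz LK Lr zK a0 c0 h.
have Ls := L2v_mul S Lz; have Lp := L2vD Ls LK; have Lm := L2vD Ls (L2vN LK).
have E := energy_identity Lz LK zK hS.
have mE (w : RR -> 'cV[C]_N) : L2v leb w -> measurable_fun setT (fun x => (vsq (w x))%:E).
  by move=> Lw; apply/measurable_EFinP; apply: measurable_vsq; exact: L2v_mV Lw.
have q0 (w : RR -> 'cV[C]_N) x : (0 <= (vsq (w x))%:E)%E by rewrite lee_fin vsq_ge0.
have foo (w : RR -> 'cV[C]_N) : L2v leb w -> (VL leb w < +oo)%E.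
  by move=> Lw; apply: lty_VL; [exact: L2v_mV Lw|move=> i; have [] := Lw i].
have k (w w' : RR -> 'cV[C]_N) (t : R) : L2v leb w -> L2v leb w' -> 0 <= t ->
    (\int[leb]_x ((vsq (w x))%:E + t%:E * (vsq (w' x))%:E) = VL leb w + t%:E * VL leb w')%E.
  move=> Lw Lw' t0; rewrite ge0_integralD//; last 3 first.
  - exact: mE.
  - by move=> x _; rewrite mule_ge0.
  - by apply: measurable_funeM; exact: mE.
  by rewrite ge0_integralZl_EFin//; exact: mE.
have : (VL leb (fun x => S *m z x - K x)%R + (4 * a)%:E * VL leb z <=
    VL leb (fun x => S *m z x + K x)%R + (4 * c)%:E * VL leb r)%E.
  rewrite -!k ?mulr_ge0//; apply: ge0_int_le.
  - by apply: emeasurable_funD; [exact: mE|apply: measurable_funeM; exact: mE].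
  - by apply: emeasurable_funD; [exact: mE|apply: measurable_funeM; exact: mE].
  - by move=> x; rewrite -EFinM -EFinD lee_fin addr_ge0 ?mulr_ge0 ?vsq_ge0.
  - move=> x; rewrite -!EFinM -!EFinD lee_fin.
    have := polarization (S *m z x) (K x); have := h x; lra.
rewrite E; have : (VL leb (fun x => S *m z x - K x) \is a fin_num).
  by rewrite ge0_fin_numE ?VL_ge0//; exact: foo.
move=> fn; rewrite leeD2lE// !EFinM -!muleA; move: (foo _ Lz) (foo _ Lr).
have := VL_ge0 leb z; have := VL_ge0 leb r.
case: (VL leb z) => [s||]//; case: (VL leb r) => [t||]// _ _ _ _.
by rewrite -!EFinM !lee_fin ler_pM2l.
Qed.

Lemma wint_mulv (q : RR -> C) X z : bounded_supp leb q -> L2v leb z ->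
  wint leb q (fun x => X *m z x) = X *m wint leb q z.
Proof. by move=> bq Lz; apply/colP => i; rewrite -wint_mul// mxE. Qed.

Lemma wintD (q : RR -> C) z r : bounded_supp leb q -> L2v leb z -> L2v leb r ->
  wint leb q (fun x => z x + r x) = wint leb q z + wint leb q r.
Proof.
move=> bq Lz Lr; apply/colP => i; rewrite !mxE; have [m1 o1] := Lz i; have [m2 o2] := Lr i.
rewrite -CintD; [|exact: bounded_supp_rC..].
by apply: Cint_ext => x; rewrite mxE mulrDr.
Qed.

Lemma L2v_ind (D : set R) z : measurable (D : set RR) -> L2v leb z -> L2v leb (fun x => (\1_D x : R)%:C *: z x).
Proof.
move=> mD Lz i; have [mi oi] := Lz i; under eq_fun do rewrite mxE.
have mI : mC (fun x : RR => (\1_D x : R)%:C) by apply: mC_R; exact: measurable_indic.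
split; first exact: mC_M.
apply: le_lt_trans (E2_bounded_mul leb mI (M := 1) _ _ mi) _ => //; last by rewrite mul1e.
by move=> x; rewrite sqnR indicE; case: (_ \in _); rewrite ?expr1n ?expr0n.
Qed.

Lemma L2vZ (c : C) z : L2v leb z -> L2v leb (fun x => c *: z x).
Proof. by move=> Lz; under eq_fun do rewrite -mul_scalar_mx; exact: L2v_mul. Qed.

Lemma measurable_lt0 : measurable ([set x : R | x < 0] : set RR).
Proof.
have -> : [set x : R | x < 0] = `]-oo, 0[%classic by apply/seteqP; split => x /=; rewrite in_itv.
exact: measurable_itv.
Qed.
#[local] Hint Resolve measurable_lt0 : core.

Variables (A S Q P : 'M[C]_N) (a eps : R).
Hypotheses (a0 : 0 < a) (eps0 : 0 < eps) (hS : is_hermitian S) (uS : S \in unitmx) (hQ : is_hermitian Q)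
  (hP : is_hermitian P) (PP : P *m P = P).
Hypothesis coercive : forall v, a * vsq v <= dotv (S *m v) (A *m v).

(** [S] cancels its inverse in the penalization and the hermitian [P], [Q] pass to the other side.
    For [w = Q v] the result is [|P Q v|^2] by [dotv_proj]: the penalization is dissipative for the
    symmetrizer. *)
Lemma dotv_penal v w : dotv (S *m v) (invmx S *m Q *m P *m w) = dotv (P *m Q *m v) w.
Proof.
rewrite -!mulmxA dotv_mul// mulmxV// mulmx1 -/(dotv v _).
by rewrite [in RHS]dotv_adj hP [in RHS]dotv_adj hQ.
Qed.

Lemma dotv_proj v : dotv (P *m v) v = vsq (P *m v).
Proof. by rewrite -dotvv [in RHS]dotv_adj hP mulmxA PP dotv_adj hP. Qed.

Let I (x : R) : R := \1_[set x : R | x < 0] x.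

(** The penalization contributes a nonnegative term, which is dropped, so the constants are free of
    [eps]. Half of the coercivity absorbs the source by [dotv_ge]. *)
Lemma penalized_bound (Z F : RR -> 'cV[C]_N) (M : R) : 0 <= M -> L2v leb Z -> L2v leb F ->
  (forall v, vsq (S *m v) <= M * vsq v) ->
  weak_eq Z (fun x => A *m Z x + F x + (I x)%:C *: (invmx S *m Q *m P *m (eps^-1%:C *: (Q *m Z x)))) ->
  ((a / 2)%:E * VL leb Z <= (a^-1 / 2 * M)%:E * VL leb F)%E.
Proof.
move=> M0 LZ LF SM zK.
have LK : L2v leb (fun x => A *m Z x + F x + (I x)%:C *: (invmx S *m Q *m P *m (eps^-1%:C *: (Q *m Z x)))).
  apply: L2vD; first by apply: L2vD => //; exact: L2v_mul.
  by apply: L2v_ind => //; apply: L2v_mul; apply: L2vZ; exact: L2v_mul.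
apply: (energy_bound hS LZ LK LF zK).
- by rewrite divr_ge0// ltW.
- by rewrite mulr_ge0// divr_ge0// invr_ge0 ltW.
move=> x; rewrite !dotvDr dotvZr dotv_penal dotvZr -[P *m Q *m _]mulmxA dotv_proj.
have h1 := coercive (Z x).
have h2 : - (a / 2 * vsq (Z x)) - a^-1 / 2 * M * vsq (F x) <= dotv (S *m Z x) (F x).
  have a20 : 0 < a / 2 by rewrite divr_gt0.
  rewrite dotv_adj hS; apply: le_trans (dotv_ge (Z x) (S *m F x) a20).
  rewrite lerD2l lerN2; have -> : (a / 2)^-1 / 4 = a^-1 / 2 by field; rewrite gt_eqF.
  by rewrite -[leRHS]mulrA ler_wpM2l// divr_ge0// invr_ge0 ltW.
have h3 : 0 <= I x * (eps^-1 * vsq (P *m (Q *m Z x))).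
  by rewrite !mulr_ge0 ?vsq_ge0// invr_ge0 ltW.
move: h1 h2 h3; set t1 := dotv _ _; set t2 := dotv _ _; set t3 := I x * _; set t4 := _ * vsq (F x).
set t5 := vsq (Z x); lra.
Qed.

(** Here the source stands behind the projection [P], so the penalization term absorbs it entirely
    and the coercivity stays whole. *)
Lemma difference_bound (Z r : RR -> 'cV[C]_N) : L2v leb Z -> L2v leb r ->
  weak_eq Z (fun x => A *m Z x + (I x)%:C *: (invmx S *m Q *m P *m (eps^-1%:C *: (Q *m Z x) + r x))) ->
  (a%:E * VL leb Z <= (eps / 4)%:E * VL leb r)%E.
Proof.
move=> LZ Lr zK.
have LK : L2v leb (fun x => A *m Z x + (I x)%:C *: (invmx S *m Q *m P *m (eps^-1%:C *: (Q *m Z x) + r x))).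
  apply: L2vD; first exact: L2v_mul.
  by apply: L2v_ind => //; apply: L2v_mul; apply: L2vD => //; apply: L2vZ; exact: L2v_mul.
apply: (energy_bound hS LZ LK Lr zK); [exact: ltW|by rewrite divr_ge0// ltW|move=> x].
rewrite dotvDr dotvZr dotv_penal dotvDr dotvZr -[P *m Q *m _]mulmxA dotv_proj.
have h1 := coercive (Z x).
have e1 : 0 < eps^-1 by rewrite invr_gt0.
(* With weight [eps^-1] the negative square cancels the penalization exactly and leaves [eps / 4] on
   the source. *)
have h2 := dotv_ge (P *m (Q *m Z x)) (r x) e1; rewrite invrK in h2.
have h3 : 0 <= eps / 4 * vsq (r x) by rewrite mulr_ge0 ?vsq_ge0// divr_ge0// ltW.
move: h1 h2 h3; set t1 := dotv (S *m _) _; set t2 := dotv _ (r x); set t3 := vsq (r x).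
set t4 := vsq (P *m _); set t5 := vsq (Z x).
by rewrite /I indicE; case: (_ \in _); rewrite /= ?mul1r ?mul0r; lra.
Qed.

End energy.

(** * The profile on the left half-line *)

Section integration_by_parts.
Context {R : realType}.
Local Notation C := R[i].
Local Notation RR := (measurableTypeR R).
Local Notation leb := (@lebesgue_measure R).

(** [p] is controlled only for [x < 0], with one-sided limits at 0. Extended by these limits, [p]
    and [q] are continuous on [[b, 0]], where the fundamental theorem applies to [chi p]. *)
Lemma ibp_left (chi p q : R -> R) (h l : R) : line_test chi ->
  (forall x : R, x < 0 -> is_derive x (1 : R) p (q x)) -> (forall x : R, x < 0 -> {for x, continuous q}) ->
  p x @[x --> 0^'-] --> h -> q x @[x --> 0^'-] --> l ->
  \int[leb]_x (\1_[set x : R | x < 0] x * ('D_1 chi x * p x + chi x * q x)) = chi 0 * h.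
Proof.
move=> lchi dp cq ph ql; have [schi [M hM]] := lchi.
(* To the left of the support of [chi], so that the lower boundary term vanishes; the absolute value
   and the [+ 1] ensure [b < 0]. *)
pose b := - (`|M| + 1); have b0 : b < 0 by rewrite oppr_lt0 ltr_wpDl.
pose p1 x := if x < 0 then p x else h. pose q1 x := if x < 0 then q x else l.
pose f x := 'D_1 chi x * p1 x + chi x * q1 x. pose F x := chi x * p1 x.
have chi0 x : x <= b -> chi x = 0.
  move=> xb; apply: hM => xM; have := ler_norm M; have := ler_norm (- x); rewrite normrN.
  by move: xb xM; rewrite /b; lra.
have nz (x : R) : x < 0 -> \forall y \near x, y < 0 by move=> x0; exact: lt_nbhsl.
have dF (x : R) : x < 0 -> is_derive x (1 : R) F (f x).
  move=> x0; apply: (@near_eq_is_derive _ _ _ (fun x => chi x * p x)).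
    by near=> y; rewrite /F /p1 ifT//; near: y; exact: nz.
  have dc : is_derive x (1 : R) chi ('D_1 chi x) by apply: DeriveDef => //; exact: smooth_derivable.
  apply: is_derive_eq (is_deriveM dc (dp x x0)) _.
  by rewrite /f /p1 /q1 x0 /GRing.scale /=; ring.
have cl (u : R -> R) (v : R) : u x @[x --> 0^'-] --> v -> (if (x : R) < 0 then u x else v) @[x --> 0^'-] --> v.
  move=> uv; apply: cvg_trans uv; apply: near_eq_cvg; near=> x.
  by rewrite ifT//; near: x; exact: nbhs_left_lt.
have cp1 (x : R) : x < 0 -> {for x, continuous p}.
  by move=> /dp dx; apply/differentiable_continuous/derivable1_diffP; exact: (@ex_derive _ _ _ _ _ _ _ dx).
have cc (u : R -> R) (v x : R) : x < 0 -> {for x, continuous u} -> {for x, continuous (fun y : R => if y < 0 then u y else v)}.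
  move=> x0 cu; rewrite /prop_for /continuous_at x0; apply: cvg_trans cu; apply: near_eq_cvg.
  by near=> y; rewrite ifT//; near: y; exact: nz.
have cD : continuous (fun x => 'D_1 chi x) by apply: smooth_continuous; exact: smooth_derive.
have cchi : continuous chi by exact: smooth_continuous.
have f_cont : {within `[b, 0], continuous f}.
  apply/continuous_within_itvP => //; split.
  - move=> x; rewrite in_itv/= => /andP[_ x0].
    apply: cvgD; apply: cvgM; [exact: cD|exact: cc (cp1 x x0)|exact: cchi|exact: cc (cq x x0)].
  - have bx := cc p h b b0 (cp1 b b0); have bq := cc q l b b0 (cq b b0).
    apply: cvg_at_right_filter; apply: cvgD; apply: cvgM; [exact: cD|exact: bx|exact: cchi|exact: bq].
  - rewrite /f /p1 /q1 ltxx; apply: cvgD; apply: cvgM.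
    + exact: cvg_at_left_filter (cD 0).
    + exact: cl.
    + exact: cvg_at_left_filter (cchi 0).
    + exact: cl.
have F_der : derivable_oo_LRcontinuous F b 0.
  split.
  - by move=> x; rewrite in_itv/= => /andP[_ x0]; exact: (@ex_derive _ _ _ _ _ _ _ (dF x x0)).
  - apply: cvg_at_right_filter; apply: cvgM; [exact: cchi|exact: cc p h b b0 (cp1 b b0)].
  - rewrite /F /p1 ltxx; apply: cvgM; [exact: cvg_at_left_filter (cchi 0)|exact: cl].
have dFf : {in `]b, 0[, F^`()%classic =1 f}.
  move=> x; rewrite in_itv/= => /andP[_ x0]; rewrite derive1E; exact: (@derive_val _ _ _ _ _ _ _ (dF x x0)).
have := continuous_FTC2 b0 f_cont F_der dFf.
rewrite /F /p1 ltxx b0 (chi0 b)// mul0r sube0 => E.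
rewrite -[RHS]/(fine (chi 0 * h)%:E) -E /Rintegral; congr fine.
have mf : measurable_fun `[b, 0[ (f : RR -> RR).
  apply: (@measurable_funS _ _ _ _ `[b, 0]); first exact: measurable_itv.
    by move=> x /=; rewrite !in_itv/= => /andP[-> /ltW].
  exact: subspace_continuous_measurable_fun.
rewrite -(integral_itv_bndo_bndc (f := fun x => (f x)%:E)); last exact/measurable_EFinP.
rewrite [RHS]integral_mkcond; apply: eq_integral => x _; rewrite patchE indicE.
have -> : (x \in [set x | x < 0]) = (x < 0) by apply/idP/idP; rewrite inE.
have -> : (x \in `[b, 0[%classic) = (b <= x < 0) by rewrite mem_setE in_itv.
case: (ltP x 0) => x0; rewrite ?andbF ?andbT /= ?mul0r// mul1r; case: (leP b x) => bx.
  by rewrite /f /p1 /q1 x0.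
rewrite chi0 ?(ltW bx)// mul0r addr0 (derive_supp hM) ?mul0r//.
by move=> xM; have := ler_norm M; have := ler_norm (- x); rewrite normrN; move: bx xM; rewrite /b; lra.
Unshelve. all: by end_near.
Qed.

End integration_by_parts.

(** Origin of the source on [x < 0]. Solving the profile equation for the derivative and writing
    [P^+ = 1 - P^-], the function [u = Q^{-1} v] satisfies [u' = A u] up to the term
    [S^{-1} Q P Q^{-1} S A u], whose leading matrix is that of the penalization. *)
Lemma profile_matrix (R : realType) N (A P M Q S : 'M[R[i]]_N) (v : 'cV[R[i]]_N) : M \in unitmx -> Q \in unitmx ->
  S = Q *m M *m Q -> invmx Q *m (invmx M *m (1%:M - P) *m M *m (Q *m A *m invmx Q) *m v) =
  A *m (invmx Q *m v) - invmx S *m Q *m P *m (invmx Q *m S *m A *m (invmx Q *m v)).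
Proof.
move=> uM uQ ->; have uQM : Q *m M \in unitmx by rewrite unitmx_mul uQ uM.
have -> : invmx (Q *m M *m Q) *m Q = invmx Q *m invmx M by rewrite invM// invM// mulmxA mulmxKV.
rewrite -[Q *m M *m Q]mulmxA (mulKmx uQ) mulmxBr mulmx1 !mulmxBl mulmxBr (mulVmx uM) mul1mx.
congr (_ - _); last by rewrite !mulmxA.
by rewrite !mulmxA (mulVmx uQ) mul1mx.
Qed.

Section left_ode.
Context {R : realType} {N : nat}.
Local Notation C := R[i].
Local Notation RR := (measurableTypeR R).
Local Notation leb := (@lebesgue_measure R).
Local Notation ind x := ((\1_[set x : R | x < 0] x : R)%:C).

Definition ccvg (F : set_system R) (v : R -> 'cV[C]_N) (l : 'cV[C]_N) := forall i,
  complex.Re (v x i 0) @[x --> F] --> complex.Re (l i 0) /\ complex.Im (v x i 0) @[x --> F] --> complex.Im (l i 0).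

Lemma ccvg_mul (F : set_system R) {FF : Filter F} (L : 'M[C]_N) v l : ccvg F v l -> ccvg F (fun x => L *m v x) (L *m l).
Proof.
move=> vl i.
have s (s : seq 'I_N) : complex.Re (\sum_(j <- s) L i j * v x j 0) @[x --> F] --> complex.Re (\sum_(j <- s) L i j * l j 0) /\
    complex.Im (\sum_(j <- s) L i j * v x j 0) @[x --> F] --> complex.Im (\sum_(j <- s) L i j * l j 0).
  elim: s => [|j s [IH1 IH2]].
    by rewrite big_nil; under eq_fun do rewrite big_nil; under [X in _ /\ cvg_to (fmap X _) _]eq_fun do rewrite big_nil; split; exact: cvg_cst.
  have [c1 c2] := vl j; split.
    under eq_fun do rewrite big_cons cReD cReM; rewrite big_cons cReD cReM.
    by apply: cvgD => //; apply: cvgB; apply: cvgM => //; exact: cvg_cst.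
  under eq_fun do rewrite big_cons cImD cImM; rewrite big_cons cImD cImM.
  by apply: cvgD => //; apply: cvgD; apply: cvgM => //; exact: cvg_cst.
by have [s1 s2] := s (index_enum 'I_N); rewrite mxE; split; under eq_fun do rewrite mxE.
Qed.

(** Extension by 0 to the right drops from [v0] to 0 at the origin, hence the jump [- v0]. *)
Lemma left_weak (v : R -> 'cV[C]_N) (L : 'M[C]_N) (v0 : 'cV[C]_N) :
  (forall x : R, x < 0 -> cderivable v x /\ cderive v x = L *m v x) -> cvg_left0 v v0 ->
  L2v leb (fun x : RR => ind x *: v x) -> forall chi, line_test chi ->
  - wint leb (fun x => ('D_1 chi x)%:C) (fun x => ind x *: v x) =
  wint leb (fun x => (chi x)%:C) (fun x => ind x *: (L *m v x)) - (chi 0)%:C *: v0.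
Proof.
move=> dv vv0 Lv chi lchi.
have vx (x : R) : x < 0 -> ccvg (nbhs x) v (v x).
  move=> x0 i; have [/(_ i)[d1 d2] _] := dv x x0.
  by split; apply/differentiable_continuous/derivable1_diffP.
have Lc (x : R) : x < 0 -> ccvg (nbhs x) (fun x => L *m v x) (L *m v x) by move=> /vx; exact: ccvg_mul.
have L0 : ccvg (0^'-) (fun x => L *m v x) (L *m v0) by exact: ccvg_mul.
have LL : L2v leb (fun x : RR => ind x *: (L *m v x)).
  by under eq_fun do rewrite scalemxAr; exact: L2v_mul.
have bchi := line_test_weight lchi; have bd := line_test_weight (line_test_derive lchi).
apply/colP => i; rewrite !mxE.
have [m1 o1] := Lv i; have [m2 o2] := LL i.
have [r1 r2] := bounded_supp_rC bd m1 o1; have [r3 r4] := bounded_supp_rC bchi m2 o2.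
have dre (x : R) : x < 0 -> is_derive x (1 : R) (fun x => complex.Re (v x i 0)) (complex.Re ((L *m v x) i 0)).
  move=> x0; have [/(_ i)[d1 d2] <-] := dv x x0; apply: DeriveDef => //.
  by rewrite mxE /= derive1E.
have dim (x : R) : x < 0 -> is_derive x (1 : R) (fun x => complex.Im (v x i 0)) (complex.Im ((L *m v x) i 0)).
  move=> x0; have [/(_ i)[d1 d2] <-] := dv x x0; apply: DeriveDef => //.
  by rewrite mxE /= derive1E.
have h1 := ibp_left lchi dre (fun x x0 => (Lc x x0 i).1) (vv0 i).1 (L0 i).1.
have h2 := ibp_left lchi dim (fun x x0 => (Lc x x0 i).2) (vv0 i).2 (L0 i).2.
have E : Cint leb (fun x => ('D_1 chi x)%:C * (ind x *: v x) i 0 + (chi x)%:C * (ind x *: (L *m v x)) i 0) =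
    (chi 0)%:C * v0 i 0.
  apply: eq_ReIm.
    rewrite [RHS]cReM /= mul0r subr0 -h1; apply: Rint_ext => x.
    by rewrite [(ind x *: v x) i 0]mxE [(ind x *: (L *m v x)) i 0]mxE cReD !cReM /=; ring.
  rewrite [RHS]cImM /= mul0r addr0 -h2; apply: Rint_ext => x.
  by rewrite [(ind x *: v x) i 0]mxE [(ind x *: (L *m v x)) i 0]mxE cImD !cImM /=; ring.
rewrite -E CintD; [|exact: bounded_supp_rC bd m1 o1|exact: bounded_supp_rC bchi m2 o2].
by rewrite opprD addrCA subrr addr0.
Qed.

Section frozen.
Variables (A S Q B : 'M[C]_N) (p : nat) (G : 'M[R]_(p, N)).
Hypotheses (hS : is_hermitian S) (uS : S \in unitmx) (hQ : is_hermitian Q) (uQ : Q \in unitmx) (QB : Q *m Q = B)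
  (GE : (Cker G == Epos (invmx S *m B))%MS).
Let M := invmx Q *m S *m invmx Q.
Let P := projneg M.

Lemma M_unit : M \in unitmx.
Proof. by rewrite !unitmx_mul !unitmx_inv uQ uS. Qed.

Lemma M_herm : is_hermitian M.
Proof.
have hVQ : (invmx Q)^t* = invmx Q by rewrite trmx_inv map_invmx hQ.
by rewrite /is_hermitian !adjM hVQ hS mulmxA.
Qed.

(** The jump of the profile is exactly the opposite of the trace [h], so that it will cancel the
    jump of the solution on the right. *)
Lemma profile_weak (v : R -> 'cV[C]_N) (h : 'cV[C]_N) : Cmx G *m h = 0 ->
  (forall x : R, x < 0 -> [/\ (1%:M - P) *m v x = v x, cderivable v x &
     M *m cderive v x - (1%:M - P) *m M *m (Q *m A *m invmx Q) *m v x = 0]) ->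
  cvg_left0 v ((1%:M - P) *m Q *m h) ->
  L2v leb (fun x : RR => ind x *: (invmx Q *m v x)) -> forall chi, line_test chi ->
  let u x := ind x *: (invmx Q *m v x) in
  - wint leb (fun x => ('D_1 chi x)%:C) u =
  wint leb (fun x => (chi x)%:C) (fun x => A *m u x - invmx S *m Q *m P *m (invmx Q *m S *m A *m u x)) - (chi 0)%:C *: h.
Proof.
move=> Gh dv vh Lu chi lchi u.
have uM := M_unit.
pose L := invmx M *m (1%:M - P) *m M *m (Q *m A *m invmx Q).
have Lv : L2v leb (fun x : RR => ind x *: v x).
  have := L2v_mul Q Lu.
  by under eq_fun do rewrite -scalemxAr mulmxA mulmxV// mul1mx.
have dv' (x : R) : x < 0 -> cderivable v x /\ cderive v x = L *m v x.
  move=> /dv[_ d1 d2]; split => //; rewrite -[LHS](mulKmx uM); move/eqP: d2; rewrite subr_eq0 => /eqP ->.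
  by rewrite /L !mulmxA.
have := left_weak dv' vh Lv lchi.
move/(congr1 (fun w => invmx Q *m w)); rewrite mulmxN mulmxBr -scalemxAr.
(* The boundary condition on [h] removes the projection from the trace of [v], and [Q^{-1}] then
   gives back [h] itself. *)
have ph : P *m Q *m h = 0 by exact: projneg_kernel hS uS hQ uQ QB GE Gh.
have -> : invmx Q *m ((1%:M - P) *m Q *m h) = h.
  by rewrite -mulmxA mulmxBl mul1mx (mulmxA P) ph subr0 mulKmx.
have bchi := line_test_weight lchi; have bd := line_test_weight (line_test_derive lchi).
have LL : L2v leb (fun x : RR => ind x *: (L *m v x)).
  by under eq_fun do rewrite scalemxAr; exact: L2v_mul.
rewrite -!wint_mulv// => E.
rewrite (_ : u = (fun x => invmx Q *m (ind x *: v x))); last by apply/funext => x; rewrite /u -scalemxAr.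
rewrite E; congr (wint _ _ _ - _); apply/funext => x.
rewrite -!scalemxAr -scalerBr; congr (_ *: _).
by apply: profile_matrix => //; rewrite /M !mulmxA (mulmxV uQ) mul1mx (mulmxKV uQ).
Qed.

End frozen.
End left_ode.

(** * Bounds uniform in the frequency *)

Section frequencies.
Context {R : realType} {n N p : nat}.
Local Notation C := R[i].
Local Notation freq := (R * 'rV[R]_n.+1)%type.

Definition half_sphere : set freq := [set z | 0 <= z.1 /\ `|z| = 1].

Lemma half_sphere_compact : compact half_sphere.
Proof.
have sub : half_sphere `<=` [set x : R | -1 <= x <= 1] `*` [set v : 'rV[R]_n.+1 | `|v| <= 1].
  move=> [x v] [/= x0 xv]; rewrite prod_normE/= in xv.
  by split => /=; [rewrite -ler_norml|]; rewrite -xv le_max lexx ?orbT.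
apply: subclosed_compact sub.
- rewrite (_ : half_sphere = (fun z : freq => z.1) @^-1` [set x | 0 <= x] `&` (fun z : freq => `|z|) @^-1` [set 1])//.
  apply: closedI.
    by apply: preimage_closed => [z _|]; [exact: cvg_fst|exact: closed_ge].
  by apply: preimage_closed => [z _|]; [exact: norm_continuous|exact: closed_eq].
- apply: compact_setX; first by rewrite (_ : [set x | _] = `[-1, 1]%classic); [exact: segment_compact|apply/seteqP; split => x /=; rewrite in_itv].
  apply: bounded_closed_compact.
    by exists 1; split => // M M1 v /= v1; rewrite (le_trans v1)// ltW.
  rewrite (_ : [set v | _] = (fun v : 'rV[R]_n.+1 => `|v|) @^-1` [set x | x <= 1])//.
  by apply: preimage_closed => [z _|]; [exact: norm_continuous|exact: closed_le].
Qed.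

(** Homogeneity of degree 0 reduces to [half_sphere], compact because it includes [gamma = 0];
    smoothness up to that boundary provides a continuous extension around it. *)
Lemma homogeneous_bounded (f : freq -> R) : smooth_on (@freq_dom R n) f ->
  (forall (k : R) z, 0 < k -> freq_dom z -> f (k *: z) = f z) ->
  exists2 M : R, 0 <= M & forall z, freq_dom z -> `|f z| <= M.
Proof.
move=> [U [h [oU ZU /(_ 0%N)[hc _] fh]]] hom.
have sub z : half_sphere z -> freq_dom z.
  by move=> [z0 z1]; split => //; rewrite -normr_eq0 z1 oner_neq0.
have : compact (h @` half_sphere).
  apply: continuous_compact half_sphere_compact; apply: continuous_in_subspaceT => z /set_mem hz.
  exact/hc/ZU/sub.
move=> /compact_bounded[M [_ HM]]; exists (`|M| + 1); first by rewrite addr_ge0.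
move=> z zd; have [z1 z0] := zd; have nz : 0 < `|z| by rewrite normr_gt0.
have zn : half_sphere (`|z|^-1 *: z).
  split; first by rewrite mulr_ge0// invr_ge0 ltW.
  by rewrite normrZ gtr0_norm ?invr_gt0// mulVf// gt_eqF.
rewrite -(hom `|z|^-1) ?invr_gt0// fh; last exact: sub.
by apply: (HM (`|M| + 1)); [rewrite (le_lt_trans (ler_norm M))// ltrDl|exists (`|z|^-1 *: z)].
Qed.

Variables (A : 'I_n -> 'M[R]_N) (Ad : 'M[R]_N) (Gam : 'M[R]_(p, N)) (S B Q : freq -> 'M[C]_N).
Hypotheses (kS : kreiss_symmetrizer A Ad Gam S) (rB : rauch_matrix Gam S B) (sQ : is_sqrt_of B Q).

(** Uniformity in the frequency is what later yields an integrable majorant; the symbol [Asym], of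
    degree 1, admits no such bound in general. *)
Lemma symmetrizer_bounded : exists2 M : R, 0 <= M & forall z, freq_dom z -> forall v : 'cV[C]_N,
  vsq (S z *m v) <= M * vsq v.
Proof.
have [hom sm _ _] := kS.
have bd (x : 'I_N * 'I_N) : exists K : R, 0 <= K /\ forall z, freq_dom z -> sqn (S z x.1 x.2) <= K.
  have [s1 s2] := sm x.1 x.2.
  have [M1 M10 h1] := homogeneous_bounded s1 (fun k z k0 zd => congr1 (fun X : 'M[C]_N => complex.Re (X x.1 x.2)) (hom k z k0 zd)).
  have [M2 M20 h2] := homogeneous_bounded s2 (fun k z k0 zd => congr1 (fun X : 'M[C]_N => complex.Im (X x.1 x.2)) (hom k z k0 zd)).
  exists (M1 ^+ 2 + M2 ^+ 2); split; first by rewrite addr_ge0 ?sqr_ge0.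
  by move=> z zd; apply: lerD; rewrite -real_normK ?num_real// lerXn2r ?nnegrE// ?h1 ?h2.
have [K hK] := choice bd.
have K0 x : 0 <= K x by case: (hK x).
have [M M0 HM] := @vsq_mul_unif _ N (\sum_x K x) (sumr_ge0 _ (fun x _ => K0 x)).
exists M => // z zd v; apply: HM => i j; have [_ /(_ _ zd) h] := hK (i, j).
by apply: le_trans h _; rewrite (bigD1 (i, j))//= lerDl sumr_ge0.
Qed.

(** Only the hermitian part of [Z] contributes to the real part of the form. *)
Lemma mx_Re_ge (Z : 'M[C]_N) (a : R) (v : 'cV[C]_N) : mx_ge (mx_Re Z) (a%:C)%:M -> a * vsq v <= dotv v (Z *m v).
Proof.
move=> /(psd_Re v); rewrite -[in X in _ -> X]subr_ge0; suff -> : complex.Re ((v^t* *m (mx_Re Z - (a%:C)%:M) *m v) 0 0) = dotv v (Z *m v) - a * vsq v by [].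
have -> : v^t* *m (mx_Re Z - (a%:C)%:M) *m v =
    (2^-1)%:C *: (v^t* *m (Z *m v) + v^t* *m (Z^t* *m v)) - a%:C *: (v^t* *m v).
  rewrite mulmxBr mulmxBl mul_mx_scalar -scalemxAl /mx_Re -scalemxAr -scalemxAl mulmxDr mulmxDl !mulmxA.
  by rewrite fmorphV rmorph_nat.
rewrite mxE cReD [X in complex.Re X + _]mxE cReM /= mul0r subr0 mxE cReD -!/(dotv _ _) -dotv_adj [dotv (Z *m v) v]dotvC.
rewrite [X in _ + complex.Re X]mxE cReN [X in complex.Re X]mxE cReM /= mul0r subr0 -/(dotv v v) dotvv.
by congr (_ - _); move: (dotv _ _) => d; field.
Qed.

Lemma dotv_herm (X Y : 'M[C]_N) (v : 'cV[C]_N) : is_hermitian X -> dotv (X *m v) (Y *m v) = dotv v (X *m Y *m v).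
Proof. by move=> hX; rewrite dotv_adj hX mulmxA. Qed.

Lemma symmetrizer_coercive : exists2 lam : R, 0 < lam & forall g th (v : 'cV[C]_N), 0 < g ->
  lam * g * vsq v <= dotv (S (g, th) *m v) (Asym A Ad (g, th) *m v).
Proof.
have [_ _ hS [lam [delta [C1 [lam0 _ h]]]]] := kS; exists lam => // g th v g0.
have zd : freq_dom (g, th).
  by split; [exact: ltW|apply/eqP => -[g00 _]; rewrite g00 ltxx in g0].
have [/(mx_Re_ge v) + _] := h _ zd.
by move/le_trans; apply; rewrite (dotv_herm _ _ (hS _ zd)).
Qed.

Lemma frequency_facts z : 0 < z.1 -> [/\ freq_dom z, is_hermitian (S z) /\ S z \in unitmx,
  is_hermitian (Q z) /\ Q z \in unitmx, Q z *m Q z = B z & (Cker Gam == Epos (invmx (S z) *m B z))%MS].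
Proof.
move=> z0; have zd : freq_dom z.
  by split; [exact: ltW|apply/eqP => z00; rewrite z00 ltxx in z0].
have [_ _ hS _] := kS; have [_ [b b0 hb] _ _ hB] := rB.
have [hQ _ QQ] := sQ zd; have [uS GE] := hB z zd.
by split => //; split; [exact: hS|exact: uS|exact: hQ|exact: sqrt_unit b0 (hb z zd) QQ].
Qed.

End frequencies.

(** * Convergence *)

Lemma mem_L2_L2v (R : realType) N d (T : measurableType d) (mu : {measure set T -> \bar R}) (D : set T) (u : T -> 'cV[R[i]]_N) :
  measurable D -> mem_L2 mu D u -> L2v mu (restrict0 D u).
Proof. by move=> mD /(mem_L2P mD)[m1 h1] i; split; [exact: m1|exact: (VL_lty m1 h1)]. Qed.

Lemma L2v_lty (R : realType) N d (T : measurableType d) (mu : {measure set T -> \bar R}) (u : T -> 'cV[R[i]]_N) :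
  L2v mu u -> (VL mu u < +oo)%E.
Proof. by move=> Lu; apply: lty_VL (L2v_mV Lu) _ => i; case: (Lu i). Qed.

Lemma cvint_restrict (R : realType) N d (T : measurableType d) (mu : {measure set T -> \bar R}) (D : set T) (f : T -> 'cV[R[i]]_N) :
  cvint mu D f = cvint mu setT (restrict0 D f).
Proof.
apply/colP => i; rewrite !mxE; apply: eq_ReIm => /=; rewrite Rintegral_mkcond; apply: Rint_ext => z.
  by rewrite /restrict0 patchE; case: ifP => //; rewrite mxE.
by rewrite /restrict0 patchE; case: ifP => //; rewrite mxE.
Qed.

Section vector_transforms.
Context {R : realType} {m N : nat}.
Local Notation C := R[i].
Local Notation RR := (measurableTypeR R).
Local Notation mm := (@lebesgue_rV R).
Local Notation dd := (lebesgue_ty m).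
Implicit Types w W v V : 'rV[R]_m * RR -> 'cV[C]_N.

Definition FTv w W := forall j, FTt (fun z => w z j 0) (fun z => W z j 0).

Lemma FTv_exists w : L2v dd w -> exists W, FTv w W.
Proof.
move=> Lw; have [W hW] := choice (fun j => FTt_exists (Lw j).1 (Lw j).2).
exists (fun z => \col_j W j z) => j; rewrite [X in FTt _ X](_ : _ = W j); first exact: hW.
by apply/funext => z; rewrite mxE.
Qed.

Lemma FTv_L2v w W : FTv w W -> L2v dd w /\ L2v dd W.
Proof. by move=> h; split=> i; have [] := h i. Qed.

Lemma FTv_ind (D : set R) w W : measurable (D : set RR) -> FTv w W ->
  FTv (fun z => (\1_D z.2 : R)%:C *: w z) (fun z => (\1_D z.2 : R)%:C *: W z).
Proof.
move=> mD h j; have := FTt_restrict mD (h j).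
by congr FTt; apply/funext => z; rewrite mxE.
Qed.

Lemma FTv_axpy (k : C) w W v V : FTv w W -> FTv v V -> FTv (fun z => w z + k *: v z) (fun z => W z + k *: V z).
Proof. by move=> h h' j; have := FTt_lin k (h j) (h' j); congr FTt; apply/funext => z; rewrite !mxE. Qed.

Lemma FTv_iso w W : FTv w W -> VL dd W = (((2 * pi) ^+ m)%:E * VL dd w)%E.
Proof.
move=> h; have [/L2v_mV h1 /L2v_mV h2] := FTv_L2v h.
rewrite !VL_sum// ge0_sume_distrr; first by apply: eq_bigr => i _; exact: FTt_iso.
by move=> i _; exact: E2_ge0.
Qed.

Lemma FTm0 : FTm (fun _ : 'rV[R]_m => 0) (fun=> 0).
Proof.
have E0 : E2 (mm m) (fun _ => 0 : C) = 0%E.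
  by rewrite /E2; under eq_integral do rewrite sqn0; rewrite lebesgue_integral_definition.integral0.
split; rewrite ?E0 ?ltry//; try exact: mC_cst.
rewrite (_ : (fun k => _) = fun=> 0%E); first exact: cvg_cst.
apply/funext => k; rewrite -[RHS]E0; congr E2; apply/funext => th.
by rewrite /ftm /cutf (@Cint_ext _ _ _ _ _ (fun=> 0)) ?Cint0 ?subr0// => s; rewrite !mulr0.
Qed.

Lemma FTm_lin (w W v V : 'rV[R]_m -> C) (k : C) : FTm w W -> FTm v V ->
  FTm (fun z => w z + k * v z) (fun z => W z + k * V z).
Proof.
apply: (FT_lin (@mC_ftm R m) _ (@trunc_cutoff R m)).
by move=> w1 w2 K c m1 m2 o1 o2 h1 h2; apply: aeW => th; exact: (ftm_lin (K := K)).
Qed.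

Lemma FTm_iso (w W : 'rV[R]_m -> C) : FTm w W -> E2 (mm m) W = (((2 * pi) ^+ m)%:E * E2 (mm m) w)%E.
Proof. exact: (FT_isometry (@mC_ftm R m) (@plancherel_m R m) (@trunc_cutoff R m)). Qed.

Lemma E2_eq0 d (T : measurableType d) (mu : {measure set T -> \bar R}) (f : T -> C) : mC f -> E2 mu f = 0%E ->
  {ae mu, forall x, f x = 0}.
Proof.
move=> mf f0; have sqn_eq0 (z : C) : sqn z = 0 -> z = 0.
  case: z => a b /eqP; rewrite /sqn /= paddr_eq0 ?sqr_ge0// !sqrf_eq0.
  by move=> /andP[/eqP -> /eqP ->].
have /ae_eq_integral_abs h : (\int[mu]_x `|(sqn (f x))%:E| = 0)%E.
  by rewrite -[RHS]f0; apply: eq_integral => x _; rewrite gee0_abs// lee_fin sqn_ge0.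
apply: filterS (h measurableT (measurable_sqnE mf)) => x /(_ I) [fx].
by apply: sqn_eq0.
Qed.

(** A constant matrix commutes with the transform, and by the isometry the transform of a function
    that is 0 almost everywhere is 0 almost everywhere. *)
Lemma FTm_kernel p (X : 'M[C]_(p, N)) (U h : 'rV[R]_m -> 'cV[C]_N) :
  (forall j, FTm (fun s => U s j 0) (fun s => h s j 0)) -> {ae mm m, forall s, X *m U s = 0} ->
  {ae mm m, forall th, X *m h th = 0}.
Proof.
move=> ft X0.
have lin i : FTm (fun s => (X *m U s) i 0) (fun s => (X *m h s) i 0).
  under eq_fun do rewrite mxE; under [X in FTm _ X]eq_fun do rewrite mxE.
  elim: (index_enum _) => [|j s IH].
    by under eq_fun do rewrite big_nil; under [X in FTm _ X]eq_fun do rewrite big_nil; exact: FTm0.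
  have := FTm_lin (X i j) IH (ft j).
  by congr FTm; apply/funext => s'; rewrite big_cons addrC.
have z i : {ae mm m, forall th, (X *m h th) i 0 = 0}.
  have [m1 m2 _ _ _] := lin i; apply: E2_eq0 => //; rewrite (FTm_iso (lin i)).
  have -> : E2 (mm m) (fun s => (X *m U s) i 0) = E2 (mm m) (fun=> 0).
    by apply: E2_ae_eq => //; apply: filterS X0 => s ->; rewrite mxE.
  by rewrite /E2; under eq_integral do rewrite sqn0; rewrite lebesgue_integral_definition.integral0 mule0.
have : {ae mm m, forall th, forall i, (X *m h th) i 0 = 0}.
  by apply: filter_forall => i; exact: z.
by apply: filterS => th h0; apply/colP => i; rewrite h0 mxE.
Qed.
End vector_transforms.

Lemma wint_comb (R : realType) N d (T : measurableType d) (mu : {measure set T -> \bar R}) (q : T -> R[i]) (c : R[i])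
    (a b : T -> 'cV[R[i]]_N) : bounded_supp mu q -> L2v mu a -> L2v mu b ->
  wint mu q (fun z => a z + c *: b z) = wint mu q a + c *: wint mu q b.
Proof.
move=> bq La Lb; apply/colP => j; rewrite !mxE; have [m1 o1] := La j; have [m2 o2] := Lb j.
have r1 := bounded_supp_rC bq m1 o1; have r2 := bounded_supp_rC bq m2 o2.
rewrite -CintZ// -CintD//; last exact: rC_Z.
by apply: Cint_ext => z; rewrite !mxE; ring.
Qed.

Lemma cvint_wint (R : realType) N d (T : measurableType d) (mu : {measure set T -> \bar R}) (q : T -> R[i])
    (a : T -> 'cV[R[i]]_N) : cvint mu setT (fun z => q z *: a z) = wint mu q a.
Proof. by apply/colP => j; rewrite CintE mxE; apply: Cint_ext => z; rewrite mxE. Qed.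

Section weak_forms.
Context {R : realType} {n N : nat}.
Local Notation C := R[i].
Local Notation RR := (measurableTypeR R).
Local Notation mm := (@lebesgue_rV R).
Local Notation m := n.+1.
Local Notation space := ('rV[R]_m * R)%type.
Local Notation dd := (lebesgue_ty m).
Implicit Types (u w F : space -> 'cV[C]_N) (phi : space -> R).

Lemma measurable_xpos : measurable (xpos : set ('rV[R]_m * RR)).
Proof.
have : measurable_fun setT (fun z : 'rV[R]_m * RR => z.2) by exact: measurable_snd.
move=> /(_ measurableT `]0, +oo[%classic (measurable_itv _)); rewrite setTI.
by congr measurable; apply/seteqP; split => z /=; rewrite in_itv/= andbT.
Qed.

Lemma exp_weightK g (t : R) : expR (g * t) * expR (- g * t) = 1.
Proof. by rewrite -expRD mulNr subrr expR0. Qed.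

Lemma weightK g u : weight g (weight (- g) u) = u.
Proof.
apply/funext => z; rewrite /weight scalerA -[X in X *: _](_ : (expR (g * time z) * expR (- g * time z))%:C = _).
  by rewrite exp_weightK scale1r.
by rewrite rmorphM.
Qed.

Lemma bweightK g (u : 'rV[R]_m -> 'cV[C]_N) : bweight g (bweight (- g) u) = u.
Proof.
apply/funext => z; rewrite /bweight scalerA -[X in X *: _](_ : (expR (g * z 0 ord0) * expR (- g * z 0 ord0))%:C = _).
  by rewrite exp_weightK scale1r.
by rewrite rmorphM.
Qed.

Lemma weight_restrict g (D : set space) u : weight g (restrict0 D u) = restrict0 D (weight g u).
Proof. by apply/funext => z; rewrite /weight /restrict0; case: ifP => // _; rewrite scaler0. Qed.

Variables (A : 'I_n -> 'M[R]_N) (Ad : 'M[R]_N).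

Lemma transport_restrict phi (D : set space) u :
  transport A Ad phi (restrict0 D u) = restrict0 D (transport A Ad phi u).
Proof.
apply/funext => z; rewrite /transport /restrict0; case: ifP => // _.
have h (a : C) (X : 'M[C]_N) : a *: (X *m (0 : 'cV[C]_N)) = 0 by rewrite mulmx0 scaler0.
by rewrite big1 => [|j _]; rewrite !h// scaler0 !addr0.
Qed.

Lemma scale_restrict phi (D : set space) u :
  (fun z => (phi z)%:C *: restrict0 D u z) = restrict0 D (fun z => (phi z)%:C *: u z).
Proof. by apply/funext => z; rewrite /restrict0; case: ifP => // _; rewrite scaler0. Qed.

Lemma bvp_weak p (G : 'M[R]_(p, N)) g F u (u0 : 'rV[R]_m -> 'cV[C]_N) : bvp_solution A Ad G g F u u0 ->
  weak_transport A Ad g (restrict0 xpos (weight (- g) u)) (restrict0 xpos (weight (- g) F)) (bweight (- g) u0).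
Proof.
move=> [_ _ wk _ _] phi tphi _; rewrite !weight_restrict !weightK bweightK transport_restrict.
by rewrite scale_restrict -!cvint_restrict; exact: wk.
Qed.

(** The penalization is moved to the source. The equation holds across [x = 0], so there is no
    boundary term. *)
Lemma penalized_weak g eps F u w : L2v dd (restrict0 xpos (weight (- g) F)) -> L2v dd (restrict0 xneg (weight (- g) w)) ->
  (forall phi, test_function phi ->
    - cvint dd setT (transport A Ad phi u) + (eps^-1)%:C *: cvint dd xneg (fun z => (phi z)%:C *: w z) =
    cvint dd xpos (fun z => (phi z)%:C *: F z)) ->
  weak_transport A Ad g (weight (- g) u)
    (fun z => restrict0 xpos (weight (- g) F) z + (- eps^-1)%:C *: restrict0 xneg (weight (- g) w) z) (fun=> 0).
Proof.
move=> LF Lw wk phi tphi bphi; rewrite weightK.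
have -> : cvint (mm m) setT (fun s => (phi (s, 0))%:C *: (Cmx Ad *m bweight g (fun=> 0) s)) = 0 :> 'cV[C]_N.
  apply/colP => i; rewrite CintE -[RHS](_ : 0 = _) ?mxE//.
  by rewrite -[RHS](@Cint0 _ _ _ (mm m)); apply: Cint_ext => s; rewrite /bweight scaler0 mulmx0 scaler0 mxE.
have e (a : space -> 'cV[C]_N) : (fun z => (phi z)%:C *: weight g a z) = fun z => (phi z * expR (g * z.1 0 ord0))%:C *: a z.
  by apply/funext => z; rewrite /weight scalerA -rmorphM.
rewrite addr0 e cvint_wint wint_comb// -!cvint_wint -!e !weight_restrict !weightK !scale_restrict -!cvint_restrict.
by rewrite -wk// rmorphN scaleNr addrK.
Qed.

End weak_forms.

(** * The two estimates at one frequency *)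

Section fixed_frequency.
Context {R : realType} {N : nat}.
Local Notation C := R[i].
Local Notation RR := (measurableTypeR R).
Local Notation leb := (@lebesgue_measure R).
Local Notation ind x := ((\1_[set y : R | y < 0] (x : R) : R)%:C).
Variables (A S Q B : 'M[C]_N) (p : nat) (G : 'M[R]_(p, N)) (Ad : 'M[R]_N) (a M : R).
Hypotheses (hS : is_hermitian S) (uS : S \in unitmx) (hQ : is_hermitian Q) (uQ : Q \in unitmx) (QB : Q *m Q = B)
  (GE : (Cker G == Epos (invmx S *m B))%MS) (uAd : Ad \in unitmx) (a0 : 0 < a) (M0 : 0 <= M).
Hypothesis coercive : forall v : 'cV[C]_N, a * vsq v <= dotv (S *m v) (A *m v).
Hypothesis bound : forall v : 'cV[C]_N, vsq (S *m v) <= M * vsq v.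
Let P := projneg (invmx Q *m S *m invmx Q).
Let Pen := - (Cmx Ad *m invmx S *m Q *m P *m Q).

Let hP : is_hermitian P.
Proof. by apply: projneg_herm; [exact: M_herm|exact: M_unit]. Qed.
Let PP : P *m P = P.
Proof. by apply: projneg_idem; [exact: M_herm|exact: M_unit]. Qed.

Lemma wintB (q : RR -> C) (b c : RR -> 'cV[C]_N) : bounded_supp leb q -> L2v leb b -> L2v leb c ->
  wint leb q (fun x => b x - c x) = wint leb q b - wint leb q c.
Proof.
move=> bq Lb Lc; have := wint_comb (- 1) bq Lb Lc; rewrite scaleN1r => <-.
by congr wint; apply/funext => x; rewrite scaleN1r.
Qed.

Section solutions.
Variables (U W F um v : RR -> 'cV[C]_N) (h : 'cV[C]_N) (eps : R).
Hypotheses (eps0 : 0 < eps) (LU : L2v leb U) (LW : L2v leb W) (LF : L2v leb F).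

(** The factor [A_d] and the sign of the penalization symbol cancel against [A_d^{-1}] and
    [- eps^-1], leaving the matrix to which [dotv_penal] applies. *)
Lemma penal_rhs x : invmx (Cmx Ad) *m (F x + (- eps^-1)%:C *: (ind x *: (Pen *m W x))) =
  invmx (Cmx Ad) *m F x + ind x *: (invmx S *m Q *m P *m (eps^-1%:C *: (Q *m W x))).
Proof.
rewrite mulmxDr; congr (_ + _); rewrite -!scalemxAr scalerA mulrC -scalerA; congr (_ *: _).
rewrite /Pen mulNmx mulmxN rmorphN scalerN scaleNr opprK; congr (_ *: _).
by rewrite !mulmxA mulVmx ?mul1mx// map_unitmx.
Qed.

Hypothesis odeW : weak_ode Ad A W (fun x => F x + (- eps^-1)%:C *: (ind x *: (Pen *m W x))) 0.

Let LK : L2v leb (fun x : RR => ind x *: (invmx S *m Q *m P *m (eps^-1%:C *: (Q *m W x)))).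
Proof. by apply: L2v_ind; [exact: measurable_lt0|apply: L2v_mul; apply: L2vZ; exact: L2v_mul]. Qed.

Let LG : L2v leb (fun x : RR => F x + (- eps^-1)%:C *: (ind x *: (Pen *m W x))).
Proof. exact: L2vD LF (L2vZ _ (L2v_ind measurable_lt0 (L2v_mul Pen LW))). Qed.

Lemma penalized_weak_eq : weak_eq W (fun x => A *m W x + invmx (Cmx Ad) *m F x +
  ind x *: (invmx S *m Q *m P *m (eps^-1%:C *: (Q *m W x)))).
Proof.
move=> chi lchi; have bchi := line_test_weight lchi.
rewrite odeW// scaler0 addr0 -(wint_mulv A bchi LW) -(wint_mulv _ bchi LG) -(wintD bchi (L2v_mul _ LW) (L2v_mul _ LG)).
by congr wint; apply/funext => x; rewrite penal_rhs addrA.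
Qed.

Lemma frequency_penalized_bound :
  ((a / 2)%:E * VL leb W <= (a^-1 / 2 * M)%:E * VL leb (fun x => invmx (Cmx Ad) *m F x)%R)%E.
Proof.
exact: (penalized_bound a0 eps0 hS uS hQ hP PP coercive M0 LW (L2v_mul _ LF) bound penalized_weak_eq).
Qed.

Hypotheses (odeU : weak_ode Ad A U F h) (U0 : forall x, ind x *: U x = 0) (Gh : Cmx G *m h = 0)
  (prof : forall x : R, x < 0 -> [/\ (1%:M - P) *m v x = v x, cderivable v x &
     (invmx Q *m S *m invmx Q) *m cderive v x - (1%:M - P) *m (invmx Q *m S *m invmx Q) *m (Q *m A *m invmx Q) *m v x = 0])
  (trace : cvg_left0 v ((1%:M - P) *m Q *m h))
  (umE : um = (fun x => ind x *: (invmx Q *m v x))) (Lum : L2v leb um).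

(** Subtracting the three weak equations cancels the source [F] and the jumps [h] and [- h]. What
    remains is the penalized equation for the difference, with the profile's defect [r] as source on
    [x < 0]. *)
Lemma frequency_difference_bound :
  (a%:E * VL leb (fun x => W x - (um x + U x))%R <=
   (eps / 4)%:E * VL leb (fun x => invmx Q *m S *m A *m um x)%R)%E.
Proof.
pose r x := invmx Q *m S *m A *m um x; pose K := invmx S *m Q *m P.
have Lr : L2v leb r by exact: L2v_mul.
have Ls : L2v leb (fun x : RR => um x + U x) by exact: L2vD.
have LZ : L2v leb (fun x : RR => W x - (um x + U x)) by apply: L2vD => //; exact: L2vN.
apply: (difference_bound a0 eps0 hS uS hQ hP PP coercive LZ Lr) => chi lchi.
have bchi := line_test_weight lchi; have bd := line_test_weight (line_test_derive lchi).
have EW := penalized_weak_eq lchi; have EU := odeU lchi.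
have Eum : - wint leb (fun x => ('D_1 chi x)%:C) um =
    wint leb (fun x => (chi x)%:C) (fun x => A *m um x - K *m r x) - (chi 0)%:C *: h.
  have := profile_weak hS uS hQ uQ QB GE Gh prof trace; rewrite -umE => /(_ _ _ lchi)/=; exact.
have LAW : L2v leb (fun x : RR => A *m W x + invmx (Cmx Ad) *m F x).
  by apply: L2vD; exact: L2v_mul.
have LAU : L2v leb (fun x : RR => A *m U x + invmx (Cmx Ad) *m F x).
  by apply: L2vD; exact: L2v_mul.
have LAum : L2v leb (fun x : RR => A *m um x - K *m r x).
  by apply: L2vD; [exact: L2v_mul|apply: L2vN; exact: L2v_mul].
rewrite (wintB bd LW Ls) (wintD bd Lum LU).
rewrite -(wint_mulv A bchi LU) -(wint_mulv _ bchi LF) -(wintD bchi (L2v_mul _ LU) (L2v_mul _ LF)) in EU.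
(* The variable [t] stands for the jump, which occurs with opposite signs in the equations of [um]
   and [U]. *)
have rearr (x y z X Y Z t : 'cV[C]_N) : - x = X -> - y = Y - t -> - z = Z + t -> - (x - (y + z)) = X - (Y + Z).
  by move=> ex ey ez; rewrite opprB addrC ex -[y]opprK ey -[z]opprK ez -opprD addrACA addNr addr0.
rewrite (rearr _ _ _ _ _ _ _ EW Eum EU) -(wintD bchi LAum LAU) -(wintB bchi (L2vD LAW LK) (L2vD LAum LAU)).
congr wint; apply/funext => x.
(* On [x < 0] the function [U] is 0 and [P Q um = P v = 0], so the penalization sees the difference
   exactly as it sees [W]. *)
have KZ : ind x *: (K *m (eps^-1%:C *: (Q *m (W x - (um x + U x))) + r x)) =
    ind x *: (K *m (eps^-1%:C *: (Q *m W x))) + K *m r x.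
  have := U0 x; have : um x = ind x *: (invmx Q *m v x) by rewrite umE.
  rewrite indicE; case: (boolP (x \in _)) => [/set_mem/= xn|xn]; last by rewrite /r => ->; rewrite !scale0r !mulmx0 addr0.
  have Pv : P *m v x = 0.
    by have [<- _ _] := prof xn; rewrite mulmxA mulmxBr mulmx1 PP subrr mul0mx.
  move: (r x) => r'; rewrite !scale1r => umx ->; rewrite [um x + 0]addr0 [K *m (_ + _)]mulmxDr; congr (_ + _).
  rewrite -!scalemxAr; congr (_ *: _); rewrite mulmxBr mulmxBr.
  have -> : K *m (Q *m um x) = 0 by rewrite umx /K -!mulmxA (mulKVmx uQ) Pv !mulmx0.
  by rewrite subr0.
rewrite -/K KZ; move: (K *m (eps^-1%:C *: _)) (K *m r x) (invmx (Cmx Ad) *m F x) => k1 k2 k3.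
rewrite mulmxBr mulmxDr; move: (A *m _) (A *m _) (A *m _) (ind x *: k1) => k4 k5 k6 k7.
by apply/colP => i; rewrite !mxE; ring.
Qed.

End solutions.
End fixed_frequency.

(* [f] is not assumed measurable, and it is not controlled on the null set [D]. *)
Lemma VL_le_off (R : realType) N d (T : measurableType d) (mu : {measure set T -> \bar R}) (D : set T)
    (f h : T -> 'cV[R[i]]_N) (c : R) : measurable D -> mu D = 0%E -> 0 <= c -> mV h ->
  (forall z, ~ D z -> vsq (f z) <= c * vsq (h z)) -> (VL mu f <= c%:E * VL mu h)%E.
Proof.
move=> mD D0 c0 mh fh.
have mvh : measurable_fun setT (fun z => (vsq (h z))%:E) by apply/measurable_EFinP; exact: measurable_vsq.
rewrite /VL -ge0_integralZl_EFin//; last by move=> z _; rewrite lee_fin vsq_ge0.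
(* Infinite on the null set [D], so it dominates [f] at every point while keeping the integral of
   the bound. *)
pose k z : \bar R := (c%:E * (vsq (h z))%:E + +oo * (\1_D z)%:E)%E.
have k0 z : (0 <= k z)%E by rewrite adde_ge0 ?mule_ge0 ?lee_fin ?vsq_ge0 ?leey.
have -> : (\int[mu]_z (c%:E * (vsq (h z))%:E) = \int[mu]_z k z)%E.
  apply: ae_eq_integral => //.
  - exact: measurable_funeM.
  - apply: emeasurable_funD; apply: measurable_funeM => //.
    by apply/measurable_EFinP; exact: measurable_indic.
  - exists D; split => // z /= /not_implyP[_ kz]; apply: contrapT => nD; apply: kz.
    by rewrite /k indicE memNset// mule0 adde0.
(* As suprema over simple functions below the integrand, the integrals compare even for a
   non-measurable [f]. *)
rewrite !ge0_integralTE//; last by move=> z; rewrite lee_fin vsq_ge0.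
apply: le_ereal_sup => _ [s /= sf <-]; exists s => //= z; apply: le_trans (sf z) _.
have [zD|nD] := pselect (D z).
  by rewrite /k indicE mem_set// mule1 addey ?leey// -EFinM.
by rewrite /k indicE memNset// mule0 adde0 -EFinM lee_fin fh.
Qed.

Section slices.
Context {R : realType} {m N : nat}.
Local Notation C := R[i].
Local Notation RR := (measurableTypeR R).
Local Notation leb := (@lebesgue_measure R).
Local Notation mm := (@lebesgue_rV R m).
Local Notation dd := (lebesgue_ty m).
Implicit Types Z : 'rV[R]_m * RR -> 'cV[C]_N.

Lemma VL_slices Z : mV Z -> VL dd Z = (\int[mm]_th VL leb (fun x : RR => Z (th, x)))%E.
Proof.
move=> mZ; rewrite /VL (fubini_tonelli1 (fun z : 'rV[R]_m * RR => (vsq (Z z))%:E))//.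
  by apply/measurable_EFinP; exact: measurable_vsq.
by move=> z; rewrite lee_fin vsq_ge0.
Qed.

Lemma measurable_VL_slice Z : mV Z -> measurable_fun setT (fun th => VL leb (fun x : RR => Z (th, x))).
Proof.
move=> mZ; apply: (@measurable_fun_fubini_tonelli_F _ _ _ _ _ leb (fun z : 'rV[R]_m * RR => (vsq (Z z))%:E)).
  by apply/measurable_EFinP; exact: measurable_vsq.
by move=> z; rewrite lee_fin vsq_ge0.
Qed.

Lemma ae_L2v_slice Z : L2v dd Z -> {ae mm, forall th, L2v leb (fun x : RR => Z (th, x))}.
Proof.
move=> LZ; have : {ae mm, forall th, forall j, (E2 leb (fun x => Z (th, x) j 0%R) < +oo)%E}.
  by apply: filter_forall => j; have [a b] := LZ j; exact: (ae_E2_slice1 (m1 := mm) (m2 := leb) a b).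
by apply: filterS => th h j; split => //; have [mj _] := LZ j; exact: (mC_slice1 th mj).
Qed.

Lemma VL_dominated (Z : nat -> 'rV[R]_m * RR -> 'cV[C]_N) (D : 'rV[R]_m -> \bar R) : (forall k, mV (Z k)) ->
  {ae mm, forall th, VL leb (fun x : RR => Z k (th, x)) @[k --> \oo] --> 0%E} -> mm.-integrable setT D ->
  (forall k, {ae mm, forall th, (VL leb (fun x : RR => Z k (th, x)) <= D th)%E}) ->
  VL dd (Z k) @[k --> \oo] --> 0%E.
Proof.
move=> mZ Z0 iD ZD; have := @dominated_convergence _ _ _ mm setT measurableT
  (fun k th => VL leb (fun x : RR => Z k (th, x))) (cst 0%E) D.
case.
- by move=> k; exact: measurable_VL_slice.
- exact: measurable_cst.
- by apply: filterS Z0 => th + _.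
- exact: iD.
- by apply: filterS (ae_foralln ZD) => th h k _; rewrite gee0_abs ?VL_ge0.
move=> _ _; rewrite lebesgue_integral_definition.integral0; under eq_fun do rewrite -VL_slices//; exact.
Qed.

Lemma integrable_VL_slice Z : L2v dd Z -> mm.-integrable setT (fun th => VL leb (fun x : RR => Z (th, x))).
Proof.
move=> LZ; apply/integrableP; split; first exact: measurable_VL_slice (L2v_mV LZ).
under eq_integral do rewrite gee0_abs ?VL_ge0//.
by rewrite -VL_slices; [exact: L2v_lty|exact: L2v_mV].
Qed.
End slices.

Section convergence.
Context {R : realType} {n N p : nat}.
Local Notation C := R[i].
Local Notation RR := (measurableTypeR R).
Local Notation leb := (@lebesgue_measure R).
Local Notation mm := (@lebesgue_rV R).
Local Notation m := n.+1.
Local Notation space := ('rV[R]_m * R)%type.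
Local Notation freq := (R * 'rV[R]_n.+1)%type.
Local Notation dd := (lebesgue_ty m).
Local Notation ind x := ((\1_[set y : R | y < 0] (x : R) : R)%:C).

Lemma restrict0_xneg (u : space -> 'cV[C]_N) : restrict0 xneg u = fun z => ind z.2 *: u z.
Proof.
apply/funext => z; rewrite /restrict0 indicE (_ : (z \in xneg) = (z.2 \in [set y : R | y < 0]))//.
by case: (_ \in _); rewrite ?scale1r ?scale0r.
Qed.

Lemma restrict0_xpos (u : space -> 'cV[C]_N) : restrict0 xpos u = fun z => (\1_[set y : R | 0 < y] z.2 : R)%:C *: u z.
Proof.
apply/funext => z; rewrite /restrict0 indicE (_ : (z \in xpos) = (z.2 \in [set y : R | 0 < y]))//.
by case: (_ \in _); rewrite ?scale1r ?scale0r.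
Qed.

Lemma measurable_gt0 : measurable ([set x : R | 0 < x] : set RR).
Proof.
rewrite (_ : [set x | _] = `]0, +oo[%classic); first exact: measurable_itv.
by apply/seteqP; split => x /=; rewrite in_itv/= andbT.
Qed.

(** The transform is multiplied by the indicator of [x > 0], which commutes with the tangential
    transform. It then vanishes at every point with [x < 0], as the pointwise arguments at a fixed
    frequency require. *)
Lemma FTv_exists_xpos (u : space -> 'cV[C]_N) : L2v dd (restrict0 xpos u) ->
  exists2 Uh, FTv (restrict0 xpos u) Uh & forall z, ind z.2 *: Uh z = 0.
Proof.
move=> /FTv_exists[W hW]; exists (fun z => (\1_[set y : R | 0 < y] z.2 : R)%:C *: W z).
  have := FTv_ind measurable_gt0 hW; congr FTv; apply/funext => z.
  rewrite restrict0_xpos scalerA; congr (_ *: _); rewrite indicE.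
  by case: (_ \in _); rewrite ?mulr0 ?mulr1.
move=> z; rewrite scalerA !indicE.
case: (boolP (z.2 \in [set y : R | y < 0])) => [/set_mem/= z0|_]; last by rewrite mul0r scale0r.
by rewrite memNset ?mulr0 ?scale0r//= => z1; have := lt_trans z0 z1; rewrite ltxx.
Qed.

Variables (A : 'I_n -> 'M[R]_N) (Ad : 'M[R]_N) (Gam : 'M[R]_(p, N)) (S B Q : freq -> 'M[C]_N).
Hypotheses (uAd : Ad \in unitmx) (kS : kreiss_symmetrizer A Ad Gam S) (rB : rauch_matrix Gam S B)
  (sQ : is_sqrt_of B Q).
Variables (lam M g : R).
Hypotheses (g0 : 0 < g) (lam0 : 0 < lam) (M0 : 0 <= M).
Hypothesis coercive : forall th (v : 'cV[C]_N),
  lam * g * vsq v <= dotv (S (g, th) *m v) (Asym A Ad (g, th) *m v).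
Hypothesis bound : forall th (v : 'cV[C]_N), vsq (S (g, th) *m v) <= M * vsq v.

Variables (F u : space -> 'cV[C]_N) (Uh Fh um v : space -> 'cV[C]_N) (u0 h0 : 'rV[R]_m -> 'cV[C]_N).
Let Fp := restrict0 xpos (weight (- g) F).
Let Up := restrict0 xpos (weight (- g) u).
Let Um := restrict0 xneg (weight (- g) um).
Let Umh := restrict0 xneg (fun z => invmx (Q (g, z.1)) *m v z).
Hypotheses (bvp : bvp_solution A Ad Gam g F u u0) (ftU : FTv Up Uh) (ftF : FTv Fp Fh) (ft0 : fourier (bweight (- g) u0) h0)
  (Uh0 : forall z, ind z.2 *: Uh z = 0) (prof : profile_system A Ad S Q g h0 v) (ftm : FTv Um Umh).

Lemma ode_interior : {ae mm m, forall th, weak_ode Ad (Asym A Ad (g, th)) (fun x => Uh (th, x)) (fun x => Fh (th, x)) (h0 th)}.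
Proof. exact: (tangential_ode uAd ftU ftF (fourier_FT ft0) (bvp_weak bvp)). Qed.

Lemma trace_kernel : {ae mm m, forall th, Cmx Gam *m h0 th = 0}.
Proof.
apply: FTm_kernel (fourier_FT ft0) _; have [_ _ _ G0 _] := bvp.
by apply: filterS G0 => s Gs; rewrite /bweight -scalemxAr Gs scaler0.
Qed.

(** The exceptional null set depends on [eps]. The limit is therefore taken along sequences, for
    which countably many null sets are united. *)
Lemma penalized_frequency eps ue : 0 < eps -> penalized_solution A Ad S Q g eps F ue ->
  exists2 W, FTv (weight (- g) ue) W & {ae mm m, forall th,
    ((lam * g)%:E * VL leb (fun x : RR => W (th, x) - (Umh (th, x) + Uh (th, x)))%R <=
     (eps / 4)%:E * VL leb (fun x : RR => invmx (Q (g, th)) *m S (g, th) *m Asym A Ad (g, th) *m Umh (th, x))%R)%E /\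
    ((lam * g / 2)%:E * VL leb (fun x : RR => W (th, x)) <=
     ((lam * g)^-1 / 2 * M)%:E * VL leb (fun x : RR => invmx (Cmx Ad) *m Fh (th, x))%R)%E}.
Proof.
move=> eps0 [_ [w [W [tW tw] wk]] _]; have ftW : FTv (weight (- g) ue) W := tfourier_FT tW.
have ftw : FTv (weight (- g) w) (fun z => penal_symbol Ad S Q (g, z.1) *m W z) := tfourier_FT tw.
exists W; first exact: ftW.
have ftwn := FTv_ind (@measurable_lt0 R) ftw.
have Lw : L2v dd (restrict0 xneg (weight (- g) w)) by rewrite restrict0_xneg; exact: (FTv_L2v ftwn).1.
have wt := penalized_weak (FTv_L2v ftF).1 Lw wk.
have ftG := FTv_axpy ((- eps^-1)%:C) ftF ftwn.
rewrite restrict0_xneg in wt.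
have ft00 j : FTm (fun s : 'rV[R]_m => (0 : 'cV[C]_N) j 0) (fun=> (0 : 'cV[C]_N) j 0).
  by under eq_fun do rewrite mxE; exact: FTm0.
have odeW := tangential_ode uAd ftW ftG ft00 wt.
have sU := ae_L2v_slice (FTv_L2v ftU).2; have sW := ae_L2v_slice (FTv_L2v ftW).2.
have sF := ae_L2v_slice (FTv_L2v ftF).2; have sm := ae_L2v_slice (FTv_L2v ftm).2.
apply: filter_app sU; apply: filter_app sW; apply: filter_app sF; apply: filter_app sm.
apply: filter_app odeW; apply: filter_app ode_interior; apply: filter_app trace_kernel; apply: filter_app prof.
apply: aeW => th [pr tr] Gh oU oW Lm LF LW LU.
have [_ [hS uS] [hQ uQ] QB GE] := frequency_facts kS rB sQ (z := (g, th)) g0.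
have a0 : 0 < lam * g by exact: mulr_gt0.
have umE : (fun x : RR => Umh (th, x)) = (fun x : RR => ind x *: (invmx (Q (g, th)) *m v (th, x))).
  by rewrite /Umh restrict0_xneg.
split; last exact: (frequency_penalized_bound hS uS hQ uQ uAd a0 M0 (coercive th) (bound th) eps0 LW LF oW).
exact: (frequency_difference_bound hS uS hQ uQ QB GE uAd a0 (coercive th) eps0 LU LW LF oW oU (fun x => Uh0 (th, x)) Gh pr tr umE Lm).
Qed.

Section sequence.
Variables (eps : nat -> R) (ue : nat -> space -> 'cV[C]_N).
Hypotheses (eps0 : forall k, 0 < eps k) (eps_cvg : eps k @[k --> \oo] --> 0)
  (pen : forall k, penalized_solution A Ad S Q g (eps k) F (ue k)).

Let a := lam * g.
Let a0 : 0 < a. Proof. exact: mulr_gt0. Qed.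

Let LU : L2v dd Uh. Proof. exact: (FTv_L2v ftU).2. Qed.
Let Lm : L2v dd Umh. Proof. exact: (FTv_L2v ftm).2. Qed.
Let LAF : L2v dd (fun z => invmx (Cmx Ad) *m Fh z). Proof. exact: L2v_mul (FTv_L2v ftF).2. Qed.

(** Twice the bound of [frequency_penalized_bound] on the penalized solution, plus the limit; the
    factors 2 and 4 come from one and two uses of [|v + w|^2 <= 2 |v|^2 + 2 |w|^2]. *)
Let majorant th : \bar R := ((a^-1 * a^-1 * M * 2)%:E * VL leb (fun x : RR => invmx (Cmx Ad) *m Fh (th, x))%R +
  (4%:E * VL leb (fun x : RR => Umh (th, x)) + 4%:E * VL leb (fun x : RR => Uh (th, x))))%E.

Let integrable_majorant : (mm m).-integrable setT majorant.
Proof.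
apply: integrableD => //; first exact: integrableZl (integrable_VL_slice LAF).
apply: integrableD => //; first exact: integrableZl (integrable_VL_slice Lm).
exact: integrableZl (integrable_VL_slice LU).
Qed.

Let majorant_bound th (W : RR -> 'cV[C]_N) : L2v leb (fun x : RR => Uh (th, x)) -> L2v leb (fun x : RR => Umh (th, x)) ->
  L2v leb W -> ((a / 2)%:E * VL leb W <= (a^-1 / 2 * M)%:E * VL leb (fun x : RR => invmx (Cmx Ad) *m Fh (th, x))%R)%E ->
  (VL leb (fun x => W x - (Umh (th, x) + Uh (th, x)))%R <= majorant th)%E.
Proof.
move=> LUt Lmt LWt h.
have Ls := L2vD Lmt LUt.
apply: le_trans (VLD_le2 leb (L2v_mV LWt) (L2v_mV (L2vN Ls))) _; apply: leeD.
  move: h; rewrite -lee_pdivlMl ?divr_gt0// muleA -EFinM => h.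
  apply: le_trans (lee_wpmul2l _ h) _ => //; rewrite muleA -EFinM lee_wpmul2r ?VL_ge0// lee_fin.
  by rewrite le_eqVlt; apply/orP; left; apply/eqP; field; rewrite gt_eqF.
have -> : VL leb (fun x => - (Umh (th, x) + Uh (th, x)))%R = VL leb (fun x => Umh (th, x) + Uh (th, x))%R.
  by apply: eq_integral => x _; rewrite vsqN.
have := VLD_le2 leb (L2v_mV Lmt) (L2v_mV LUt) => /(lee_wpmul2l (x := 2%:E)) h2.
apply: le_trans (h2 _) _ => //; rewrite ge0_muleDr ?mule_ge0 ?VL_ge0// !muleA -!EFinM.
by rewrite (_ : (2 * 2 = 4)%R)//; rewrite -natrM.
Qed.

Lemma difference_cvg : VL dd (fun z => weight (- g) (ue k) z - (Um z + Up z)) @[k --> \oo] --> 0%E.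
Proof.
have [W hW] := choice (fun k => let: ex_intro2 W h1 h2 := penalized_frequency (eps0 k) (pen k) in ex_intro _ W (conj h1 h2)).
pose Z k (z : space) := W k z - (Umh z + Uh z).
have ftZ k : FTv (fun z => weight (- g) (ue k) z - (Um z + Up z)) (Z k).
  have [ftW _] := hW k; have := FTv_axpy (- 1) ftW (FTv_axpy 1 ftm ftU).
  by congr FTv; apply/funext => z; rewrite scale1r scaleN1r.
have LZ k : L2v dd (Z k) by exact: (FTv_L2v (ftZ k)).2.
have cZ : VL dd (Z k) @[k --> \oo] --> 0%E.
  apply: (VL_dominated (D := majorant)).
  - by move=> k; exact: L2v_mV.
  - apply: filter_app (ae_L2v_slice Lm).
    have := ae_foralln (fun k => (hW k).2); apply: filterS => th h Lth.
    set r := fun x : RR => invmx (Q (g, th)) *m S (g, th) *m Asym A Ad (g, th) *m Umh (th, x).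
    have : (VL leb r < +oo)%E by apply: L2v_lty; exact: L2v_mul.
    have := VL_ge0 leb r; case Er : (VL leb r) => [y||]// y0 _.
    apply: cvge0P => [k|e e0]; first exact: VL_ge0.
    (* [y] is finite at this frequency but not bounded over frequencies: it gives the pointwise
       limit only, the domination coming from [majorant]. *)
    pose c := a^-1 / 4 * y; have c0 : 0 <= c by rewrite !mulr_ge0 ?invr_ge0// ltW.
    have d0 : 0 < e / (c + 1) by rewrite divr_gt0// ltr_wpDl.
    move/cvgrPdist_lt : eps_cvg => /(_ _ d0); apply: filterS => k; rewrite sub0r normrN gtr0_norm// => ek.
    have [+ _] := h k; rewrite -/r Er -EFinM -/a -lee_pdivlMl// -EFinM => /le_trans; apply.
    rewrite lee_fin (_ : _ * _ = eps k * c); last by rewrite /c; ring.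
    apply: le_trans (ler_wpM2r c0 (ltW ek)) _; rewrite -mulrA ler_piMr ?(ltW e0)//.
    by rewrite mulrC ler_pdivrMr ?ltr_wpDl// mul1r lerDl.
  - exact: integrable_majorant.
  - move=> k; have := (hW k).2; move=> h.
    apply: filter_app h; apply: filter_app (ae_L2v_slice (FTv_L2v (hW k).1).2).
    apply: filter_app (ae_L2v_slice Lm); apply: filter_app (ae_L2v_slice LU).
    apply: aeW => th LUt Lmt LWt [_ hb].
    apply: majorant_bound => //; exact: hb.
apply: (cvge0_squeeze (g := fun k => (((2 * pi) ^+ m)^-1%:E * VL dd (Z k))%E)).
- by move=> k; exact: VL_ge0.
- by move=> k; rewrite lee_pdivlMl ?twopi_gt0// -(FTv_iso (ftZ k)).
- by have := cvgeZl (y := ((2 * pi) ^+ m)^-1%:E) (fin_numE _) cZ; rewrite mule0; apply.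
Qed.
End sequence.
End convergence.

(** At [x = 0] the function [glue_halves] takes the value of [u], whereas both restrictions to open
    half-spaces are 0. *)
Lemma null_hyperplane (R : realType) m : @lebesgue_ty R m [set z | z.2 = 0] = 0%E.
Proof.
rewrite (_ : [set z | _] = setT `*` [set 0]); last by apply/seteqP; split => z //= [].
have -> : lebesgue_ty m (setT `*` [set 0]) = (lebesgue_rV m \x @lebesgue_measure R)%E (setT `*` [set 0 : measurableTypeR R]) by [].
rewrite product_measure1E//.
by transitivity (lebesgue_rV m setT * 0 : \bar R)%E; [congr (_ * _)%E; exact: lebesgue_measure_set1|rewrite mule0].
Qed.

Theorem corollary1p8 (R : realType) (n N p : nat) (T : R)
    (A : 'I_n -> 'M[R]_N) (Ad : 'M[R]_N) (Gam : 'M[R]_(p, N))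
    (S B Rm : R * 'rV[R]_n.+1 -> 'M[R[i]]_N) :
  0 < T ->
  Ad \in unitmx ->
  \rank Gam = p ->
  hyperbolic A Ad ->
  uniform_lopatinski A Ad Gam ->
  kreiss_symmetrizer A Ad Gam S ->
  rauch_matrix Gam S B ->
  is_sqrt_of B Rm ->
  exists2 g0 : R, 0 < g0 & forall g : R, g0 <= g ->
  forall (f F u um : 'rV[R]_n.+1 * R -> 'cV[R[i]]_N)
         (u0 : 'rV[R]_n.+1 -> 'cV[R[i]]_N)
         (ue : R -> 'rV[R]_n.+1 * R -> 'cV[R[i]]_N),
  mem_L2 (lebesgue_ty n.+1) (Omega_T T `&` xpos) f ->
  time_extension T g f F ->
  bvp_solution A Ad Gam g F u u0 ->
  profile A Ad S Rm g u0 um ->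
  (forall eps : R, 0 < eps -> penalized_solution A Ad S Rm g eps F (ue eps)) ->
  L2norm (lebesgue_ty n.+1) (Omega_T T) (fun z => ue eps z - glue_halves um u z)
    @[eps --> 0^'+] --> 0%E.
Proof.
move=> T0 uAd _ _ _ kS rB sQ.
have [lam lam0 coer] := symmetrizer_coercive kS; have [M M0 bd] := symmetrizer_bounded kS.
(* The threshold 1 serves to make [g] positive. *)
exists 1 => // g g1 f F u um u0 ue _ [LF _ _] bvp [h0 [v [ft0 prof ftm]]] pen.
have g0 : 0 < g := lt_le_trans ltr01 g1.
have [Fh ftF _] := FTv_exists_xpos (mem_L2_L2v (@measurable_xpos R n) LF).
have [Lu _ _ _ _] := bvp; have [Uh ftU Uh0] := FTv_exists_xpos (mem_L2_L2v (@measurable_xpos R n) Lu).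
have zd (th : 'rV[R]_n.+1) : freq_dom (g, th) by have [] := frequency_facts kS rB sQ (z := (g, th)) g0.
(* Convergence as [eps] decreases to 0 is tested on arbitrary positive sequences tending to 0. *)
apply/cvge_at_rightP => eps [eps0 eps_cvg]; apply/L2norm_cvg0.
pose z k (w : 'rV[R]_n.+1 * measurableTypeR R) : 'cV[R[i]]_N :=
  weight (- g) (ue (eps k)) w - (restrict0 xneg (weight (- g) um) w + restrict0 xpos (weight (- g) u) w).
have cz : VL (lebesgue_ty n.+1) (z k) @[k --> \oo] --> 0%E := difference_cvg uAd kS rB sQ g0 lam0 M0 (fun th w => coer g th w g0) (fun th w => bd _ (zd th) w) bvp ftU ftF ft0
  Uh0 prof (tfourier_FT ftm) eps0 eps_cvg (fun k => pen _ (eps0 k)).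
(* On [Omega_T] the time is at most [T], so removing the weight [e^{-g t}] costs at most this factor
   on squares. *)
pose c := expR (g * T) ^+ 2; have c0 : 0 <= c by exact: sqr_ge0.
refine (@cvge0_squeeze R _ (fun k => (c%:E * VL (lebesgue_ty n.+1) (z k))%E) _ _ _); first by move=> k; exact: VL_ge0.
  move=> k; apply: VL_le_off (null_hyperplane R n.+1) c0 _ _.
  - rewrite (_ : [set z | _] = setT `*` [set 0 : measurableTypeR R]); last by apply/seteqP; split => y //= [].
    by apply: measurableX => //; exact: measurable_set1.
  - have [mu _ _] := pen _ (eps0 k); apply: (@L2v_mV _ _ _ _ (lebesgue_ty n.+1)); apply: L2vD.
      by have := mem_L2_L2v measurableT mu; rewrite restrict0T.
    exact: L2vN (L2vD (FTv_L2v (tfourier_FT ftm)).1 (FTv_L2v ftU).1).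
  - move=> y /= y0; rewrite {1}/restrict0; case: (boolP (y \in _)) => [/set_mem/andP[t0 tT]|_]; last first.
      by rewrite vsq0; apply: mulr_ge0 (vsq_ge0 _); exact: sqr_ge0.
    have -> : ue (eps k) y - glue_halves um u y = (expR (g * time y))%:C *: z k y.
      have wK (b : 'rV[R]_n.+1 * R -> 'cV[R[i]]_N) : (expR (g * time y))%:C *: weight (- g) b y = b y.
        by have := congr1 (fun h => h y) (weightK g b).
      rewrite /z scalerBr scalerDr wK; congr (_ - _); rewrite /glue_halves /restrict0.
      case: (ltgtP y.2 0) => // yn; [rewrite mem_set// memNset/= ?wK ?scaler0 ?addr0//|rewrite memNset/= ?mem_set ?wK ?scaler0 ?add0r//];
        by move=> h; have := lt_trans h yn; rewrite ltxx.
    rewrite vsqZ ler_wpM2r ?vsq_ge0// /sqn /= expr0n addr0 ler_pXn2r ?nnegrE ?expR_ge0//.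
    by rewrite ler_expR ler_pM2l.
by have := cvgeZl (y := c%:E) (fin_numE _) cz; rewrite mule0; apply.
Qed.
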